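(* Let $\mathcal B\in\overline{\mathbb C}$ and let $E$ be a horospherical end of asymptotic boundary $\mathcal B$. (1) If $\mathcal B\in\mathbb C$, then there exists a complex number $\kappa$ such that, for all couples $(\mathcal C,\mathcal D)$ of distinct points in $\overline{\mathbb C}$, the flux through $E$ of the Killing field associated to the translation along the geodesic $(\mathcal C,\mathcal D)$ is $$-2\pi\operatorname{Re}\left(\kappa\frac{(\mathcal C-\mathcal B)(\mathcal D-\mathcal B)}{\mathcal C-\mathcal D}\right),$$ the flux through $E$ of the Killing field associated to the rotation about $(\mathcal C,\mathcal D)$ is $$2\pi\operatorname{Im}\left(\kappa\frac{(\mathcal C-\mathcal B)(\mathcal D-\mathcal B)}{\mathcal C-\mathcal D}\right),$$ and the flux polynomial of $E$ is $\Pi_E(X)=-2\pi\kappa(X-\mathcal B)^2$. (2) If $\mathcal B=\infty$, then there exists a complex number $\kappa$ such that, for all couples $(\mathcal C,\mathcal D)$ of distinct points in $\overline{\mathbb C}$, the flux through $E$ of the Killing field associated to the translation along $(\mathcal C,\mathcal D)$ is $-2\pi\operatorname{Re}\left(\frac{\kappa}{\mathcal C-\mathcal D}\right)$, the flux through $E$ of the Killing field associated to the rotation about $(\mathcal C,\mathcal D)$ is $2\pi\operatorname{Im}\left(\frac{\kappa}{\mathcal C-\mathcal D}\right)$, and the flux polynomial of $E$ is $\Pi_E(X)=-2\pi\kappa$. In both cases, $\kappa=0$ (or, equivalently, $\Pi_E(X)=0$) if and only if the Hopf differential $\omega\,dg$ of $E$ is holomorphic at zero, i.e. the degree $\mu$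 of the secondary Gauss map $g$ at zero is at least $3$. (The number $\kappa$ is called the flux coefficient of $E$.)
   Context: Hyperbolic space is $\mathbb H^3=\{(\zeta,w)\in\mathbb C\times\mathbb R: w>0\}$, $\zeta=u+iv$, with metric $\langle\cdot,\cdot\rangle=(|d\zeta|^2+dw^2)/w^2$ and orientation $du\wedge dv\wedge dw$; its asymptotic boundary is identified with $\overline{\mathbb C}=\mathbb C\cup\{\infty\}$, on which isometries act. $(\mathcal A,\mathcal B)$ is the oriented geodesic from $\mathcal A$ to $\mathcal B$. In the formulas, if $\mathcal C$ or $\mathcal D$ is $\infty$ the fractions are understood as limits. A Bryant surface is a surface of constant mean curvature $1$ (half the trace of the second fundamental form). $\Omega$ is a neighbourhood of $0$ in $\mathbb C$, $\Omega^*=\Omega\setminus\{0\}$. A Bryant surface end is given by a conformal immersion $X=(\zeta,w):\Omega^*\to\mathbb H^3$ of constant mean curvature $1$ (puncture $0$ corresponding to the end), with the orientation induced by $X$ being that induced by the mean curvature vector $\vec H$. A Bryant representation is a holomorphic map $F=\begin{pmatrix} A & B \\ C & D \end{pmatrix}$ from the universal cover of $\Omega^*$ to $\mathrm{SL}_2(\mathbb C)$ with $dA\,dD-dB\,dC=0$, $\zeta=\frac{\bar A C+\bar B D}{|A|^2+|B|^2}$, $w=\frac1{|A|^2+|B|^2}$. The Weierstrass data $(g,\omega)$ are defined by $F^{-1}dF=\begin{pmatrix} g & -g^2 \\ 1 & -g \end{pmatrix}\omega$; $g$ is the secondary Gauss map and $\omega\,dg$ is the Hopf differential (single-valued, invariant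 under isometries). Canonical horospherical end of asymptotic boundary $\infty$: an embedded Bryant surface end of finite total curvature, with Weierstrass data $g=z^\mu$, $\omega=z^{-2}h(z)\,dz$, where $\mu\ge2$ is an integer and $h$ is holomorphic near $0$ with $h(0)\neq0$, and with a Bryant representation $F(z)=\begin{pmatrix} f_2(z) & b z^{2\mu-1}g_2(z) \\ c z^{-1}f_1(z) & g_1(z) \end{pmatrix}$, $b,c\in\mathbb C^*$, $f_1,f_2,g_1,g_2$ holomorphic near $0$ and equal to $1$ at $0$. Horospherical end of asymptotic boundary $\mathcal B$: an embedded Bryant surface end of finite total curvature, not part of a horosphere, which is mapped by an orientation-preserving isometry of $\mathbb H^3$ sending $\mathcal B$ to $\infty$ onto a canonical horospherical end of asymptotic boundary $\infty$; $\mu$ is the integer attached to this canonical end. Killing fields: for the translation $\Phi_t$ of (signed) distance $t$ along $(\mathcal C,\mathcal D)$, $Y$ is defined by $\frac{d\Phi_t}{dt}=Y(\Phi_t)$; for the rotation $R_\theta$ of angle $\theta$ in the direct sense about $(\mathcal C,\mathcal D)$, by $\frac{dR_\theta}{d\theta}=Y(R_\theta)$ (for $(0,\infty)$: $Y=(\zeta,w)$ and $Y=(i\zeta,0)$ respectively; the direct sense in general is obtained by conjugating with orientation-preserving isometries). Flux of a Killing field $Y$ through $E$: $\int_\Gamma\langle\eta,Y\rangle-2\int_K\langle\nu,Y\rangle$, where $\Gamma$ is a generator of $\pi_1(E)$, $K$ a topological disk with boundary $\Gamma$, $\eta$ the unit conormal to $\Gamma$ pointing towards the asymptotic boundary of the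 end; $\Gamma$ is oriented so that $(\Gamma,\eta,-\vec H)$ is positively oriented, and $\nu$ is the unit normal to $K$ inducing the same orientation on $\Gamma$. It does not depend on $\Gamma$, $K$. Flux polynomial: there is a unique $P_E(X,Y)\in\mathbb C[X,Y]$ such that for all distinct $\mathcal C,\mathcal D\in\overline{\mathbb C}$ the flux of the translation field along $(\mathcal C,\mathcal D)$ is $\operatorname{Re}\frac{P_E(\mathcal C,\mathcal D)}{\mathcal C-\mathcal D}$ and that of the rotation field is $-\operatorname{Im}\frac{P_E(\mathcal C,\mathcal D)}{\mathcal C-\mathcal D}$ (limits taken at $\infty$); it is $P_E=\varphi_2XY+\varphi_1(X+Y)+\varphi_0$ with $\varphi_0,\varphi_1,\varphi_2$ equal to $4\pi$ times the residues at $0$ of $D\,dC-C\,dD$, $C\,dB-D\,dA$, $B\,dA-A\,dB$. The flux polynomial is $\Pi_E(X)=P_E(X,X)$. *)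

(* Defs.v *)
(* Stdlib real numbers, with Coquelicot. *)
From Stdlib Require Import Reals.
From Coquelicot Require Import Coquelicot.

Open Scope R_scope.

(** * The upper half-space model of hyperbolic 3-space *)

(* Points (zeta, w) and tangent vectors share this type. *)
Definition Pt : Type := (C * R)%type.

Definition Pt_NM : NormedModule R_AbsRing :=
  prod_NormedModule R_AbsRing C_R_NormedModule R_NormedModule.

Definition px (p : Pt) : R := fst (fst p).
Definition py (p : Pt) : R := snd (fst p).
Definition pw (p : Pt) : R := snd p.

Definition H3 (p : Pt) : Prop := 0 < pw p.

Definition edot (a b : Pt) : R := px a * px b + py a * py b + pw a * pw b.

Definition ecross (a b : Pt) : Pt :=
  ((py a * pw b - pw a * py b, pw a * px b - px a * pw b),
   px a * py b - py a * px b).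

(* Positive exactly on the frames that are direct for du /\ dv /\ dw. *)
Definition det3 (a b c : Pt) : R := edot (ecross a b) c.

Definition vscal (k : R) (a : Pt) : Pt := ((k * px a, k * py a), k * pw a).
Definition vadd (a b : Pt) : Pt := ((px a + px b, py a + py b), pw a + pw b).

(* The metric <a, b> at the point p. *)
Definition hip (p a b : Pt) : R := edot a b / (pw p) ^ 2.
Definition hnorm (p a : Pt) : R := sqrt (hip p a a).

(* The unit normal n to the plane spanned by a and b, with (a, b, n) direct. *)
Definition unit_normal (p a b : Pt) : Pt :=
  vscal (pw p / sqrt (edot (ecross a b) (ecross a b))) (ecross a b).

Definition area_density (p a b : Pt) : R :=
  sqrt (hip p a a * hip p b b - (hip p a b) ^ 2).

(* The metric is e^(2f) times the Euclidean one with f = - ln w, so that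
   nabla_a b = D_a b + df(a) b + df(b) a - (a . b) grad f;
   Dab stands for the Euclidean derivative D_a b. *)
Definition cov_deriv (p a b Dab : Pt) : Pt :=
  vadd Dab
    (vadd (vscal (- (pw a / pw p)) b)
       (vadd (vscal (- (pw b / pw p)) a)
          ((0, 0), edot a b / pw p))).

(** * Asymptotic boundary and isometries *)

Inductive Cbar : Type := Fin (c : C) | Inf.

Definition to_bdry (b : Cbar) : (Pt -> Prop) -> Prop :=
  match b with
  | Fin c => within H3 (locally ((c, 0) : Pt))
  | Inf => fun P => exists M : R, forall p, H3 p -> M < edot p p -> P p
  end.

(* The continuous extension of Phi to the asymptotic boundary sends a to b. *)
Definition bdry_maps (Phi : Pt -> Pt) (a b : Cbar) : Prop :=
  filterlim Phi (to_bdry a) (to_bdry b).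

Definition preserves_metric_and_orientation (Phi : Pt -> Pt) : Prop :=
  forall p, H3 p -> H3 (Phi p) /\
  exists L : Pt -> Pt,
    filterdiff (U := Pt_NM) (V := Pt_NM) Phi (locally (T := Pt_NM) p) L /\
    (forall a b, hip (Phi p) (L a) (L b) = hip p a b) /\
    0 < det3 (L ((1, 0), 0)) (L ((0, 1), 0)) (L ((0, 0), 1)).

Definition oriented_isometry (Phi : Pt -> Pt) : Prop :=
  preserves_metric_and_orientation Phi /\
  exists Psi : Pt -> Pt,
    preserves_metric_and_orientation Psi /\
    forall p, H3 p -> Psi (Phi p) = p /\ Phi (Psi p) = p.

(** * Translations, rotations and their Killing fields *)

Definition std_translation (t : R) (p : Pt) : Pt := vscal (exp t) p.

Definition std_rotation (theta : R) (p : Pt) : Pt :=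
  ((cos theta * px p - sin theta * py p, sin theta * px p + cos theta * py p),
   pw p).

(* flow is the conjugate of the one-parameter group std of the geodesic
   (0, oo) by a direct isometry sending (0, oo) to (c, d). *)
Definition conjugate_flow (std : R -> Pt -> Pt) (c d : Cbar)
    (flow : R -> Pt -> Pt) : Prop :=
  exists Psi : Pt -> Pt, oriented_isometry Psi /\
    bdry_maps Psi (Fin 0%C) c /\ bdry_maps Psi Inf d /\
    forall t p, H3 p -> flow t (Psi p) = Psi (std t p).

Definition generates (flow : R -> Pt -> Pt) (Y : Pt -> Pt) : Prop :=
  forall t p, H3 p ->
    is_derive (V := Pt_NM) (fun s => flow s p) t (Y (flow t p)).

Definition translation_field (c d : Cbar) (Y : Pt -> Pt) : Prop :=
  exists flow, conjugate_flow std_translation c d flow /\ generates flow Y.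

Definition rotation_field (c d : Cbar) (Y : Pt -> Pt) : Prop :=
  exists flow, conjugate_flow std_rotation c d flow /\ generates flow Y.

(** * Parametrized surfaces *)

Definition du (f : C -> R) (z : C) : R := Derive (fun x => f (x, snd z)) (fst z).
Definition dv (f : C -> R) (z : C) : R := Derive (fun y => f (fst z, y)) (snd z).

Fixpoint class_C (k : nat) (U : C -> Prop) (f : C -> R) : Prop :=
  (forall z, U z -> continuous f z) /\
  match k with
  | O => True
  | S k' =>
      (forall z, U z -> ex_derive (fun x => f (x, snd z)) (fst z) /\
                        ex_derive (fun y => f (fst z, y)) (snd z)) /\
      class_C k' U (du f) /\ class_C k' U (dv f)
  end.

Definition class_C_Pt (k : nat) (U : C -> Prop) (X : C -> Pt) : Prop :=
  class_C k U (fun z => px (X z)) /\ class_C k U (fun z => py (X z)) /\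
  class_C k U (fun z => pw (X z)).

Definition du_Pt (X : C -> Pt) (z : C) : Pt :=
  ((du (fun z => px (X z)) z, du (fun z => py (X z)) z),
   du (fun z => pw (X z)) z).
Definition dv_Pt (X : C -> Pt) (z : C) : Pt :=
  ((dv (fun z => px (X z)) z, dv (fun z => py (X z)) z),
   dv (fun z => pw (X z)) z).

(* The differential of X at z, applied to n in C = R^2. *)
Definition dmap (X : C -> Pt) (z n : C) : Pt :=
  vadd (vscal (fst n) (du_Pt X z)) (vscal (snd n) (dv_Pt X z)).

Definition normal (X : C -> Pt) (z : C) : Pt :=
  unit_normal (X z) (du_Pt X z) (dv_Pt X z).

(* First (I_) and second (II_) fundamental forms, the latter with respect to
   [normal X]. *)
Definition I_uu X z := hip (X z) (du_Pt X z) (du_Pt X z).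
Definition I_uv X z := hip (X z) (du_Pt X z) (dv_Pt X z).
Definition I_vv X z := hip (X z) (dv_Pt X z) (dv_Pt X z).
Definition II_uu X z :=
  hip (X z) (cov_deriv (X z) (du_Pt X z) (du_Pt X z) (du_Pt (du_Pt X) z))
    (normal X z).
Definition II_uv X z :=
  hip (X z) (cov_deriv (X z) (du_Pt X z) (dv_Pt X z) (du_Pt (dv_Pt X) z))
    (normal X z).
Definition II_vv X z :=
  hip (X z) (cov_deriv (X z) (dv_Pt X z) (dv_Pt X z) (dv_Pt (dv_Pt X) z))
    (normal X z).

(* Half the trace of the second fundamental form. *)
Definition mean_curvature_vector (X : C -> Pt) (z : C) : Pt :=
  vscal ((I_vv X z * II_uu X z - 2 * I_uv X z * II_uv X z + I_uu X z * II_vv X z)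
         / (2 * (I_uu X z * I_vv X z - I_uv X z ^ 2)))
    (normal X z).

(* Gauss equation in ambient curvature -1. *)
Definition gauss_curvature (X : C -> Pt) (z : C) : R :=
  - 1 + (II_uu X z * II_vv X z - II_uv X z ^ 2)
        / (I_uu X z * I_vv X z - I_uv X z ^ 2).

(** * Bryant surface ends *)

Definition punctured (Omega : C -> Prop) (z : C) : Prop := Omega z /\ z <> 0%C.
Definition disc (r : R) (z : C) : Prop := Cmod z < r.
Definition closed_disc (r : R) (z : C) : Prop := Cmod z <= r.

Definition bryant_end (Omega : C -> Prop) (X : C -> Pt) : Prop :=
  open Omega /\ Omega 0%C /\
  (forall k, class_C_Pt k (punctured Omega) X) /\
  forall z, punctured Omega z ->
    H3 (X z) /\
    0 < I_uu X z /\ I_vv X z = I_uu X z /\ I_uv X z = 0 /\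
    hnorm (X z) (mean_curvature_vector X z) = 1 /\
    0 < det3 (du_Pt X z) (dv_Pt X z) (mean_curvature_vector X z).

(* An injective map that is a homeomorphism onto its image. *)
Definition embedded (Omega : C -> Prop) (X : C -> Pt) : Prop :=
  (forall z z', punctured Omega z -> punctured Omega z' -> X z = X z' -> z = z') /\
  forall z, punctured Omega z -> forall eps : posreal, exists delta : posreal,
    forall z', punctured Omega z' -> ball (X z) delta (X z') -> ball z eps z'.

(* r e^(it) *)
Definition polar (r t : R) : C := (r * cos t, r * sin t).

(* Integral over the annulus eps < |z| < r, in polar coordinates. *)
Definition annulus_int (f : C -> R) (eps r : R) : R :=
  RInt (fun s => s * RInt (fun t => f (polar s t)) 0 (2 * PI)) eps r.

Definition finite_total_curvature (Omega : C -> Prop) (X : C -> Pt) : Prop :=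
  exists r M : R, 0 < r /\ (forall z, closed_disc r z -> Omega z) /\
    forall eps, 0 < eps < r ->
      annulus_int (fun z => Rabs (gauss_curvature X z)
                            * area_density (X z) (du_Pt X z) (dv_Pt X z))
        eps r <= M.

Definition horosphere (S : Pt -> Prop) : Prop :=
  (exists c, 0 < c /\ forall p, S p <-> pw p = c) \/
  (exists a b rho, 0 < rho /\ forall p, S p <->
     H3 p /\ (px p - a) ^ 2 + (py p - b) ^ 2 + (pw p - rho) ^ 2 = rho ^ 2).

Definition not_part_of_horosphere (Omega : C -> Prop) (X : C -> Pt) : Prop :=
  forall S, horosphere S -> ~ forall z, punctured Omega z -> S (X z).

(** * Bryant representations and Weierstrass data *)

Definition complex_derive (f : C -> C) (z l : C) : Prop :=
  is_derive (K := C_AbsRing) (V := C_NormedModule) f z l.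

Definition holomorphic_on (U : C -> Prop) (f : C -> C) : Prop :=
  forall z, U z -> exists l : C, complex_derive f z l.

(* F is the matrix with rows (A, B) and (C0, D); a representation on the
   universal cover of a punctured domain is, over any disc, a representation
   in this sense. *)
Definition bryant_rep (U : C -> Prop) (X : C -> Pt) (A B C0 D : C -> C) : Prop :=
  forall z, U z ->
    (A z * D z - B z * C0 z = 1)%C /\
    (exists A' B' C' D' : C,
       complex_derive A z A' /\ complex_derive B z B' /\
       complex_derive C0 z C' /\ complex_derive D z D' /\
       (A' * D' - B' * C' = 0)%C) /\
    let m := Cmod (A z) ^ 2 + Cmod (B z) ^ 2 in
    X z = (((Cconj (A z) * C0 z + Cconj (B z) * D z) / RtoC m)%C, 1 / m).

(* F^-1 dF = ((g, - g^2), (1, - g)) om dz; om is the coefficient of omega. *)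
Definition weierstrass_data (U : C -> Prop) (A B C0 D g om : C -> C) : Prop :=
  forall z, U z ->
    exists A' B' C' D' : C,
      complex_derive A z A' /\ complex_derive B z B' /\
      complex_derive C0 z C' /\ complex_derive D z D' /\
      (D z * A' - B z * C' = g z * om z)%C /\
      (D z * B' - B z * D' = - (g z ^ 2) * om z)%C /\
      (- C0 z * A' + A z * C' = om z)%C /\
      (- C0 z * B' + A z * D' = - g z * om z)%C.

(* The Hopf differential of X at z is q dz^2. It is computed from a local
   branch of a Bryant representation whose Gauss map has no pole near z; such
   branches differ by constant factors in SU(2), which do not change it. *)
Definition hopf_coefficient (X : C -> Pt) (z q : C) : Prop :=
  exists (eps : R) (A B C0 D g om : C -> C) (g' : C),
    0 < eps /\
    let U := fun y : C => Cmod (y - z)%C < eps in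
    bryant_rep U X A B C0 D /\ weierstrass_data U A B C0 D g om /\
    complex_derive g z g' /\ q = (om z * g')%C.

Definition hopf_holomorphic_at_0 (Omega : C -> Prop) (X : C -> Pt) : Prop :=
  exists (r : R) (q : C -> C), 0 < r /\ holomorphic_on (disc r) q /\
    forall z, punctured (disc r) z -> Omega z /\ hopf_coefficient X z (q z).

(** * Horospherical ends *)

Definition canonical_horospherical_end (Omega : C -> Prop) (X : C -> Pt)
    (mu : nat) : Prop :=
  bryant_end Omega X /\ embedded Omega X /\ finite_total_curvature Omega X /\
  (2 <= mu)%nat /\
  exists (r : R) (h f1 f2 g1 g2 : C -> C) (b c : C),
    0 < r /\ (forall z, disc r z -> Omega z) /\
    holomorphic_on (disc r) h /\ h 0%C <> 0%C /\
    holomorphic_on (disc r) f1 /\ f1 0%C = 1%C /\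
    holomorphic_on (disc r) f2 /\ f2 0%C = 1%C /\
    holomorphic_on (disc r) g1 /\ g1 0%C = 1%C /\
    holomorphic_on (disc r) g2 /\ g2 0%C = 1%C /\
    b <> 0%C /\ c <> 0%C /\
    let A := f2 in
    let B := fun z => (b * z ^ (2 * mu - 1) * g2 z)%C in
    let C0 := fun z => (c * / z * f1 z)%C in
    let D := g1 in
    bryant_rep (punctured (disc r)) X A B C0 D /\
    weierstrass_data (punctured (disc r)) A B C0 D
      (fun z => (z ^ mu)%C) (fun z => (h z / z ^ 2)%C).

(* Near their punctures the two parametrizations differ by a local conformal
   change of coordinate: they are parametrizations of the same end. *)
Definition same_end (Omega : C -> Prop) (X : C -> Pt)
    (Omega' : C -> Prop) (X' : C -> Pt) : Prop :=
  exists (r : R) (phi : C -> C) (phi'0 : C),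
    0 < r /\ holomorphic_on (disc r) phi /\ phi 0%C = 0%C /\
    complex_derive phi 0%C phi'0 /\ phi'0 <> 0%C /\
    forall z, punctured (disc r) z ->
      Omega z /\ punctured Omega' (phi z) /\ X z = X' (phi z).

Definition horospherical_end (Omega : C -> Prop) (X : C -> Pt) (B : Cbar)
    (mu : nat) : Prop :=
  bryant_end Omega X /\ embedded Omega X /\ finite_total_curvature Omega X /\
  not_part_of_horosphere Omega X /\
  exists (Phi : Pt -> Pt) (Omega' : C -> Prop) (X' : C -> Pt),
    oriented_isometry Phi /\ bdry_maps Phi B Inf /\
    canonical_horospherical_end Omega' X' mu /\
    same_end Omega (fun z => Phi (X z)) Omega' X'.

(** * Flux *)

Definition velocity (gam : R -> C) (t : R) : C :=
  (Derive (fun s => fst (gam s)) t, Derive (fun s => snd (gam s)) t).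

Definition regular_loop (Omega : C -> Prop) (gam : R -> C) : Prop :=
  forall t, punctured Omega (gam t) /\ gam (t + 2 * PI) = gam t /\
    ex_derive (fun s => fst (gam s)) t /\ ex_derive (fun s => snd (gam s)) t /\
    continuous (velocity gam) t /\ velocity gam t <> 0%C.

Definition freely_homotopic (Omega : C -> Prop) (gam0 gam1 : R -> C) : Prop :=
  exists Hm : R * R -> C,
    (forall st, continuous Hm st) /\
    forall s t, 0 <= s <= 1 ->
      punctured Omega (Hm (s, t)) /\ Hm (s, t + 2 * PI) = Hm (s, t) /\
      Hm (0, t) = gam0 t /\ Hm (1, t) = gam1 t.

(* dX(n) is the unit conormal eta at z = gam t to Gamma = X o gam (v is the
   velocity of gam), with (Gamma', eta, - H) direct. *)
Definition conormal_at (X : C -> Pt) (z v n : C) : Prop :=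
  hip (X z) (dmap X z n) (dmap X z v) = 0 /\
  hnorm (X z) (dmap X z n) = 1 /\
  0 < det3 (dmap X z v) (dmap X z n) (vscal (-1) (mean_curvature_vector X z)).

(* gam is a generator of the fundamental group, oriented so that the conormal
   fixed by [conormal_at] points towards the puncture. For a loop that is not
   simple, "towards the puncture" has no pointwise meaning; it is read on a
   circle |z| = rho in the free homotopy class of gam. *)
Definition end_generator (Omega : C -> Prop) (X : C -> Pt) (gam : R -> C) : Prop :=
  regular_loop Omega gam /\
  exists rho sigma : R, 0 < rho /\ (forall z, closed_disc rho z -> Omega z) /\
    (sigma = 1 \/ sigma = -1) /\
    let circ := fun t => polar rho (sigma * t) in
    freely_homotopic Omega gam circ /\
    forall t n, conormal_at X (circ t) (velocity circ t) n ->
      Re (Cconj (circ t) * n)%C < 0.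

(* k parametrizes K by the closed unit disc; its boundary is parametrized
   counterclockwise by Gamma, so that the normal [normal k] of K induces on
   Gamma its own orientation (outward direction first). *)
Definition spanning_disk (X : C -> Pt) (gam : R -> C) (k : C -> Pt) : Prop :=
  (exists r, 1 < r /\ class_C_Pt 2 (disc r) k) /\
  (forall z, closed_disc 1 z -> H3 (k z)) /\
  forall t, k (polar 1 t) = X (gam t).

Definition flux_config (Omega : C -> Prop) (X : C -> Pt)
    (gam n : R -> C) (k : C -> Pt) : Prop :=
  end_generator Omega X gam /\
  (forall t, conormal_at X (gam t) (velocity gam t) (n t)) /\
  spanning_disk X gam k.

(* Where k is not immersed the area density of K vanishes, and so does the
   second integrand. *)
Definition flux_integral (X : C -> Pt) (Y : Pt -> Pt) (gam n : R -> C) (k : C -> Pt) : R :=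
  RInt (fun t =>
          let p := X (gam t) in
          hip p (dmap X (gam t) (n t)) (Y p)
          * hnorm p (dmap X (gam t) (velocity gam t))) 0 (2 * PI)
  - 2 * annulus_int (fun z =>
          hip (k z) (normal k z) (Y (k z))
          * area_density (k z) (du_Pt k z) (dv_Pt k z)) 0 1.

Definition is_flux (Omega : C -> Prop) (X : C -> Pt) (Y : Pt -> Pt) (v : R) : Prop :=
  (exists gam n k, flux_config Omega X gam n k) /\
  forall gam n k, flux_config Omega X gam n k -> flux_integral X Y gam n k = v.

Definition translation_flux (Omega : C -> Prop) (X : C -> Pt) (c d : Cbar)
    (v : R) : Prop :=
  (exists Y, translation_field c d Y) /\
  forall Y, translation_field c d Y -> is_flux Omega X Y v.

Definition rotation_flux (Omega : C -> Prop) (X : C -> Pt) (c d : Cbar)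
    (v : R) : Prop :=
  (exists Y, rotation_field c d Y) /\
  forall Y, rotation_field c d Y -> is_flux Omega X Y v.

(** * Flux polynomial *)

Definition C_infty (P : C -> Prop) : Prop := exists M : R, forall z, M < Cmod z -> P z.

(* l is the value of num(c, d) / (c - d), a limit if c or d is infinite. *)
Definition ext_fraction (num : C -> C -> C) (c d : Cbar) (l : C) : Prop :=
  match c, d with
  | Fin c, Fin d => l = (num c d / (c - d))%C
  | Inf, Fin d => filterlim (fun z => (num z d / (z - d))%C) C_infty (locally l)
  | Fin c, Inf => filterlim (fun z => (num c z / (c - z))%C) C_infty (locally l)
  | Inf, Inf => False
  end.

(* Polynomials over C are identified with polynomial functions. *)
Definition polynomial2 (P : C -> C -> C) : Prop :=
  exists (N : nat) (a : nat -> nat -> C), forall x y : C,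
    P x y = sum_n (fun i => sum_n (fun j => (a i j * x ^ i * y ^ j)%C) N) N.

Definition is_flux_polynomial2 (Omega : C -> Prop) (X : C -> Pt)
    (P : C -> C -> C) : Prop :=
  polynomial2 P /\
  forall c d : Cbar, c <> d -> exists l : C, ext_fraction P c d l /\
    translation_flux Omega X c d (Re l) /\ rotation_flux Omega X c d (- Im l).

(* Pi(x) = P(x, x) for the unique P of [is_flux_polynomial2]. *)
Definition is_flux_polynomial (Omega : C -> Prop) (X : C -> Pt)
    (Pi : C -> C) : Prop :=
  exists P : C -> C -> C, is_flux_polynomial2 Omega X P /\
    (forall P', is_flux_polynomial2 Omega X P' -> forall x y, P' x y = P x y) /\
    forall x, Pi x = P x x.

(* Main.v *)
Require Import Defs.
From Stdlib Require Import Reals.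
From Coquelicot Require Import Coquelicot.
From Stdlib Require Import Lra Psatz Classical ClassicalEpsilon.
(* again, so that [disc] denotes the disc in the plane *)
Require Import Defs.

(** Why the theorem is true.

    A Killing field of hyperbolic space is determined by a quadratic vector field
    [q(z) d/dz] of the sphere at infinity ([killing]). Killing fields are divergence
    free, and [sigma q] is an explicit primitive of twice the contraction of the
    volume form with [killing q]. Green's formula therefore turns the integral over
    the spanning disk into one over its boundary, and since in a conformal
    parametrization the conormal is a quarter turn of the tangent, the whole flux is
    the integral of a 1-form [theta] over the generator ([flux_is_loop_int]). Mean
    curvature one makes [theta] closed ([theta_closed]). Closed forms have the same
    integral over freely homotopic loops ([homotopy_invariance]), so the flux can be
    computed on any small circle, turning clockwise ([is_flux_small_circle]).

    On a surface with a Bryant representation [theta] is twice the imaginary part of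
    a holomorphic form, which up to an exact form is
    [dg (q_2 C^2 + q_1 A C + q_0 A^2)] ([along_bryant], [pairing_primitive]). On the
    canonical end [g = z^mu] and [C = (c / z) f_1], so only the term of [C^2] can
    have a pole at the puncture: its residue is [2 q_2 c^2] if [mu = 2] and zero if
    [mu >= 3]. Hence the flux is [- 8 pi Re (q_2 c^2)] or zero
    ([canonical_loop_limit]).

    A horospherical end is carried to a canonical one by an isometry sending [B] to
    infinity. An oriented isometry fixing infinity is a similarity
    ([isometry_fixing_inf]): isometries preserve the distance, because [ln w] is
    1-Lipschitz on vertical lines, and letting one of two points go to infinity shows
    that the heights are multiplied by a constant. So the isometry is a Moebius
    transformation; [theta] is natural under it, and the coefficient [q_2] of the
    transformed field is a nonzero multiple [a] of the value of [q] at [B]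
    ([horospherical_normal_form], [canonical_flux]). Two isometries sending the
    vertical axis to the geodesic [(c, d)] differ by a dilation, which commutes with
    translations and rotations; the translation field therefore is the one of
    [(z - c) (z - d) / (c - d)] and the rotation field is the one of [i] times this
    polynomial ([conjugate_field_unique]). This gives the two formulas, with
    [kappa = 4 a c^2] if [mu = 2] and [kappa = 0] if [mu >= 3].

    In the coordinate of the canonical end the Hopf differential is
    [mu h z^(mu - 3) dz^2], with a pole exactly for [mu = 2] ([canonical_hopf]). It
    does not depend on the local representation, because two of them differ by a
    constant matrix of SU(2) ([hopf_coefficient_unique]), and the change of
    coordinate has a holomorphic derivative ([derivative_holomorphic], obtained from
    Goursat's lemma and a mean value property).

    Finally a flux polynomial is determined off the diagonal by the fluxes along
    geodesics with finite end points, and on the diagonal by continuity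
    ([flux_polynomial2_unique]). *)

Open Scope R_scope.

(** * Differential calculus in the plane *)

(** The partial derivatives are parameters, so that the rules below compute them
    by unification. *)
Definition D2 (f : C -> R) (z : C) (a b : R) : Prop :=
  differentiable_pt_lim (fun x y => f (x, y)) (fst z) (snd z) a b.

Lemma D2_eq f z a b a' b' : D2 f z a b -> a = a' -> b = b' -> D2 f z a' b'.
Proof. now intros H <- <-. Qed.

Lemma Cball_locally (P : C -> Prop) (z : C) :
  locally z P <-> exists d, 0 < d /\ forall y, Cmod (y - z) < d -> P y.
Proof.
  split.
  - intros [d Hd]. exists d. split; [apply cond_pos|]. intros y Hy. apply Hd.
    apply C_NormedModule_mixin_compat1. exact Hy.
  - intros [d [Hd H]].
    assert (Hs : 0 < d / sqrt 2) by (apply Rdiv_lt_0_compat; auto; apply sqrt_lt_R0; lra).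
    exists (mkposreal _ Hs). intros y Hy. apply H.
    pose proof (C_NormedModule_mixin_compat2 z y _ Hy) as H1. simpl in H1.
    replace d with (sqrt 2 * (d / sqrt 2)); [exact H1|]. field. apply Rgt_not_eq, sqrt_lt_R0; lra.
Qed.

Lemma locally_2d_C (P : R -> R -> Prop) (z : C) :
  locally_2d P (fst z) (snd z) <-> locally z (fun y : C => P (fst y) (snd y)).
Proof. destruct z as [x y]. apply locally_2d_locally. Qed.

Lemma locally_2d_C' (P : C -> Prop) (z : C) :
  locally_2d (fun x y => P (x, y)) (fst z) (snd z) <-> locally z P.
Proof.
  rewrite (locally_2d_C (fun x y => P (x, y))). split; apply filter_imp; intros [x y]; auto.
Qed.

Lemma D2_ext_loc f g z a b : locally z (fun y => f y = g y) -> D2 f z a b -> D2 g z a b.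
Proof.
  intros H. apply differentiable_pt_lim_ext. apply (locally_2d_C' (fun y => f y = g y)). exact H.
Qed.

Lemma D2_ext f g z a b : (forall y, f y = g y) -> D2 f z a b -> D2 g z a b.
Proof. intros H. apply D2_ext_loc. apply filter_forall. exact H. Qed.

Lemma continuity_2d_C (f : C -> R) (z : C) :
  continuity_2d_pt (fun x y => f (x, y)) (fst z) (snd z) <-> continuous f z.
Proof.
  rewrite continuity_2d_pt_filterlim. destruct z as [x y]. simpl. unfold continuous.
  split; apply filterlim_ext; intros [u v]; reflexivity.
Qed.

Lemma D2_continuous f z a b : D2 f z a b -> continuous f z.
Proof.
  intros H. apply continuity_2d_C. apply differentiable_continuity_pt. exists a, b. exact H.
Qed.

Lemma D2_partials f z a b : D2 f z a b -> du f z = a /\ dv f z = b.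
Proof. intros H. apply differentiable_pt_lim_unique in H. exact H. Qed.

Lemma D2_unique f z a b a' b' : D2 f z a b -> D2 f z a' b' -> a = a' /\ b = b'.
Proof.
  intros H H'. apply D2_partials in H. apply D2_partials in H'. intuition congruence.
Qed.

Lemma D2_comp2 (F : R -> R -> R) (f g : C -> R) z lx ly a b a' b' :
  differentiable_pt_lim F (f z) (g z) lx ly -> D2 f z a b -> D2 g z a' b' ->
  D2 (fun y => F (f y) (g y)) z (lx * a + ly * a') (lx * b + ly * b').
Proof.
  destruct z as [x y]. unfold D2. intros H Hf Hg.
  now apply (differentiable_pt_lim_comp F (fun x y => f (x, y)) (fun x y => g (x, y))).
Qed.

Lemma D2_const c z : D2 (fun _ => c) z 0 0.
Proof.
  intros eps. exists (mkposreal 1 Rlt_0_1). intros u v _ _.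
  replace (c - c - _) with 0 by ring. rewrite Rabs_R0.
  apply Rmult_le_pos; [apply Rlt_le, cond_pos|]. eapply Rle_trans; [apply Rabs_pos|apply Rmax_l].
Qed.

Lemma D2_fst z : D2 (fun y => fst y) z 1 0.
Proof.
  intros eps. exists (mkposreal 1 Rlt_0_1). intros u v _ _. simpl.
  replace (u - fst z - _) with 0 by ring. rewrite Rabs_R0.
  apply Rmult_le_pos; [apply Rlt_le, cond_pos|]. eapply Rle_trans; [apply Rabs_pos|apply Rmax_l].
Qed.

Lemma D2_snd z : D2 (fun y => snd y) z 0 1.
Proof.
  intros eps. exists (mkposreal 1 Rlt_0_1). intros u v _ _. simpl.
  replace (v - snd z - _) with 0 by ring. rewrite Rabs_R0.
  apply Rmult_le_pos; [apply Rlt_le, cond_pos|]. eapply Rle_trans; [apply Rabs_pos|apply Rmax_l].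
Qed.

Lemma D2_comp1 (F : R -> R) (f : C -> R) z l a b :
  is_derive F (f z) l -> D2 f z a b -> D2 (fun y => F (f y)) z (l * a) (l * b).
Proof.
  intros HF Hf. apply is_derive_Reals in HF.
  apply differentiable_pt_lim_proj1_0 with (y := f z) in HF.
  eapply D2_eq; [exact (D2_comp2 (fun u _ => F u) f f z _ _ _ _ _ _ HF Hf Hf)|ring|ring].
Qed.

Lemma D2_plus f g z a b a' b' :
  D2 f z a b -> D2 g z a' b' -> D2 (fun y => f y + g y) z (a + a') (b + b').
Proof.
  intros Hf Hg.
  assert (H : differentiable_pt_lim Rplus (f z) (g z) 1 1).
  { intros eps. exists (mkposreal 1 Rlt_0_1). intros u v _ _. simpl.
    replace (u + v - _ - _) with 0 by ring. rewrite Rabs_R0.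
    apply Rmult_le_pos; [apply Rlt_le, cond_pos|].
    eapply Rle_trans; [apply Rabs_pos|apply Rmax_l]. }
  eapply D2_eq; [exact (D2_comp2 _ _ _ _ _ _ _ _ _ _ H Hf Hg)|ring|ring].
Qed.

Lemma D2_mult f g z a b a' b' :
  D2 f z a b -> D2 g z a' b' ->
  D2 (fun y => f y * g y) z (a * g z + f z * a') (b * g z + f z * b').
Proof.
  intros Hf Hg.
  assert (H : differentiable_pt_lim Rmult (f z) (g z) (g z) (f z)).
  { intros eps. exists eps. intros u v Hu Hv. simpl.
    replace (u * v - _ - _) with ((u - f z) * (v - g z)) by ring. rewrite Rabs_mult.
    apply Rmult_le_compat; try apply Rabs_pos; [lra|apply Rmax_r]. }
  eapply D2_eq; [exact (D2_comp2 _ _ _ _ _ _ _ _ _ _ H Hf Hg)|ring|ring].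
Qed.

Lemma D2_scal k f z a b : D2 f z a b -> D2 (fun y => k * f y) z (k * a) (k * b).
Proof.
  intros Hf. eapply D2_eq; [exact (D2_mult _ _ _ _ _ _ _ (D2_const k z) Hf)|cbv beta; ring|cbv beta; ring].
Qed.

Lemma D2_opp f z a b : D2 f z a b -> D2 (fun y => - f y) z (- a) (- b).
Proof.
  intros Hf. apply (D2_ext (fun y => -1 * f y)); [intros; ring|].
  eapply D2_eq; [exact (D2_scal (-1) _ _ _ _ Hf)|ring|ring].
Qed.

Lemma D2_minus f g z a b a' b' :
  D2 f z a b -> D2 g z a' b' -> D2 (fun y => f y - g y) z (a - a') (b - b').
Proof.
  intros Hf Hg. exact (D2_plus _ _ _ _ _ _ _ Hf (D2_opp _ _ _ _ Hg)).
Qed.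

Lemma D2_inv f z a b : D2 f z a b -> f z <> 0 ->
  D2 (fun y => / f y) z (- a / f z ^ 2) (- b / f z ^ 2).
Proof.
  intros Hf H0. assert (H := is_derive_inv (fun x => x) (f z) 1 (is_derive_id _) H0).
  eapply D2_eq; [exact (D2_comp1 _ _ _ _ _ _ H Hf)|cbv beta; now field|cbv beta; now field].
Qed.

Lemma D2_div f g z a b a' b' : D2 f z a b -> D2 g z a' b' -> g z <> 0 ->
  D2 (fun y => f y / g y) z ((a * g z - f z * a') / g z ^ 2)
    ((b * g z - f z * b') / g z ^ 2).
Proof.
  intros Hf Hg H0.
  eapply D2_eq; [exact (D2_mult _ _ _ _ _ _ _ Hf (D2_inv _ _ _ _ Hg H0))|cbv beta; now field|cbv beta; now field].
Qed.

Lemma D2_pow2 f z a b : D2 f z a b -> D2 (fun y => f y ^ 2) z (2 * f z * a) (2 * f z * b).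
Proof.
  intros Hf. apply (D2_ext (fun y => f y * f y)); [intros; ring|].
  eapply D2_eq; [exact (D2_mult _ _ _ _ _ _ _ Hf Hf)|ring|ring].
Qed.

Lemma D2_comp (f g h : C -> R) z a b a1 b1 a2 b2 :
  D2 f (g z, h z) a b -> D2 g z a1 b1 -> D2 h z a2 b2 ->
  D2 (fun y => f (g y, h y)) z (a * a1 + b * a2) (a * b1 + b * b2).
Proof. exact (D2_comp2 (fun x y => f (x, y)) g h z a b a1 b1 a2 b2). Qed.

Lemma D2_curve (f : C -> R) (x y : R -> R) t a b x' y' :
  D2 f (x t, y t) a b -> is_derive x t x' -> is_derive y t y' ->
  is_derive (fun s => f (x s, y s)) t (a * x' + b * y').
Proof.
  intros H Hx Hy. apply is_derive_Reals. apply is_derive_Reals in Hx, Hy.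
  exact (derivable_pt_lim_comp_2d (fun x y => f (x, y)) x y t a b x' y' H Hx Hy).
Qed.

Lemma continuous_pair {T : UniformSpace} (f g : T -> R) (x : T) :
  continuous f x -> continuous g x -> continuous (fun t => (f t, g t) : C) x.
Proof.
  intros Hx Hy. apply filterlim_locally. intros eps.
  generalize (proj1 (filterlim_locally _ _) Hx eps) (proj1 (filterlim_locally _ _) Hy eps).
  intros H1 H2. generalize (filter_and _ _ H1 H2). apply filter_imp. intros s [H3 H4]. now split.
Qed.

Lemma continuous_curve (f : C -> R) (x y : R -> R) t :
  continuous f (x t, y t) -> continuous x t -> continuous y t ->
  continuous (fun s => f (x s, y s)) t.
Proof.
  intros Hf Hx Hy. apply (continuous_comp (fun s => (x s, y s) : C) f); auto.
  now apply continuous_pair.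
Qed.

(** ** Complex differentiability *)

Lemma complex_derive_eps (f : C -> C) (z l : C) :
  complex_derive f z l <->
  forall eps, 0 < eps -> exists d, 0 < d /\ forall y : C, Cmod (y - z) < d ->
    Cmod (f y - f z - (y - z) * l)%C <= eps * Cmod (y - z)%C.
Proof.
  split.
  - intros [_ H] eps Heps.
    specialize (H z (fun P HP => HP) (mkposreal _ Heps)).
    apply locally_C in H. apply Cball_locally in H. destruct H as [d [Hd H]].
    exists d. split; [exact Hd|]. intros y Hy. exact (H y Hy).
  - intros H. split.
    + apply (is_linear_scal_l (K := C_AbsRing) (V := C_NormedModule) l).
    + intros x Hx.
      assert (E : z = x).
      { apply (is_filter_lim_locally_unique (K := C_AbsRing) (V := AbsRing_NormedModule C_AbsRing)).
        exact Hx. }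
      rewrite <- E. intros eps. apply locally_C. apply Cball_locally.
      destruct (H eps (cond_pos eps)) as [d [Hd H']]. exists d. split; [exact Hd|].
      intros y Hy. exact (H' y Hy).
Qed.

Lemma Cmod_le_Rabs (z : C) : Cmod z <= Rabs (fst z) + Rabs (snd z).
Proof.
  unfold Cmod. apply Rsqr_incr_0_var.
  - rewrite Rsqr_sqrt by (apply Rplus_le_le_0_compat; apply pow2_ge_0).
    unfold Rsqr. rewrite <- (pow2_abs (fst z)), <- (pow2_abs (snd z)).
    pose proof (Rabs_pos (fst z)). pose proof (Rabs_pos (snd z)). nra.
  - pose proof (Rabs_pos (fst z)). pose proof (Rabs_pos (snd z)). lra.
Qed.

Lemma Rabs_fst_le_Cmod (z : C) : Rabs (fst z) <= Cmod z.
Proof. eapply Rle_trans; [apply Rmax_l|apply Rmax_Cmod]. Qed.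
Lemma Rabs_snd_le_Cmod (z : C) : Rabs (snd z) <= Cmod z.
Proof. eapply Rle_trans; [apply Rmax_r|apply Rmax_Cmod]. Qed.

Lemma D2_eps (f : C -> R) z a b :
  D2 f z a b <->
  forall eps, 0 < eps -> exists d, 0 < d /\ forall y : C, Cmod (y - z) < d ->
    Rabs (f y - f z - (a * (fst y - fst z) + b * (snd y - snd z))) <= eps * Cmod (y - z)%C.
Proof.
  split.
  - intros H eps Heps. destruct (H (mkposreal _ Heps)) as [d Hd].
    exists d. split; [apply cond_pos|]. intros [y1 y2] Hy. destruct z as [z1 z2].
    eapply Rle_trans; [apply (Hd y1 y2)|].
    + simpl. eapply Rle_lt_trans; [|exact Hy]. apply (Rabs_fst_le_Cmod ((y1, y2) - (z1, z2))%C).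
    + simpl. eapply Rle_lt_trans; [|exact Hy]. apply (Rabs_snd_le_Cmod ((y1, y2) - (z1, z2))%C).
    + simpl. apply Rmult_le_compat_l; [lra|].
      apply (Rmax_Cmod ((y1, y2) - (z1, z2))%C).
  - intros H eps.
    assert (He : 0 < eps / 2) by (generalize (cond_pos eps); lra).
    destruct (H _ He) as [d [Hd H1]].
    exists (mkposreal _ (is_pos_div_2 (mkposreal _ Hd))). simpl. intros u v Hu Hv.
    assert (Hc : Cmod ((u, v) - z)%C <= 2 * Rmax (Rabs (u - fst z)) (Rabs (v - snd z))).
    { eapply Rle_trans; [apply Cmod_le_Rabs|]. simpl.
      change (u + - fst z) with (u - fst z). change (v + - snd z) with (v - snd z).
      pose proof (Rmax_l (Rabs (u - fst z)) (Rabs (v - snd z))).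
      pose proof (Rmax_r (Rabs (u - fst z)) (Rabs (v - snd z))). lra. }
    destruct z as [z1 z2]. simpl in *.
    eapply Rle_trans; [apply (H1 (u, v))|].
    + eapply Rle_lt_trans; [apply Cmod_le_Rabs|]. simpl.
      change (u + - z1) with (u - z1). change (v + - z2) with (v - z2). lra.
    + replace (eps * _) with (eps / 2 * (2 * Rmax (Rabs (u - z1)) (Rabs (v - z2)))) by field.
      apply Rmult_le_compat_l; lra.
Qed.

(** The Cauchy-Riemann equations. Through them every rule for differentiable
    functions of the plane becomes a rule for holomorphic functions. *)
Lemma complex_derive_D2 (f : C -> C) (z l : C) :
  complex_derive f z l <->
  D2 (fun y => Re (f y)) z (Re l) (- Im l) /\ D2 (fun y => Im (f y)) z (Im l) (Re l).
Proof.
  rewrite complex_derive_eps, !D2_eps. split.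
  - intros H. split; intros eps Heps; destruct (H eps Heps) as [d [Hd H1]]; exists d;
      split; auto; intros y Hy; eapply Rle_trans; [| exact (H1 y Hy) | | exact (H1 y Hy)].
    + eapply Rle_trans; [|apply Rabs_fst_le_Cmod]. right. f_equal.
      destruct y, z, l, (f (r, r0)), (f (r1, r2)). simpl. ring.
    + eapply Rle_trans; [|apply Rabs_snd_le_Cmod]. right. f_equal.
      destruct y, z, l, (f (r, r0)), (f (r1, r2)). simpl. ring.
  - intros [H1 H2] eps Heps.
    destruct (H1 (eps / 2)) as [d1 [Hd1 H1']]; [lra|].
    destruct (H2 (eps / 2)) as [d2 [Hd2 H2']]; [lra|].
    exists (Rmin d1 d2). split; [now apply Rmin_pos|]. intros y Hy.
    specialize (H1' y (Rlt_le_trans _ _ _ Hy (Rmin_l _ _))).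
    specialize (H2' y (Rlt_le_trans _ _ _ Hy (Rmin_r _ _))).
    eapply Rle_trans; [apply Cmod_le_Rabs|].
    match goal with |- ?a + ?b <= _ =>
      assert (E1 : a = Rabs (Re (f y) - Re (f z) - (Re l * (fst y - fst z) + - Im l * (snd y - snd z))));
      [|assert (E2 : b = Rabs (Im (f y) - Im (f z) - (Im l * (fst y - fst z) + Re l * (snd y - snd z))))]
    end.
    + f_equal. destruct y, z, l, (f (r, r0)), (f (r1, r2)). simpl. ring.
    + f_equal. destruct y, z, l, (f (r, r0)), (f (r1, r2)). simpl. ring.
    + rewrite E1, E2. lra.
Qed.

Lemma complex_derive_unique (f : C -> C) (z l l' : C) :
  complex_derive f z l -> complex_derive f z l' -> l = l'.
Proof.
  rewrite !complex_derive_D2. intros [H1 H2] [H3 H4].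
  destruct (D2_unique _ _ _ _ _ _ H1 H3), (D2_unique _ _ _ _ _ _ H2 H4).
  destruct l, l'. simpl in *. congruence.
Qed.

Lemma complex_derive_eq (f : C -> C) z l l' : complex_derive f z l -> l = l' -> complex_derive f z l'.
Proof. now intros H <-. Qed.

Lemma complex_derive_ext_loc (f g : C -> C) z l :
  locally z (fun y => f y = g y) -> complex_derive f z l -> complex_derive g z l.
Proof.
  intros H. rewrite !complex_derive_D2. intros [H1 H2].
  split; eapply D2_ext_loc; try eassumption; revert H; apply filter_imp; intros y ->; reflexivity.
Qed.

Lemma complex_derive_ext (f g : C -> C) z l :
  (forall y, f y = g y) -> complex_derive f z l -> complex_derive g z l.
Proof. intros H. apply complex_derive_ext_loc. now apply filter_forall. Qed.

Lemma complex_derive_const (c z : C) : complex_derive (fun _ => c) z 0%C.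
Proof.
  apply complex_derive_D2. simpl. rewrite Ropp_0. split; apply D2_const.
Qed.

Lemma complex_derive_id (z : C) : complex_derive (fun y => y) z 1%C.
Proof.
  apply complex_derive_D2. simpl. rewrite Ropp_0. split; [apply D2_fst|apply D2_snd].
Qed.

Lemma complex_derive_plus f g (z l m : C) : complex_derive f z l -> complex_derive g z m ->
  complex_derive (fun y => (f y + g y)%C) z (l + m)%C.
Proof.
  rewrite !complex_derive_D2. intros [H1 H2] [H3 H4]. split.
  - eapply D2_eq; [apply (D2_plus _ _ _ _ _ _ _ H1 H3)| |]; unfold Re, Im; simpl; ring.
  - eapply D2_eq; [apply (D2_plus _ _ _ _ _ _ _ H2 H4)| |]; unfold Re, Im; simpl; ring.
Qed.

Lemma complex_derive_mult f g (z l m : C) : complex_derive f z l -> complex_derive g z m ->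
  complex_derive (fun y => (f y * g y)%C) z (l * g z + f z * m)%C.
Proof.
  rewrite !complex_derive_D2. intros [H1 H2] [H3 H4]. split.
  - eapply D2_eq; [apply (D2_minus _ _ _ _ _ _ _ (D2_mult _ _ _ _ _ _ _ H1 H3)
      (D2_mult _ _ _ _ _ _ _ H2 H4))| | ]; unfold Re, Im; simpl; ring.
  - eapply D2_eq; [apply (D2_plus _ _ _ _ _ _ _ (D2_mult _ _ _ _ _ _ _ H1 H4)
      (D2_mult _ _ _ _ _ _ _ H2 H3))| | ]; unfold Re, Im; simpl; ring.
Qed.

Lemma complex_derive_scal c f (z l : C) : complex_derive f z l ->
  complex_derive (fun y => (c * f y)%C) z (c * l)%C.
Proof.
  intros H. eapply complex_derive_eq; [exact (complex_derive_mult _ _ _ _ _ (complex_derive_const c z) H)|].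
  cbv beta; ring.
Qed.

Lemma complex_derive_opp f (z l : C) : complex_derive f z l ->
  complex_derive (fun y => (- f y)%C) z (- l)%C.
Proof.
  intros H. apply (complex_derive_ext (fun y => ((-(1)) * f y)%C)); [intros; ring|].
  eapply complex_derive_eq; [exact (complex_derive_scal _ _ _ _ H)|]. ring.
Qed.

Lemma complex_derive_minus f g (z l m : C) : complex_derive f z l -> complex_derive g z m ->
  complex_derive (fun y => (f y - g y)%C) z (l - m)%C.
Proof.
  intros Hf Hg. exact (complex_derive_plus _ _ _ _ _ Hf (complex_derive_opp _ _ _ Hg)).
Qed.

Lemma complex_derive_comp f g (z l m : C) : complex_derive f (g z) l -> complex_derive g z m ->
  complex_derive (fun y => f (g y)) z (l * m)%C.
Proof.
  rewrite !complex_derive_D2. intros [H1 H2] [H3 H4].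
  rewrite (surjective_pairing (g z)) in H1, H2. split.
  - apply (D2_ext (fun y => Re (f (Re (g y), Im (g y))))).
    { intros y. unfold Re at 2, Im. now rewrite <- surjective_pairing. }
    eapply D2_eq; [apply (D2_comp (fun y => Re (f y)) (fun y => Re (g y)) (fun y => Im (g y)) _ _ _ _ _ _ _ H1 H3 H4)| |]; unfold Re, Im; simpl; ring.
  - apply (D2_ext (fun y => Im (f (Re (g y), Im (g y))))).
    { intros y. unfold Re, Im at 2. now rewrite <- surjective_pairing. }
    eapply D2_eq; [apply (D2_comp (fun y => Im (f y)) (fun y => Re (g y)) (fun y => Im (g y)) _ _ _ _ _ _ _ H2 H3 H4)| |]; unfold Re, Im; simpl; ring.
Qed.

Lemma complex_derive_Cinv (z : C) : z <> 0%C -> complex_derive Cinv z (- / (z * z))%C.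
Proof.
  intros Hz.
  assert (Hn : fst z ^ 2 + snd z ^ 2 <> 0).
  { intros H. apply Hz. destruct z as [x y]. simpl in H.
    apply injective_projections; simpl; nra. }
  assert (HN := D2_plus _ _ _ _ _ _ _ (D2_pow2 _ _ _ _ (D2_fst z)) (D2_pow2 _ _ _ _ (D2_snd z))).
  apply complex_derive_D2. split.
  - eapply D2_eq; [exact (D2_div _ _ _ _ _ _ _ (D2_fst z) HN Hn)| |];
      destruct z as [x y]; unfold Re, Im; simpl in *; field; split; try nra.
  - eapply D2_eq; [exact (D2_div _ _ _ _ _ _ _ (D2_opp _ _ _ _ (D2_snd z)) HN Hn)| |];
      destruct z as [x y]; unfold Re, Im; simpl in *; field; split; try nra.
Qed.

Lemma complex_derive_inv f (z l : C) : complex_derive f z l -> f z <> 0%C ->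
  complex_derive (fun y => (/ f y)%C) z (- l / (f z * f z))%C.
Proof.
  intros H H0. eapply complex_derive_eq;
    [exact (complex_derive_comp _ _ _ _ _ (complex_derive_Cinv _ H0) H)|]. now field.
Qed.

Lemma complex_derive_pow f (z l : C) n : complex_derive f z l ->
  complex_derive (fun y => (f y ^ n)%C) z (INR n * f z ^ (n - 1) * l)%C.
Proof.
  intros H. induction n.
  - simpl. eapply complex_derive_eq; [apply complex_derive_const|].
    apply injective_projections; simpl; ring.
  - apply (complex_derive_ext (fun y => (f y * f y ^ n)%C)); [reflexivity|].
    eapply complex_derive_eq; [exact (complex_derive_mult _ _ _ _ _ H IHn)|].
    replace (S n - 1)%nat with n by lia. rewrite S_INR, RtoC_plus.
    destruct n; [simpl; apply injective_projections; simpl; ring|].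
    replace (S n - 1)%nat with n by lia. simpl Cpow. ring.
Qed.

Lemma continuous_C_pair (f : C -> C) (z : C) :
  continuous f z <-> continuous (fun y => Re (f y)) z /\ continuous (fun y => Im (f y)) z.
Proof.
  split.
  - intros H. split; apply (continuous_comp f); auto; [apply continuous_fst|apply continuous_snd].
  - intros [Hx Hy]. apply filterlim_locally. intros eps.
    generalize (proj1 (filterlim_locally _ _) Hx eps) (proj1 (filterlim_locally _ _) Hy eps).
    intros H1 H2. generalize (filter_and _ _ H1 H2). apply filter_imp. intros s [H3 H4]. now split.
Qed.

Lemma complex_derive_continuous f (z l : C) : complex_derive f z l -> continuous f z.
Proof.
  rewrite complex_derive_D2, continuous_C_pair. intros [H1 H2].
  split; eapply D2_continuous; eassumption.
Qed.

(** ** Functions of class C^k *)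

Lemma class_C_continuous k U f z : class_C k U f -> U z -> continuous f z.
Proof. destruct k; simpl; intuition. Qed.

Lemma class_C_le k U f : class_C (S k) U f -> class_C k U f.
Proof.
  revert f. induction k; intros f [H1 [H2 [H3 H4]]].
  - simpl; auto.
  - split; auto.
Qed.

Lemma class_C_le' k n U f : (k <= n)%nat -> class_C n U f -> class_C k U f.
Proof. induction 1; auto. intros H1. apply IHle. now apply class_C_le. Qed.

(** [class_C] only speaks of partial derivatives; their continuity is what makes
    the function differentiable. *)
Lemma class_C_D2 U f z : open U -> class_C 1 U f -> U z -> D2 f z (du f z) (dv f z).
Proof.
  intros HU [Hc [Hd [[Hu _] _]]] Hz. unfold D2. destruct z as [x y]. simpl.
  apply filterdiff_differentiable_pt_lim.
  eapply filterdiff_ext_lin.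
  - apply (is_derive_filterdiff (fun x y => f (x, y)) x y (fun x y => du f (x, y)) (dv f (x, y))).
    + generalize (HU _ Hz). apply filter_imp. intros [a b] Hab. simpl.
      apply Derive_correct. apply (Hd _ Hab).
    + apply Derive_correct. apply (Hd _ Hz).
    + apply continuous_ext with (f := du f); [now intros []|]. now apply Hu.
  - intros [a b]. reflexivity.
Qed.

Lemma class_C_mixed U f z : open U -> class_C 2 U f -> U z -> du (dv f) z = dv (du f) z.
Proof.
  intros HU [Hc [Hd [Hu Hv]]] Hz.
  destruct z as [x y].
  apply (Schwarz (fun x y => f (x, y)) x y).
  - match goal with |- locally_2d ?P _ _ => apply (locally_2d_C P (x, y)) end.
    generalize (HU _ Hz). apply filter_imp. intros [u v] Hz'. simpl.
    destruct (Hd _ Hz') as [H1 H2]. destruct Hu as [_ [Hu _]]. destruct Hv as [_ [Hv _]].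
    split; [exact H1|]. split; [exact H2|]. split; [exact (proj1 (Hv _ Hz'))|].
    exact (proj2 (Hu _ Hz')).
  - apply (continuity_2d_C (du (dv f)) (x, y)). destruct Hv as [_ [_ [[Hv _] _]]]. auto.
  - apply (continuity_2d_C (dv (du f)) (x, y)). destruct Hu as [_ [_ [_ [Hu _]]]]. auto.
Qed.

(** * Closed forms in the plane *)

Definition seg (a b : C) (s : R) : C :=
  (fst a + s * (fst b - fst a), snd a + s * (snd b - snd a)).

Definition seg_form (P Q : C -> R) (a b : C) (s : R) : R :=
  P (seg a b s) * (fst b - fst a) + Q (seg a b s) * (snd b - snd a).

Definition seg_int (P Q : C -> R) (a b : C) : R := RInt (seg_form P Q a b) 0 1.

(** The partial derivatives need not be continuous: the real and imaginary parts
    of [f dz] are closed in this sense as soon as [f] is holomorphic. *)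
Definition closed_form (U : C -> Prop) (P Q : C -> R) : Prop :=
  forall z, U z -> exists p q r, D2 P z p q /\ D2 Q z q r.

Definition ballC (c : C) (r : R) (z : C) : Prop := Cmod (z - c)%C < r.

Lemma seg_dist a b c s M : 0 <= s <= 1 -> Cmod (a - c)%C <= M -> Cmod (b - c)%C <= M ->
  Cmod (seg a b s - c)%C <= M.
Proof.
  intros Hs Ha Hb.
  replace (seg a b s - c)%C with (RtoC (1 - s) * (a - c) + RtoC s * (b - c))%C.
  2:{ destruct a, b, c; apply injective_projections; simpl; ring. }
  eapply Rle_trans; [apply Cmod_triangle|]. rewrite !Cmod_mult, !Cmod_R, !Rabs_pos_eq by lra. nra.
Qed.

Lemma seg_ball a b c r s : 0 <= s <= 1 -> ballC c r a -> ballC c r b -> ballC c r (seg a b s).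
Proof.
  intros Hs Ha Hb. unfold ballC in *.
  eapply Rle_lt_trans; [apply (seg_dist a b c s (Rmax (Cmod (a - c)) (Cmod (b - c))) Hs)|].
  apply Rmax_l. apply Rmax_r. now apply Rmax_lub_lt.
Qed.

Lemma seg_form_continuous P Q a b s :
  continuous P (seg a b s) -> continuous Q (seg a b s) -> continuous (seg_form P Q a b) s.
Proof.
  intros HP HQ.
  assert (H1 : continuous (fun s => fst a + s * (fst b - fst a)) s).
  { apply (ex_derive_continuous (fun s => fst a + s * (fst b - fst a))). now auto_derive. }
  assert (H2 : continuous (fun s => snd a + s * (snd b - snd a)) s).
  { apply (ex_derive_continuous (fun s => snd a + s * (snd b - snd a))). now auto_derive. }
  apply (continuous_plus (V := R_NormedModule)); apply (continuous_mult (K := R_AbsRing)).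
  - now apply (continuous_curve P).
  - apply continuous_const.
  - now apply (continuous_curve Q).
  - apply continuous_const.
Qed.

Definition cont_on (U : C -> Prop) (P : C -> R) := forall z, U z -> continuous P z.

Lemma seg_form_ex P Q c r a b u v :
  cont_on (ballC c r) P -> cont_on (ballC c r) Q -> ballC c r a -> ballC c r b ->
  0 <= u <= 1 -> 0 <= v <= 1 -> ex_RInt (seg_form P Q a b) u v.
Proof.
  intros HP HQ Ha Hb Hu Hv. apply (ex_RInt_continuous (V := R_CompleteNormedModule)).
  intros s Hs. assert (0 <= s <= 1).
  { split; eapply Rle_trans; [|apply Hs| apply Hs|]. now apply Rmin_glb. now apply Rmax_lub. }
  apply seg_form_continuous; [apply HP|apply HQ]; now apply seg_ball.
Qed.

Lemma is_RInt_seg P Q c r a b :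
  cont_on (ballC c r) P -> cont_on (ballC c r) Q -> ballC c r a -> ballC c r b ->
  is_RInt (seg_form P Q a b) 0 1 (seg_int P Q a b).
Proof.
  intros. apply (RInt_correct (seg_form P Q a b)). eapply seg_form_ex; eauto; lra.
Qed.

Lemma seg_int_sub P Q c r a b u v :
  cont_on (ballC c r) P -> cont_on (ballC c r) Q -> ballC c r a -> ballC c r b ->
  0 <= u <= 1 -> 0 <= v <= 1 ->
  seg_int P Q (seg a b u) (seg a b v) = RInt (seg_form P Q a b) u v.
Proof.
  intros HP HQ Ha Hb Hu Hv.
  unfold seg_int.
  assert (H := RInt_comp_lin (seg_form P Q a b) (v - u) u 0 1).
  replace ((v - u) * 0 + u) with u in H by ring. replace ((v - u) * 1 + u) with v in H by ring.
  rewrite <- H by (eapply seg_form_ex; eauto).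
  apply RInt_ext. intros s _. unfold seg_form. simpl.
  change (scal ?x ?y) with (x * y).
  replace (seg (seg a b u) (seg a b v) s) with (seg a b ((v - u) * s + u)); [ring|].
  unfold seg; simpl; f_equal; ring.
Qed.

Lemma seg_0 a b : seg a b 0 = a.
Proof. unfold seg. apply injective_projections; simpl; ring. Qed.
Lemma seg_1 a b : seg a b 1 = b.
Proof. unfold seg. apply injective_projections; simpl; ring. Qed.

Definition mid (a b : C) : C := seg a b (1 / 2).

Section Triangles.
Context (P Q : C -> R) (c : C) (r : R)
  (HP : cont_on (ballC c r) P) (HQ : cont_on (ballC c r) Q).

Lemma seg_int_rev a b : ballC c r a -> ballC c r b -> seg_int P Q b a = - seg_int P Q a b.
Proof.
  intros Ha Hb. rewrite <- (seg_1 a b) at 1. rewrite <- (seg_0 a b) at 2.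
  rewrite (seg_int_sub P Q c r) by (auto; lra).
  rewrite <- (opp_RInt_swap (V := R_CompleteNormedModule)); [reflexivity|].
  eapply seg_form_ex; eauto; lra.
Qed.

Lemma seg_int_mid a b : ballC c r a -> ballC c r b ->
  seg_int P Q a b = seg_int P Q a (mid a b) + seg_int P Q (mid a b) b.
Proof.
  intros Ha Hb.
  assert (H1 : seg_int P Q a (mid a b) = RInt (seg_form P Q a b) 0 (1 / 2)).
  { rewrite <- (seg_0 a b) at 1. unfold mid. apply (seg_int_sub P Q c r); auto; lra. }
  assert (H2 : seg_int P Q (mid a b) b = RInt (seg_form P Q a b) (1 / 2) 1).
  { rewrite <- (seg_1 a b) at 2. unfold mid. apply (seg_int_sub P Q c r); auto; lra. }
  rewrite H1, H2. symmetry. apply (RInt_Chasles (V := R_CompleteNormedModule));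
  eapply seg_form_ex; eauto; lra.
Qed.

Lemma mid_ball a b : ballC c r a -> ballC c r b -> ballC c r (mid a b).
Proof. intros. apply seg_ball; auto; lra. Qed.

Definition tri (t : C * C * C) : R :=
  let '(x, y, z) := t in seg_int P Q x y + seg_int P Q y z + seg_int P Q z x.

Definition sub1 (t : C * C * C) := let '(x, y, z) := t in (x, mid x y, mid z x).
Definition sub2 (t : C * C * C) := let '(x, y, z) := t in (mid x y, y, mid y z).
Definition sub3 (t : C * C * C) := let '(x, y, z) := t in (mid z x, mid y z, z).
Definition sub4 (t : C * C * C) := let '(x, y, z) := t in (mid x y, mid y z, mid z x).

Definition inball (R' : R) (t : C * C * C) : Prop :=
  let '(x, y, z) := t in
  Cmod (x - c) <= R' /\ Cmod (y - c) <= R' /\ Cmod (z - c) <= R'.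

Definition sides (d : R) (t : C * C * C) : Prop :=
  let '(x, y, z) := t in
  Cmod (y - x) <= d /\ Cmod (z - y) <= d /\ Cmod (x - z) <= d.

Lemma tri_sub t R' : R' < r -> inball R' t ->
  tri t = tri (sub1 t) + tri (sub2 t) + tri (sub3 t) + tri (sub4 t).
Proof.
  destruct t as [[x y] z]. simpl. intros HR [Hx [Hy Hz]].
  assert (Bx : ballC c r x) by (unfold ballC; lra).
  assert (By : ballC c r y) by (unfold ballC; lra).
  assert (Bz : ballC c r z) by (unfold ballC; lra).
  rewrite (seg_int_mid x y), (seg_int_mid y z), (seg_int_mid z x) by auto.
  assert (Bxy := mid_ball _ _ Bx By). assert (Byz := mid_ball _ _ By Bz).
  assert (Bzx := mid_ball _ _ Bz Bx).
  rewrite (seg_int_rev (mid x y) (mid y z)), (seg_int_rev (mid y z) (mid z x)),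
    (seg_int_rev (mid z x) (mid x y)) by auto. ring.
Qed.

Lemma mid_le a b M : Cmod (a - c) <= M -> Cmod (b - c) <= M -> Cmod (mid a b - c) <= M.
Proof. intros. apply seg_dist; auto; lra. Qed.

Lemma sub_inball R' t : inball R' t ->
  inball R' (sub1 t) /\ inball R' (sub2 t) /\ inball R' (sub3 t) /\ inball R' (sub4 t).
Proof.
  destruct t as [[x y] z]. simpl. intros [Hx [Hy Hz]].
  repeat split; auto using mid_le.
Qed.

Lemma half_diff (u v w : C) d : Cmod w <= d -> (v - u = RtoC (1 / 2) * w)%C ->
  Cmod (v - u) <= d / 2.
Proof.
  intros H ->. rewrite Cmod_mult, Cmod_R, Rabs_pos_eq by lra. lra.
Qed.

Lemma sub_sides d t : sides d t ->
  sides (d / 2) (sub1 t) /\ sides (d / 2) (sub2 t) /\ sides (d / 2) (sub3 t) /\ sides (d / 2) (sub4 t).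
Proof.
  destruct t as [[x y] z]. simpl. intros [Hx [Hy Hz]].
  assert (Hx' : Cmod (x - y) <= d) by (rewrite <- Cmod_opp; now replace (- (x - y))%C with (y - x)%C by ring).
  assert (Hy' : Cmod (y - z) <= d) by (rewrite <- Cmod_opp; now replace (- (y - z))%C with (z - y)%C by ring).
  assert (Hz' : Cmod (z - x) <= d) by (rewrite <- Cmod_opp; now replace (- (z - x))%C with (x - z)%C by ring).
  repeat split; match goal with H : Cmod _ <= d |- _ =>
    solve [eapply half_diff; [exact H|]; unfold mid, seg; apply injective_projections; simpl; field] end.
Qed.

(** The subdivision step of Goursat's argument: a triangle that carries at least
    a quarter of the integral. If the first three tests fail, the fourth triangle
    does. *)
Definition next (t : C * C * C) : C * C * C :=
  if Rle_dec (Rabs (tri t) / 4) (Rabs (tri (sub1 t))) then sub1 t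
  else if Rle_dec (Rabs (tri t) / 4) (Rabs (tri (sub2 t))) then sub2 t
  else if Rle_dec (Rabs (tri t) / 4) (Rabs (tri (sub3 t))) then sub3 t
  else sub4 t.

Lemma next_tri R' t : R' < r -> inball R' t -> Rabs (tri t) / 4 <= Rabs (tri (next t)).
Proof.
  intros HR Ht. unfold next. pose proof (tri_sub t R' HR Ht) as H.
  repeat destruct Rle_dec; auto.
  pose proof (Rabs_triang (tri (sub1 t) + tri (sub2 t) + tri (sub3 t)) (tri (sub4 t))).
  pose proof (Rabs_triang (tri (sub1 t) + tri (sub2 t)) (tri (sub3 t))).
  pose proof (Rabs_triang (tri (sub1 t)) (tri (sub2 t))). rewrite <- H in *. lra.
Qed.

Lemma next_inball R' t : inball R' t -> inball R' (next t).
Proof. intros H. apply sub_inball in H. unfold next. repeat destruct Rle_dec; tauto. Qed.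

Lemma next_sides d t : sides d t -> sides (d / 2) (next t).
Proof. intros H. apply sub_sides in H. unfold next. repeat destruct Rle_dec; tauto. Qed.

Definition vertex (t : C * C * C) : C := fst (fst t).

Lemma next_vertex d t : 0 <= d -> sides d t -> Cmod (vertex (next t) - vertex t)%C <= d.
Proof.
  intros Hd. destruct t as [[x y] z]. simpl. intros [Hx [Hy Hz]].
  assert (Hz' : Cmod (z - x) <= d) by (rewrite <- Cmod_opp; now replace (- (z - x))%C with (x - z)%C by ring).
  assert (Hxx : Cmod (x - x) <= d) by (replace (x - x)%C with (RtoC 0) by ring; rewrite Cmod_0; lra).
  assert (Hm : Cmod (mid x y - x)%C <= d) by (apply seg_dist; auto; lra).
  assert (Hm' : Cmod (mid z x - x)%C <= d) by (apply seg_dist; auto; lra).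
  unfold next, vertex. repeat destruct Rle_dec; simpl; auto.
Qed.
End Triangles.

(** * Goursat's lemma and primitives *)

Lemma Cmod_minus_sym (a b : C) : Cmod (a - b)%C = Cmod (b - a)%C.
Proof. rewrite <- Cmod_opp. f_equal. ring. Qed.

Lemma Cmod_triangle' (a b x : C) : Cmod (a - b)%C <= Cmod (a - x)%C + Cmod (x - b)%C.
Proof. replace (a - b)%C with ((a - x) + (x - b))%C by ring. apply Cmod_triangle. Qed.

(** The vertices of the nested triangles converge at the rate of the diameters. *)
Lemma geometric_R (a : nat -> R) (d : R) : 0 <= d ->
  (forall n, Rabs (a (S n) - a n) <= d / 2 ^ n) ->
  exists l, forall n, Rabs (l - a n) <= 2 * d / 2 ^ n.
Proof.
  intros Hd H.
  assert (Hp : forall n, 0 < 2 ^ n) by (intros; apply pow_lt; lra).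
  assert (Hk : forall n k, Rabs (a (n + k)%nat - a n) <= 2 * d / 2 ^ n - 2 * d / 2 ^ (n + k)).
  { intros n k. induction k.
    - rewrite Nat.add_0_r, Rminus_diag, Rabs_R0. lra.
    - rewrite Nat.add_succ_r. specialize (H (n + k)%nat).
      replace (a (S (n + k)) - a n) with ((a (S (n + k)) - a (n + k)%nat) + (a (n + k)%nat - a n)) by ring.
      eapply Rle_trans; [apply Rabs_triang|]. simpl pow.
      replace (2 * d / (2 * 2 ^ (n + k))) with (2 * d / 2 ^ (n + k) - d / 2 ^ (n + k)); [lra|].
      field. apply Rgt_not_eq, Hp. }
  assert (Hz : is_lim_seq (fun n => 2 * d / 2 ^ n) 0).
  { apply is_lim_seq_ext with (fun n => 2 * d * (1 / 2) ^ n).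
    - intros n. unfold Rdiv. rewrite Rmult_1_l, <- pow_inv. reflexivity.
    - replace (Finite 0) with (Rbar_mult (2 * d) 0) by (simpl; f_equal; ring).
      apply is_lim_seq_scal_l. apply is_lim_seq_geom. rewrite Rabs_pos_eq; lra. }
  assert (Hc : ex_lim_seq_cauchy a).
  { intros eps. apply is_lim_seq_spec in Hz. destruct (Hz (pos_div_2 eps)) as [N HN].
    exists N. intros n m Hn Hm. specialize (HN N (le_n N)). rewrite Rminus_0_r in HN.
    apply Rabs_def2 in HN. simpl in HN.
    replace n with (N + (n - N))%nat by lia. replace m with (N + (m - N))%nat by lia.
    pose proof (Hk N (n - N)%nat) as H1. pose proof (Hk N (m - N)%nat) as H2.
    assert (0 <= 2 * d / 2 ^ (N + (n - N))) by (apply Rmult_le_pos; [lra|apply Rlt_le, Rinv_0_lt_compat, Hp]).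
    assert (0 <= 2 * d / 2 ^ (N + (m - N))) by (apply Rmult_le_pos; [lra|apply Rlt_le, Rinv_0_lt_compat, Hp]).
    apply Rabs_le_between in H1. apply Rabs_le_between in H2. apply Rabs_def1; lra. }
  apply ex_lim_seq_cauchy_corr in Hc. destruct Hc as [l Hl]. exists l. intros n.
  assert (Hl' : is_lim_seq (fun k => Rabs (a (n + k)%nat - a n)) (Rabs (l - a n))).
  { apply (is_lim_seq_abs _ (Finite (l - a n))). apply (is_lim_seq_minus' _ (fun _ => a n)); [|apply is_lim_seq_const].
    apply is_lim_seq_ext with (fun k => a (k + n)%nat); [intros; f_equal; lia|].
    now apply is_lim_seq_incr_n. }
  apply (is_lim_seq_le _ (fun _ => 2 * d / 2 ^ n) _ (2 * d / 2 ^ n) ) with (2 := Hl'); [|apply is_lim_seq_const].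
  intros k. eapply Rle_trans; [apply Hk|].
  assert (0 <= 2 * d / 2 ^ (n + k)) by (apply Rmult_le_pos; [lra|apply Rlt_le, Rinv_0_lt_compat, Hp]). lra.
Qed.

Lemma geometric_C (a : nat -> C) (d : R) : 0 <= d ->
  (forall n, Cmod (a (S n) - a n)%C <= d / 2 ^ n) ->
  exists l : C, forall n, Cmod (l - a n)%C <= 4 * d / 2 ^ n.
Proof.
  intros Hd H.
  destruct (geometric_R (fun n => fst (a n)) d Hd) as [x Hx].
  { intros n. eapply Rle_trans; [|apply H]. apply (Rabs_fst_le_Cmod (a (S n) - a n)%C). }
  destruct (geometric_R (fun n => snd (a n)) d Hd) as [y Hy].
  { intros n. eapply Rle_trans; [|apply H]. apply (Rabs_snd_le_Cmod (a (S n) - a n)%C). }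
  exists (x, y). intros n. eapply Rle_trans; [apply Cmod_le_Rabs|]. simpl.
  specialize (Hx n). specialize (Hy n). unfold Rminus, Rdiv in *. lra.
Qed.

(** The exact form will be the linearization of the given one at a point, so that
    only the remainder contributes. *)
Lemma seg_int_approx P Q P0 Q0 L c r a b M :
  cont_on (ballC c r) P -> cont_on (ballC c r) Q -> ballC c r a -> ballC c r b ->
  (forall z, D2 L z (P0 z) (Q0 z)) ->
  (forall z, continuous P0 z) -> (forall z, continuous Q0 z) ->
  (forall s, 0 <= s <= 1 -> Rabs (P (seg a b s) - P0 (seg a b s)) <= M /\
                        Rabs (Q (seg a b s) - Q0 (seg a b s)) <= M) ->
  Rabs (seg_int P Q a b - (L b - L a)) <= 2 * M * Cmod (b - a)%C.
Proof.
  intros HP HQ Ha Hb HL HP0 HQ0 HM.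
  assert (H1 := is_RInt_seg P Q c r a b HP HQ Ha Hb).
  assert (H2 : is_RInt (seg_form P0 Q0 a b) 0 1 (L b - L a)).
  { replace (L b - L a) with (minus (L (seg a b 1)) (L (seg a b 0))) by (rewrite seg_0, seg_1; reflexivity).
    apply (is_RInt_derive (V := R_CompleteNormedModule) (fun s => L (seg a b s))).
    - intros s _. unfold seg, seg_form.
      apply (D2_curve L (fun s => fst a + s * (fst b - fst a)) (fun s => snd a + s * (snd b - snd a))).
      + apply HL.
      + auto_derive; [easy|ring].
      + auto_derive; [easy|ring].
    - intros s _. apply seg_form_continuous; auto. }
  assert (H3 := is_RInt_minus (V := R_NormedModule) _ _ _ _ _ _ H1 H2).
  replace (2 * M * Cmod (b - a)%C) with ((1 - 0) * (2 * M * Cmod (b - a)%C)) by ring.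
  apply (norm_RInt_le_const (V := R_NormedModule)
    (fun s => seg_form P Q a b s - seg_form P0 Q0 a b s) 0 1); [lra| |exact H3].
  intros s Hs. destruct (HM s Hs) as [H5 H6].
  change (norm ?x) with (Rabs x). unfold seg_form.
  match goal with |- Rabs ?x <= _ => replace x with ((P (seg a b s) - P0 (seg a b s)) * (fst b - fst a) +
     (Q (seg a b s) - Q0 (seg a b s)) * (snd b - snd a)) by ring end.
  eapply Rle_trans; [apply Rabs_triang|]. rewrite !Rabs_mult.
  pose proof (Rabs_fst_le_Cmod (b - a)%C) as H7. pose proof (Rabs_snd_le_Cmod (b - a)%C) as H8.
  simpl in H7, H8. change (fst b + - fst a) with (fst b - fst a) in H7.
  change (snd b + - snd a) with (snd b - snd a) in H8.
  assert (Rabs (P (seg a b s) - P0 (seg a b s)) * Rabs (fst b - fst a) <= M * Cmod (b - a)%C)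
    by (apply Rmult_le_compat; auto using Rabs_pos).
  assert (Rabs (Q (seg a b s) - Q0 (seg a b s)) * Rabs (snd b - snd a) <= M * Cmod (b - a)%C)
    by (apply Rmult_le_compat; auto using Rabs_pos).
  lra.
Qed.

Lemma D2_affine p q k z0 z : D2 (fun z => k + p * (fst z - fst z0) + q * (snd z - snd z0)) z p q.
Proof.
  eapply D2_eq.
  - apply D2_plus; [apply D2_plus; [apply (D2_const k)|]|]; apply D2_scal; apply D2_minus.
    apply D2_fst. apply (D2_const (fst z0)). apply D2_snd. apply (D2_const (snd z0)).
  - ring.
  - ring.
Qed.

(** The linear part of a closed form at [z0] is exact, because its matrix is
    symmetric; the integral over a small triangle only sees the remainder, which is
    at most [eps] times the distance to [z0]. *)
Lemma tri_local P Q c r z0 p q s eps :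
  cont_on (ballC c r) P -> cont_on (ballC c r) Q -> D2 P z0 p q -> D2 Q z0 q s -> 0 < eps ->
  exists d, 0 < d /\ forall x y z e, ballC c r x -> ballC c r y -> ballC c r z ->
    Cmod (x - z0) <= e -> Cmod (y - z0) <= e -> Cmod (z - z0) <= e -> e < d ->
    Rabs (tri P Q (x, y, z)) <= 2 * (eps * e) * (Cmod (y - x) + Cmod (z - y) + Cmod (x - z)).
Proof.
  intros HP HQ HDP HDQ Heps.
  destruct (proj1 (D2_eps _ _ _ _) HDP eps Heps) as [d1 [Hd1 H1]].
  destruct (proj1 (D2_eps _ _ _ _) HDQ eps Heps) as [d2 [Hd2 H2]].
  exists (Rmin d1 d2). split; [now apply Rmin_pos|].
  intros x y z e Bx By Bz Hx Hy Hz He.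
  set (P0 := fun z : C => P z0 + p * (fst z - fst z0) + q * (snd z - snd z0)).
  set (Q0 := fun z : C => Q z0 + q * (fst z - fst z0) + s * (snd z - snd z0)).
  set (L := fun z : C => P z0 * (fst z - fst z0) + Q z0 * (snd z - snd z0)
     + (p * ((fst z - fst z0) * (fst z - fst z0)) / 2 + q * ((fst z - fst z0) * (snd z - snd z0))
        + s * ((snd z - snd z0) * (snd z - snd z0)) / 2)).
  assert (HL : forall z, D2 L z (P0 z) (Q0 z)).
  { intros w. unfold L, P0, Q0.
    assert (F1 : D2 (fun z => fst z - fst z0) w 1 0).
    { eapply D2_eq; [apply D2_minus; [apply D2_fst|apply (D2_const (fst z0))]|ring|ring]. }
    assert (F2 : D2 (fun z => snd z - snd z0) w 0 1).
    { eapply D2_eq; [apply D2_minus; [apply D2_snd|apply (D2_const (snd z0))]|ring|ring]. }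
    eapply D2_eq.
    - apply D2_plus; [apply D2_plus; apply D2_scal; eassumption|].
      apply D2_plus; [apply D2_plus|].
      + eapply (D2_ext (fun z => p / 2 * ((fst z - fst z0) * (fst z - fst z0)))); [intros; field|].
        apply D2_scal. apply D2_mult; eassumption.
      + apply D2_scal. apply D2_mult; eassumption.
      + eapply (D2_ext (fun z => s / 2 * ((snd z - snd z0) * (snd z - snd z0)))); [intros; field|].
        apply D2_scal. apply D2_mult; eassumption.
    - cbv beta; field.
    - cbv beta; field. }
  assert (C0 : forall z, continuous P0 z) by (intros w; eapply D2_continuous, D2_affine).
  assert (C1 : forall z, continuous Q0 z) by (intros w; eapply D2_continuous, D2_affine).
  assert (K : forall u v, ballC c r u -> ballC c r v -> Cmod (u - z0) <= e -> Cmod (v - z0) <= e ->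
    Rabs (seg_int P Q u v - (L v - L u)) <= 2 * (eps * e) * Cmod (v - u)%C).
  { intros u v Bu Bv Hu Hv. apply (seg_int_approx P Q P0 Q0 L c r); auto.
    intros t Ht. assert (Hs := seg_dist u v z0 t e Ht Hu Hv).
    pose proof (Rmin_l d1 d2). pose proof (Rmin_r d1 d2).
    unfold P0, Q0. split.
    - replace (P (seg u v t) - _) with (P (seg u v t) - P z0 -
        (p * (fst (seg u v t) - fst z0) + q * (snd (seg u v t) - snd z0))) by ring.
      eapply Rle_trans; [apply H1; lra|]. apply Rmult_le_compat_l; lra.
    - replace (Q (seg u v t) - _) with (Q (seg u v t) - Q z0 -
        (q * (fst (seg u v t) - fst z0) + s * (snd (seg u v t) - snd z0))) by ring.
      eapply Rle_trans; [apply H2; lra|]. apply Rmult_le_compat_l; lra. }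
  simpl.
  assert (K1 := K _ _ Bx By Hx Hy). assert (K2 := K _ _ By Bz Hy Hz). assert (K3 := K _ _ Bz Bx Hz Hx).
  apply Rabs_le_between in K1. apply Rabs_le_between in K2. apply Rabs_le_between in K3.
  apply Rabs_le. lra.
Qed.

(** At each subdivision the integral loses at most a factor 4, while near the
    common point of the triangles both the distance to that point and the perimeter
    are halved and [eps] is arbitrary. *)
Lemma goursat P Q c r x y z :
  closed_form (ballC c r) P Q -> ballC c r x -> ballC c r y -> ballC c r z ->
  tri P Q (x, y, z) = 0.
Proof.
  intros HC Bx By Bz.
  assert (HP : cont_on (ballC c r) P).
  { intros w Hw. destruct (HC w Hw) as [p [q [s [H _]]]]. eapply D2_continuous; eauto. }
  assert (HQ : cont_on (ballC c r) Q).
  { intros w Hw. destruct (HC w Hw) as [p [q [s [_ H]]]]. eapply D2_continuous; eauto. }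
  set (R' := Rmax (Cmod (x - c)) (Rmax (Cmod (y - c)) (Cmod (z - c)))).
  assert (HR : R' < r) by (repeat apply Rmax_lub_lt; assumption).
  assert (HI : inball c R' (x, y, z)).
  { simpl. repeat split. apply Rmax_l. eapply Rle_trans; [apply Rmax_l|apply Rmax_r].
    eapply Rle_trans; [apply Rmax_r|apply Rmax_r]. }
  set (d := Rmax (Cmod (y - x)) (Rmax (Cmod (z - y)) (Cmod (x - z)))).
  assert (HS : sides d (x, y, z)).
  { simpl. repeat split. apply Rmax_l. eapply Rle_trans; [apply Rmax_l|apply Rmax_r].
    eapply Rle_trans; [apply Rmax_r|apply Rmax_r]. }
  assert (Hd : 0 <= d) by (eapply Rle_trans; [apply Cmod_ge_0|apply Rmax_l]).
  assert (Hp : forall n, 0 < 2 ^ n) by (intros; apply pow_lt; lra).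
  set (T := fun n => Nat.iter n (next P Q) (x, y, z)).
  assert (TI : forall n, inball c R' (T n)) by (induction n; [exact HI|now apply next_inball]).
  assert (TS : forall n, sides (d / 2 ^ n) (T n)).
  { induction n; [simpl pow; rewrite Rdiv_1_r; exact HS|].
    replace (d / 2 ^ S n) with (d / 2 ^ n / 2); [now apply next_sides|].
    simpl; field. apply Rgt_not_eq, Hp. }
  assert (TT : forall n, Rabs (tri P Q (x, y, z)) / 4 ^ n <= Rabs (tri P Q (T n))).
  { induction n; [simpl pow; rewrite Rdiv_1_r; apply Rle_refl|].
    pose proof (next_tri P Q c r HP HQ R' (T n) HR (TI n)) as H. change (next P Q (T n)) with (T (S n)) in H.
    simpl pow. replace (Rabs (tri P Q (x, y, z)) / (4 * 4 ^ n)) with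
      (Rabs (tri P Q (x, y, z)) / 4 ^ n / 4); [lra|].
    field. apply Rgt_not_eq, pow_lt; lra. }
  destruct (geometric_C (fun n => vertex (T n)) d Hd) as [z0 Hz0].
  { intros n. apply (next_vertex P Q (d / 2 ^ n)); [|apply TS].
    apply Rmult_le_pos; [lra|apply Rlt_le, Rinv_0_lt_compat, Hp]. }
  assert (Hsmall : forall e, 0 < e -> exists n, 5 * d / 2 ^ n < e).
  { intros e He.
    assert (Hz : is_lim_seq (fun n => 5 * d * (1 / 2) ^ n) 0).
    { replace (Finite 0) with (Rbar_mult (5 * d) 0) by (simpl; f_equal; ring).
      apply is_lim_seq_scal_l. apply is_lim_seq_geom. rewrite Rabs_pos_eq; lra. }
    apply is_lim_seq_spec in Hz. destruct (Hz (mkposreal _ He)) as [N HN].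
    exists N. specialize (HN N (le_n N)). rewrite Rminus_0_r in HN. simpl in HN.
    apply Rabs_def2 in HN. unfold Rdiv in *. rewrite Rmult_1_l, pow_inv in HN. lra. }
  assert (Hn5 : forall n, 4 * d / 2 ^ n <= 5 * d / 2 ^ n /\ 4 * d / 2 ^ n + d / 2 ^ n = 5 * d / 2 ^ n).
  { intros n. assert (0 <= d / 2 ^ n) by (apply Rmult_le_pos; [lra|apply Rlt_le, Rinv_0_lt_compat, Hp]).
    unfold Rdiv in *; split; lra. }
  assert (Bz0 : ballC c r z0).
  { destruct (Hsmall (r - R')) as [n Hn]; [lra|]. specialize (Hz0 n). pose proof (Hn5 n).
    pose proof (TI n) as HT. unfold ballC. eapply Rle_lt_trans; [apply (Cmod_triangle' z0 c (vertex (T n)))|].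
    assert (Cmod (vertex (T n) - c) <= R') by (destruct (T n) as [[x1 y1] z1]; apply HT).
    assert (0 <= d / 2 ^ n) by (apply Rmult_le_pos; [lra|apply Rlt_le, Rinv_0_lt_compat, Hp]).
    lra. }
  destruct (HC z0 Bz0) as [p [q [s [DP DQ]]]].
  destruct (Req_dec (tri P Q (x, y, z)) 0) as [H0|H0]; auto. exfalso.
  set (K := Rabs (tri P Q (x, y, z))) in *.
  assert (HK : 0 < K) by now apply Rabs_pos_lt.
  (* with distance 5 d / 2^n and perimeter 3 d / 2^n the local estimate is then
     smaller than K / 4^n *)
  assert (He : 0 < K / (60 * (d * d + 1))) by (apply Rdiv_lt_0_compat; nra).
  destruct (tri_local P Q c r z0 p q s _ HP HQ DP DQ He) as [del [Hdel Hloc]].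
  destruct (Hsmall del Hdel) as [n Hn].
  pose proof (TT n) as H1. pose proof (TI n) as H2. pose proof (TS n) as H3. pose proof (Hz0 n) as H4.
  destruct (T n) as [[x1 y1] z1]. simpl in H2, H3. unfold vertex in H4. simpl in H4.
  destruct H2 as [I1 [I2 I3]], H3 as [S1 [S2 S3]]. destruct (Hn5 n) as [N1 N2].
  assert (H := Hloc x1 y1 z1 (5 * d / 2 ^ n)).
  rewrite Cmod_minus_sym in H4.
  assert (E1 : Cmod (x1 - z0) <= 5 * d / 2 ^ n) by lra.
  assert (E2 : Cmod (y1 - z0) <= 5 * d / 2 ^ n).
  { eapply Rle_trans; [apply (Cmod_triangle' y1 z0 x1)|]. lra. }
  assert (E3 : Cmod (z1 - z0) <= 5 * d / 2 ^ n).
  { eapply Rle_trans; [apply (Cmod_triangle' z1 z0 x1)|]. rewrite (Cmod_minus_sym z1 x1). lra. }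
  assert (H' := H ltac:(unfold ballC; lra) ltac:(unfold ballC; lra) ltac:(unfold ballC; lra) E1 E2 E3 Hn).
  assert (Hf : K / 4 ^ n <= 2 * (K / (60 * (d * d + 1)) * (5 * d / 2 ^ n)) * (3 * (d / 2 ^ n))).
  { eapply Rle_trans; [exact H1|]. eapply Rle_trans; [exact H'|].
    apply Rmult_le_compat_l; [|lra].
    apply Rmult_le_pos; [lra|]. apply Rmult_le_pos; [lra|].
    apply Rmult_le_pos; [lra|apply Rlt_le, Rinv_0_lt_compat, Hp]. }
  replace (2 * (K / (60 * (d * d + 1)) * (5 * d / 2 ^ n)) * (3 * (d / 2 ^ n))) with
    (K / 4 ^ n * (d * d / (2 * (d * d + 1)))) in Hf.
  2:{ replace (4 ^ n) with (2 ^ n * 2 ^ n) by (rewrite <- Rpow_mult_distr; f_equal; ring).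
      field. split; [apply Rgt_not_eq, Hp|nra]. }
  assert (H5 : d * d / (2 * (d * d + 1)) < 1).
  { apply Rlt_div_l; nra. }
  assert (H6 : 0 < K / 4 ^ n) by (apply Rdiv_lt_0_compat; auto; apply pow_lt; lra).
  nra.
Qed.

(** By Goursat's lemma the integral along the segments from the centre is
    additive, hence a primitive. *)
Theorem closed_form_exact P Q c r : 0 < r -> closed_form (ballC c r) P Q ->
  exists G, forall z, ballC c r z -> D2 G z (P z) (Q z).
Proof.
  intros Hr HC. exists (seg_int P Q c). intros z Bz.
  assert (Bc : ballC c r c).
  { unfold ballC. replace (c - c)%C with (RtoC 0) by ring. now rewrite Cmod_0. }
  assert (HP : cont_on (ballC c r) P).
  { intros w Hw. destruct (HC w Hw) as [p [q [s [H _]]]]. eapply D2_continuous; eauto. }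
  assert (HQ : cont_on (ballC c r) Q).
  { intros w Hw. destruct (HC w Hw) as [p [q [s [_ H]]]]. eapply D2_continuous; eauto. }
  apply D2_eps. intros eps Heps.
  assert (He : 0 < eps / 2) by lra.
  assert (H1 : locally z (fun y => Rabs (P y - P z) < eps / 2 /\ Rabs (Q y - Q z) < eps / 2 )).
  { apply filter_and.
    - exact (proj1 (filterlim_locally P (P z)) (HP z Bz) (mkposreal _ He)).
    - exact (proj1 (filterlim_locally Q (Q z)) (HQ z Bz) (mkposreal _ He)). }
  apply Cball_locally in H1. destruct H1 as [d [Hd H1]].
  exists (Rmin d (r - Cmod (z - c)%C)). split.
  { apply Rmin_pos; auto. unfold ballC in Bz. lra. }
  intros y Hy.
  assert (Hy1 := Rlt_le_trans _ _ _ Hy (Rmin_l _ _)).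
  assert (Hy2 := Rlt_le_trans _ _ _ Hy (Rmin_r _ _)).
  assert (By : ballC c r y).
  { unfold ballC. eapply Rle_lt_trans; [apply (Cmod_triangle' y c z)|]. lra. }
  assert (HT := goursat P Q c r c z y HC Bc Bz By). simpl in HT.
  rewrite (seg_int_rev P Q c r HP HQ c y Bc By) in HT.
  replace (seg_int P Q c y - seg_int P Q c z) with (seg_int P Q z y) by lra.
  set (L := fun w : C => 0 + P z * (fst w - fst z) + Q z * (snd w - snd z)).
  replace (P z * (fst y - fst z) + Q z * (snd y - snd z)) with (L y - L z) by (unfold L; ring).
  replace (eps * Cmod (y - z)) with (2 * (eps / 2) * Cmod (y - z)) by field.
  apply (seg_int_approx P Q (fun _ => P z) (fun _ => Q z) L c r); auto.
  - intros w. apply (D2_affine (P z) (Q z) 0).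
  - intros w. apply continuous_const.
  - intros w. apply continuous_const.
  - intros s Hs.
    assert (Hzz : Cmod (z - z)%C <= Cmod (y - z)%C).
    { replace (z - z)%C with (RtoC 0) by ring. rewrite Cmod_0. apply Cmod_ge_0. }
    assert (Hsd := seg_dist z y z s (Cmod (y - z)%C) Hs Hzz (Rle_refl _)).
    destruct (H1 (seg z y s)); [lra|]. split; lra.
Qed.

(** * Integrals of closed forms along freely homotopic loops *)

Definition along (P Q : C -> R) (g : R -> C) (t : R) : R :=
  P (g t) * fst (velocity g t) + Q (g t) * snd (velocity g t).

Definition loop_int (P Q : C -> R) (g : R -> C) : R := RInt (along P Q g) 0 (2 * PI).

(** Continuity of the integrand is asked for instead of continuity of the
    velocity: it is what survives when a loop is pushed forward by a merely
    differentiable map. *)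
Definition integrable_loop (P Q : C -> R) (g : R -> C) : Prop :=
  forall t, ex_derive (fun s => fst (g s)) t /\ ex_derive (fun s => snd (g s)) t /\
    continuous (along P Q g) t.

Lemma along_derive P Q G g t :
  D2 G (g t) (P (g t)) (Q (g t)) ->
  ex_derive (fun s => fst (g s)) t -> ex_derive (fun s => snd (g s)) t ->
  is_derive (fun s => G (g s)) t (along P Q g t).
Proof.
  intros HG Hx Hy. rewrite (surjective_pairing (g t)) in HG.
  apply (is_derive_ext (fun s => G (fst (g s), snd (g s)))).
  { intros s. now rewrite <- surjective_pairing. }
  eapply (D2_curve G (fun s => fst (g s)) (fun s => snd (g s))).
  - rewrite <- surjective_pairing in *. exact HG.
  - apply Derive_correct, Hx.
  - apply Derive_correct, Hy.
Qed.

Lemma along_exact P Q G g a b : integrable_loop P Q g -> a <= b ->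
  (forall t, a <= t <= b -> D2 G (g t) (P (g t)) (Q (g t))) ->
  is_RInt (along P Q g) a b (G (g b) - G (g a)).
Proof.
  intros Hg Hab HG.
  apply (is_RInt_derive (V := R_CompleteNormedModule) (fun t => G (g t))).
  - intros t Ht. rewrite Rmin_left, Rmax_right in Ht by lra.
    apply along_derive; [now apply HG|apply Hg|apply Hg].
  - intros t Ht. apply Hg.
Qed.

Lemma seg_int_exact P Q G c r a b :
  (forall z, ballC c r z -> D2 G z (P z) (Q z)) ->
  cont_on (ballC c r) P -> cont_on (ballC c r) Q ->
  ballC c r a -> ballC c r b -> seg_int P Q a b = G b - G a.
Proof.
  intros HG HP HQ Ha Hb. apply is_RInt_unique.
  replace (G b - G a) with (minus (G (seg a b 1)) (G (seg a b 0))) by (rewrite seg_0, seg_1; reflexivity).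
  apply (is_RInt_derive (V := R_CompleteNormedModule) (fun s => G (seg a b s)));
    intros s Hs; rewrite Rmin_left, Rmax_right in Hs by lra.
  - unfold seg, seg_form.
    apply (D2_curve G (fun s => fst a + s * (fst b - fst a)) (fun s => snd a + s * (snd b - snd a))).
    + apply HG, seg_ball; auto.
    + auto_derive; [easy|ring].
    + auto_derive; [easy|ring].
  - apply seg_form_continuous; [apply HP|apply HQ]; apply seg_ball; auto.
Qed.

Lemma open_ball (U : C -> Prop) z : open U -> U z ->
  exists r, 0 < r /\ forall y, ballC z r y -> U y.
Proof. intros HU Hz. apply HU in Hz. now apply Cball_locally in Hz. Qed.

(** A Lebesgue number for the pull-back by [H] of the discs contained in [U]. *)
Lemma lebesgue_number (U : C -> Prop) (H : R * R -> C) (T : R) :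
  open U -> (forall st, continuous H st) ->
  (forall s t, 0 <= s <= 1 -> 0 <= t <= T -> U (H (s, t))) ->
  exists d, 0 < d /\ forall x y, 0 <= x <= 1 -> 0 <= y <= T ->
    exists c r, 0 < r /\ (forall z, ballC c r z -> U z) /\
      forall s t, Rabs (s - x) < d -> Rabs (t - y) < d -> ballC c r (H (s, t)).
Proof.
  intros HU Hc HH.
  assert (Hex : forall ij : R * R, exists del : posreal,
    0 <= fst ij <= 1 -> 0 <= snd ij <= T ->
    exists c r, 0 < r /\ (forall z, ballC c r z -> U z) /\
      forall s t, Rabs (s - fst ij) < 2 * del -> Rabs (t - snd ij) < 2 * del -> ballC c r (H (s, t))).
  { intros [i j]. simpl.
    destruct (classic (0 <= i <= 1 /\ 0 <= j <= T)) as [[Hi Hj]|Hn].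
    - destruct (open_ball U (H (i, j)) HU (HH i j Hi Hj)) as [r [Hr HrU]].
      assert (Hl : locally (i, j) (fun st => ballC (H (i, j)) r (H st))).
      { apply (Hc (i, j) (fun z => ballC (H (i, j)) r z)). apply Cball_locally.
        exists r. split; auto. }
      apply (locally_2d_C' (fun st => ballC (H (i, j)) r (H st)) (i, j)) in Hl.
      destruct Hl as [d Hd]. exists (pos_div_2 d). intros _ _. exists (H (i, j)), r.
      split; [exact Hr|]. split; [exact HrU|]. intros s t Hs Ht. apply Hd; simpl in *; lra.
    - exists (mkposreal 1 Rlt_0_1). intros H1 H2. exfalso. auto. }
  set (delta := fun i j => proj1_sig (constructive_indefinite_description _ (Hex (i, j)))).
  assert (Hdelta : forall i j, 0 <= i <= 1 -> 0 <= j <= T ->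
    exists c r, 0 < r /\ (forall z, ballC c r z -> U z) /\
      forall s t, Rabs (s - i) < 2 * delta i j -> Rabs (t - j) < 2 * delta i j -> ballC c r (H (s, t))).
  { intros i j. unfold delta. destruct constructive_indefinite_description as [del Hdel]. simpl in *. auto. }
  destruct (compactness_value_2d 0 1 0 T delta) as [d Hd].
  exists d. split; [apply cond_pos|]. intros x y Hx Hy.
  specialize (Hd x y Hx Hy). apply NNPP in Hd. destruct Hd as [i [j [Hi [Hj [Hxi [Hyj Hdd]]]]]].
  destruct (Hdelta i j Hi Hj) as [c [r [Hr [HrU Hst]]]]. exists c, r.
  split; [exact Hr|]. split; [exact HrU|]. intros s t Hs Ht. apply Hst.
  - replace (s - i) with ((s - x) + (x - i)) by ring. eapply Rle_lt_trans; [apply Rabs_triang|]. lra.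
  - replace (t - j) with ((t - y) + (y - j)) by ring. eapply Rle_lt_trans; [apply Rabs_triang|]. lra.
Qed.

Fixpoint psum (f : nat -> R) (n : nat) : R :=
  match n with O => 0 | S m => psum f m + f m end.

(** On a fine grid each cell of the homotopy lies in a disc where the form has a
    primitive, so the integral around it vanishes. Summed over a row of cells, the
    transversal sides cancel by periodicity, and consecutive rows have the same
    integral. The intermediate rows are polygons, so only the two given loops have
    to be regular. *)
Theorem homotopy_invariance (U : C -> Prop) (P Q : C -> R) (g0 g1 : R -> C) (H : R * R -> C) :
  open U -> closed_form U P Q ->
  integrable_loop P Q g0 -> integrable_loop P Q g1 ->
  (forall st, continuous H st) ->
  (forall s t, 0 <= s <= 1 -> U (H (s, t)) /\ H (s, t + 2 * PI) = H (s, t) /\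
     H (0, t) = g0 t /\ H (1, t) = g1 t) ->
  loop_int P Q g0 = loop_int P Q g1.
Proof.
  intros HU HC HI0 HI1 Hc HH.
  set (T := 2 * PI). assert (HT : 1 < T) by (unfold T; generalize PI2_1; lra).
  destruct (lebesgue_number U H T HU Hc) as [d [Hd HL]].
  { intros s t Hs _. now apply HH. }
  destruct (nfloor_ex (T / d)) as [N0 [_ HN0]].
  { apply Rlt_le, Rdiv_lt_0_compat; lra. }
  set (N := S N0). assert (HN : 0 < INR N) by (apply lt_0_INR; unfold N; lia).
  assert (HNd : T / INR N < d).
  { assert (HTd : T < INR N * d).
    { unfold N. rewrite S_INR. apply (Rmult_lt_compat_r d) in HN0; [|exact Hd].
      unfold Rdiv in HN0. rewrite Rmult_assoc, Rinv_l, Rmult_1_r in HN0 by lra. exact HN0. }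
    apply (Rmult_lt_reg_r (INR N)); [exact HN|]. unfold Rdiv.
    rewrite Rmult_assoc, Rinv_l, Rmult_1_r by lra. lra. }
  set (st := fun k : nat => T * INR k / INR N).
  set (ss := fun j : nat => INR j / INR N).
  set (z := fun j k => H (ss j, st k)).
  assert (Hst : forall k, st (S k) = st k + T / INR N).
  { intros k. unfold st. rewrite S_INR. field. lra. }
  assert (Hss : forall k, ss (S k) = ss k + 1 / INR N).
  { intros k. unfold ss. rewrite S_INR. field. lra. }
  assert (HsN : 1 / INR N <= T / INR N) by (apply Rmult_le_compat_r; [apply Rlt_le, Rinv_0_lt_compat; lra|lra]).
  assert (HsN0 : 0 < 1 / INR N) by (apply Rdiv_lt_0_compat; lra).
  assert (Hss1 : forall j, (j <= N)%nat -> 0 <= ss j <= 1).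
  { intros j Hj. apply le_INR in Hj. unfold ss. split; [apply Rdiv_le_0_compat; auto using pos_INR|].
    apply Rle_div_l; lra. }
  assert (HstN : st N = T) by (unfold st; field; lra).
  assert (Hst0 : st 0%nat = 0) by (unfold st; change (INR 0) with 0; field; lra).
  assert (Hst1 : forall k, (k <= N)%nat -> 0 <= st k <= T).
  { intros j Hj. apply le_INR in Hj. unfold st. split; [apply Rdiv_le_0_compat; auto; apply Rmult_le_pos; auto using pos_INR; lra|].
    apply Rle_div_l; [lra|]. apply Rmult_le_compat_l; lra. }
  assert (HsN1 : ss N = 1) by (unfold ss; field; lra).
  assert (Hss0 : ss 0%nat = 0) by (unfold ss; change (INR 0) with 0; field; lra).
  (* on each cell of the grid the form has a primitive *)
  assert (Hcell : forall j k, (j <= N)%nat -> (k <= N)%nat -> exists G c r,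
    (forall w, ballC c r w -> D2 G w (P w) (Q w)) /\
    cont_on (ballC c r) P /\ cont_on (ballC c r) Q /\
    forall s t, ss j <= s <= ss (S j) -> st k <= t <= st (S k) -> ballC c r (H (s, t))).
  { intros j k Hj Hk.
    destruct (HL (ss j) (st k) (Hss1 j Hj) (Hst1 k Hk)) as [c [r [Hr [HrU Hrb]]]].
    assert (HCr : closed_form (ballC c r) P Q) by (intros w Hw; apply HC; auto).
    destruct (closed_form_exact P Q c r Hr HCr) as [G HG]. exists G, c, r.
    split; [exact HG|]. split; [|split].
    - intros w Hw. destruct (HCr w Hw) as [p [q [u [HD _]]]]. eapply D2_continuous; eauto.
    - intros w Hw. destruct (HCr w Hw) as [p [q [u [_ HD]]]]. eapply D2_continuous; eauto.
    - intros s t Hs Ht. rewrite Hss in Hs. rewrite Hst in Ht.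
      apply Hrb; rewrite Rabs_pos_eq by lra; lra. }
  set (row := fun j => psum (fun k => seg_int P Q (z j k) (z j (S k)))).
  set (V := fun j k => seg_int P Q (z j k) (z (S j) k)).
  assert (Hrow : forall j K, (j < N)%nat -> (K <= N)%nat -> row j K + V j K = V j 0%nat + row (S j) K).
  { intros j K Hj. induction K; intros HK.
    - unfold row. simpl. ring.
    - unfold row in *. simpl. specialize (IHK ltac:(lia)).
      destruct (Hcell j K ltac:(lia) ltac:(lia)) as [G [c [r [HG [HP [HQ Hb]]]]]].
      assert (B1 : ballC c r (z j K)) by (apply Hb; rewrite ?Hss, ?Hst; lra).
      assert (B2 : ballC c r (z j (S K))) by (apply Hb; rewrite ?Hss, ?Hst; lra).
      assert (B3 : ballC c r (z (S j) K)) by (apply Hb; rewrite ?Hss, ?Hst; lra).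
      assert (B4 : ballC c r (z (S j) (S K))) by (apply Hb; rewrite ?Hss, ?Hst; lra).
      unfold V in *.
      assert (E1 := seg_int_exact P Q G c r _ _ HG HP HQ B1 B2).
      assert (E2 := seg_int_exact P Q G c r _ _ HG HP HQ B1 B3).
      assert (E3 := seg_int_exact P Q G c r _ _ HG HP HQ B2 B4).
      assert (E4 := seg_int_exact P Q G c r _ _ HG HP HQ B3 B4).
      lra. }
  assert (Hrows : forall j, (j <= N)%nat -> row 0%nat N = row j N).
  { induction j; intros Hj; auto. rewrite IHj by lia.
    assert (H1 := Hrow j N ltac:(lia) (le_n N)).
    replace (V j N) with (V j 0%nat) in H1; [lra|].
    assert (Hper : forall j, (j <= N)%nat -> z j N = z j 0%nat).
    { intros i Hi. unfold z. rewrite HstN, Hst0.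
      destruct (HH (ss i) 0 (Hss1 i Hi)) as [_ [H2 _]]. rewrite <- H2. unfold T. do 2 f_equal. ring. }
    unfold V. rewrite !Hper by lia. reflexivity. }
  assert (Hend : forall j g, (j <= N)%nat -> integrable_loop P Q g -> (forall t, H (ss j, t) = g t) ->
    forall K, (K <= N)%nat -> is_RInt (along P Q g) 0 (st K) (row j K)).
  { intros j g Hj Hg Hgz. induction K; intros HK.
    - unfold row. simpl. rewrite Hst0. apply (is_RInt_point (V := R_NormedModule)).
    - unfold row. simpl. apply (is_RInt_Chasles (V := R_NormedModule) _ 0 (st K)).
      + apply IHK. lia.
      + destruct (Hcell j K ltac:(lia) ltac:(lia)) as [G [c [r [HG [HP [HQ Hb]]]]]].
        assert (Hb' : forall t, st K <= t <= st (S K) -> ballC c r (g t)).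
        { intros t Ht. rewrite <- Hgz. apply Hb; [|exact Ht]. rewrite Hss. lra. }
        assert (Hlt : st K <= st (S K)) by (rewrite Hst; lra).
        rewrite (seg_int_exact P Q G c r); auto; try (unfold z; rewrite Hgz; apply Hb'; lra).
        unfold z. rewrite !Hgz. apply along_exact; auto. }
  assert (E0 : loop_int P Q g0 = row 0%nat N).
  { apply is_RInt_unique. fold T. rewrite <- HstN. apply Hend; auto; [lia|].
    intros t. rewrite Hss0. apply (HH 0); lra. }
  assert (E1 : loop_int P Q g1 = row N N).
  { apply is_RInt_unique. fold T. rewrite <- HstN at 1. apply Hend; auto.
    intros t. rewrite HsN1. apply (HH 1); lra. }
  rewrite E0, E1. apply Hrows. lia.
Qed.

(** * Integrals depending on a parameter in the plane *)

(** Joint continuity, curried to fit the arguments of [RInt]. *)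
Definition jcont (F : C -> R -> R) (z : C) (t : R) : Prop :=
  continuous (fun p : C * R => F (fst p) (snd p)) (z, t).

(** Compactness makes the modulus of continuity in the parameter uniform in the
    variable of integration. *)
Lemma tube (F : C -> R -> R) (z : C) (a b : R) :
  (forall t, a <= t <= b -> jcont F z t) ->
  forall eps, 0 < eps -> exists d, 0 < d /\ forall y t, Cmod (y - z)%C < d -> a <= t <= b ->
    Rabs (F y t - F z t) < eps.
Proof.
  intros HF eps Heps.
  assert (He : 0 < eps / 2) by lra.
  assert (Hex : forall t, exists del : posreal, a <= t <= b ->
    forall y t', Cmod (y - z)%C < del -> Rabs (t' - t) < del -> Rabs (F y t' - F z t) < eps / 2).
  { intros t. destruct (classic (a <= t <= b)) as [Ht|Ht].
    - destruct (proj1 (filterlim_locally _ _) (HF t Ht) (mkposreal _ He)) as [d Hd].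
      exists d. intros _ y t' Hy Ht'. apply (Hd (y, t')). split; [|exact Ht'].
      apply C_NormedModule_mixin_compat1. exact Hy.
    - exists (mkposreal 1 Rlt_0_1). intros; tauto. }
  set (delta := fun t => proj1_sig (constructive_indefinite_description _ (Hex t))).
  assert (Hdelta : forall t, a <= t <= b -> forall y t', Cmod (y - z)%C < delta t ->
     Rabs (t' - t) < delta t -> Rabs (F y t' - F z t) < eps / 2).
  { intros t. unfold delta. destruct constructive_indefinite_description as [del Hdel]. auto. }
  destruct (compactness_value_1d a b delta) as [d Hd].
  exists d. split; [apply cond_pos|]. intros y t Hy Ht.
  specialize (Hd t Ht). apply NNPP in Hd. destruct Hd as [t0 [Ht0 [Htt Hdd]]].
  assert (H1 := Hdelta t0 Ht0 y t ltac:(lra) Htt).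
  assert (H2 : Rabs (F z t - F z t0) < eps / 2).
  { apply (Hdelta t0 Ht0); auto. replace (z - z)%C with (RtoC 0) by ring. rewrite Cmod_0.
    apply cond_pos. }
  replace (F y t - F z t) with ((F y t - F z t0) - (F z t - F z t0)) by ring.
  eapply Rle_lt_trans; [apply Rabs_triang|]. rewrite Rabs_Ropp. lra.
Qed.

Lemma jcont_section F z t : jcont F z t -> continuous (F z) t.
Proof.
  intros H. apply (continuous_comp (fun s => (z, s) : C * R) (fun p => F (fst p) (snd p))); [|exact H].
  apply filterlim_locally. intros eps. exists eps. intros y Hy. split; [apply ball_center|exact Hy].
Qed.

Lemma ex_RInt_section F z a b : a <= b -> (forall t, a <= t <= b -> jcont F z t) -> ex_RInt (F z) a b.
Proof.
  intros Hab H. apply (ex_RInt_continuous (V := R_CompleteNormedModule)). intros t Ht.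
  rewrite Rmin_left, Rmax_right in Ht by lra. now apply jcont_section, H.
Qed.

Lemma RInt_bound f a b M : a <= b -> ex_RInt f a b ->
  (forall t, a <= t <= b -> Rabs (f t) <= M) -> Rabs (RInt f a b) <= (b - a) * M.
Proof.
  intros Hab Hf HM. apply (norm_RInt_le_const (V := R_NormedModule) f a b); auto.
  now apply (RInt_correct (V := R_CompleteNormedModule)).
Qed.

Lemma RInt_minus_R f g a b : ex_RInt f a b -> ex_RInt g a b ->
  RInt (fun t => f t - g t) a b = RInt f a b - RInt g a b.
Proof. intros. now apply (RInt_minus (V := R_CompleteNormedModule)). Qed.

Lemma RInt_plus_R f g a b : ex_RInt f a b -> ex_RInt g a b ->
  RInt (fun t => f t + g t) a b = RInt f a b + RInt g a b.
Proof. intros. now apply (RInt_plus (V := R_CompleteNormedModule)). Qed.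

Lemma RInt_scal_R f k a b : ex_RInt f a b -> RInt (fun t => k * f t) a b = k * RInt f a b.
Proof. intros. now apply (RInt_scal (V := R_CompleteNormedModule)). Qed.

Lemma continuous_RInt_param F z a b : a <= b ->
  locally z (fun y => forall t, a <= t <= b -> jcont F y t) ->
  continuous (fun y => RInt (F y) a b) z.
Proof.
  intros Hab HF. apply filterlim_locally. intros eps.
  assert (He : 0 < eps / (b - a + 1)) by (apply Rdiv_lt_0_compat; [apply cond_pos|lra]).
  destruct (tube F z a b (locally_singleton _ _ HF) _ He) as [d [Hd H]].
  assert (Hb : locally z (fun y => Cmod (y - z)%C < d)) by (apply Cball_locally; exists d; auto).
  generalize (filter_and _ _ HF Hb). apply filter_imp. intros y [Hy Hyd].
  change (Rabs (RInt (F y) a b - RInt (F z) a b) < eps).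
  assert (E1 := ex_RInt_section F y a b Hab Hy).
  assert (E2 := ex_RInt_section F z a b Hab (locally_singleton _ _ HF)).
  rewrite <- RInt_minus_R by auto.
  eapply Rle_lt_trans; [apply (RInt_bound _ a b (eps / (b - a + 1))); auto|].
  - now apply (ex_RInt_minus (V := R_NormedModule)).
  - intros t Ht. apply Rlt_le, H; auto.
  - replace ((b - a) * (eps / (b - a + 1))) with (eps * ((b - a) / (b - a + 1))) by (field; lra).
    rewrite <- (Rmult_1_r eps) at 2. apply Rmult_lt_compat_l; [apply cond_pos|].
    apply Rlt_div_l; lra.
Qed.

(** The mean value theorem along a segment; it makes the differentiability of an
    integrand uniform in the variable of integration. *)
Lemma D2_segment (f A B : C -> R) z y M :
  (forall s, 0 <= s <= 1 -> D2 f (seg z y s) (A (seg z y s)) (B (seg z y s))) ->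
  (forall s, 0 <= s <= 1 -> Rabs (A (seg z y s) - A z) <= M /\ Rabs (B (seg z y s) - B z) <= M) ->
  Rabs (f y - f z - (A z * (fst y - fst z) + B z * (snd y - snd z))) <= 2 * M * Cmod (y - z)%C.
Proof.
  intros HD HM.
  set (L := A z * (fst y - fst z) + B z * (snd y - snd z)).
  destruct (MVT_gen (fun s => f (seg z y s) - s * L) 0 1
    (fun s => A (seg z y s) * (fst y - fst z) + B (seg z y s) * (snd y - snd z) - L)) as [s [Hs Hmv]].
  - intros s Hs. rewrite Rmin_left, Rmax_right in Hs by lra.
    apply (is_derive_minus (fun s => f (seg z y s)) (fun s => s * L)).
    + unfold seg. apply (D2_curve f (fun s => fst z + s * (fst y - fst z)) (fun s => snd z + s * (snd y - snd z))).
      * apply (HD s). lra.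
      * auto_derive; [easy|ring].
      * auto_derive; [easy|ring].
    + auto_derive; [easy|ring].
  - intros s Hs. rewrite Rmin_left, Rmax_right in Hs by lra.
    apply continuity_pt_filterlim. apply (continuous_minus (V := R_NormedModule) (fun s => f (seg z y s)) (fun s => s * L)).
    + apply (ex_derive_continuous (fun s => f (seg z y s))). eexists.
      unfold seg. apply (D2_curve f (fun s => fst z + s * (fst y - fst z)) (fun s => snd z + s * (snd y - snd z))).
      * apply (HD s). lra.
      * auto_derive; [easy|reflexivity].
      * auto_derive; [easy|reflexivity].
    + apply (ex_derive_continuous (fun s => s * L)). now auto_derive.
  - rewrite Rmin_left, Rmax_right in Hs by lra. rewrite seg_0, seg_1 in Hmv.
    destruct (HM s Hs) as [H1 H2].
    replace (f y - f z - L) with ((A (seg z y s) - A z) * (fst y - fst z) + (B (seg z y s) - B z) * (snd y - snd z)).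
    2:{ unfold L in *. lra. }
    eapply Rle_trans; [apply Rabs_triang|]. rewrite !Rabs_mult.
    pose proof (Rabs_fst_le_Cmod (y - z)%C) as H7. pose proof (Rabs_snd_le_Cmod (y - z)%C) as H8.
    simpl in H7, H8. change (fst y + - fst z) with (fst y - fst z) in H7.
    change (snd y + - snd z) with (snd y - snd z) in H8.
    assert (Rabs (A (seg z y s) - A z) * Rabs (fst y - fst z) <= M * Cmod (y - z)%C)
      by (apply Rmult_le_compat; auto using Rabs_pos).
    assert (Rabs (B (seg z y s) - B z) * Rabs (snd y - snd z) <= M * Cmod (y - z)%C)
      by (apply Rmult_le_compat; auto using Rabs_pos).
    lra.
Qed.

Lemma D2_RInt_param (F A B : C -> R -> R) z a b : a <= b ->
  locally z (fun y => forall t, a <= t <= b -> D2 (fun y => F y t) y (A y t) (B y t) /\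
    jcont F y t /\ jcont A y t /\ jcont B y t) ->
  D2 (fun y => RInt (F y) a b) z (RInt (A z) a b) (RInt (B z) a b).
Proof.
  intros Hab HF. apply D2_eps. intros eps Heps.
  assert (He : 0 < eps / (2 * (b - a + 1))) by (apply Rdiv_lt_0_compat; lra).
  pose proof (locally_singleton _ _ HF) as HFz.
  destruct (tube A z a b (fun t Ht => proj1 (proj2 (proj2 (HFz t Ht)))) _ He) as [d1 [Hd1 H1]].
  destruct (tube B z a b (fun t Ht => proj2 (proj2 (proj2 (HFz t Ht)))) _ He) as [d2 [Hd2 H2]].
  apply Cball_locally in HF. destruct HF as [d3 [Hd3 HF]].
  exists (Rmin d1 (Rmin d2 d3)). split; [repeat apply Rmin_pos; auto|].
  intros y Hy.
  assert (Hy1 : Cmod (y - z)%C < d1) by (eapply Rlt_le_trans; [exact Hy|apply Rmin_l]).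
  assert (Hy2 : Cmod (y - z)%C < d2) by (eapply Rlt_le_trans; [exact Hy|eapply Rle_trans; [apply Rmin_r|apply Rmin_l]]).
  assert (Hy3 : Cmod (y - z)%C < d3) by (eapply Rlt_le_trans; [exact Hy|eapply Rle_trans; [apply Rmin_r|apply Rmin_r]]).
  assert (Ey : ex_RInt (F y) a b) by (apply ex_RInt_section; auto; intros t Ht; apply (HF y Hy3 t Ht)).
  assert (Ez : ex_RInt (F z) a b) by (apply ex_RInt_section; auto; intros t Ht; apply (HFz t Ht)).
  assert (EA : ex_RInt (A z) a b) by (apply ex_RInt_section; auto; intros t Ht; apply (HFz t Ht)).
  assert (EB : ex_RInt (B z) a b) by (apply ex_RInt_section; auto; intros t Ht; apply (HFz t Ht)).
  assert (EL : is_RInt (fun t => F y t - F z t - ((fst y - fst z) * A z t + (snd y - snd z) * B z t)) a b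
    (RInt (F y) a b - RInt (F z) a b - ((fst y - fst z) * RInt (A z) a b + (snd y - snd z) * RInt (B z) a b))).
  { apply (is_RInt_minus (V := R_NormedModule)); [apply (is_RInt_minus (V := R_NormedModule))|
      apply (is_RInt_plus (V := R_NormedModule)); apply (is_RInt_scal (V := R_NormedModule))];
    now apply (RInt_correct (V := R_CompleteNormedModule)). }
  rewrite (Rmult_comm (RInt (A z) a b)), (Rmult_comm (RInt (B z) a b)).
  rewrite <- (is_RInt_unique _ _ _ _ EL).
  eapply Rle_trans; [apply (RInt_bound _ a b (2 * (eps / (2 * (b - a + 1))) * Cmod (y - z)%C)); auto|].
  - eexists; exact EL.
  - intros t Ht. rewrite (Rmult_comm _ (A z t)), (Rmult_comm _ (B z t)).
    assert (Hzz : Cmod (z - z)%C <= Cmod (y - z)%C).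
    { replace (z - z)%C with (RtoC 0) by ring. rewrite Cmod_0. apply Cmod_ge_0. }
    apply (D2_segment (fun y => F y t) (fun y => A y t) (fun y => B y t)).
    + intros s Hs. assert (Hsd := seg_dist z y z s (Cmod (y - z)%C) Hs Hzz (Rle_refl _)).
      apply HF; auto. lra.
    + intros s Hs. assert (Hsd := seg_dist z y z s (Cmod (y - z)%C) Hs Hzz (Rle_refl _)).
      split; apply Rlt_le; [apply H1|apply H2]; auto; lra.
  - replace ((b - a) * (2 * (eps / (2 * (b - a + 1))) * Cmod (y - z))) with
      (eps * Cmod (y - z) * ((b - a) / (b - a + 1))) by (field; lra).
    rewrite <- (Rmult_1_r (eps * _)) at 2. apply Rmult_le_compat_l.
    + apply Rmult_le_pos; [lra|apply Cmod_ge_0].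
    + apply Rle_div_l; lra.
Qed.

(** Equations obtained from lemmas on normed modules live in a carrier that is only
    convertible to [R]; [ring], [field] and [lra] want [R] itself. *)
Ltac req := match goal with |- @eq _ ?a ?b => change (@eq R a b) end.

Lemma jcont_plus F G z t : jcont F z t -> jcont G z t -> jcont (fun y t => F y t + G y t) z t.
Proof. intros HF HG. exact (continuous_plus (V := R_NormedModule) _ _ _ HF HG). Qed.

Lemma jcont_mult F G z t : jcont F z t -> jcont G z t -> jcont (fun y t => F y t * G y t) z t.
Proof. intros HF HG. exact (continuous_mult (K := R_AbsRing) _ _ _ HF HG). Qed.

Lemma jcont_opp F z t : jcont F z t -> jcont (fun y t => - F y t) z t.
Proof. intros HF. exact (continuous_opp (V := R_NormedModule) _ _ HF). Qed.

Lemma jcont_minus F G z t : jcont F z t -> jcont G z t -> jcont (fun y t => F y t - G y t) z t.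
Proof. intros HF HG. exact (jcont_plus _ _ _ _ HF (jcont_opp _ _ _ HG)). Qed.

Lemma jcont_t f z t : continuous f t -> jcont (fun _ t => f t) z t.
Proof.
  intros Hf. apply (continuous_comp (fun p : C * R => snd p) f); [apply continuous_snd|exact Hf].
Qed.

Lemma jcont_z f z t : continuous f z -> jcont (fun y _ => f y) z t.
Proof.
  intros Hf. apply (continuous_comp (fun p : C * R => fst p) f); [apply continuous_fst|exact Hf].
Qed.

Lemma jcont_comp (u : C -> R) F G z t : jcont F z t -> jcont G z t -> continuous u (F z t, G z t) ->
  jcont (fun y t => u (F y t, G y t)) z t.
Proof.
  intros HF HG Hu.
  apply (continuous_comp (fun p : C * R => (F (fst p) (snd p), G (fst p) (snd p)) : C) u); [|exact Hu].
  apply filterlim_locally. intros eps.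
  generalize (proj1 (filterlim_locally _ _) HF eps) (proj1 (filterlim_locally _ _) HG eps).
  intros H1 H2. generalize (filter_and _ _ H1 H2). apply filter_imp. intros s [H3 H4]. now split.
Qed.

Lemma continuous_cos_R t : continuous cos t.
Proof. apply (ex_derive_continuous cos). now auto_derive. Qed.
Lemma continuous_sin_R t : continuous sin t.
Proof. apply (ex_derive_continuous sin). now auto_derive. Qed.

(** * Holomorphic functions have holomorphic derivatives *)

Definition circ_pt (z : C) (s t : R) : C := (fst z + s * cos t, snd z + s * sin t).

Lemma circ_pt_dist z s t : Cmod (circ_pt z s t - z)%C = Rabs s.
Proof.
  rewrite <- sqrt_Rsqr_abs. unfold Cmod, circ_pt. f_equal. simpl. unfold Rsqr.
  pose proof (sin2_cos2 t) as H. unfold Rsqr in H.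
  replace (_ + _) with (s * s * (sin t * sin t + cos t * cos t)) by ring. rewrite H. ring.
Qed.

(** The real part of [(u + i v) e^{-it}] on a circle; the imaginary part is the
    same expression for [v] and [- u]. *)
Definition kernel_cos (u v : C -> R) (s : R) (z : C) (t : R) : R :=
  u (circ_pt z s t) * cos t + v (circ_pt z s t) * sin t.

Lemma jcont_circ (u : C -> R) (s : R) z t : continuous u (circ_pt z s t) ->
  jcont (fun y t => u (circ_pt y s t)) z t.
Proof.
  intros Hu. apply (jcont_comp u (fun y t => fst y + s * cos t) (fun y t => snd y + s * sin t)).
  - apply jcont_plus; [apply jcont_z, continuous_fst|].
    apply jcont_mult; apply jcont_t; [apply continuous_const|apply continuous_cos_R].
  - apply jcont_plus; [apply jcont_z, continuous_snd|].
    apply jcont_mult; apply jcont_t; [apply continuous_const|apply continuous_sin_R].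
  - exact Hu.
Qed.

Lemma jcont_kernel u v s z t : continuous u (circ_pt z s t) -> continuous v (circ_pt z s t) ->
  jcont (fun y t => kernel_cos u v s y t) z t.
Proof.
  intros Hu Hv.
  apply (jcont_plus (fun y t => u (circ_pt y s t) * cos t) (fun y t => v (circ_pt y s t) * sin t)).
  - apply (jcont_mult (fun y t => u (circ_pt y s t)) (fun _ t => cos t)).
    now apply jcont_circ. apply jcont_t, continuous_cos_R.
  - apply (jcont_mult (fun y t => v (circ_pt y s t)) (fun _ t => sin t)).
    now apply jcont_circ. apply jcont_t, continuous_sin_R.
Qed.

Lemma D2_shift u s t z a b : D2 u (circ_pt z s t) a b -> D2 (fun y => u (circ_pt y s t)) z a b.
Proof.
  intros H. eapply D2_eq.
  - apply (D2_comp u (fun y => fst y + s * cos t) (fun y => snd y + s * sin t) z a b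
      (1 + 0) (0 + 0) (0 + 0) (1 + 0) H).
    + apply D2_plus; [apply D2_fst|apply (D2_const (s * cos t))].
    + apply D2_plus; [apply D2_snd|apply (D2_const (s * sin t))].
  - ring.
  - ring.
Qed.

Lemma D2_kernel u v a b a' b' s z r :
  (forall y, ballC z r y -> D2 u y (a y) (b y) /\ D2 v y (a' y) (b' y)) ->
  cont_on (ballC z r) a -> cont_on (ballC z r) b -> cont_on (ballC z r) a' -> cont_on (ballC z r) b' ->
  0 <= s < r ->
  D2 (fun y => RInt (kernel_cos u v s y) 0 (2 * PI)) z
    (RInt (kernel_cos a a' s z) 0 (2 * PI)) (RInt (kernel_cos b b' s z) 0 (2 * PI)).
Proof.
  intros HD Ha Hb Ha' Hb' Hs.
  apply (D2_RInt_param (kernel_cos u v s) (kernel_cos a a' s) (kernel_cos b b' s)).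
  { generalize PI_RGT_0; lra. }
  apply Cball_locally. exists (r - s). split; [lra|]. intros y Hy t _.
  assert (Hb1 : ballC z r (circ_pt y s t)).
  { unfold ballC. eapply Rle_lt_trans; [apply (Cmod_triangle' _ _ y)|]. rewrite circ_pt_dist, Rabs_pos_eq; lra. }
  destruct (HD _ Hb1) as [H1 H2].
  split; [|split; [|split]]; try (apply jcont_kernel; auto; eapply D2_continuous; eauto).
  unfold kernel_cos. eapply D2_eq.
  - apply D2_plus; apply D2_mult.
    + apply (D2_shift u). exact H1.
    + apply (D2_const (cos t)).
    + apply (D2_shift v). exact H2.
    + apply (D2_const (sin t)).
  - cbv beta. ring.
  - cbv beta. ring.
Qed.

Lemma is_derive_eq (f : R -> R) (x l l' : R) : is_derive f x l -> l = l' -> is_derive f x l'.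
Proof. now intros H <-. Qed.

(** Reduces differentiation in one real parameter to the planar case. *)
Lemma is_derive_section (K : R -> R) (s l m : R) : D2 (fun y => K (fst y)) (s, 0) l m -> is_derive K s l.
Proof.
  intros H. apply (is_derive_eq _ _ (l * 1 + m * 0)); [|ring].
  apply (D2_curve (fun y => K (fst y)) (fun s => s) (fun _ => 0) s l m 1 0 H).
  - apply (is_derive_id (K := R_AbsRing)).
  - apply (is_derive_const (K := R_AbsRing) (V := R_NormedModule)).
Qed.

(** Cauchy's formula for the derivative: for [G = u + i v] holomorphic,
    [K s = int G (z + s e^{it}) e^{-it} dt] satisfies [s K' = K] (integrate by
    parts), so [K s / s] is constant, equal to its limit [K' 0] at [0]. *)
Lemma circle_mean u v a b z r s :
  (forall y, ballC z r y -> D2 u y (a y) (b y) /\ D2 v y (- b y) (a y)) ->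
  cont_on (ballC z r) a -> cont_on (ballC z r) b -> 0 < s < r ->
  RInt (kernel_cos u v s z) 0 (2 * PI) = 2 * PI * s * a z.
Proof.
  intros HD Ha Hb Hs. assert (HPI := PI_RGT_0).
  set (K := fun s => RInt (kernel_cos u v s z) 0 (2 * PI)).
  set (A := fun s => RInt (fun t => a (circ_pt z s t)) 0 (2 * PI)).
  assert (Hin : forall s t, Rabs s < r -> ballC z r (circ_pt z s t)).
  { intros s' t Hs'. unfold ballC. now rewrite circ_pt_dist. }
  assert (Hder : forall s t, Rabs s < r ->
     is_derive (fun t => u (circ_pt z s t)) t (s * (- a (circ_pt z s t) * sin t + b (circ_pt z s t) * cos t)) /\
     is_derive (fun t => v (circ_pt z s t)) t (s * (b (circ_pt z s t) * sin t + a (circ_pt z s t) * cos t)) /\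
     is_derive (fun s => u (circ_pt z s t)) s (a (circ_pt z s t) * cos t + b (circ_pt z s t) * sin t) /\
     is_derive (fun s => v (circ_pt z s t)) s (- b (circ_pt z s t) * cos t + a (circ_pt z s t) * sin t)).
  { intros s' t Hs'. destruct (HD _ (Hin s' t Hs')) as [H1 H2]. unfold circ_pt in *.
    assert (X1 : is_derive (fun t => fst z + s' * cos t) t (- s' * sin t)) by (auto_derive; [easy|ring]).
    assert (X2 : is_derive (fun t => snd z + s' * sin t) t (s' * cos t)) by (auto_derive; [easy|ring]).
    assert (X3 : is_derive (fun s => fst z + s * cos t) s' (cos t)) by (auto_derive; [easy|ring]).
    assert (X4 : is_derive (fun s => snd z + s * sin t) s' (sin t)) by (auto_derive; [easy|ring]).
    split; [|split; [|split]].
    - eapply is_derive_eq; [exact (D2_curve u _ _ t _ _ _ _ H1 X1 X2)|ring].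
    - eapply is_derive_eq; [exact (D2_curve v _ _ t _ _ _ _ H2 X1 X2)|ring].
    - exact (D2_curve u _ _ s' _ _ _ _ H1 X3 X4).
    - exact (D2_curve v _ _ s' _ _ _ _ H2 X3 X4). }
  assert (HCu : cont_on (ballC z r) u) by (intros y Hy; destruct (HD y Hy); eapply D2_continuous; eauto).
  assert (HCv : cont_on (ballC z r) v) by (intros y Hy; destruct (HD y Hy); eapply D2_continuous; eauto).
  (* joint continuity in the radius and the angle *)
  assert (JR : forall f s t, cont_on (ballC z r) f -> Rabs s < r ->
     jcont (fun y t => f (circ_pt z (fst y) t)) (s, 0) t).
  { intros f s' t Hf Hs'.
    apply (jcont_comp f (fun y t => fst z + fst y * cos t) (fun y t => snd z + fst y * sin t)).
    - apply jcont_plus; [apply jcont_t, continuous_const|].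
      apply jcont_mult; [apply jcont_z, continuous_fst|apply jcont_t, continuous_cos_R].
    - apply jcont_plus; [apply jcont_t, continuous_const|].
      apply jcont_mult; [apply jcont_z, continuous_fst|apply jcont_t, continuous_sin_R].
    - apply Hf. exact (Hin s' t Hs'). }
  assert (JR' : forall f y t, cont_on (ballC z r) f -> Rabs (fst y) < r ->
     jcont (fun y t => f (circ_pt z (fst y) t)) y t).
  { intros f y t Hf Hs'.
    apply (jcont_comp f (fun y t => fst z + fst y * cos t) (fun y t => snd z + fst y * sin t)).
    - apply jcont_plus; [apply jcont_t, continuous_const|].
      apply jcont_mult; [apply jcont_z, continuous_fst|apply jcont_t, continuous_cos_R].
    - apply jcont_plus; [apply jcont_t, continuous_const|].
      apply jcont_mult; [apply jcont_z, continuous_fst|apply jcont_t, continuous_sin_R].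
    - apply Hf. exact (Hin (fst y) t Hs'). }
  assert (Hloc : forall s, Rabs s < r -> locally (s, 0) (fun y : C => Rabs (fst y) < r)).
  { intros s' Hs'. apply Cball_locally. exists (r - Rabs s'). split; [lra|]. intros y Hy.
    replace (fst y) with ((fst y - s') + s') by ring. eapply Rle_lt_trans; [apply Rabs_triang|].
    pose proof (Rabs_fst_le_Cmod (y - (s', 0))%C) as H. simpl in H.
    change (fst y + - s') with (fst y - s') in H. lra. }
  assert (HK : forall s, Rabs s < r -> is_derive K s (A s)).
  { intros s' Hs'.
    apply (is_derive_section K s' (A s') (RInt (fun _ => 0) 0 (2 * PI))).
    apply (D2_RInt_param (fun y => kernel_cos u v (fst y) z) (fun y t => a (circ_pt z (fst y) t))
      (fun _ _ => 0) (s', 0)); [lra|].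
    generalize (Hloc s' Hs'). apply filter_imp. intros y Hy t _. split; [|split; [|split]].
    - destruct (Hder (fst y) t Hy) as [_ [_ [H1 H2]]]. unfold kernel_cos. eapply D2_eq.
      + apply D2_plus; apply D2_mult.
        * exact (D2_comp1 (fun s => u (circ_pt z s t)) (fun y => fst y) y _ _ _ H1 (D2_fst y)).
        * apply (D2_const (cos t)).
        * exact (D2_comp1 (fun s => v (circ_pt z s t)) (fun y => fst y) y _ _ _ H2 (D2_fst y)).
        * apply (D2_const (sin t)).
      + cbv beta. pose proof (sin2_cos2 t) as H. unfold Rsqr in H.
        transitivity (a (circ_pt z (fst y) t) * (sin t * sin t + cos t * cos t)); [ring|rewrite H; apply Rmult_1_r].
      + cbv beta. ring.
    - apply (jcont_plus (fun y t => u (circ_pt z (fst y) t) * cos t) (fun y t => v (circ_pt z (fst y) t) * sin t)).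
      + apply (jcont_mult (fun y t => u (circ_pt z (fst y) t)) (fun _ t => cos t)).
        now apply JR'. apply jcont_t, continuous_cos_R.
      + apply (jcont_mult (fun y t => v (circ_pt z (fst y) t)) (fun _ t => sin t)).
        now apply JR'. apply jcont_t, continuous_sin_R.
    - now apply JR'.
    - apply jcont_t, continuous_const. }
  assert (Hparts : forall s, Rabs s < r -> K s = s * A s).
  { intros s' Hs'.
    assert (Hsec : forall f, cont_on (ballC z r) f -> forall t, continuous (fun t => f (circ_pt z s' t)) t).
    { intros f Hf t. exact (jcont_section (fun y t => f (circ_pt z (fst y) t)) (s', 0) t (JR f s' t Hf Hs')). }
    assert (Hk : forall t, continuous (kernel_cos u v s' z) t).
    { intros t. apply (continuous_plus (V := R_NormedModule)); apply (continuous_mult (K := R_AbsRing));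
        auto using continuous_cos_R, continuous_sin_R. }
    assert (Ek : ex_RInt (kernel_cos u v s' z) 0 (2 * PI)).
    { apply (ex_RInt_continuous (V := R_CompleteNormedModule)). auto. }
    assert (Ea : ex_RInt (fun t => a (circ_pt z s' t)) 0 (2 * PI)).
    { apply (ex_RInt_continuous (V := R_CompleteNormedModule)). intros t _. now apply Hsec. }
    (* the integrand is the derivative of Im (- G e^{-it}) *)
    assert (Hw : is_RInt (fun t => kernel_cos u v s' z t - s' * a (circ_pt z s' t)) 0 (2 * PI) 0).
    { set (w := fun t => u (circ_pt z s' t) * sin t - v (circ_pt z s' t) * cos t).
      replace 0 with (minus (w (2 * PI)) (w 0)) at 2.
      - apply (is_RInt_derive (V := R_CompleteNormedModule) w).
        + intros t _. destruct (Hder s' t Hs') as [H1 [H2 _]].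
          eapply is_derive_eq.
          * apply (is_derive_minus (fun t => u (circ_pt z s' t) * sin t) (fun t => v (circ_pt z s' t) * cos t)).
            -- apply (is_derive_mult (fun t => u (circ_pt z s' t)) sin); [exact H1|apply is_derive_sin|apply Rmult_comm].
            -- apply (is_derive_mult (fun t => v (circ_pt z s' t)) cos); [exact H2|apply is_derive_cos|apply Rmult_comm].
          * unfold minus, plus, opp, mult; simpl. unfold kernel_cos.
            pose proof (sin2_cos2 t) as H. unfold Rsqr in H.
            transitivity (u (circ_pt z s' t) * cos t + v (circ_pt z s' t) * sin t
              - s' * (a (circ_pt z s' t) * (sin t * sin t + cos t * cos t))); [|rewrite H]; ring.
        + intros t _. apply (continuous_minus (V := R_NormedModule)); [auto|].
          apply (continuous_mult (K := R_AbsRing)); [apply continuous_const|now apply Hsec].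
      - unfold w, circ_pt, minus, plus, opp; simpl. rewrite sin_2PI, cos_2PI, sin_0, cos_0. ring. }
    apply (is_RInt_unique (V := R_CompleteNormedModule)) in Hw. rewrite RInt_minus_R in Hw; auto.
    - rewrite RInt_scal_R in Hw by auto. unfold K, A. lra.
    - now apply (ex_RInt_scal (V := R_NormedModule)). }
  assert (HA0 : A 0 = 2 * PI * a z).
  { unfold A. rewrite (RInt_ext _ (fun _ => a z)).
    - rewrite RInt_const. unfold scal; simpl; unfold mult; simpl. req; ring.
    - intros t _. f_equal. unfold circ_pt. rewrite !Rmult_0_l, !Rplus_0_r. now destruct z. }
  assert (HAs : A s = A 0).
  { destruct (MVT_gen A 0 s (fun _ => 0)) as [x [_ Hx]].
    - intros x Hx. rewrite Rmin_left, Rmax_right in Hx by lra.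
      apply (is_derive_ext_loc (fun s => K s / s)).
      + apply (locally_interval _ x 0 r); simpl; [lra|lra|]. intros y Hy1 Hy2. simpl in *.
        rewrite Hparts by (rewrite Rabs_pos_eq; lra). req; field. lra.
      + assert (Hxr : Rabs x < r) by (rewrite Rabs_pos_eq; lra).
        eapply is_derive_eq; [apply (is_derive_div K (fun s => s)); [apply (HK x Hxr)|
          apply (is_derive_id (K := R_AbsRing))|lra]|].
        rewrite Hparts by auto. unfold one; simpl. req; field. lra.
    - intros x Hx. rewrite Rmin_left, Rmax_right in Hx by lra.
      assert (Hxr : Rabs x < r) by (rewrite Rabs_pos_eq; lra).
      apply continuity_pt_filterlim.
      apply (continuous_comp (fun x : R => (x, 0) : C) (fun y => A (fst y))).
      + apply continuous_pair; [apply continuous_id|apply continuous_const].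
      + apply (continuous_RInt_param (fun y t => a (circ_pt z (fst y) t))); [lra|].
        generalize (Hloc x Hxr). apply filter_imp. intros y Hy t _. now apply JR'.
    - lra. }
  fold (K s). rewrite Hparts by (rewrite Rabs_pos_eq; lra). rewrite HAs, HA0. req. ring.
Qed.

(** Defined by partial derivatives, to have a total function without choosing the
    derivative. *)
Definition cderiv (f : C -> C) (z : C) : C := (du (fun y => Re (f y)) z, du (fun y => Im (f y)) z).

Lemma cderiv_correct f z l : complex_derive f z l -> cderiv f z = l.
Proof.
  intros H. apply complex_derive_D2 in H. destruct H as [H1 H2].
  apply D2_partials in H1. apply D2_partials in H2. unfold cderiv. destruct l; simpl in *.
  f_equal; tauto.
Qed.

(** One application of [circle_mean] writes the derivative of a holomorphic
    function with continuous derivative as a circle integral of the function,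
    which can be differentiated once more. *)
Lemma derivative_gain (f f1 : C -> C) z0 r : 0 < r ->
  (forall y, ballC z0 r y -> complex_derive f y (f1 y)) ->
  (forall y, ballC z0 r y -> continuous f1 y) ->
  exists f2, forall y, ballC z0 (r / 2) y -> complex_derive f1 y (f2 y) /\ continuous f2 y.
Proof.
  intros Hr HD HC.
  set (u := fun y => Re (f y)). set (v := fun y => Im (f y)).
  set (a := fun y => Re (f1 y)). set (b := fun y => - Im (f1 y)).
  assert (HD' : forall y, ballC z0 r y -> D2 u y (a y) (b y) /\ D2 v y (- b y) (a y)).
  { intros y Hy. destruct (proj1 (complex_derive_D2 _ _ _) (HD y Hy)) as [H1 H2].
    unfold u, v, a, b. rewrite Ropp_involutive. now split. }
  assert (Ha : cont_on (ballC z0 r) a) by (intros y Hy; apply HC, continuous_C_pair in Hy; apply Hy).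
  assert (Hb : cont_on (ballC z0 r) b).
  { intros y Hy. apply (continuous_opp (V := R_NormedModule)). apply HC, continuous_C_pair in Hy; apply Hy. }
  assert (Hnb : cont_on (ballC z0 r) (fun y => - b y)).
  { intros y Hy. apply (continuous_opp (V := R_NormedModule)). now apply Hb. }
  set (s := r / 4). assert (HPI := PI_RGT_0).
  assert (Hsub : forall y w, ballC z0 (r / 2) y -> ballC y (r / 2) w -> ballC z0 r w).
  { intros y w Hy Hw. unfold ballC in *. eapply Rle_lt_trans; [apply (Cmod_triangle' _ _ y)|]. lra. }
  assert (Ea : forall y, ballC z0 (r / 2) y -> a y = / (2 * PI * s) * RInt (kernel_cos u v s y) 0 (2 * PI)).
  { intros y Hy. rewrite (circle_mean u v a b y (r / 2)).
    - field. unfold s. split; lra.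
    - intros w Hw. apply HD'. eauto.
    - intros w Hw. apply Ha. eauto.
    - intros w Hw. apply Hb. eauto.
    - unfold s. lra. }
  assert (Eb : forall y, ballC z0 (r / 2) y ->
    - b y = / (2 * PI * s) * RInt (kernel_cos v (fun y => - u y) s y) 0 (2 * PI)).
  { intros y Hy. rewrite (circle_mean v (fun y => - u y) (fun y => - b y) a y (r / 2)).
    - field. unfold s. split; lra.
    - intros w Hw. destruct (HD' w) as [H1 H2]; [eauto|]. split; [exact H2|].
      apply (D2_opp _ _ _ _ H1).
    - intros w Hw. apply Hnb. eauto.
    - intros w Hw. apply Ha. eauto.
    - unfold s. lra. }
  assert (Hopen : forall y, ballC z0 (r / 2) y -> locally y (fun w => ballC z0 (r / 2) w)).
  { intros y Hy. apply Cball_locally. exists (r / 2 - Cmod (y - z0)). unfold ballC in *.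
    split; [lra|]. intros w Hw. eapply Rle_lt_trans; [apply (Cmod_triangle' _ _ y)|]. lra. }
  set (k := / (2 * PI * s)).
  exists (fun y => (k * RInt (kernel_cos a (fun y => - b y) s y) 0 (2 * PI),
               k * RInt (kernel_cos (fun y => - b y) (fun y => - a y) s y) 0 (2 * PI))).
  intros y Hy.
  assert (Hna : cont_on (ballC z0 r) (fun y => - a y)).
  { intros w Hw. apply (continuous_opp (V := R_NormedModule)). now apply Ha. }
  assert (HDa : D2 a y (k * RInt (kernel_cos a (fun y => - b y) s y) 0 (2 * PI))
                       (k * RInt (kernel_cos b a s y) 0 (2 * PI))).
  { apply (D2_ext_loc (fun y => k * RInt (kernel_cos u v s y) 0 (2 * PI))).
    - generalize (Hopen y Hy). apply filter_imp. intros w Hw. now rewrite Ea.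
    - apply D2_scal. apply (D2_kernel u v a b (fun y => - b y) a s y (r / 2)).
      + intros w Hw. apply HD'. eauto.
      + intros w Hw. apply Ha. eauto.
      + intros w Hw. apply Hb. eauto.
      + intros w Hw. apply Hnb. eauto.
      + intros w Hw. apply Ha. eauto.
      + unfold s; lra. }
  assert (HDb : D2 (fun y => - b y) y (k * RInt (kernel_cos (fun y => - b y) (fun y => - a y) s y) 0 (2 * PI))
                       (k * RInt (kernel_cos a (fun y => - b y) s y) 0 (2 * PI))).
  { apply (D2_ext_loc (fun y => k * RInt (kernel_cos v (fun y => - u y) s y) 0 (2 * PI))).
    - generalize (Hopen y Hy). apply filter_imp. intros w Hw. now rewrite Eb.
    - apply D2_scal. apply (D2_kernel v (fun y => - u y) (fun y => - b y) a (fun y => - a y) (fun y => - b y) s y (r / 2)).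
      + intros w Hw. destruct (HD' w) as [H1 H2]; [eauto|]. split; [exact H2|].
        apply (D2_opp _ _ _ _ H1).
      + intros w Hw. apply Hnb. eauto.
      + intros w Hw. apply Ha. eauto.
      + intros w Hw. apply Hna. eauto.
      + intros w Hw. apply Hnb. eauto.
      + unfold s; lra. }
  assert (Hopp : RInt (kernel_cos b a s y) 0 (2 * PI) = - RInt (kernel_cos (fun y => - b y) (fun y => - a y) s y) 0 (2 * PI)).
  { rewrite (RInt_ext _ (fun t => (-1) * kernel_cos (fun y => - b y) (fun y => - a y) s y t)).
    - rewrite RInt_scal_R; [req; ring|].
      apply (ex_RInt_section (kernel_cos (fun y => - b y) (fun y => - a y) s)); [lra|].
      intros t _. apply jcont_kernel; [apply Hnb|apply Hna]; apply (Hsub y); auto;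
        unfold ballC; rewrite circ_pt_dist, Rabs_pos_eq; unfold s; lra.
    - intros t _. unfold kernel_cos. req. ring. }
  split.
  - apply complex_derive_D2. simpl. split.
    + eapply D2_eq; [exact HDa|reflexivity|]. rewrite Hopp. ring.
    + apply (D2_ext (fun y => - b y)); [|exact HDb]. intros w. unfold b. ring.
  - apply continuous_C_pair. simpl. split; apply (continuous_mult (K := R_AbsRing)); try apply continuous_const.
    + apply (continuous_RInt_param (kernel_cos a (fun y => - b y) s)); [lra|].
      generalize (Hopen y Hy). apply filter_imp. intros w Hw t _.
      apply jcont_kernel; [apply Ha|apply Hnb]; apply (Hsub w); auto;
        unfold ballC; rewrite circ_pt_dist, Rabs_pos_eq; unfold s; lra.
    + apply (continuous_RInt_param (kernel_cos (fun y => - b y) (fun y => - a y) s)); [lra|].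
      generalize (Hopen y Hy). apply filter_imp. intros w Hw t _.
      apply jcont_kernel; [apply Hnb|apply Hna]; apply (Hsub w); auto;
        unfold ballC; rewrite circ_pt_dist, Rabs_pos_eq; unfold s; lra.
Qed.

(** The form [f dz] is closed, hence has a primitive [G], although nothing is known yet
    on the continuity of [f1]. As [f] is continuous, one gain of differentiability
    applied to [G] makes [f1] continuous, and a second one applied to [f] makes it
    holomorphic. *)
Theorem derivative_holomorphic (f f1 : C -> C) z0 r : 0 < r ->
  (forall y, ballC z0 r y -> complex_derive f y (f1 y)) ->
  exists l, complex_derive f1 z0 l.
Proof.
  intros Hr HD.
  assert (HD' : forall y, ballC z0 r y -> D2 (fun y => Re (f y)) y (Re (f1 y)) (- Im (f1 y)) /\
     D2 (fun y => Im (f y)) y (Im (f1 y)) (Re (f1 y))).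
  { intros y Hy. now apply complex_derive_D2, HD. }
  destruct (closed_form_exact (fun y => Re (f y)) (fun y => - Im (f y)) z0 r Hr) as [G1 HG1].
  { intros y Hy. destruct (HD' y Hy) as [H1 H2]. do 3 eexists. split; [exact H1|].
    exact (D2_opp _ _ _ _ H2). }
  destruct (closed_form_exact (fun y => Im (f y)) (fun y => Re (f y)) z0 r Hr) as [G2 HG2].
  { intros y Hy. destruct (HD' y Hy) as [H1 H2]. do 3 eexists. split; [exact H2|exact H1]. }
  destruct (derivative_gain (fun y => (G1 y, G2 y)) f z0 r Hr) as [f1' Hf1'].
  - intros y Hy. apply complex_derive_D2. simpl. auto.
  - intros y Hy. eapply complex_derive_continuous. now apply HD.
  - assert (E : forall y, ballC z0 (r / 2) y -> f1 y = f1' y).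
    { intros y Hy. apply (complex_derive_unique f y); [apply HD; unfold ballC in *; lra|].
      now apply Hf1'. }
    destruct (derivative_gain f f1' z0 (r / 2)) as [f2 Hf2]; [lra| | |].
    + intros y Hy. now apply Hf1'.
    + intros y Hy. now apply Hf1'.
    + exists (f2 z0).
      assert (B : forall e, 0 < e -> ballC z0 e z0).
      { intros e He. unfold ballC. replace (z0 - z0)%C with (RtoC 0) by ring. now rewrite Cmod_0. }
      apply (complex_derive_ext_loc f1'); [|apply Hf2, B; lra].
      apply Cball_locally. exists (r / 2). split; [lra|]. intros y Hy. symmetry. now apply E.
Qed.

Lemma polar_Cmod s t : Cmod (polar s t) = Rabs s.
Proof.
  rewrite <- (circ_pt_dist 0%C s t). f_equal. apply injective_projections; simpl; ring.
Qed.

Lemma jcont_polar f y t : continuous f (polar (fst y) t) ->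
  jcont (fun y t => f (polar (fst y) t)) y t.
Proof.
  intros Hf.
  apply (jcont_comp f (fun y t => fst y * cos t) (fun y t => fst y * sin t)); [| |exact Hf].
  - apply jcont_mult; [apply jcont_z, continuous_fst|apply jcont_t, continuous_cos_R].
  - apply jcont_mult; [apply jcont_z, continuous_fst|apply jcont_t, continuous_sin_R].
Qed.

Definition polar_form (P Q : C -> R) (s t : R) : R :=
  s * (Q (polar s t) * cos t - P (polar s t) * sin t).

(** * Green's formula on the unit disc *)

(** The integral over the circle of radius [s] vanishes for [s = 0], and its
    derivative in [s] is [s] times the integral of [Qu - Pv], after an integration by
    parts in the angle. *)
Theorem green_disc (P Q Pu Pv Qu Qv : C -> R) (r : R) : 1 < r ->
  (forall y, disc r y -> D2 P y (Pu y) (Pv y) /\ D2 Q y (Qu y) (Qv y)) ->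
  cont_on (disc r) Pu -> cont_on (disc r) Pv -> cont_on (disc r) Qu -> cont_on (disc r) Qv ->
  is_RInt (fun s => s * RInt (fun t => Qu (polar s t) - Pv (polar s t)) 0 (2 * PI)) 0 1
    (RInt (polar_form P Q 1) 0 (2 * PI)).
Proof.
  intros Hr HD HPu HPv HQu HQv. assert (HPI := PI_RGT_0).
  assert (Hin : forall s t, Rabs s < r -> disc r (polar s t)).
  { intros s t Hs. unfold disc. now rewrite polar_Cmod. }
  assert (HP : cont_on (disc r) P) by (intros y Hy; destruct (HD y Hy); eapply D2_continuous; eauto).
  assert (HQ : cont_on (disc r) Q) by (intros y Hy; destruct (HD y Hy); eapply D2_continuous; eauto).
  set (K := fun s => RInt (polar_form P Q s) 0 (2 * PI)).
  set (B := fun s => RInt (fun t => Qu (polar s t) - Pv (polar s t)) 0 (2 * PI)).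
  set (A := fun (y : C) t => (Qu (polar (fst y) t) * cos t + Qv (polar (fst y) t) * sin t) * (fst y * cos t)
     - (Pu (polar (fst y) t) * cos t + Pv (polar (fst y) t) * sin t) * (fst y * sin t)
     + (Q (polar (fst y) t) * cos t - P (polar (fst y) t) * sin t)).
  assert (Hder : forall f fu fv s t, Rabs s < r -> D2 f (polar s t) (fu (polar s t)) (fv (polar s t)) ->
     is_derive (fun t => f (polar s t)) t (s * (- fu (polar s t) * sin t + fv (polar s t) * cos t)) /\
     is_derive (fun s => f (polar s t)) s (fu (polar s t) * cos t + fv (polar s t) * sin t)).
  { intros f fu fv s t Hs H1. unfold polar in *.
    assert (X1 : is_derive (fun t => s * cos t) t (- s * sin t)) by (auto_derive; [easy|ring]).
    assert (X2 : is_derive (fun t => s * sin t) t (s * cos t)) by (auto_derive; [easy|ring]).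
    assert (X3 : is_derive (fun s => s * cos t) s (cos t)) by (auto_derive; [easy|ring]).
    assert (X4 : is_derive (fun s => s * sin t) s (sin t)) by (auto_derive; [easy|ring]).
    split.
    - eapply is_derive_eq; [exact (D2_curve f _ _ t _ _ _ _ H1 X1 X2)|ring].
    - exact (D2_curve f _ _ s _ _ _ _ H1 X3 X4). }
  assert (Hloc : forall s, Rabs s < r -> locally (s, 0) (fun y : C => Rabs (fst y) < r)).
  { intros s' Hs'. apply Cball_locally. exists (r - Rabs s'). split; [lra|]. intros y Hy.
    replace (fst y) with ((fst y - s') + s') by ring. eapply Rle_lt_trans; [apply Rabs_triang|].
    pose proof (Rabs_fst_le_Cmod (y - (s', 0))%C) as H. simpl in H.
    change (fst y + - s') with (fst y - s') in H. lra. }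
  assert (JP : forall f y t, cont_on (disc r) f -> Rabs (fst y) < r ->
     jcont (fun y t => f (polar (fst y) t)) y t).
  { intros f y t Hf Hy. apply jcont_polar, Hf, Hin, Hy. }
  assert (JA : forall y t, Rabs (fst y) < r -> jcont A y t).
  { intros y t Hy. unfold A.
    assert (Jc : jcont (fun _ t => cos t) y t) by apply jcont_t, continuous_cos_R.
    assert (Js : jcont (fun _ t => sin t) y t) by apply jcont_t, continuous_sin_R.
    assert (Jf : jcont (fun y _ => fst y) y t) by apply jcont_z, continuous_fst.
    apply (jcont_plus (fun y t => _ - _) (fun y t => _ - _)).
    - apply (jcont_minus (fun y t => _ * _) (fun y t => _ * _)); apply (jcont_mult (fun y t => _ + _) (fun y t => _ * _)).
      + apply (jcont_plus (fun y t => _ * _) (fun y t => _ * _)).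
        apply (jcont_mult (fun y t => Qu (polar (fst y) t)) (fun y t => cos t)); auto.
        apply (jcont_mult (fun y t => Qv (polar (fst y) t)) (fun y t => sin t)); auto.
      + apply (jcont_mult (fun y t => fst y) (fun y t => cos t)); auto.
      + apply (jcont_plus (fun y t => _ * _) (fun y t => _ * _)).
        apply (jcont_mult (fun y t => Pu (polar (fst y) t)) (fun y t => cos t)); auto.
        apply (jcont_mult (fun y t => Pv (polar (fst y) t)) (fun y t => sin t)); auto.
      + apply (jcont_mult (fun y t => fst y) (fun y t => sin t)); auto.
    - apply (jcont_minus (fun y t => _ * _) (fun y t => _ * _)).
      apply (jcont_mult (fun y t => Q (polar (fst y) t)) (fun y t => cos t)); auto.
      apply (jcont_mult (fun y t => P (polar (fst y) t)) (fun y t => sin t)); auto. }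
  assert (HK1 : forall s, Rabs s < r -> is_derive K s (RInt (A (s, 0)) 0 (2 * PI))).
  { intros s' Hs'.
    apply (is_derive_section K s' _ (RInt (fun _ => 0) 0 (2 * PI))).
    apply (D2_RInt_param (fun y => polar_form P Q (fst y)) A (fun _ _ => 0) (s', 0)); [lra|].
    generalize (Hloc s' Hs'). apply filter_imp. intros y Hy t _. split; [|split; [|split]].
    - destruct (HD _ (Hin (fst y) t Hy)) as [H1 H2].
      destruct (Hder P Pu Pv (fst y) t Hy H1) as [_ H3].
      destruct (Hder Q Qu Qv (fst y) t Hy H2) as [_ H4].
      unfold polar_form. eapply D2_eq.
      + apply D2_mult; [apply D2_fst|]. apply D2_minus; apply D2_mult.
        * exact (D2_comp1 (fun s => Q (polar s t)) (fun y => fst y) y _ _ _ H4 (D2_fst y)).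
        * apply (D2_const (cos t)).
        * exact (D2_comp1 (fun s => P (polar s t)) (fun y => fst y) y _ _ _ H3 (D2_fst y)).
        * apply (D2_const (sin t)).
      + unfold A. cbv beta. destruct y as [y1 y2]; simpl fst; req; ring.
      + cbv beta. ring.
    - apply (jcont_mult (fun y t => fst y) (fun y t => _ - _)); [apply jcont_z, continuous_fst|].
      apply (jcont_minus (fun y t => _ * _) (fun y t => _ * _)).
      + apply (jcont_mult (fun y t => Q (polar (fst y) t)) (fun y t => cos t)); auto.
        apply jcont_t, continuous_cos_R.
      + apply (jcont_mult (fun y t => P (polar (fst y) t)) (fun y t => sin t)); auto.
        apply jcont_t, continuous_sin_R.
    - now apply JA.
    - apply jcont_t, continuous_const. }
  assert (Hsec : forall f s t, cont_on (disc r) f -> Rabs s < r -> continuous (fun t => f (polar s t)) t).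
  { intros f s t Hf Hs. exact (jcont_section (fun y t => f (polar (fst y) t)) (s, 0) t (JP f (s, 0) t Hf Hs)). }
  assert (HK : forall s, Rabs s < r -> is_derive K s (s * B s)).
  { intros s Hs. eapply is_derive_eq; [exact (HK1 s Hs)|].
    assert (E1 : ex_RInt (A (s, 0)) 0 (2 * PI)) by (apply ex_RInt_section; [lra|]; intros t _; now apply JA).
    assert (E2 : ex_RInt (fun t => Qu (polar s t) - Pv (polar s t)) 0 (2 * PI)).
    { apply (ex_RInt_continuous (V := R_CompleteNormedModule)). intros t _.
      apply (continuous_minus (V := R_NormedModule)); now apply Hsec. }
    assert (Hw : is_RInt (fun t => A (s, 0) t - s * (Qu (polar s t) - Pv (polar s t))) 0 (2 * PI) 0).
    { set (w := fun t => P (polar s t) * cos t + Q (polar s t) * sin t).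
      replace 0 with (minus (w (2 * PI)) (w 0)) at 2.
      - apply (is_RInt_derive (V := R_CompleteNormedModule) w).
        + intros t _. destruct (HD _ (Hin s t Hs)) as [H1 H2].
          destruct (Hder P Pu Pv s t Hs H1) as [H3 _].
          destruct (Hder Q Qu Qv s t Hs H2) as [H4 _].
          eapply is_derive_eq.
          * apply (is_derive_plus (fun t => P (polar s t) * cos t) (fun t => Q (polar s t) * sin t)).
            -- apply (is_derive_mult (fun t => P (polar s t)) cos); [exact H3|apply is_derive_cos|apply Rmult_comm].
            -- apply (is_derive_mult (fun t => Q (polar s t)) sin); [exact H4|apply is_derive_sin|apply Rmult_comm].
          * unfold A, minus, plus, opp, mult; simpl fst; simpl.
            pose proof (sin2_cos2 t) as H. unfold Rsqr in H.
            assert (Hs2 : sin t * sin t = 1 - cos t * cos t) by lra. req.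
            match goal with |- ?x = ?y => cut (x - y = 0); [lra|] end.
            ring_simplify. replace (sin t ^ 2) with (1 - cos t * cos t) by (rewrite <- Hs2; ring). ring.
        + intros t _. apply (continuous_minus (V := R_NormedModule)).
          * apply jcont_section. now apply JA.
          * apply (continuous_mult (K := R_AbsRing)); [apply continuous_const|].
            apply (continuous_minus (V := R_NormedModule)); now apply Hsec.
      - unfold w, polar, minus, plus, opp; simpl. rewrite sin_2PI, cos_2PI, sin_0, cos_0. ring. }
    apply (is_RInt_unique (V := R_CompleteNormedModule)) in Hw. rewrite RInt_minus_R in Hw; auto.
    - rewrite RInt_scal_R in Hw by auto. unfold B. lra.
    - now apply (ex_RInt_scal (V := R_NormedModule)). }
  assert (HB : forall s, Rabs s < r -> continuous B s).
  { intros s Hs.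
    apply (continuous_comp (fun x : R => (x, 0) : C) (fun y => B (fst y))).
    - apply continuous_pair; [apply continuous_id|apply continuous_const].
    - apply (continuous_RInt_param (fun y t => Qu (polar (fst y) t) - Pv (polar (fst y) t))); [lra|].
      generalize (Hloc s Hs). apply filter_imp. intros y Hy t _.
      apply (jcont_minus (fun y t => Qu (polar (fst y) t)) (fun y t => Pv (polar (fst y) t))); auto. }
  assert (HR : is_RInt (fun s => s * B s) 0 1 (K 1 - K 0)).
  { apply (is_RInt_derive (V := R_CompleteNormedModule) K); intros s Hs;
      rewrite Rmin_left, Rmax_right in Hs by lra;
      assert (Hsr : Rabs s < r) by (rewrite Rabs_pos_eq; lra).
    - now apply HK.
    - apply (continuous_mult (K := R_AbsRing)); [apply continuous_id|now apply HB]. }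
  assert (HK0 : K 0 = 0).
  { unfold K. rewrite (RInt_ext _ (fun _ => 0)).
    - rewrite RInt_const. unfold scal; simpl; unfold mult; simpl. req. ring.
    - intros t _. unfold polar_form. req. ring. }
  rewrite HK0, Rminus_0_r in HR. exact HR.
Qed.

(** * Killing fields and the form theta *)

(** Coefficients of [q(z) d/dz], the holomorphic vector fields of the sphere; they
    form the Lie algebra sl_2(C) of the isometries. *)
Definition quad : Type := (C * C * C)%type.
Definition qc0 (q : quad) : C := fst (fst q).
Definition qc1 (q : quad) : C := snd (fst q).
Definition qc2 (q : quad) : C := snd q.
Definition qeval (q : quad) (z : C) : C := (qc0 q + qc1 q * z + qc2 q * z ^ 2)%C.

(** The Killing field of hyperbolic space that extends the field [q(z) d/dz] of the
    asymptotic boundary. *)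
Definition killing (q : quad) (p : Pt) : Pt :=
  ((qeval q (fst p) - Cconj (qc2 q) * RtoC (pw p ^ 2))%C,
   pw p * Re (qc1 q + 2 * qc2 q * fst p)%C).

(** A 1-form in [v], depending on the point [p], such that [d sigma] is twice the
    contraction of the volume form with [killing q]; it exists because Killing fields
    are divergence free. *)
Definition sigma (q : quad) (p v : Pt) : R :=
  Im (Cconj (qc0 q) * fst v + Cconj (qc1 q) * (Cconj (fst p) * fst v + RtoC (pw p * pw v))
      + Cconj (qc2 q) * (Cconj (fst p) ^ 2 * fst v + RtoC (2 * pw p * pw v) * Cconj (fst p)
                         - RtoC (pw p ^ 2) * Cconj (fst v)))%C / pw p ^ 2.

(** Components of the 1-form [v |-> <dX(- i v), Y> - sigma(dX v)] with
    [Y = killing q]: its integral along a generator will be the flux. *)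
Definition thetaU (q : quad) (X : C -> Pt) (z : C) : R :=
  - hip (X z) (dv_Pt X z) (killing q (X z)) - sigma q (X z) (du_Pt X z).
Definition thetaV (q : quad) (X : C -> Pt) (z : C) : R :=
  hip (X z) (du_Pt X z) (killing q (X z)) - sigma q (X z) (dv_Pt X z).

Ltac d2 :=
  lazymatch goal with
  | |- D2 (fun _ => ?c) _ _ _ => apply (D2_const c)
  | |- D2 (fun t => @?f t + @?g t) _ _ _ => apply (D2_plus f g); d2
  | |- D2 (fun t => @?f t - @?g t) _ _ _ => apply (D2_minus f g); d2
  | |- D2 (fun t => @?f t * @?g t) _ _ _ => apply (D2_mult f g); d2
  | |- D2 (fun t => - @?f t) _ _ _ => apply (D2_opp f); d2
  | |- D2 (fun t => ?f t) _ _ _ => change (fun t => f t) with f; eassumption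
  | _ => eassumption
  end.

(** The equation of conformal immersions of mean curvature one: the Laplacian of
    the coordinates, corrected by the Christoffel symbols of the metric, is
    [2 / w] times the cross product of the two tangent vectors. *)
Definition cmc_one_at (X : C -> Pt) (z : C) : Prop :=
  let x f := du (fun z => du (fun z => f (X z)) z) z + dv (fun z => dv (fun z => f (X z)) z) z in
  let p := X z in let a := du_Pt X z in let b := dv_Pt X z in
  let c := ecross a b in
  x px = 2 / pw p * (pw a * px a + pw b * px b + px c) /\
  x py = 2 / pw p * (pw a * py a + pw b * py b + py c) /\
  x pw = 2 / pw p * (pw a * pw a + pw b * pw b + pw c) - (edot a a + edot b b) / pw p.

(** The classical conservation law: for a Killing field [Y] the first term has
    differential [<tension, Y>], which for mean curvature one is twice the volume form
    evaluated on the tangent plane and [Y], that is the differential of the second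
    term. In coordinates it is a polynomial identity once [cmc_one_at] eliminates the
    second derivatives in the first variable. *)
Lemma theta_closed (U : C -> Prop) (X : C -> Pt) (q : quad) :
  open U -> class_C_Pt 2 U X -> (forall z, U z -> H3 (X z)) ->
  (forall z, U z -> cmc_one_at X z) ->
  closed_form U (thetaU q X) (thetaV q X).
Proof.
  intros HU [Hx [Hy Hw]] HH HT z Hz.
  specialize (HH z Hz). specialize (HT z Hz). unfold H3 in HH.
  set (x := fun z => px (X z)) in *. set (y := fun z => py (X z)) in *.
  set (w := fun z => pw (X z)) in *.
  assert (Dx := class_C_D2 U x z HU (class_C_le' 1 2 U x ltac:(lia) Hx) Hz).
  assert (Dy := class_C_D2 U y z HU (class_C_le' 1 2 U y ltac:(lia) Hy) Hz).
  assert (Dw := class_C_D2 U w z HU (class_C_le' 1 2 U w ltac:(lia) Hw) Hz).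
  assert (Dxu := class_C_D2 U (du x) z HU (proj1 (proj2 (proj2 Hx))) Hz).
  assert (Dyu := class_C_D2 U (du y) z HU (proj1 (proj2 (proj2 Hy))) Hz).
  assert (Dwu := class_C_D2 U (du w) z HU (proj1 (proj2 (proj2 Hw))) Hz).
  assert (Dxv := class_C_D2 U (dv x) z HU (proj2 (proj2 (proj2 Hx))) Hz).
  assert (Dyv := class_C_D2 U (dv y) z HU (proj2 (proj2 (proj2 Hy))) Hz).
  assert (Dwv := class_C_D2 U (dv w) z HU (proj2 (proj2 (proj2 Hw))) Hz).
  rewrite (class_C_mixed U x z HU Hx Hz) in Dxv. rewrite (class_C_mixed U y z HU Hy Hz) in Dyv.
  rewrite (class_C_mixed U w z HU Hw Hz) in Dwv.
  assert (Hw0 : w z <> 0) by (unfold w; lra).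
  unfold cmc_one_at in HT. cbv zeta in HT.
  change (fun z => px (X z)) with x in HT. change (fun z => py (X z)) with y in HT.
  change (fun z => pw (X z)) with w in HT.
  change (fun z => du x z) with (du x) in HT. change (fun z => dv x z) with (dv x) in HT.
  change (fun z => du y z) with (du y) in HT. change (fun z => dv y z) with (dv y) in HT.
  change (fun z => du w z) with (du w) in HT. change (fun z => dv w z) with (dv w) in HT.
  destruct q as [[[a0 b0] [a1 b1]] [a2 b2]].
  set (K1 := fun z => a0 + (a1 * x z - b1 * y z) + a2 * (x z * x z - y z * y z) - 2 * b2 * (x z * y z) - a2 * (w z * w z)).
  set (K2 := fun z => b0 + (a1 * y z + b1 * x z) + 2 * a2 * (x z * y z) + b2 * (x z * x z - y z * y z) + b2 * (w z * w z)).
  set (K3 := fun z => w z * (a1 + 2 * (a2 * x z - b2 * y z))).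
  set (S := fun (f g h : C -> R) z => a0 * g z - b0 * f z + a1 * (x z * g z - y z * f z)
    - b1 * (x z * f z + y z * g z + w z * h z)
    + a2 * ((x z * x z - y z * y z) * g z - 2 * (x z * y z * f z) - 2 * (w z * (y z * h z)) + w z * w z * g z)
    - b2 * ((x z * x z - y z * y z) * f z + 2 * (x z * y z * g z) + 2 * (w z * (x z * h z)) - w z * w z * f z)).
  assert (EP : forall z, (- (dv x z * K1 z + dv y z * K2 z + dv w z * K3 z) - S (du x) (du y) (du w) z) / (w z * w z) =
     thetaU (a0, b0, (a1, b1), (a2, b2)) X z).
  { intros t. unfold thetaU, hip, edot, killing, sigma, qeval, du_Pt, dv_Pt, K1, K2, K3, S, qc0, qc1, qc2, x, y, w, Rdiv.
    unfold px, py, pw, Im, Re. simpl. rewrite !Rmult_1_r. ring. }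
  assert (EQ : forall z, (du x z * K1 z + du y z * K2 z + du w z * K3 z - S (dv x) (dv y) (dv w) z) / (w z * w z) =
     thetaV (a0, b0, (a1, b1), (a2, b2)) X z).
  { intros t. unfold thetaV, hip, edot, killing, sigma, qeval, du_Pt, dv_Pt, K1, K2, K3, S, qc0, qc1, qc2, x, y, w, Rdiv.
    unfold px, py, pw, Im, Re. simpl. rewrite !Rmult_1_r. ring. }
  assert (DP : exists p r, D2 (thetaU (a0, b0, (a1, b1), (a2, b2)) X) z p r /\ exists p' r',
     D2 (thetaV (a0, b0, (a1, b1), (a2, b2)) X) z p' r' /\ p' = r).
  { do 2 eexists. split.
    - apply (D2_ext _ _ _ _ _ EP). apply D2_div; [| |now apply Rmult_integral_contrapositive_currified];
        unfold S, K1, K2, K3; d2.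
    - do 2 eexists. split.
      + apply (D2_ext _ _ _ _ _ EQ). apply D2_div; [| |now apply Rmult_integral_contrapositive_currified];
        unfold S, K1, K2, K3; d2.
      + destruct HT as [T1 [T2 T3]].
        change (pw (X z)) with (w z) in T1, T2, T3.
        unfold ecross, edot, du_Pt, dv_Pt in T1, T2, T3.
        change (fun z => px (X z)) with x in T1, T2, T3.
        change (fun z => py (X z)) with y in T1, T2, T3.
        change (fun z => pw (X z)) with w in T1, T2, T3.
        unfold px, py, pw in T1, T2, T3. simpl in T1, T2, T3.
        apply (Rplus_eq_compat_l (- dv (dv x) z)) in T1.
        apply (Rplus_eq_compat_l (- dv (dv y) z)) in T2.
        apply (Rplus_eq_compat_l (- dv (dv w) z)) in T3.
        replace (- dv (dv x) z + (du (du x) z + dv (dv x) z)) with (du (du x) z) in T1 by ring.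
        replace (- dv (dv y) z + (du (du y) z + dv (dv y) z)) with (du (du y) z) in T2 by ring.
        replace (- dv (dv w) z + (du (du w) z + dv (dv w) z)) with (du (du w) z) in T3 by ring.
        unfold S, K1, K2, K3. cbv beta. rewrite T1, T2, T3. field. exact Hw0. }
  destruct DP as [p [r [DP [p' [r' [DQ E]]]]]]. exists p, r, r'. rewrite E in DQ. now split.
Qed.

(** * Conformal immersions of mean curvature one *)

Lemma Pt_eq (a b : Pt) : px a = px b -> py a = py b -> pw a = pw b -> a = b.
Proof. destruct a as [[? ?] ?], b as [[? ?] ?]. unfold px, py, pw. simpl. now intros -> -> ->. Qed.

Lemma orthogonal_frame_zero (a b d : Pt) :
  let c := ecross a b in
  edot d a = 0 -> edot d b = 0 -> edot d c = 0 -> 0 < edot c c -> px d = 0 /\ py d = 0 /\ pw d = 0.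
Proof.
  intros c Ha Hb Hc Hcc.
  assert (H1 : px d * edot c c = edot d a * px (ecross b c) + edot d b * px (ecross c a) + edot d c * px c)
    by (unfold c, edot, ecross, px, py, pw; simpl; ring).
  assert (H2 : py d * edot c c = edot d a * py (ecross b c) + edot d b * py (ecross c a) + edot d c * py c)
    by (unfold c, edot, ecross, px, py, pw; simpl; ring).
  assert (H3 : pw d * edot c c = edot d a * pw (ecross b c) + edot d b * pw (ecross c a) + edot d c * pw c)
    by (unfold c, edot, ecross, px, py, pw; simpl; ring).
  rewrite Ha, Hb, Hc in *.
  split; [|split]; apply (Rmult_eq_reg_r (edot c c)); lra.
Qed.

(** Lagrange's identity. *)
Lemma conformal_cross (a b : Pt) E : edot a a = E -> edot b b = E -> edot a b = 0 ->
  edot (ecross a b) (ecross a b) = E * E.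
Proof.
  intros Ha Hb Hab.
  replace (edot (ecross a b) (ecross a b)) with (edot a a * edot b b - edot a b * edot a b)
    by (unfold edot, ecross, px, py, pw; simpl; ring).
  rewrite Ha, Hb, Hab. ring.
Qed.

(** In a conformal parametrization the tension field is orthogonal to the
    surface, so it is determined by its scalar product with the normal. *)
Lemma tension_algebra (p a b Auu Avv : Pt) E :
  0 < pw p -> 0 < E -> edot a a = E -> edot b b = E -> edot a b = 0 ->
  edot (vadd Auu Avv) a = 0 -> edot (vadd Auu Avv) b = 0 ->
  edot (vadd (cov_deriv p a a Auu) (cov_deriv p b b Avv)) (ecross a b) = 2 * (E * E) / pw p ->
  let c := ecross a b in
  px Auu + px Avv = 2 / pw p * (pw a * px a + pw b * px b + px c) /\
  py Auu + py Avv = 2 / pw p * (pw a * py a + pw b * py b + py c) /\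
  pw Auu + pw Avv = 2 / pw p * (pw a * pw a + pw b * pw b + pw c) - (edot a a + edot b b) / pw p.
Proof.
  intros Hp HE Ha Hb Hab Sa Sb HN c.
  assert (Hcc := conformal_cross a b E Ha Hb Hab).
  set (D := vadd (vadd (cov_deriv p a a Auu) (cov_deriv p b b Avv)) (vscal (- (2 / pw p)) c)).
  assert (Hca : edot c a = 0) by (unfold c, edot, ecross, px, py, pw; simpl; ring).
  assert (Hcb : edot c b = 0) by (unfold c, edot, ecross, px, py, pw; simpl; ring).
  assert (Da : edot D a = 0).
  { transitivity (edot (vadd Auu Avv) a - 2 / pw p * (pw a * edot a a + pw b * edot a b)
       + (edot a a + edot b b) / pw p * pw a - 2 / pw p * edot c a).
    - unfold D, cov_deriv, vadd, vscal, edot. generalize c. intros c'. unfold px, py, pw. simpl. field. unfold pw in Hp. lra.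
    - rewrite Sa, Ha, Hb, Hab, Hca. field. lra. }
  assert (Db : edot D b = 0).
  { transitivity (edot (vadd Auu Avv) b - 2 / pw p * (pw a * edot a b + pw b * edot b b)
       + (edot a a + edot b b) / pw p * pw b - 2 / pw p * edot c b).
    - unfold D, cov_deriv, vadd, vscal, edot. generalize c. intros c'. unfold px, py, pw. simpl. field. unfold pw in Hp. lra.
    - rewrite Sb, Ha, Hb, Hab, Hcb. field. lra. }
  assert (Dc : edot D c = 0).
  { transitivity (edot (vadd (cov_deriv p a a Auu) (cov_deriv p b b Avv)) c - 2 / pw p * edot c c).
    - unfold D. generalize (vadd (cov_deriv p a a Auu) (cov_deriv p b b Avv)) c. intros d' c'.
      unfold vadd, vscal, edot, px, py, pw. simpl. field. unfold pw in Hp. lra.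
    - unfold c. rewrite HN, Hcc. field. lra. }
  destruct (orthogonal_frame_zero a b D Da Db Dc) as [H1 [H2 H3]].
  { rewrite Hcc. nra. }
  assert (G1 : px D = px Auu + px Avv - 2 / pw p * (pw a * px a + pw b * px b + px c)).
  { unfold D, cov_deriv, vadd, vscal, edot. generalize c. intros c'. unfold px, py, pw. simpl. field. unfold pw in Hp. lra. }
  assert (G2 : py D = py Auu + py Avv - 2 / pw p * (pw a * py a + pw b * py b + py c)).
  { unfold D, cov_deriv, vadd, vscal, edot. generalize c. intros c'. unfold px, py, pw. simpl. field. unfold pw in Hp. lra. }
  assert (G3 : pw D = pw Auu + pw Avv - (2 / pw p * (pw a * pw a + pw b * pw b + pw c) - (edot a a + edot b b) / pw p)).
  { unfold D, cov_deriv, vadd, vscal, edot. generalize c. intros c'. unfold px, py, pw. simpl. field. unfold pw in Hp. lra. }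
  lra.
Qed.

Lemma edot_vscal_l k a b : edot (vscal k a) b = k * edot a b.
Proof. unfold edot, vscal, px, py, pw; simpl; ring. Qed.
Lemma edot_vscal_r k a b : edot a (vscal k b) = k * edot a b.
Proof. unfold edot, vscal, px, py, pw; simpl; ring. Qed.
Lemma edot_vadd_l a b c : edot (vadd a b) c = edot a c + edot b c.
Proof. unfold edot, vadd, px, py, pw; simpl; ring. Qed.
Lemma edot_vadd_r a b c : edot a (vadd b c) = edot a b + edot a c.
Proof. unfold edot, vadd, px, py, pw; simpl; ring. Qed.
Lemma edot_sym a b : edot a b = edot b a.
Proof. unfold edot; ring. Qed.

Lemma vscal_normal_hnorm p k c : 0 < pw p -> 0 < edot c c ->
  hnorm p (vscal k (vscal (pw p / sqrt (edot c c)) c)) = Rabs k.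
Proof.
  intros Hp Hc. unfold hnorm, hip.
  assert (Hs : sqrt (edot c c) * sqrt (edot c c) = edot c c) by (apply sqrt_sqrt; lra).
  assert (Hs0 : 0 < sqrt (edot c c)) by now apply sqrt_lt_R0.
  rewrite <- sqrt_Rsqr_abs. f_equal.
  rewrite !edot_vscal_l, !edot_vscal_r. rewrite <- Hs at 3. unfold Rsqr. field. lra.
Qed.

Definition conf (X : C -> Pt) (z : C) : R := edot (du_Pt X z) (du_Pt X z).

Lemma bryant_conformal Omega X z : bryant_end Omega X -> punctured Omega z ->
  0 < pw (X z) /\ 0 < conf X z /\ edot (dv_Pt X z) (dv_Pt X z) = conf X z /\
  edot (du_Pt X z) (dv_Pt X z) = 0.
Proof.
  intros [_ [_ [_ H]]] Hz. destruct (H z Hz) as [Hw [H1 [H2 [H5 _]]]]. unfold H3 in Hw.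
  unfold I_uu, I_vv, I_uv, hip in *. unfold conf.
  assert (Hp : 0 < pw (X z) ^ 2) by (apply pow_lt; exact Hw).
  split; [exact Hw|]. split; [|split].
  - apply (Rmult_lt_reg_r (/ pw (X z) ^ 2)); [now apply Rinv_0_lt_compat|]. rewrite Rmult_0_l. exact H1.
  - apply (Rmult_eq_reg_r (/ pw (X z) ^ 2)); [exact H2|]. apply Rinv_neq_0_compat. lra.
  - apply (Rmult_eq_reg_r (/ pw (X z) ^ 2)); [rewrite Rmult_0_l; exact H5|]. apply Rinv_neq_0_compat. lra.
Qed.

(** The mean curvature vector is a unit multiple of the normal, and the orientation
    of the frame that it completes selects the sign. *)
Lemma bryant_mean_curvature Omega X z : bryant_end Omega X -> punctured Omega z ->
  mean_curvature_vector X z = normal X z /\ II_uu X z + II_vv X z = 2 * I_uu X z.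
Proof.
  intros HB Hz. destruct (bryant_conformal Omega X z HB Hz) as [Hw [HE [Hb Hab]]].
  destruct HB as [_ [_ [_ H]]]. destruct (H z Hz) as [_ [H1 [H2 [H3 [H4 H5]]]]].
  unfold mean_curvature_vector in *.
  set (k := (I_vv X z * II_uu X z - 2 * I_uv X z * II_uv X z + I_uu X z * II_vv X z)
         / (2 * (I_uu X z * I_vv X z - I_uv X z ^ 2))) in *.
  assert (Hcc := conformal_cross _ _ (conf X z) eq_refl Hb Hab).
  assert (Hc0 : 0 < edot (ecross (du_Pt X z) (dv_Pt X z)) (ecross (du_Pt X z) (dv_Pt X z))) by (rewrite Hcc; nra).
  unfold normal, unit_normal in *.
  rewrite vscal_normal_hnorm in H4 by auto.
  assert (Hk : 0 < k).
  { unfold det3 in H5. set (c := ecross (du_Pt X z) (dv_Pt X z)) in *.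
    rewrite !edot_vscal_r in H5.
    assert (0 < pw (X z) / sqrt (edot c c) * edot c c).
    { apply Rmult_lt_0_compat; [apply Rdiv_lt_0_compat; [lra|now apply sqrt_lt_R0]|exact Hc0]. }
    nra. }
  rewrite Rabs_pos_eq in H4 by lra. rewrite H4. split.
  - unfold vscal, px, py, pw. simpl. rewrite !Rmult_1_l. reflexivity.
  - unfold k in H4. rewrite H2, H3 in H4.
    apply (Rmult_eq_compat_r (2 * I_uu X z)) in H4.
    replace ((I_uu X z * II_uu X z - 2 * 0 * II_uv X z + I_uu X z * II_vv X z) /
     (2 * (I_uu X z * I_uu X z - 0 ^ 2)) * (2 * I_uu X z)) with (II_uu X z + II_vv X z) in H4 by (field; lra).
    lra.
Qed.

Lemma punctured_open Omega : open Omega -> open (punctured Omega).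
Proof.
  intros HO z [Hz H0]. apply filter_and; [now apply HO|].
  apply Cball_locally. exists (Cmod z). split; [now apply Cmod_gt_0|]. intros y Hy ->.
  replace (0 - z)%C with (- z)%C in Hy by ring. rewrite Cmod_opp in Hy. lra.
Qed.

Lemma D2_locally_zero f z a b : locally z (fun y => f y = 0) -> D2 f z a b -> a = 0 /\ b = 0.
Proof.
  intros H HD. apply (D2_unique (fun _ => 0) z).
  - revert HD. apply D2_ext_loc. exact H.
  - apply D2_const.
Qed.

(** Differentiating the conformality relations shows that the tension field is
    normal to the surface; the mean curvature gives its normal component. *)
Lemma bryant_cmc_one Omega X z : bryant_end Omega X -> punctured Omega z -> cmc_one_at X z.
Proof.
  intros HB Hz. destruct (bryant_conformal Omega X z HB Hz) as [Hw [HE [Hb Hab]]].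
  destruct (bryant_mean_curvature Omega X z HB Hz) as [_ HII].
  assert (HU : open (punctured Omega)) by (apply punctured_open, HB).
  assert (HX : class_C_Pt 2 (punctured Omega) X) by apply HB.
  destruct HX as [Hx [Hy Hw']].
  set (U := punctured Omega) in *.
  set (x := fun z => px (X z)) in *. set (y := fun z => py (X z)) in *. set (w := fun z => pw (X z)) in *.
  assert (Dxu := class_C_D2 U (du x) z HU (proj1 (proj2 (proj2 Hx))) Hz).
  assert (Dyu := class_C_D2 U (du y) z HU (proj1 (proj2 (proj2 Hy))) Hz).
  assert (Dwu := class_C_D2 U (du w) z HU (proj1 (proj2 (proj2 Hw'))) Hz).
  assert (Dxv := class_C_D2 U (dv x) z HU (proj2 (proj2 (proj2 Hx))) Hz).
  assert (Dyv := class_C_D2 U (dv y) z HU (proj2 (proj2 (proj2 Hy))) Hz).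
  assert (Dwv := class_C_D2 U (dv w) z HU (proj2 (proj2 (proj2 Hw'))) Hz).
  rewrite (class_C_mixed U x z HU Hx Hz) in Dxv. rewrite (class_C_mixed U y z HU Hy Hz) in Dyv.
  rewrite (class_C_mixed U w z HU Hw' Hz) in Dwv.
  assert (F1 : locally z (fun t => (dv x t * dv x t + dv y t * dv y t + dv w t * dv w t) -
     (du x t * du x t + du y t * du y t + du w t * du w t) = 0)).
  { generalize (HU z Hz). apply filter_imp. intros t Ht.
    destruct (bryant_conformal Omega X t HB Ht) as [_ [_ [H _]]]. unfold conf, edot in H.
    apply Rminus_diag_eq. exact H. }
  assert (F2 : locally z (fun t => du x t * dv x t + du y t * dv y t + du w t * dv w t = 0)).
  { generalize (HU z Hz). apply filter_imp. intros t Ht.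
    destruct (bryant_conformal Omega X t HB Ht) as [_ [_ [_ H]]]. exact H. }
  assert (G1 : exists a b, D2 (fun t => (dv x t * dv x t + dv y t * dv y t + dv w t * dv w t) -
     (du x t * du x t + du y t * du y t + du w t * du w t)) z a b /\
     a / 2 = (dv x z * dv (du x) z + dv y z * dv (du y) z + dv w z * dv (du w) z)
        - (du x z * du (du x) z + du y z * du (du y) z + du w z * du (du w) z) /\
     b / 2 = (dv x z * dv (dv x) z + dv y z * dv (dv y) z + dv w z * dv (dv w) z)
        - (du x z * dv (du x) z + du y z * dv (du y) z + du w z * dv (du w) z)).
  { do 2 eexists. split; [d2|]. split; field. }
  assert (G2 : exists a b, D2 (fun t => du x t * dv x t + du y t * dv y t + du w t * dv w t) z a b /\
     a = (dv x z * du (du x) z + dv y z * du (du y) z + dv w z * du (du w) z)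
        + (du x z * dv (du x) z + du y z * dv (du y) z + du w z * dv (du w) z) /\
     b = (dv x z * dv (du x) z + dv y z * dv (du y) z + dv w z * dv (du w) z)
        + (du x z * dv (dv x) z + du y z * dv (dv y) z + du w z * dv (dv w) z)).
  { do 2 eexists. split; [d2|]. split; ring. }
  destruct G1 as [a1 [b1 [G1 [Ea1 Eb1]]]]. destruct G2 as [a2 [b2 [G2 [Ea2 Eb2]]]].
  destruct (D2_locally_zero _ _ _ _ F1 G1) as [-> ->]. destruct (D2_locally_zero _ _ _ _ F2 G2) as [-> ->].
  unfold cmc_one_at. cbv zeta.
  refine (tension_algebra (X z) (du_Pt X z) (dv_Pt X z) (du_Pt (du_Pt X) z) (dv_Pt (dv_Pt X) z) (conf X z)
    Hw HE eq_refl Hb Hab _ _ _).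
  - change (edot (vadd (du_Pt (du_Pt X) z) (dv_Pt (dv_Pt X) z)) (du_Pt X z)) with
      ((du (du x) z + dv (dv x) z) * du x z + (du (du y) z + dv (dv y) z) * du y z
       + (du (du w) z + dv (dv w) z) * du w z). lra.
  - change (edot (vadd (du_Pt (du_Pt X) z) (dv_Pt (dv_Pt X) z)) (dv_Pt X z)) with
      ((du (du x) z + dv (dv x) z) * dv x z + (du (du y) z + dv (dv y) z) * dv y z
       + (du (du w) z + dv (dv w) z) * dv w z). lra.
  - unfold II_uu, II_vv, I_uu, normal, unit_normal, hip in HII. fold (conf X z) in HII.
    rewrite (conformal_cross _ _ (conf X z) eq_refl Hb Hab) in HII.
    rewrite sqrt_square in HII by lra.
    set (c := ecross (du_Pt X z) (dv_Pt X z)) in *.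
    set (d1 := cov_deriv (X z) (du_Pt X z) (du_Pt X z) (du_Pt (du_Pt X) z)) in *.
    set (d2 := cov_deriv (X z) (dv_Pt X z) (dv_Pt X z) (dv_Pt (dv_Pt X) z)) in *.
    rewrite !edot_vscal_r in HII. rewrite edot_vadd_l.
    apply (Rmult_eq_compat_r (conf X z * pw (X z))) in HII.
    match type of HII with ?l = ?r => replace l with (edot d1 c + edot d2 c) in HII by (field; lra);
      replace r with (2 * (conf X z * conf X z) / pw (X z)) in HII by (field; lra) end.
    exact HII.
Qed.

(** * Algebra of functions of class C^k *)

Lemma du_ext_loc f g z : locally z (fun y => f y = g y) -> du f z = du g z /\ dv f z = dv g z.
Proof.
  intros H. apply (locally_2d_C' (fun y => f y = g y)) in H. destruct z as [x y]. unfold du, dv. simpl in *.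
  split; apply Derive_ext_loc.
  - exact (locally_2d_1d_const_y _ _ _ H).
  - exact (locally_2d_1d_const_x _ _ _ H).
Qed.

Lemma class_C_ext k U f g : open U -> (forall z, U z -> f z = g z) -> class_C k U f -> class_C k U g.
Proof.
  revert f g. induction k; intros f g HU Hfg [Hc Hd].
  - split; auto. intros z Hz.
    apply (continuous_ext_loc g f z); [|now apply Hc]. generalize (HU z Hz). apply filter_imp. auto.
  - split.
    + intros z Hz. apply (continuous_ext_loc g f z); [|now apply Hc].
      generalize (HU z Hz). apply filter_imp. auto.
    + destruct Hd as [H1 [H2 H3]].
      assert (Hloc : forall z, U z -> locally z (fun y => f y = g y)).
      { intros z Hz. generalize (HU z Hz). apply filter_imp. auto. }
      split; [|split].
      * intros z Hz. destruct (H1 z Hz) as [E1 E2]. pose proof (Hloc z Hz) as HL.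
        apply (locally_2d_C' (fun y => f y = g y)) in HL. destruct z as [x y]. simpl in *.
        split; eapply ex_derive_ext_loc; try eassumption.
        exact (locally_2d_1d_const_y _ _ _ HL). exact (locally_2d_1d_const_x _ _ _ HL).
      * apply (IHk (du f)); auto. intros z Hz. now apply du_ext_loc, Hloc.
      * apply (IHk (dv f)); auto. intros z Hz. now apply du_ext_loc, Hloc.
Qed.

(** It suffices to exhibit the differential. *)
Lemma class_C_S k U f a b : open U -> (forall z, U z -> D2 f z (a z) (b z)) ->
  class_C k U a -> class_C k U b -> class_C (S k) U f.
Proof.
  intros HU HD Ha Hb.
  split; [intros z Hz; eapply D2_continuous; eauto|]. split; [|split].
  - intros z Hz. specialize (HD z Hz). destruct z as [x y]. unfold D2 in HD. simpl in *.
    split; eexists.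
    + apply (D2_curve f (fun x => x) (fun _ => y) x (a (x, y)) (b (x, y)) 1 0 HD).
      apply (is_derive_id (K := R_AbsRing)). apply (is_derive_const (K := R_AbsRing) (V := R_NormedModule)).
    + apply (D2_curve f (fun _ => x) (fun y => y) y (a (x, y)) (b (x, y)) 0 1 HD).
      apply (is_derive_const (K := R_AbsRing) (V := R_NormedModule)). apply (is_derive_id (K := R_AbsRing)).
  - apply (class_C_ext k U a); auto. intros z Hz. symmetry. now apply (D2_partials f z _ (b z)), HD.
  - apply (class_C_ext k U b); auto. intros z Hz. symmetry. now apply (D2_partials f z (a z)), HD.
Qed.

Lemma class_C_const k U c : class_C k U (fun _ => c).
Proof.
  revert c. induction k; intros c; split; try (intros; apply continuous_const); auto.
  split; [|split].
  - intros; split; apply ex_derive_const.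
  - replace (du (fun _ => c)) with (fun _ : C => 0); auto.
    apply FunctionalExtensionality.functional_extensionality. intros z. symmetry. unfold du, dv. apply Derive_const.
  - replace (dv (fun _ => c)) with (fun _ : C => 0); auto.
    apply FunctionalExtensionality.functional_extensionality. intros z. symmetry. unfold du, dv. apply Derive_const.
Qed.

Lemma class_C_plus k U f g : open U -> class_C k U f -> class_C k U g -> class_C k U (fun z => f z + g z).
Proof.
  intros HU. revert f g. induction k; intros f g Hf Hg.
  - split; auto. intros z Hz. apply (continuous_plus (V := R_NormedModule)); [now apply Hf|now apply Hg].
  - apply (class_C_S k U _ (fun z => du f z + du g z) (fun z => dv f z + dv g z) HU).
    + intros z Hz. apply D2_plus; apply (class_C_D2 U); auto; eapply class_C_le'; try eassumption; lia.
    + apply IHk; [apply Hf|apply Hg].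
    + apply IHk; [apply Hf|apply Hg].
Qed.

Lemma class_C_mult k U f g : open U -> class_C k U f -> class_C k U g -> class_C k U (fun z => f z * g z).
Proof.
  intros HU. revert f g. induction k; intros f g Hf Hg.
  - split; auto. intros z Hz. apply (continuous_mult (K := R_AbsRing)); [now apply Hf|now apply Hg].
  - apply (class_C_S k U _ (fun z => du f z * g z + f z * du g z) (fun z => dv f z * g z + f z * dv g z) HU).
    + intros z Hz. apply D2_mult; apply (class_C_D2 U); auto; eapply class_C_le'; try eassumption; lia.
    + apply class_C_plus; auto; apply IHk; try apply Hf; try apply Hg; now apply class_C_le.
    + apply class_C_plus; auto; apply IHk; try apply Hf; try apply Hg; now apply class_C_le.
Qed.

Lemma class_C_opp k U f : open U -> class_C k U f -> class_C k U (fun z => - f z).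
Proof.
  intros HU Hf. apply (class_C_ext k U (fun z => -1 * f z)); auto; [intros; ring|].
  apply class_C_mult; auto. apply class_C_const.
Qed.

Lemma class_C_minus k U f g : open U -> class_C k U f -> class_C k U g -> class_C k U (fun z => f z - g z).
Proof. intros HU Hf Hg. apply class_C_plus; auto. now apply class_C_opp. Qed.

Lemma class_C_inv k U f : open U -> (forall z, U z -> f z <> 0) -> class_C k U f -> class_C k U (fun z => / f z).
Proof.
  intros HU H0. revert f H0. induction k; intros f H0 Hf.
  - split; auto. intros z Hz. apply (continuous_comp f Rinv); [now apply Hf|].
    apply (ex_derive_continuous Rinv). auto_derive. now apply H0.
  - assert (H1 : class_C k U (fun z => / f z * / f z)).
    { apply class_C_mult; auto; apply IHk; auto; now apply class_C_le. }
    apply (class_C_S k U _ (fun z => - du f z * (/ f z * / f z)) (fun z => - dv f z * (/ f z * / f z)) HU).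
    + intros z Hz. eapply D2_eq.
      * apply D2_inv; [|now apply H0].
        apply (class_C_D2 U); auto; eapply class_C_le'; try eassumption; lia.
      * field. now apply H0.
      * field. now apply H0.
    + apply class_C_mult; auto. apply class_C_opp; auto. apply Hf.
    + apply class_C_mult; auto. apply class_C_opp; auto. apply Hf.
Qed.

Ltac cC :=
  lazymatch goal with
  | |- class_C _ _ (fun _ => ?c) => apply class_C_const
  | |- class_C _ _ (fun t => @?f t + @?g t) => apply (class_C_plus _ _ f g); [assumption|cC|cC]
  | |- class_C _ _ (fun t => @?f t - @?g t) => apply (class_C_minus _ _ f g); [assumption|cC|cC]
  | |- class_C _ _ (fun t => @?f t * @?g t) => apply (class_C_mult _ _ f g); [assumption|cC|cC]
  | |- class_C _ _ (fun t => - @?f t) => apply (class_C_opp _ _ f); [assumption|cC]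
  | |- class_C _ _ (fun t => / @?f t) => apply (class_C_inv _ _ f); [assumption| |cC]
  | |- class_C _ _ (fun t => ?f t) => change (fun t => f t) with f; eassumption
  | _ => eassumption
  end.

(** * The flux as the integral of a closed form *)

Lemma sigma_linear q p a b s t :
  sigma q p (vadd (vscal s a) (vscal t b)) = s * sigma q p a + t * sigma q p b.
Proof.
  unfold sigma, Rdiv. destruct q as [[[? ?] [? ?]] [? ?]], p as [[? ?] ?], a as [[? ?] ?], b as [[? ?] ?].
  unfold vadd, vscal, px, py, pw, qc0, qc1, qc2, Im. simpl. ring.
Qed.

Lemma hip_linear p a b c s t :
  hip p (vadd (vscal s a) (vscal t b)) c = s * hip p a c + t * hip p b c.
Proof. unfold hip, Rdiv. rewrite edot_vadd_l, !edot_vscal_l. ring. Qed.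

(** In a conformal parametrization orthogonality can be read in the plane, and the
    orientations make the conormal a positive multiple of [- i v]. *)
Lemma conormal_quarter_turn Omega X z v n : bryant_end Omega X -> punctured Omega z ->
  conormal_at X z v n -> v <> 0%C ->
  exists h, 0 < h /\ h = hnorm (X z) (dmap X z v) /\ h * fst n = snd v /\ h * snd n = - fst v.
Proof.
  intros HB Hz [Hn1 [Hn2 Hn3]] Hv.
  destruct (bryant_conformal Omega X z HB Hz) as [Hw [HE [Hb Hab]]].
  rewrite (proj1 (bryant_mean_curvature Omega X z HB Hz)) in Hn3.
  set (E := conf X z) in *. set (w := pw (X z)) in *.
  assert (Hdot : forall a b, edot (dmap X z a) (dmap X z b) = E * (fst a * fst b + snd a * snd b)).
  { intros a b. unfold dmap. rewrite edot_vadd_l, !edot_vadd_r, !edot_vscal_l, !edot_vscal_r.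
    rewrite Hb, (edot_sym (dv_Pt X z)), Hab. fold (conf X z). fold E. ring. }
  assert (Hv2 : 0 < fst v * fst v + snd v * snd v).
  { destruct v as [v1 v2]. simpl. destruct (Req_dec v1 0) as [->|]; [|nra].
    destruct (Req_dec v2 0) as [->|]; [|nra]. now contradiction Hv. }
  assert (Hw2 : 0 < w ^ 2) by (apply pow_lt; exact Hw).
  assert (N1 : fst n * fst v + snd n * snd v = 0).
  { unfold hip in Hn1. rewrite Hdot in Hn1. fold w in Hn1.
    apply (Rmult_eq_compat_r (w ^ 2 / E)) in Hn1.
    replace (E * (fst n * fst v + snd n * snd v) / w ^ 2 * (w ^ 2 / E)) with
      (fst n * fst v + snd n * snd v) in Hn1 by (field; lra). lra. }
  assert (N2 : E * (fst n * fst n + snd n * snd n) = w ^ 2).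
  { unfold hnorm, hip in Hn2. rewrite Hdot in Hn2. fold w in Hn2.
    apply (f_equal (fun x => x * x)) in Hn2. rewrite sqrt_sqrt in Hn2.
    - apply (Rmult_eq_compat_r (w ^ 2)) in Hn2. field_simplify in Hn2; lra.
    - apply Rmult_le_pos; [nra|]. apply Rlt_le, Rinv_0_lt_compat. lra. }
  assert (N3 : fst v * snd n - snd v * fst n < 0).
  { unfold normal, unit_normal in Hn3. rewrite (conformal_cross _ _ E eq_refl Hb Hab) in Hn3.
    rewrite sqrt_square in Hn3 by lra. fold w in Hn3.
    set (c := ecross (du_Pt X z) (dv_Pt X z)) in *.
    unfold det3 in Hn3.
    assert (Hx : ecross (dmap X z v) (dmap X z n) = vscal (fst v * snd n - snd v * fst n) c).
    { apply Pt_eq; unfold c, dmap, ecross, vadd, vscal, px, py, pw; simpl; ring. }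
    rewrite Hx, edot_vscal_l, !edot_vscal_r in Hn3.
    assert (Hcc : edot c c = E * E) by (apply conformal_cross; auto). rewrite Hcc in Hn3.
    replace ((fst v * snd n - snd v * fst n) * (-1 * (w / E * (E * E)))) with
      (- (fst v * snd n - snd v * fst n) * (w * E)) in Hn3 by (field; lra).
    assert (0 < w * E) by nra. nra. }
  set (h := hnorm (X z) (dmap X z v)).
  assert (Hh2 : h * h = E * (fst v * fst v + snd v * snd v) / w ^ 2).
  { unfold h, hnorm, hip. rewrite Hdot. fold w. apply sqrt_sqrt.
    apply Rmult_le_pos; [nra|]. apply Rlt_le, Rinv_0_lt_compat. lra. }
  assert (Hh0 : 0 < h * h).
  { rewrite Hh2. apply Rdiv_lt_0_compat; nra. }
  assert (Hh : 0 < h).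
  { assert (0 <= h) by apply sqrt_pos. destruct (Req_dec h 0) as [Eq|]; [rewrite Eq in Hh0|]; lra. }
  exists h. split; [exact Hh|]. split; [reflexivity|].
  set (V := fst v * fst v + snd v * snd v) in *.
  set (m := snd v * fst n - fst v * snd n) in *.
  (* n = (m / |v|^2) (v2, - v1) *)
  assert (M1 : V * fst n = m * snd v).
  { transitivity (m * snd v + fst v * (fst n * fst v + snd n * snd v)); [unfold V, m; ring|rewrite N1; ring]. }
  assert (M2 : V * snd n = - (m * fst v)).
  { transitivity (- (m * fst v) + snd v * (fst n * fst v + snd n * snd v)); [unfold V, m; ring|rewrite N1; ring]. }
  assert (Hm2 : m * m = V * (fst n * fst n + snd n * snd n)).
  { replace (V * (fst n * fst n + snd n * snd n)) with (m * m + (fst n * fst v + snd n * snd v) ^ 2)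
      by (unfold V, m; ring). rewrite N1. ring. }
  assert (Hmh : h * m = V).
  { assert (HH : (h * m) * (h * m) = V * V).
    { transitivity (h * h * (m * m)); [ring|]. rewrite Hh2, Hm2.
      transitivity (V * V * (E * (fst n * fst n + snd n * snd n)) / w ^ 2); [field; lra|]. rewrite N2. field. lra. }
    assert (0 < h * m) by (apply Rmult_lt_0_compat; unfold m; lra). nra. }
  split; apply (Rmult_eq_reg_l V); try lra.
  - transitivity (h * (V * fst n)); [ring|]. rewrite M1, <- Hmh. ring.
  - transitivity (h * (V * snd n)); [ring|]. rewrite M2, <- Hmh. ring.
Qed.

(** The normalizing factors of the unit normal and of the area cancel; where [k] is
    not immersed both sides vanish. *)
Lemma disk_density k z (Y : Pt) : 0 < pw (k z) ->
  hip (k z) (normal k z) Y * area_density (k z) (du_Pt k z) (dv_Pt k z)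
  = det3 (du_Pt k z) (dv_Pt k z) Y / pw (k z) ^ 3.
Proof.
  intros Hw. set (a := du_Pt k z). set (b := dv_Pt k z). set (w := pw (k z)) in *.
  set (c := ecross a b).
  assert (Hc0 : 0 <= edot c c) by (unfold edot; nra).
  assert (Ha : area_density (k z) a b = sqrt (edot c c) / w ^ 2).
  { unfold area_density, hip. fold w.
    replace (edot a a / w ^ 2 * (edot b b / w ^ 2) - (edot a b / w ^ 2) ^ 2) with
      (edot c c * (/ w ^ 2) ^ 2).
    - rewrite sqrt_mult by (auto; apply pow2_ge_0). rewrite sqrt_pow2; [reflexivity|].
      apply Rlt_le, Rinv_0_lt_compat, pow_lt, Hw.
    - replace (edot c c) with (edot a a * edot b b - edot a b * edot a b)
        by (unfold c, edot, ecross, px, py, pw; simpl; ring). field. lra. }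
  rewrite Ha. unfold normal, unit_normal, hip. fold w a b c. rewrite edot_vscal_l.
  unfold det3. fold c.
  destruct (Req_dec (edot c c) 0) as [H0|H0].
  - rewrite H0, sqrt_0.
    assert (px c = 0 /\ py c = 0 /\ pw c = 0) as [h1 [h2 h3]].
    { unfold edot in H0. split; [|split]; nra. }
    unfold edot. rewrite h1, h2, h3. unfold Rdiv. ring.
  - assert (Hs : 0 < sqrt (edot c c)) by (apply sqrt_lt_R0; lra). field. lra.
Qed.

Definition sigU (q : quad) (k : C -> Pt) (z : C) : R := sigma q (k z) (du_Pt k z).
Definition sigV (q : quad) (k : C -> Pt) (z : C) : R := sigma q (k z) (dv_Pt k z).

(** The pull-back by [k] of [d sigma = 2 iota_Y vol]. *)
Lemma sigma_exterior (U : C -> Prop) (k : C -> Pt) (q : quad) :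
  open U -> class_C_Pt 2 U k -> (forall z, U z -> H3 (k z)) ->
  class_C 1 U (sigU q k) /\ class_C 1 U (sigV q k) /\
  forall z, U z -> du (sigV q k) z - dv (sigU q k) z
    = 2 * (det3 (du_Pt k z) (dv_Pt k z) (killing q (k z)) / pw (k z) ^ 3).
Proof.
  intros HU [Hx [Hy Hw]] HH.
  set (x := fun z => px (k z)) in *. set (y := fun z => py (k z)) in *.
  set (w := fun z => pw (k z)) in *.
  destruct q as [[[a0 b0] [a1 b1]] [a2 b2]].
  set (S := fun (f g h : C -> R) z => a0 * g z - b0 * f z + a1 * (x z * g z - y z * f z)
    - b1 * (x z * f z + y z * g z + w z * h z)
    + a2 * ((x z * x z - y z * y z) * g z - 2 * (x z * y z * f z) - 2 * (w z * (y z * h z)) + w z * w z * g z)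
    - b2 * ((x z * x z - y z * y z) * f z + 2 * (x z * y z * g z) + 2 * (w z * (x z * h z)) - w z * w z * f z)).
  assert (EP : forall z, S (du x) (du y) (du w) z * / (w z * w z) = sigU (a0, b0, (a1, b1), (a2, b2)) k z).
  { intros t. unfold sigU, sigma, du_Pt, S, qc0, qc1, qc2, x, y, w, Rdiv.
    unfold px, py, pw, Im, Re. simpl. rewrite !Rmult_1_r. ring. }
  assert (EQ : forall z, S (dv x) (dv y) (dv w) z * / (w z * w z) = sigV (a0, b0, (a1, b1), (a2, b2)) k z).
  { intros t. unfold sigV, sigma, dv_Pt, S, qc0, qc1, qc2, x, y, w, Rdiv.
    unfold px, py, pw, Im, Re. simpl. rewrite !Rmult_1_r. ring. }
  assert (Cx : class_C 1 U x) by now apply class_C_le. assert (Cy : class_C 1 U y) by now apply class_C_le.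
  assert (Cw : class_C 1 U w) by now apply class_C_le.
  assert (Cxu : class_C 1 U (du x)) by apply Hx. assert (Cyu : class_C 1 U (du y)) by apply Hy.
  assert (Cwu : class_C 1 U (du w)) by apply Hw.
  assert (Cxv : class_C 1 U (dv x)) by apply Hx. assert (Cyv : class_C 1 U (dv y)) by apply Hy.
  assert (Cwv : class_C 1 U (dv w)) by apply Hw.
  assert (Hw0 : forall z, U z -> w z * w z <> 0).
  { intros z Hz. specialize (HH z Hz). unfold H3 in HH. fold (w z) in HH. nra. }
  assert (CP : class_C 1 U (fun z => S (du x) (du y) (du w) z * / (w z * w z))).
  { unfold S. cC. exact Hw0. }
  assert (CQ : class_C 1 U (fun z => S (dv x) (dv y) (dv w) z * / (w z * w z))).
  { unfold S. cC. exact Hw0. }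
  split; [|split].
  - eapply class_C_ext; [exact HU| |exact CP]. intros z _. apply EP.
  - eapply class_C_ext; [exact HU| |exact CQ]. intros z _. apply EQ.
  - intros z Hz.
    assert (Dx := class_C_D2 U x z HU Cx Hz). assert (Dy := class_C_D2 U y z HU Cy Hz).
    assert (Dw := class_C_D2 U w z HU Cw Hz).
    assert (Dxu := class_C_D2 U (du x) z HU Cxu Hz). assert (Dyu := class_C_D2 U (du y) z HU Cyu Hz).
    assert (Dwu := class_C_D2 U (du w) z HU Cwu Hz).
    assert (Dxv := class_C_D2 U (dv x) z HU Cxv Hz). assert (Dyv := class_C_D2 U (dv y) z HU Cyv Hz).
    assert (Dwv := class_C_D2 U (dv w) z HU Cwv Hz).
    rewrite (class_C_mixed U x z HU Hx Hz) in Dxv. rewrite (class_C_mixed U y z HU Hy Hz) in Dyv.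
    rewrite (class_C_mixed U w z HU Hw Hz) in Dwv.
    assert (DP : exists p r, D2 (sigU (a0, b0, (a1, b1), (a2, b2)) k) z p r /\ exists p' r',
       D2 (sigV (a0, b0, (a1, b1), (a2, b2)) k) z p' r' /\
       p' - r = 2 * (det3 (du_Pt k z) (dv_Pt k z) (killing (a0, b0, (a1, b1), (a2, b2)) (k z)) / pw (k z) ^ 3)).
    { do 2 eexists. split.
      - apply (D2_ext _ _ _ _ _ EP). apply D2_div; [| |now apply Hw0]; unfold S; d2.
      - do 2 eexists. split.
        + apply (D2_ext _ _ _ _ _ EQ). apply D2_div; [| |now apply Hw0]; unfold S; d2.
        + unfold det3, ecross, edot, killing, qeval, du_Pt, dv_Pt, qc0, qc1, qc2.
          change (fun z => px (k z)) with x. change (fun z => py (k z)) with y. change (fun z => pw (k z)) with w.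
          unfold px, py, pw, Re, Im. unfold S. simpl.
          change (fst (fst (k z))) with (x z). change (snd (fst (k z))) with (y z).
          change (snd (k z)) with (w z). field. intros H. apply (Hw0 z Hz). rewrite H. ring. }
    destruct DP as [p [r [DP [p' [r' [DQ E]]]]]].
    destruct (D2_partials _ _ _ _ DP) as [_ E1]. destruct (D2_partials _ _ _ _ DQ) as [E2 _].
    rewrite <- E1, <- E2 in E. exact E.
Qed.

Lemma polar_exists (z : C) : exists t, 0 <= t <= 2 * PI /\ z = polar (Cmod z) t.
Proof.
  assert (HPI := PI_RGT_0).
  destruct (Req_dec (Cmod z) 0) as [H0|H0].
  { exists 0. split; [lra|]. rewrite H0. apply Cmod_eq_0 in H0. rewrite H0.
    unfold polar. apply injective_projections; simpl; ring. }
  assert (Hr : 0 < Cmod z) by (pose proof (Cmod_ge_0 z); lra).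
  set (r := Cmod z) in *. destruct z as [x y].
  assert (Hxy : x * x + y * y = r * r).
  { unfold r, Cmod. simpl fst. simpl snd. rewrite sqrt_sqrt; [ring|].
    apply Rplus_le_le_0_compat; apply pow2_ge_0. }
  assert (Hc : -1 <= x / r <= 1).
  { assert (x <= r) by nra. assert (- r <= x) by nra.
    split; apply (Rmult_le_reg_r r); auto; unfold Rdiv; rewrite ?Rmult_assoc, Rinv_l; lra. }
  assert (Hcos : cos (acos (x / r)) = x / r) by now apply cos_acos.
  assert (Hsin : sin (acos (x / r)) = Rabs y / r).
  { rewrite sin_acos by exact Hc. replace (1 - (x / r)²) with ((Rabs y / r) ^ 2).
    - apply sqrt_pow2. apply Rmult_le_pos; [apply Rabs_pos|]. apply Rlt_le, Rinv_0_lt_compat. lra.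
    - unfold Rsqr. replace ((Rabs y / r) ^ 2) with (Rabs y ^ 2 / (r * r)) by (field; lra).
      rewrite pow2_abs, <- Hxy. replace (1 - x / r * (x / r)) with ((r * r - x * x) / (r * r)) by (field; lra).
      rewrite <- Hxy. f_equal. ring. }
  pose proof (acos_bound (x / r)) as [A1 A2].
  destruct (Rle_dec 0 y) as [Hy|Hy].
  - exists (acos (x / r)). split; [lra|]. unfold polar. rewrite Hcos, Hsin, Rabs_pos_eq by lra.
    apply injective_projections; simpl; field; lra.
  - exists (2 * PI - acos (x / r)). split; [lra|]. unfold polar.
    replace (2 * PI - acos (x / r)) with (- acos (x / r) + 2 * INR 1 * PI) by (simpl; ring).
    rewrite cos_period, sin_period, cos_neg, sin_neg, Hcos, Hsin, Rabs_left by lra.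
    apply injective_projections; simpl; field; lra.
Qed.

Lemma continuous_polar_pair (st : R * R) : continuous (fun st => polar (fst st) (snd st)) st.
Proof.
  destruct st as [s t].
  apply (continuous_pair (fun st : R * R => fst st * cos (snd st)) (fun st : R * R => fst st * sin (snd st)));
    apply (continuous_mult (K := R_AbsRing)); try apply continuous_fst.
  - apply (continuous_comp (fun st : R * R => snd st) cos); [apply continuous_snd|apply continuous_cos_R].
  - apply (continuous_comp (fun st : R * R => snd st) sin); [apply continuous_snd|apply continuous_sin_R].
Qed.

Lemma closed_disc_nbhd (U : C -> Prop) : open U -> (forall z, closed_disc 1 z -> U z) ->
  exists r, 1 < r /\ forall z, disc r z -> U z.
Proof.
  intros HU H1.
  destruct (lebesgue_number U (fun st => polar (fst st) (snd st)) (2 * PI) HU) as [d [Hd HL]].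
  - exact continuous_polar_pair.
  - intros s t Hs _. apply H1. unfold closed_disc. simpl. rewrite polar_Cmod, Rabs_pos_eq; lra.
  - exists (1 + d). split; [lra|]. intros z Hz. unfold disc in Hz.
    destruct (Rle_dec (Cmod z) 1) as [Hz1|Hz1]; [now apply H1|].
    destruct (polar_exists z) as [t [Ht ->]].
    destruct (HL 1 t) as [c [r [_ [HrU Hb]]]]; [lra|exact Ht|].
    apply HrU. apply (Hb (Cmod z) t).
    + rewrite Rabs_pos_eq; lra.
    + rewrite Rminus_diag, Rabs_R0. exact Hd.
Qed.

Lemma closed_form_cont U P Q : closed_form U P Q -> cont_on U P /\ cont_on U Q.
Proof.
  intros H. split; intros z Hz; destruct (H z Hz) as [p [q [r [H1 H2]]]]; eapply D2_continuous; eauto.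
Qed.

Lemma continuous_along (U : C -> Prop) P g t : cont_on U P -> (forall t, U (g t)) ->
  ex_derive (fun s => fst (g s)) t -> ex_derive (fun s => snd (g s)) t ->
  continuous (fun t => P (g t)) t.
Proof.
  intros HP Hg H1 H2. apply (continuous_comp g P); [|apply HP, Hg].
  apply (continuous_ext (fun s => (fst (g s), snd (g s)) : C)).
  - intros s. symmetry. apply surjective_pairing.
  - apply continuous_pair; apply (ex_derive_continuous (K := R_AbsRing) (V := R_NormedModule)); assumption.
Qed.

Lemma continuous_fst_C (z : C) : continuous (fst : C -> R) z.
Proof. destruct z. apply continuous_fst. Qed.
Lemma continuous_snd_C (z : C) : continuous (snd : C -> R) z.
Proof. destruct z. apply continuous_snd. Qed.

Lemma regular_loop_integrable Omega P Q gam :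
  cont_on (punctured Omega) P -> cont_on (punctured Omega) Q ->
  regular_loop Omega gam -> integrable_loop P Q gam.
Proof.
  intros HP HQ Hg t. destruct (Hg t) as [_ [_ [H1 [H2 [H3 _]]]]].
  split; [exact H1|]. split; [exact H2|].
  assert (Hall : forall t, punctured Omega (gam t)) by (intros s; apply Hg).
  apply (continuous_plus (V := R_NormedModule)); apply (continuous_mult (K := R_AbsRing)).
  - eapply continuous_along; eauto.
  - exact (continuous_comp (velocity gam) fst t H3 (continuous_fst_C _)).
  - eapply continuous_along; eauto.
  - exact (continuous_comp (velocity gam) snd t H3 (continuous_snd_C _)).
Qed.

Lemma D2_velocity f gam t a b : D2 f (gam t) a b ->
  ex_derive (fun s => fst (gam s)) t -> ex_derive (fun s => snd (gam s)) t ->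
  is_derive (fun s => f (gam s)) t (a * fst (velocity gam t) + b * snd (velocity gam t)).
Proof.
  intros HD Hx Hy. rewrite (surjective_pairing (gam t)) in HD.
  apply (is_derive_ext (fun s => f (fst (gam s), snd (gam s)))).
  { intros s. now rewrite <- surjective_pairing. }
  apply (D2_curve f (fun s => fst (gam s)) (fun s => snd (gam s))); [exact HD| |].
  - now apply Derive_correct. - now apply Derive_correct.
Qed.

Lemma polar_derive s t : is_derive (fun t => fst (polar s t)) t (- s * sin t) /\
  is_derive (fun t => snd (polar s t)) t (s * cos t).
Proof. unfold polar. simpl. split; auto_derive; auto; ring. Qed.

Lemma polar_velocity s t : velocity (polar s) t = (- s * sin t, s * cos t).
Proof.
  destruct (polar_derive s t) as [H1 H2]. unfold velocity.
  apply injective_projections; apply is_derive_unique; assumption.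
Qed.

Lemma class_C1_cont U f : class_C 1 U f -> cont_on U (du f) /\ cont_on U (dv f).
Proof. intros [_ [_ [[H1 _] [H2 _]]]]. split; assumption. Qed.

Lemma green_class_C P Q r : 1 < r -> open (disc r) -> class_C 1 (disc r) P -> class_C 1 (disc r) Q ->
  is_RInt (fun s => s * RInt (fun t => du Q (polar s t) - dv P (polar s t)) 0 (2 * PI)) 0 1
    (RInt (polar_form P Q 1) 0 (2 * PI)).
Proof.
  intros Hr Hop CP CQ.
  assert (CP' := class_C1_cont _ _ CP). assert (CQ' := class_C1_cont _ _ CQ).
  apply (green_disc P Q (du P) (dv P) (du Q) (dv Q) r Hr).
  - intros y Hy. split; now apply (class_C_D2 (disc r)).
  - apply CP'.
  - apply CP'.
  - apply CQ'.
  - apply CQ'.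
Qed.

(** The flux is the integral of [theta] along the generator: the conormal gives
    the first part, and Green's formula on the disk the second one. *)
Theorem flux_is_loop_int Omega X q Y gam n k :
  bryant_end Omega X -> (forall p, H3 p -> Y p = killing q p) ->
  regular_loop Omega gam ->
  (forall t, conormal_at X (gam t) (velocity gam t) (n t)) ->
  spanning_disk X gam k ->
  flux_integral X Y gam n k = loop_int (thetaU q X) (thetaV q X) gam.
Proof.
  intros HB HY Hg Hn [[r0 [Hr0 Hk]] [HkH Hbd]].
  assert (HU : open (punctured Omega)) by (apply punctured_open, HB).
  assert (HX2 : class_C_Pt 2 (punctured Omega) X) by apply HB.
  assert (HC : closed_form (punctured Omega) (thetaU q X) (thetaV q X)).
  { apply theta_closed; auto. intros z Hz. now apply HB. intros z Hz. now apply (bryant_cmc_one Omega). }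
  destruct (closed_form_cont _ _ _ HC) as [CU CV].
  assert (HI := regular_loop_integrable Omega _ _ gam CU CV Hg).
  (* a larger disc on which k stays in hyperbolic space *)
  assert (Hop0 : open (disc r0)).
  { intros z Hz. apply Cball_locally. exists (r0 - Cmod z). unfold disc in *. split; [lra|].
    intros y Hy. replace y with ((y - z) + z)%C by ring. eapply Rle_lt_trans; [apply Cmod_triangle|]. lra. }
  destruct (closed_disc_nbhd (fun z => disc r0 z /\ 0 < pw (k z))) as [r [Hr HrU]].
  { intros z [Hz1 Hz2]. apply filter_and; [now apply Hop0|].
    assert (Hc : continuous (fun z => pw (k z)) z) by exact (class_C_continuous 2 _ _ z (proj2 (proj2 Hk)) Hz1).
    apply (Hc (fun w => 0 < w)). now apply (open_gt 0). }
  { intros z Hz. split; [unfold disc, closed_disc in *; lra|now apply HkH]. }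
  assert (Hop : open (disc r)).
  { intros z Hz. apply Cball_locally. exists (r - Cmod z). unfold disc in *. split; [lra|].
    intros y Hy. replace y with ((y - z) + z)%C by ring. eapply Rle_lt_trans; [apply Cmod_triangle|]. lra. }
  assert (Hsub : forall j (f : C -> R), class_C j (disc r0) f -> class_C j (disc r) f).
  { induction j; intros f; simpl.
    - intros [H _]. split; auto. intros z Hz. apply H. now apply HrU.
    - intros [H1 [H2 [H3 H4]]]. split; [|split; [|split]]; auto.
      + intros z Hz. apply H1. now apply HrU.
      + intros z Hz. apply H2. now apply HrU. }
  assert (Hk2 : class_C_Pt 2 (disc r) k) by (split; [|split]; apply Hsub, Hk).
  destruct (sigma_exterior (disc r) k q Hop Hk2) as [CP [CQ Hext]].
  { intros z Hz. now apply HrU. }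
  assert (HG := green_class_C (sigU q k) (sigV q k) r Hr Hop CP CQ).
  assert (HK2 : 2 * annulus_int (fun z => hip (k z) (normal k z) (Y (k z))
          * area_density (k z) (du_Pt k z) (dv_Pt k z)) 0 1 = RInt (polar_form (sigU q k) (sigV q k) 1) 0 (2 * PI)).
  { apply (is_RInt_scal (V := R_NormedModule) _ _ _ (/ 2)) in HG.
    unfold annulus_int. rewrite (is_RInt_unique (V := R_CompleteNormedModule) _ 0 1
      (scal (/ 2) (RInt (polar_form (sigU q k) (sigV q k) 1) 0 (2 * PI)))).
    { unfold scal; simpl; unfold mult; simpl. field. }
    revert HG. apply (is_RInt_ext (V := R_NormedModule)). intros s Hs.
    rewrite Rmin_left, Rmax_right in Hs by lra.
    unfold scal; simpl; unfold mult; simpl.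
    assert (Hin : forall t, disc r (polar s t)) by (intros t; unfold disc; rewrite polar_Cmod, Rabs_pos_eq; lra).
    assert (Ein : ex_RInt (fun t => du (sigV q k) (polar s t) - dv (sigU q k) (polar s t)) 0 (2 * PI)).
    { apply (ex_RInt_continuous (V := R_CompleteNormedModule)). intros t _.
      destruct (polar_derive s t) as [Px Py].
      apply (continuous_minus (V := R_NormedModule) (fun t => du (sigV q k) (polar s t))
        (fun t => dv (sigU q k) (polar s t))).
      - apply (continuous_along (disc r) _ (polar s)); auto; try (eexists; eassumption).
        apply (class_C1_cont _ _ CQ).
      - apply (continuous_along (disc r) _ (polar s)); auto; try (eexists; eassumption).
        apply (class_C1_cont _ _ CP). }
    transitivity (s * RInt (fun t => / 2 * (du (sigV q k) (polar s t) - dv (sigU q k) (polar s t))) 0 (2 * PI)).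
    - rewrite RInt_scal_R by exact Ein. req. ring.
    - f_equal. apply RInt_ext. intros t _. rewrite (Hext _ (Hin t)).
      rewrite disk_density by (apply HrU, Hin).
      rewrite HY by (apply HrU, Hin). req. field. apply Rgt_not_eq. apply HrU, Hin. }
  assert (Hbdt : forall t, polar_form (sigU q k) (sigV q k) 1 t
     = sigma q (X (gam t)) (dmap X (gam t) (velocity gam t))).
  { intros t.
    assert (Ht1 : disc r (polar 1 t)) by (unfold disc; rewrite polar_Cmod, Rabs_R1; lra).
    assert (Hcomp : forall f : Pt -> R, class_C 1 (disc r) (fun z => f (k z)) ->
       class_C 1 (punctured Omega) (fun z => f (X z)) ->
       1 * (- sin t) * du (fun z => f (k z)) (polar 1 t) + 1 * cos t * dv (fun z => f (k z)) (polar 1 t)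
       = fst (velocity gam t) * du (fun z => f (X z)) (gam t) + snd (velocity gam t) * dv (fun z => f (X z)) (gam t)).
    { intros f Cf Cf'.
      assert (D1 := class_C_D2 _ _ _ Hop Cf Ht1).
      assert (D2' := class_C_D2 _ _ _ HU Cf' (proj1 (Hg t))).
      destruct (Hg t) as [_ [_ [Hx [Hy _]]]].
      assert (I1 := D2_velocity _ gam t _ _ D2' Hx Hy).
      destruct (polar_derive 1 t) as [Px Py].
      assert (I2 := D2_velocity _ (polar 1) t _ _ D1 (ex_intro _ _ Px) (ex_intro _ _ Py)).
      apply (is_derive_ext (fun s => f (k (polar 1 s))) (fun s => f (X (gam s)))) in I2.
      2:{ intros s. now rewrite Hbd. }
      apply is_derive_unique in I1. apply is_derive_unique in I2. rewrite I1 in I2.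
      rewrite polar_velocity in I2. simpl in I2.
      match type of I2 with @eq _ ?a ?b => change (@eq R a b) in I2 end. clear - I2. unfold velocity. simpl. lra. }
    transitivity (sigma q (X (gam t)) (vadd (vscal (1 * (- sin t)) (du_Pt k (polar 1 t)))
       (vscal (1 * cos t) (dv_Pt k (polar 1 t))))).
    - rewrite sigma_linear. unfold polar_form, sigU, sigV. rewrite Hbd. req. ring.
    - f_equal. unfold dmap, vadd, vscal. apply Pt_eq.
      + apply (Hcomp px). apply class_C_le, Hk2. apply class_C_le, HX2.
      + apply (Hcomp py). apply class_C_le, Hk2. apply class_C_le, HX2.
      + apply (Hcomp pw). apply class_C_le, Hk2. apply class_C_le, HX2. }
  assert (Hsum : forall t, along (thetaU q X) (thetaV q X) gam t + polar_form (sigU q k) (sigV q k) 1 t =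
     hip (X (gam t)) (dmap X (gam t) (n t)) (Y (X (gam t))) * hnorm (X (gam t)) (dmap X (gam t) (velocity gam t))).
  { intros t. destruct (Hg t) as [Ht [_ [_ [_ [_ Hv]]]]].
    destruct (conormal_quarter_turn Omega X (gam t) _ _ HB Ht (Hn t) Hv) as [h [Hh [Eh [E1 E2]]]].
    rewrite <- Eh, Hbdt. unfold dmap. rewrite hip_linear, sigma_linear.
    rewrite HY by now apply HB.
    unfold along, thetaU, thetaV.
    transitivity (h * fst (n t) * hip (X (gam t)) (du_Pt X (gam t)) (killing q (X (gam t)))
      + h * snd (n t) * hip (X (gam t)) (dv_Pt X (gam t)) (killing q (X (gam t)))); [|ring].
    rewrite E1, E2. ring. }
  assert (Epf : ex_RInt (polar_form (sigU q k) (sigV q k) 1) 0 (2 * PI)).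
  { apply (ex_RInt_continuous (V := R_CompleteNormedModule)). intros t _.
    apply (continuous_mult (K := R_AbsRing)); [apply continuous_const|].
    assert (Hin : forall t, disc r (polar 1 t)) by (intros s; unfold disc; rewrite polar_Cmod, Rabs_R1; lra).
    destruct (polar_derive 1 t) as [Px Py].
    apply (continuous_minus (V := R_NormedModule) (fun t => sigV q k (polar 1 t) * cos t)
      (fun t => sigU q k (polar 1 t) * sin t));
      [apply (continuous_mult (K := R_AbsRing) (fun t => sigV q k (polar 1 t)) cos)|
       apply (continuous_mult (K := R_AbsRing) (fun t => sigU q k (polar 1 t)) sin)];
      try apply continuous_cos_R; try apply continuous_sin_R.
    - apply (continuous_along (disc r) (sigV q k) (polar 1)); auto; try (eexists; eassumption).
      intros z Hz. exact (class_C_continuous _ _ _ z CQ Hz).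
    - apply (continuous_along (disc r) (sigU q k) (polar 1)); auto; try (eexists; eassumption).
      intros z Hz. exact (class_C_continuous _ _ _ z CP Hz). }
  assert (Eal : ex_RInt (along (thetaU q X) (thetaV q X) gam) 0 (2 * PI)).
  { apply (ex_RInt_continuous (V := R_CompleteNormedModule)). intros t _. apply HI. }
  unfold flux_integral, loop_int. rewrite HK2.
  rewrite <- (RInt_ext (fun t => along (thetaU q X) (thetaV q X) gam t + polar_form (sigU q k) (sigV q k) 1 t))
    by (intros t _; apply Hsum).
  rewrite RInt_plus_R by assumption. req. ring.
Qed.

(** * Generators of the fundamental group of an end *)

Definition turning (rho sigma : R) (t : R) : C := polar rho (sigma * t).

Lemma turning_derive rho sigma t :
  is_derive (fun t => fst (turning rho sigma t)) t (- sigma * snd (turning rho sigma t)) /\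
  is_derive (fun t => snd (turning rho sigma t)) t (sigma * fst (turning rho sigma t)).
Proof. unfold turning, polar. simpl. split; auto_derive; auto; ring. Qed.

Lemma turning_velocity rho sigma t :
  velocity (turning rho sigma) t = (- sigma * snd (turning rho sigma t), sigma * fst (turning rho sigma t)).
Proof.
  destruct (turning_derive rho sigma t) as [H1 H2].
  apply injective_projections; apply is_derive_unique; assumption.
Qed.

Lemma turning_Cmod rho sigma t : 0 <= rho -> Cmod (turning rho sigma t) = rho.
Proof. intros H. unfold turning. rewrite polar_Cmod. now apply Rabs_pos_eq. Qed.

Lemma turning_neq0 rho sigma t : 0 < rho -> turning rho sigma t <> 0%C.
Proof. intros H. apply Cmod_gt_0. rewrite turning_Cmod; lra. Qed.

Lemma turning_periodic rho sigma t : sigma = 1 \/ sigma = -1 ->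
  turning rho sigma (t + 2 * PI) = turning rho sigma t.
Proof.
  intros [-> | ->]; unfold turning, polar.
  - replace (1 * (t + 2 * PI)) with (1 * t + 2 * INR 1 * PI) by (simpl; ring).
    now rewrite cos_period, sin_period.
  - rewrite <- (cos_period (-1 * (t + 2 * PI)) 1), <- (sin_period (-1 * (t + 2 * PI)) 1).
    replace (-1 * (t + 2 * PI) + 2 * INR 1 * PI) with (-1 * t) by (simpl; ring). reflexivity.
Qed.

Lemma turning_continuous rho sigma t : continuous (turning rho sigma) t.
Proof.
  destruct (turning_derive rho sigma t) as [H1 H2].
  apply (continuous_ext (fun s => (fst (turning rho sigma s), snd (turning rho sigma s)) : C)).
  - intros s. symmetry. apply surjective_pairing.
  - apply continuous_pair; apply (ex_derive_continuous (K := R_AbsRing) (V := R_NormedModule));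
      eexists; eassumption.
Qed.

Lemma turning_regular Omega rho sigma : 0 < rho -> (forall z, closed_disc rho z -> Omega z) ->
  sigma = 1 \/ sigma = -1 -> regular_loop Omega (turning rho sigma).
Proof.
  intros Hr HO Hs t. destruct (turning_derive rho sigma t) as [H1 H2].
  split; [|split; [|split; [|split; [|split]]]].
  - split; [|now apply turning_neq0]. apply HO. unfold closed_disc. rewrite turning_Cmod; lra.
  - now apply turning_periodic.
  - eexists; exact H1.
  - eexists; exact H2.
  - apply (continuous_ext (fun t => (- sigma * snd (turning rho sigma t), sigma * fst (turning rho sigma t)) : C)).
    + intros s. symmetry. apply turning_velocity.
    + apply continuous_pair; apply (continuous_mult (K := R_AbsRing)); try apply continuous_const;
        apply (ex_derive_continuous (K := R_AbsRing) (V := R_NormedModule)); eexists; eassumption.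
  - rewrite turning_velocity. intros E. apply (turning_neq0 rho sigma t Hr).
    injection E as E1 E2. apply injective_projections; simpl; destruct Hs; subst; lra.
Qed.

Lemma closed_discs_homotopic (Omega : C -> Prop) P Q rho1 rho2 :
  open Omega -> closed_form (punctured Omega) P Q ->
  0 < rho1 -> 0 < rho2 -> (forall z, closed_disc rho1 z -> Omega z) -> (forall z, closed_disc rho2 z -> Omega z) ->
  loop_int P Q (turning rho1 (-1)) = loop_int P Q (turning rho2 (-1)).
Proof.
  intros HO HC H1 H2 D1 D2.
  destruct (closed_form_cont _ _ _ HC) as [CP CQ].
  apply (homotopy_invariance (punctured Omega) P Q _ _
    (fun st => turning ((1 - fst st) * rho1 + fst st * rho2) (-1) (snd st))); auto.
  - now apply punctured_open.
  - apply (regular_loop_integrable Omega); auto. apply turning_regular; auto.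
  - apply (regular_loop_integrable Omega); auto. apply turning_regular; auto.
  - intros [s t]. unfold turning.
    apply (continuous_comp (fun st : R * R => (((1 - fst st) * rho1 + fst st * rho2), -1 * snd st))
      (fun st : R * R => polar (fst st) (snd st))); [|apply continuous_polar_pair].
    apply (continuous_pair (fun st : R * R => (1 - fst st) * rho1 + fst st * rho2) (fun st : R * R => -1 * snd st)).
    + apply (continuous_plus (V := R_NormedModule)); apply (continuous_mult (K := R_AbsRing));
        try apply continuous_const; try apply continuous_fst.
      apply (continuous_minus (V := R_NormedModule)); [apply continuous_const|apply continuous_fst].
    + apply (continuous_mult (K := R_AbsRing)); [apply continuous_const|apply continuous_snd].
  - intros s t Hs. simpl.
    assert (Hpos : 0 < (1 - s) * rho1 + s * rho2).
    { destruct (Rle_dec s (1 / 2)); nra. }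
    split; [|split; [|split]].
    + split; [|now apply turning_neq0].
      destruct (Rle_dec rho1 rho2).
      * apply D2. unfold closed_disc. rewrite turning_Cmod by lra. nra.
      * apply D1. unfold closed_disc. rewrite turning_Cmod by lra. nra.
    + apply turning_periodic. now right.
    + f_equal. ring.
    + f_equal. ring.
Qed.

Lemma conormal_exists Omega X z (v : C) : bryant_end Omega X -> punctured Omega z -> v <> 0%C ->
  exists n, conormal_at X z v n.
Proof.
  intros HB Hz Hv.
  destruct (bryant_conformal Omega X z HB Hz) as [Hw [HE [Hb Hab]]].
  set (E := conf X z) in *. set (w := pw (X z)) in *.
  assert (Hdot : forall a b, edot (dmap X z a) (dmap X z b) = E * (fst a * fst b + snd a * snd b)).
  { intros a b. unfold dmap. rewrite edot_vadd_l, !edot_vadd_r, !edot_vscal_l, !edot_vscal_r.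
    rewrite Hb, (edot_sym (dv_Pt X z)), Hab. fold (conf X z). fold E. ring. }
  set (V := fst v * fst v + snd v * snd v).
  assert (Hv2 : 0 < V).
  { unfold V. destruct v as [v1 v2]. simpl. destruct (Req_dec v1 0) as [->|]; [|nra].
    destruct (Req_dec v2 0) as [->|]; [|nra]. now contradiction Hv. }
  set (h := w / sqrt (E * V)).
  assert (HEV : 0 < E * V) by nra.
  assert (Hs : 0 < sqrt (E * V)) by now apply sqrt_lt_R0.
  assert (Hh : 0 < h) by (apply Rdiv_lt_0_compat; auto).
  assert (Hw2 : 0 < w ^ 2) by (apply pow_lt; exact Hw).
  exists (h * snd v, - (h * fst v)). split; [|split].
  - unfold hip. rewrite Hdot. simpl. unfold Rdiv. ring.
  - unfold hnorm, hip. rewrite Hdot. simpl fst. simpl snd. fold w.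
    replace (E * (h * snd v * (h * snd v) + - (h * fst v) * - (h * fst v)) / w ^ 2) with 1; [apply sqrt_1|].
    replace (E * (h * snd v * (h * snd v) + - (h * fst v) * - (h * fst v))) with (h * h * (E * V)) by (unfold V; ring).
    unfold h. rewrite <- (sqrt_sqrt (E * V)) at 3 by lra. field. lra.
  - rewrite (proj1 (bryant_mean_curvature Omega X z HB Hz)).
    unfold normal, unit_normal. rewrite (conformal_cross _ _ E eq_refl Hb Hab).
    rewrite sqrt_square by lra. fold w.
    set (c := ecross (du_Pt X z) (dv_Pt X z)).
    assert (Hcc : edot c c = E * E) by (apply conformal_cross; auto).
    unfold det3.
    assert (Hx : ecross (dmap X z v) (dmap X z (h * snd v, - (h * fst v))) = vscal (- (h * V)) c).
    { apply Pt_eq; unfold c, V, dmap, ecross, vadd, vscal, px, py, pw; simpl; ring. }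
    rewrite Hx, edot_vscal_l, !edot_vscal_r, Hcc.
    replace (- (h * V) * (-1 * (w / E * (E * E)))) with (h * V * (w * E)) by (field; lra).
    apply Rmult_lt_0_compat; nra.
Qed.

(** The vector [- i v] points to the centre exactly when the circle is followed
    clockwise. *)
Lemma inward_normal rho sigma t (n : C) h : 0 < h -> sigma = 1 \/ sigma = -1 ->
  h * fst n = snd (velocity (turning rho sigma) t) -> h * snd n = - fst (velocity (turning rho sigma) t) ->
  h * Re (Cconj (turning rho sigma t) * n)%C = sigma * (rho * rho).
Proof.
  intros Hh Hs H1 H2. rewrite turning_velocity in H1, H2. simpl fst in H1, H2. simpl snd in H1, H2.
  transitivity (fst (turning rho sigma t) * (h * fst n) + snd (turning rho sigma t) * (h * snd n)).
  { unfold Re. simpl. ring. }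
  rewrite H1, H2. unfold turning, polar. simpl. pose proof (sin2_cos2 (sigma * t)) as H. unfold Rsqr in H.
  transitivity (sigma * (rho * rho) * (sin (sigma * t) * sin (sigma * t) + cos (sigma * t) * cos (sigma * t)));
    [ring|rewrite H; ring].
Qed.

(** The orientation condition forces the model circle to turn clockwise, so all
    generators are homotopic to each other as oriented loops. *)
Lemma end_generator_loop_int Omega X gam P Q rho : bryant_end Omega X ->
  closed_form (punctured Omega) P Q -> end_generator Omega X gam ->
  0 < rho -> (forall z, closed_disc rho z -> Omega z) ->
  loop_int P Q gam = loop_int P Q (turning rho (-1)).
Proof.
  intros HB HC [Hg [rho' [sigma [Hr' [Hd' [Hs [Hf Hn]]]]]]] Hr Hd.
  destruct (closed_form_cont _ _ _ HC) as [CP CQ].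
  assert (HO : open Omega) by apply HB.
  change (fun t => polar rho' (sigma * t)) with (turning rho' sigma) in *.
  assert (Hreg := turning_regular Omega rho' sigma Hr' Hd' Hs).
  assert (Es : sigma = -1).
  { destruct Hs as [Hs|Hs]; auto. exfalso.
    destruct (Hreg 0) as [Hz [_ [_ [_ [_ Hv]]]]].
    destruct (conormal_exists Omega X _ _ HB Hz Hv) as [n Hcn].
    destruct (conormal_quarter_turn Omega X _ _ _ HB Hz Hcn Hv) as [h [Hh [_ [E1 E2]]]].
    specialize (Hn 0 n Hcn).
    assert (H := inward_normal rho' sigma 0 n h Hh (or_introl Hs) E1 E2).
    change (polar rho' (sigma * 0)) with (turning rho' sigma 0) in Hn. rewrite Hs in *. nra. }
  subst sigma.
  rewrite <- (closed_discs_homotopic Omega P Q rho' rho HO HC); auto.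
  destruct Hf as [Hm [Hmc Hmh]].
  apply (homotopy_invariance (punctured Omega) P Q gam (turning rho' (-1)) Hm); auto.
  - now apply punctured_open.
  - now apply (regular_loop_integrable Omega).
  - now apply (regular_loop_integrable Omega).
Qed.

Lemma end_generator_turning Omega X rho : bryant_end Omega X -> 0 < rho ->
  (forall z, closed_disc rho z -> Omega z) -> end_generator Omega X (turning rho (-1)).
Proof.
  intros HB Hr Hd.
  assert (Hreg := turning_regular Omega rho (-1) Hr Hd (or_intror eq_refl)).
  split; [exact Hreg|]. exists rho, (-1). split; [exact Hr|]. split; [exact Hd|]. split; [now right|].
  change (fun t => polar rho (-1 * t)) with (turning rho (-1)). split.
  - exists (fun st => turning rho (-1) (snd st)). split.
    + intros [s t]. apply (continuous_comp (fun st : R * R => snd st) (turning rho (-1))).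
      apply continuous_snd. apply turning_continuous.
    + intros s t _. simpl. repeat split; try apply Hreg.
  - intros t n Hcn. destruct (Hreg t) as [Hz [_ [_ [_ [_ Hv]]]]].
    destruct (conormal_quarter_turn Omega X _ _ _ HB Hz Hcn Hv) as [h [Hh [_ [E1 E2]]]].
    assert (H := inward_normal rho (-1) t n h Hh (or_intror eq_refl) E1 E2).
    change (polar rho (-1 * t)) with (turning rho (-1) t). nra.
Qed.

(** ** Spanning disks *)

Definition pos_part (x : R) : R := (x + Rabs x) / 2.

Lemma pos_part_pos x : 0 <= x -> pos_part x = x.
Proof. intros H. unfold pos_part. rewrite Rabs_pos_eq by auto. field. Qed.
Lemma pos_part_neg x : x <= 0 -> pos_part x = 0.
Proof. intros H. unfold pos_part. rewrite Rabs_left1 by auto. field. Qed.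

Lemma pos_part_continuous x : continuous pos_part x.
Proof.
  apply (continuous_mult (K := R_AbsRing) (fun x => x + Rabs x)); [|apply continuous_const].
  apply (continuous_plus (V := R_NormedModule) (fun x => x) Rabs); [apply continuous_id|apply continuous_Rabs].
Qed.

Lemma pos_part_sqr_derive x : is_derive (fun x => pos_part x ^ 2) x (2 * pos_part x).
Proof.
  destruct (Rtotal_order x 0) as [H|[->|H]].
  - rewrite pos_part_neg by lra. apply (is_derive_ext_loc (fun _ => 0)).
    + apply (locally_interval _ x m_infty 0); simpl; auto. intros y _ Hy. rewrite pos_part_neg by (simpl in Hy; lra).
      req. ring.
    + rewrite Rmult_0_r. apply (is_derive_const (K := R_AbsRing) (V := R_NormedModule)).
  - rewrite pos_part_neg by lra. rewrite Rmult_0_r. apply is_derive_Reals. intros eps Heps.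
    exists (mkposreal _ Heps). simpl. intros h Hh0 Hh. rewrite Rplus_0_l, (pos_part_neg 0) by lra.
    replace ((pos_part h * (pos_part h * 1) - 0 * (0 * 1)) / h - 0) with (pos_part h * pos_part h / h) by (field; auto).
    destruct (Rle_dec h 0) as [H|H].
    + rewrite pos_part_neg by lra. replace (0 * 0 / h) with 0 by (field; auto). now rewrite Rabs_R0.
    + rewrite pos_part_pos by lra. replace (h * h / h) with h by (field; auto). exact Hh.
  - rewrite pos_part_pos by lra. apply (is_derive_ext_loc (fun x => x ^ 2)).
    + apply (locally_interval _ x 0 p_infty); simpl; auto. intros y Hy _. simpl in Hy. rewrite pos_part_pos by lra.
      reflexivity.
    + auto_derive; [easy|ring].
Qed.

Lemma pos_part_cube_derive x : is_derive (fun x => pos_part x ^ 3) x (3 * pos_part x ^ 2).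
Proof.
  apply (is_derive_ext (fun x => x * pos_part x ^ 2)).
  - intros t. req. destruct (Rle_dec 0 t); [rewrite pos_part_pos by lra|rewrite pos_part_neg by lra]; ring.
  - eapply is_derive_eq.
    + apply (is_derive_mult (fun x => x) (fun x => pos_part x ^ 2)).
      * apply (is_derive_id (K := R_AbsRing)). * apply pos_part_sqr_derive. * apply Rmult_comm.
    + unfold plus, mult, one; simpl. req.
      destruct (Rle_dec 0 x); [rewrite pos_part_pos by lra|rewrite pos_part_neg by lra]; ring.
Qed.

Lemma class_C_local k U f :
  (forall z, U z -> exists V, V z /\ class_C k V f) -> class_C k U f.
Proof.
  revert f. induction k; intros f H.
  - split; auto. intros z Hz. destruct (H z Hz) as [V [Vz [Hc _]]]. auto.
  - split; [|split; [|split]].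
    + intros z Hz. destruct (H z Hz) as [V [Vz [Hc _]]]. auto.
    + intros z Hz. destruct (H z Hz) as [V [Vz [_ [Hc _]]]]. auto.
    + apply IHk. intros z Hz. destruct (H z Hz) as [V [Vz [_ [_ [Hc _]]]]]. eauto.
    + apply IHk. intros z Hz. destruct (H z Hz) as [V [Vz [_ [_ [_ Hc]]]]]. eauto.
Qed.

Definition reflect (rho : R) (z : C) : C := (rho * fst z, - (rho * snd z)).

Lemma class_C_reflect k (U V : C -> Prop) rho f : open U -> open V ->
  (forall z, U z -> V (reflect rho z)) -> class_C k V f -> class_C k U (fun z => f (reflect rho z)).
Proof.
  intros HU HV HUV.
  assert (Hr1 : forall z, D2 (fun z => rho * fst z) z rho 0).
  { intros z. eapply D2_eq; [apply D2_scal, D2_fst|ring|ring]. }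
  assert (Hr2 : forall z, D2 (fun z => - (rho * snd z)) z 0 (- rho)).
  { intros z. eapply D2_eq; [apply D2_opp, D2_scal, D2_snd|ring|ring]. }
  revert f. induction k; intros f Hf.
  - split; auto. intros z Hz. apply (continuous_comp (reflect rho) f).
    + apply continuous_pair; eapply D2_continuous; [apply Hr1|apply Hr2].
    + apply Hf, HUV, Hz.
  - apply (class_C_S k U _ (fun z => rho * du f (reflect rho z)) (fun z => - rho * dv f (reflect rho z)) HU).
    + intros z Hz. assert (HD := class_C_D2 V f _ HV (class_C_le' 1 (S k) V f ltac:(lia) Hf) (HUV z Hz)).
      eapply D2_eq; [exact (D2_comp f _ _ z _ _ _ _ _ _ HD (Hr1 z) (Hr2 z))|ring|ring].
    + apply (class_C_mult k U (fun _ => rho)); [exact HU|apply class_C_const|]. apply IHk, Hf.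
    + apply (class_C_mult k U (fun _ => - rho)); [exact HU|apply class_C_const|]. apply IHk, Hf.
Qed.

(** Of class C^2, zero for [|z| <= 1/2]; the factor is [(3/4)^-3], which makes it one
    on the unit circle. *)
Definition cutoff (z : C) : R := 64 / 27 * pos_part (fst z * fst z + snd z * snd z - 1 / 4) ^ 3.

Lemma cutoff_class_C2 U : open U -> class_C 2 U cutoff.
Proof.
  intros HU.
  set (s := fun z : C => fst z * fst z + snd z * snd z - 1 / 4).
  assert (Hs : forall z, D2 s z (2 * fst z) (2 * snd z)).
  { intros z. eapply D2_eq.
    - apply D2_minus; [|apply (D2_const (1 / 4))]. apply D2_plus; apply D2_mult; first [apply D2_fst|apply D2_snd].
    - ring.
    - ring. }
  assert (C1 : forall k, class_C k U (fun z : C => fst z)).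
  { intros [|k]; [split; auto; intros z _; apply continuous_fst_C|].
    apply (class_C_S k U _ (fun _ => 1) (fun _ => 0) HU); try apply class_C_const. intros; apply D2_fst. }
  assert (C2 : forall k, class_C k U (fun z : C => snd z)).
  { intros [|k]; [split; auto; intros z _; apply continuous_snd_C|].
    apply (class_C_S k U _ (fun _ => 0) (fun _ => 1) HU); try apply class_C_const. intros; apply D2_snd. }
  assert (P1 : class_C 0 U (fun z => pos_part (s z))).
  { split; auto. intros z _. apply (continuous_comp s pos_part); [|apply pos_part_continuous].
    eapply D2_continuous; apply Hs. }
  assert (P2 : class_C 1 U (fun z => pos_part (s z) ^ 2)).
  { apply (class_C_S 0 U _ (fun z => 2 * pos_part (s z) * (2 * fst z)) (fun z => 2 * pos_part (s z) * (2 * snd z)) HU).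
    - intros z _. exact (D2_comp1 (fun x => pos_part x ^ 2) s z _ _ _ (pos_part_sqr_derive (s z)) (Hs z)).
    - pose proof (C1 0%nat). cC.
    - pose proof (C2 0%nat). cC. }
  assert (P3 : class_C 2 U (fun z => pos_part (s z) ^ 3)).
  { apply (class_C_S 1 U _ (fun z => 3 * pos_part (s z) ^ 2 * (2 * fst z)) (fun z => 3 * pos_part (s z) ^ 2 * (2 * snd z)) HU).
    - intros z _. exact (D2_comp1 (fun x => pos_part x ^ 3) s z _ _ _ (pos_part_cube_derive (s z)) (Hs z)).
    - pose proof (C1 1%nat). cC.
    - pose proof (C2 1%nat). cC. }
  unfold cutoff. fold s. apply (class_C_mult 2 U (fun _ => 64 / 27)); auto. apply class_C_const.
Qed.

Lemma disc_open r : open (disc r).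
Proof.
  intros z Hz. apply Cball_locally. exists (r - Cmod z). unfold disc in *. split; [lra|].
  intros y Hy. replace y with ((y - z) + z)%C by ring. eapply Rle_lt_trans; [apply Cmod_triangle|]. lra.
Qed.

Lemma Cmod_sqr (z : C) : fst z * fst z + snd z * snd z = Cmod z * Cmod z.
Proof.
  unfold Cmod. rewrite sqrt_sqrt; [ring|]. apply Rplus_le_le_0_compat; apply pow2_ge_0.
Qed.

Lemma reflect_polar rho t : reflect rho (polar 1 t) = turning rho (-1) t.
Proof.
  unfold reflect, turning, polar. simpl. replace (-1 * t) with (- t) by ring. rewrite cos_neg, sin_neg.
  apply injective_projections; simpl; ring.
Qed.

Lemma reflect_Cmod rho z : 0 <= rho -> Cmod (reflect rho z) = rho * Cmod z.
Proof.
  intros H. replace (reflect rho z) with (RtoC rho * Cconj z)%C.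
  - rewrite Cmod_mult, Cmod_R, Cmod_conj, Rabs_pos_eq; auto.
  - apply injective_projections; simpl; ring.
Qed.

(** Convex combinations with a fixed point of the half-space contract the surface
    near the puncture; conjugation makes the boundary clockwise. *)
Lemma spanning_disk_exists Omega X rho : bryant_end Omega X -> 0 < rho ->
  (forall z, disc (2 * rho) z -> Omega z) -> exists k, spanning_disk X (turning rho (-1)) k.
Proof.
  intros HB Hr HD.
  (* the fixed point is (0, 0, 1) *)
  set (mix := fun (c : R) (f : Pt -> R) z => c + cutoff z * (f (X (reflect rho z)) - c)).
  exists (fun z => ((mix 0 px z, mix 0 py z), mix 1 pw z)).
  assert (HU : open (punctured Omega)) by (apply punctured_open, HB).
  assert (Hlow : forall z, Cmod z <= 1 / 2 -> cutoff z = 0).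
  { intros z Hz. unfold cutoff. rewrite pos_part_neg; [ring|]. rewrite Cmod_sqr.
    pose proof (Cmod_ge_0 z). nra. }
  assert (Hin : forall z, disc 2 z -> z <> 0%C -> punctured Omega (reflect rho z)).
  { intros z Hz H0. split.
    - apply HD. unfold disc in *. rewrite reflect_Cmod; nra.
    - apply Cmod_gt_0. rewrite reflect_Cmod by lra. apply Cmod_gt_0 in H0. nra. }
  assert (HC : forall c f, class_C 2 (punctured Omega) (fun z => f (X z)) -> class_C 2 (disc 2) (mix c f)).
  { intros c f Hf. apply class_C_local. intros z Hz.
    destruct (Rlt_dec (Cmod z) (1 / 2)) as [H|H].
    - exists (disc (1 / 2)). split; [exact H|].
      apply (class_C_ext 2 (disc (1 / 2)) (fun _ => c)); [apply disc_open| |apply class_C_const].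
      intros y Hy. unfold mix. rewrite Hlow by (unfold disc in Hy; lra). ring.
    - exists (punctured (disc 2)).
      assert (HO : open (punctured (disc 2))) by apply punctured_open, disc_open.
      split.
      + split; auto. apply Cmod_gt_0. lra.
      + assert (Hc : class_C 2 (punctured (disc 2)) cutoff) by now apply cutoff_class_C2.
        assert (HX : class_C 2 (punctured (disc 2)) (fun z => f (X (reflect rho z)))).
        { apply (class_C_reflect 2 (punctured (disc 2)) (punctured Omega) rho (fun z => f (X z))); auto.
          intros y [Hy1 Hy2]. auto. }
        unfold mix. apply (class_C_plus 2 _ (fun _ => c)); [exact HO|apply class_C_const|].
        apply class_C_mult; [exact HO|exact Hc|].
        apply (class_C_minus 2 _ (fun z => f (X (reflect rho z))) (fun _ => c)); [exact HO|exact HX|apply class_C_const]. }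
  assert (HX2 : class_C_Pt 2 (punctured Omega) X) by apply HB.
  split; [|split].
  - exists 2. split; [lra|]. split; [|split].
    + apply (HC 0 px), HX2. + apply (HC 0 py), HX2. + apply (HC 1 pw), HX2.
  - intros z Hz. unfold H3, pw at 1, mix. simpl. unfold closed_disc in Hz.
    destruct (Rle_dec (Cmod z) (1 / 2)) as [H|H]; [rewrite Hlow by auto; lra|].
    assert (Hw : 0 < pw (X (reflect rho z))).
    { assert (HP : punctured Omega (reflect rho z)).
      { apply Hin; [unfold disc; lra|]. apply Cmod_gt_0. lra. }
      apply HB in HP. apply HP. }
    assert (Hc : 0 <= cutoff z <= 1).
    { unfold cutoff. rewrite Cmod_sqr. rewrite pos_part_pos by nra.
      assert (0 <= Cmod z * Cmod z - 1 / 4 <= 3 / 4) by nra. set (v := Cmod z * Cmod z - 1 / 4) in *.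
      assert (0 <= v ^ 3 <= (3 / 4) ^ 3) by (split; [apply pow_le; lra|apply pow_incr; lra]). lra. }
    destruct (Req_dec (cutoff z) 0) as [E|E]; [rewrite E; lra|nra].
  - intros t. unfold mix. rewrite reflect_polar.
    assert (Hc : cutoff (polar 1 t) = 1).
    { unfold cutoff. rewrite Cmod_sqr, polar_Cmod, Rabs_R1, pos_part_pos by lra. field. }
    rewrite Hc. apply Pt_eq; unfold px, py, pw; simpl; ring.
Qed.

Lemma flux_config_exists Omega X : bryant_end Omega X -> exists gam n k, flux_config Omega X gam n k.
Proof.
  intros HB. assert (HO : open Omega) by apply HB. assert (H0 : Omega 0%C) by apply HB.
  destruct (open_ball Omega 0%C HO H0) as [r [Hr Hb]].
  assert (Hd : forall z, disc r z -> Omega z).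
  { intros z Hz. apply Hb. unfold ballC. replace (z - 0)%C with z by ring. exact Hz. }
  set (rho := r / 2). assert (Hrho : 0 < rho) by (unfold rho; lra).
  assert (Hcd : forall z, closed_disc rho z -> Omega z).
  { intros z Hz. apply Hd. unfold closed_disc, disc, rho in *. lra. }
  destruct (spanning_disk_exists Omega X rho HB Hrho) as [k Hk].
  { intros z Hz. apply Hd. unfold disc, rho in *. lra. }
  assert (Hreg := turning_regular Omega rho (-1) Hrho Hcd (or_intror eq_refl)).
  assert (Hn : forall t, exists n, conormal_at X (turning rho (-1) t) (velocity (turning rho (-1)) t) n).
  { intros t. destruct (Hreg t) as [Hz [_ [_ [_ [_ Hv]]]]]. now apply (conormal_exists Omega). }
  exists (turning rho (-1)), (fun t => proj1_sig (ClassicalEpsilon.constructive_indefinite_description _ (Hn t))), k.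
  split; [now apply end_generator_turning|]. split; [|exact Hk].
  intros t. now destruct ClassicalEpsilon.constructive_indefinite_description.
Qed.

(** [theta] is closed, so its integral is the same for all generators. *)
Theorem is_flux_small_circle Omega X q Y rho : bryant_end Omega X ->
  (forall p, H3 p -> Y p = killing q p) -> 0 < rho -> (forall z, closed_disc rho z -> Omega z) ->
  is_flux Omega X Y (loop_int (thetaU q X) (thetaV q X) (turning rho (-1))).
Proof.
  intros HB HY Hr Hd. split; [now apply flux_config_exists|].
  intros gam n k [Hg [Hn Hk]].
  rewrite (flux_is_loop_int Omega X q Y gam n k HB HY (proj1 Hg) Hn Hk).
  apply (end_generator_loop_int Omega X); auto.
  apply theta_closed.
  - apply punctured_open, HB. - apply HB. - intros z Hz. now apply HB.
  - intros z Hz. now apply (bryant_cmc_one Omega).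
Qed.

(** * Bryant representations *)

Definition quad_scal (c : C) (q : quad) : quad := ((c * qc0 q, c * qc1 q), c * qc2 q)%C.

(** Up to a factor, the Killing form of [sl_2(C)]. *)
Definition pairing (q p : quad) : C :=
  (qc1 q * qc1 p / 2 - qc0 q * qc2 p - qc2 q * qc0 p)%C.

(** The tangent vectors to a represented surface are values of Killing fields
    [killing (v p)], where [v] is the tangent vector in the parameter and [p] is
    holomorphic; then [theta] is twice the imaginary part of the holomorphic
    1-form [pairing q p]. *)
Lemma theta_killing q p x : 0 < pw x ->
  - hip x (killing (quad_scal Ci p) x) (killing q x) - sigma q x (killing p x) = 2 * Im (pairing q p).
Proof.
  intros Hx.
  destruct q as [[[a0 b0] [a1 b1]] [a2 b2]], p as [[[c0 d0] [c1 d1]] [c2 d2]], x as [[x y] w].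
  unfold pw in Hx. simpl in Hx.
  unfold hip, edot, sigma, killing, qeval, quad_scal, pairing, px, py, pw, qc0, qc1, qc2, Im, Re. simpl.
  field. lra.
Qed.

Lemma killing_opp p x : killing (quad_scal Ci (quad_scal Ci p)) x = vscal (-1) (killing p x).
Proof.
  destruct p as [[[c0 d0] [c1 d1]] [c2 d2]], x as [[x y] w].
  apply Pt_eq; unfold killing, qeval, quad_scal, vscal, px, py, pw, qc0, qc1, qc2, Im, Re; simpl; ring.
Qed.

Lemma theta_killing' q p x : 0 < pw x ->
  hip x (killing p x) (killing q x) - sigma q x (killing (quad_scal Ci p) x) = 2 * Im (Ci * pairing q p)%C.
Proof.
  intros Hx. replace (Ci * pairing q p)%C with (pairing q (quad_scal Ci p)).
  - rewrite <- (theta_killing q (quad_scal Ci p) x Hx), killing_opp. unfold hip, Rdiv. rewrite edot_vscal_l. ring.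
  - unfold pairing, quad_scal, qc0, qc1, qc2. simpl. field.
Qed.

(** The quadratic field attached to the matrix [F^{-1} dF] conjugated by [F], that is
    to [dF F^{-1}]: [om] times the square of the linear form defined by the column
    [F (g, 1)]. *)
Definition bryant_quad (A B C0 D g om : C) : quad :=
  ((om * (C0 * g + D) ^ 2, - (2) * om * (A * g + B) * (C0 * g + D)), om * (A * g + B) ^ 2)%C.

(** The point [(Z / m, 1 / m)] of a represented surface is the image of a base point
    under [F], so it moves with velocity the Killing field of [dF F^{-1}]. These are
    the two components of this identity. *)
Lemma bryant_algebra (A B C0 D g om v m : C) :
  (A * D - B * C0 = 1)%C -> (m = A * Cconj A + B * Cconj B)%C -> m <> 0%C ->
  let a := (A * g + B)%C in let e := (C0 * g + D)%C in
  let Z := (Cconj A * C0 + Cconj B * D)%C in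
  let A' := (om * a)%C in let B' := (- g * om * a)%C in
  let C' := (om * e)%C in let D' := (- g * om * e)%C in
  let m' := (A' * v * Cconj A + A * Cconj (A' * v) + B' * v * Cconj B + B * Cconj (B' * v))%C in
  let Z' := (Cconj (A' * v) * C0 + Cconj A * (C' * v) + Cconj (B' * v) * D + Cconj B * (D' * v))%C in
  ((Z' * m - Z * m') / (m * m)
    = v * om * e ^ 2 + v * (- (2) * om * a * e) * (Z / m) + v * om * a ^ 2 * (Z / m) ^ 2
      - Cconj (v * om * a ^ 2) / (m * m))%C /\
  (m' = - m * ((v * (- (2) * om * a * e) + 2 * (v * om * a ^ 2) * (Z / m))
         + Cconj (v * (- (2) * om * a * e) + 2 * (v * om * a ^ 2) * (Z / m))) / 2)%C.
Proof.
  intros Hdet Hm Hm0 a e Z A' B' C' D' m' Z'.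
  assert (L1 : (e * m - a * Z = Cconj A - g * Cconj B)%C).
  { transitivity ((Cconj A - g * Cconj B) * (A * D - B * C0))%C; [unfold e, a, Z; rewrite Hm; ring|rewrite Hdet; ring]. }
  assert (L2 : ((C0 - Cconj g * D) * m - Z * (A - Cconj g * B) = - Cconj a)%C).
  { transitivity (- Cconj a * (A * D - B * C0))%C; [unfold a, Z; rewrite Hm, Cplus_conj, Cmult_conj; ring|rewrite Hdet; ring]. }
  assert (Hcm : Cconj m = m) by (rewrite Hm, Cplus_conj, !Cmult_conj, !Cconj_conj; ring).
  assert (Hm' : m' = (om * v * a * (Cconj A - g * Cconj B) + Cconj (om * v * a) * (A - Cconj g * B))%C).
  { unfold m', A', B'. rewrite !Cmult_conj, !Copp_conj. ring. }
  assert (HZ' : Z' = (Cconj (om * v * a) * (C0 - Cconj g * D) + om * v * e * (Cconj A - g * Cconj B))%C).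
  { unfold Z', A', B', C', D'. rewrite !Cmult_conj, !Copp_conj. ring. }
  split.
  - transitivity ((om * v * (e * m - a * Z) * (e * m - a * Z) +
       Cconj (om * v * a) * ((C0 - Cconj g * D) * m - Z * (A - Cconj g * B))) / (m * m))%C.
    + rewrite L1, Hm', HZ'.
      replace (om * v * (Cconj A - g * Cconj B) * (Cconj A - g * Cconj B))%C
        with (om * v * (Cconj A - g * Cconj B) * (e * m - a * Z))%C by (rewrite L1; ring).
      field. exact Hm0.
    + rewrite L2. replace (v * om * a ^ 2)%C with (om * v * a * a)%C by ring.
      rewrite (Cmult_conj (om * v * a) a). field. exact Hm0.
  - rewrite Hm'. rewrite <- L1.
    assert (L3 : (A - Cconj g * B = Cconj e * m - Cconj a * Cconj Z)%C).
    { rewrite <- (Cconj_conj (A - Cconj g * B)), Cminus_conj, Cmult_conj, Cconj_conj, <- L1,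
        Cminus_conj, !Cmult_conj, Hcm. reflexivity. }
    rewrite L3. rewrite !Cplus_conj, !Cmult_conj.
    replace (Cconj (Z / m)) with (Cconj Z / m)%C by (rewrite Cdiv_conj, Hcm; auto).
    rewrite !Copp_conj. replace (Cconj 2) with (RtoC 2) by (apply injective_projections; simpl; ring).
    simpl Cpow. rewrite ?Cmult_conj.
    replace (Cconj 1) with (RtoC 1) by (apply injective_projections; simpl; ring).
    field. exact Hm0.
Qed.

Definition Pt_D2 (X : C -> Pt) (z : C) (a b : Pt) : Prop :=
  D2 (fun y => px (X y)) z (px a) (px b) /\ D2 (fun y => py (X y)) z (py a) (py b) /\
  D2 (fun y => pw (X y)) z (pw a) (pw b).

Lemma Pt_D2_partials X z a b : Pt_D2 X z a b -> du_Pt X z = a /\ dv_Pt X z = b.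
Proof.
  intros [H1 [H2 H3]]. apply D2_partials in H1. apply D2_partials in H2. apply D2_partials in H3.
  split; apply Pt_eq; unfold px, py, pw, du_Pt, dv_Pt; simpl; tauto.
Qed.

Lemma Pt_D2_ext_loc X Y z a b : locally z (fun y => X y = Y y) -> Pt_D2 X z a b -> Pt_D2 Y z a b.
Proof.
  intros H [H1 [H2 H3]]. split; [|split]; eapply D2_ext_loc; try eassumption;
    revert H; apply filter_imp; intros y ->; reflexivity.
Qed.

Lemma weierstrass_solve (A B C0 D g om A' B' C' D' : C) :
  (A * D - B * C0 = 1)%C ->
  (D * A' - B * C' = g * om)%C -> (D * B' - B * D' = - (g ^ 2) * om)%C ->
  (- C0 * A' + A * C' = om)%C -> (- C0 * B' + A * D' = - g * om)%C ->
  (A' = om * (A * g + B) /\ B' = - g * om * (A * g + B) /\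
   C' = om * (C0 * g + D) /\ D' = - g * om * (C0 * g + D))%C.
Proof.
  intros Hdet H1 H2 H3 H4. split; [|split; [|split]].
  - transitivity ((A * D - B * C0) * A')%C; [rewrite Hdet; ring|].
    transitivity (A * (D * A' - B * C') + B * (- C0 * A' + A * C'))%C; [ring|rewrite H1, H3; ring].
  - transitivity ((A * D - B * C0) * B')%C; [rewrite Hdet; ring|].
    transitivity (A * (D * B' - B * D') + B * (- C0 * B' + A * D'))%C; [ring|rewrite H2, H4; ring].
  - transitivity ((A * D - B * C0) * C')%C; [rewrite Hdet; ring|].
    transitivity (C0 * (D * A' - B * C') + D * (- C0 * A' + A * C'))%C; [ring|rewrite H1, H3; ring].
  - transitivity ((A * D - B * C0) * D')%C; [rewrite Hdet; ring|].
    transitivity (C0 * (D * B' - B * D') + D * (- C0 * B' + A * D'))%C; [ring|rewrite H2, H4; ring].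
Qed.

Lemma Cdiv_RtoC (x y r : R) : r <> 0 -> ((x, y) / RtoC r)%C = (x / r, y / r).
Proof. intros H. apply injective_projections; simpl; field; intros E; nra. Qed.

Lemma Cmod_sqr_RtoC (A : C) : RtoC (fst A * fst A + snd A * snd A) = (A * Cconj A)%C.
Proof. destruct A. apply injective_projections; simpl; ring. Qed.

(** A represented surface moves along the infinitesimal isometries [dF F^{-1}]. *)
Lemma bryant_tangent (U : C -> Prop) X A B C0 D g om z : locally z U ->
  bryant_rep U X A B C0 D -> weierstrass_data U A B C0 D g om ->
  let p := bryant_quad (A z) (B z) (C0 z) (D z) (g z) (om z) in
  0 < pw (X z) /\ Pt_D2 X z (killing p (X z)) (killing (quad_scal Ci p) (X z)).
Proof.
  intros HU HR HW p. pose proof (locally_singleton _ _ HU) as Hz.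
  destruct (HR z Hz) as [Hdet _].
  destruct (HW z Hz) as [A' [B' [C' [D' [dA [dB [dC [dD [W1 [W2 [W3 W4]]]]]]]]]]].
  destruct (weierstrass_solve _ _ _ _ _ _ _ _ _ _ Hdet W1 W2 W3 W4) as [EA [EB [EC ED]]].
  apply complex_derive_D2 in dA, dB, dC, dD.
  destruct dA as [dA1 dA2], dB as [dB1 dB2], dC as [dC1 dC2], dD as [dD1 dD2].
  set (a1 := fun y => Re (A y)) in *. set (a2 := fun y => Im (A y)) in *.
  set (b1 := fun y => Re (B y)) in *. set (b2 := fun y => Im (B y)) in *.
  set (c1 := fun y => Re (C0 y)) in *. set (c2 := fun y => Im (C0 y)) in *.
  set (d1 := fun y => Re (D y)) in *. set (d2' := fun y => Im (D y)) in *.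
  set (m := fun y => (a1 y * a1 y + a2 y * a2 y) + (b1 y * b1 y + b2 y * b2 y)).
  set (Z1 := fun y => (a1 y * c1 y + a2 y * c2 y) + (b1 y * d1 y + b2 y * d2' y)).
  set (Z2 := fun y => (a1 y * c2 y - a2 y * c1 y) + (b1 y * d2' y - b2 y * d1 y)).
  assert (Hmpos : forall y, U y -> 0 < m y).
  { intros y Hy. destruct (HR y Hy) as [Hd _]. unfold m.
    destruct (Rle_lt_dec ((a1 y * a1 y + a2 y * a2 y) + (b1 y * b1 y + b2 y * b2 y)) 0) as [Hle|]; auto. exfalso.
    assert (a1 y = 0 /\ a2 y = 0 /\ b1 y = 0 /\ b2 y = 0) as [h1 [h2 [h3 h4]]].
    { repeat split; nra. }
    unfold a1, a2, b1, b2, Re, Im in *.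
    assert (EA0 : A y = 0%C) by (apply injective_projections; assumption).
    assert (EB0 : B y = 0%C) by (apply injective_projections; assumption).
    rewrite EA0, EB0 in Hd. injection Hd. simpl. lra. }
  assert (HX : forall y, U y -> X y = ((Z1 y / m y, Z2 y / m y), / m y)).
  { intros y Hy. destruct (HR y Hy) as [_ [_ HXy]]. cbv zeta in HXy.
    assert (Em : Cmod (A y) ^ 2 + Cmod (B y) ^ 2 = m y).
    { simpl. rewrite !Rmult_1_r, <- !Cmod_sqr. reflexivity. }
    rewrite Em in HXy. rewrite HXy.
    replace (Cconj (A y) * C0 y + Cconj (B y) * D y)%C with ((Z1 y, Z2 y) : C).
    - rewrite Cdiv_RtoC by (apply Rgt_not_eq, Hmpos, Hy). unfold Rdiv at 3. now rewrite Rmult_1_l.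
    - unfold Z1, Z2, a1, a2, b1, b2, c1, c2, d1, d2', Re, Im. apply injective_projections; simpl; ring. }
  assert (Hm := Hmpos z Hz).
  assert (Hw : pw (X z) = / m z) by (rewrite (HX z Hz); reflexivity).
  split; [rewrite Hw; now apply Rinv_0_lt_compat|].
  set (mz := (m z)). fold mz in Hm, Hw.
  assert (EmC : (RtoC mz = A z * Cconj (A z) + B z * Cconj (B z))%C).
  { rewrite <- !Cmod_sqr_RtoC, <- RtoC_plus. reflexivity. }
  assert (Hm0 : RtoC mz <> 0%C) by (intros E; injection E; lra).
  set (Zz := ((Z1 z, Z2 z) : C)).
  assert (EZ : (Zz = Cconj (A z) * C0 z + Cconj (B z) * D z)%C).
  { unfold Zz, Z1, Z2, a1, a2, b1, b2, c1, c2, d1, d2', Re, Im. apply injective_projections; simpl; ring. }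
  assert (Hfst : fst (X z) = (Zz / RtoC mz)%C).
  { rewrite (HX z Hz). simpl. unfold Zz. rewrite Cdiv_RtoC by lra. reflexivity. }
  (* the derivatives in the directions 1 and i *)
  set (mp := fun v : C => (A' * v * Cconj (A z) + A z * Cconj (A' * v) + B' * v * Cconj (B z) + B z * Cconj (B' * v))%C).
  set (Zp := fun v : C => (Cconj (A' * v) * C0 z + Cconj (A z) * (C' * v) + Cconj (B' * v) * D z + Cconj (B z) * (D' * v))%C).
  assert (Hkill : forall v, killing (quad_scal v p) (X z) =
    ((fst ((Zp v * RtoC mz - Zz * mp v) / (RtoC mz * RtoC mz)), snd ((Zp v * RtoC mz - Zz * mp v) / (RtoC mz * RtoC mz)))%C,
     - fst (mp v) / (mz * mz))).
  { intros v.
    destruct (bryant_algebra (A z) (B z) (C0 z) (D z) (g z) (om z) v (RtoC mz) Hdet EmC Hm0) as [H1 H2].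
    cbv zeta in H1, H2. rewrite <- EA, <- EB, <- EC, <- ED in H1.
    rewrite <- EA, <- EB in H2. fold (mp v) in H1, H2. fold (Zp v) in H1. rewrite <- EZ in H1, H2.
    rewrite H1. unfold killing. rewrite Hw, Hfst. rewrite <- surjective_pairing. f_equal.
    - unfold qeval, quad_scal, p, bryant_quad, qc0, qc1, qc2. cbn [fst snd].
      replace (RtoC ((/ mz) ^ 2)) with (/ (RtoC mz * RtoC mz))%C.
      + rewrite (Cmult_assoc v (om z) ((A z * g z + B z) ^ 2)). unfold Cdiv. ring.
      + replace ((/ mz) ^ 2) with (/ (mz * mz)) by (field; lra).
        rewrite <- RtoC_mult, <- RtoC_inv by nra. reflexivity.
    - unfold quad_scal, p, bryant_quad, qc0, qc1, qc2. cbn [fst snd].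
      set (W := (v * (- (2) * om z * (A z * g z + B z) * (C0 z * g z + D z)) +
          2 * (v * om z * (A z * g z + B z) ^ 2) * (Zz / RtoC mz))%C) in H2.
      replace (v * (- (2) * om z * (A z * g z + B z) * (C0 z * g z + D z)) +
          2 * (v * (om z * (A z * g z + B z) ^ 2)) * (Zz / RtoC mz))%C with W by (unfold W; ring).
      rewrite H2. generalize W. intros [W1' W2']. simpl. field. lra. }
  replace (killing p (X z)) with (killing (quad_scal 1 p) (X z)).
  2:{ f_equal. unfold quad_scal, p, bryant_quad, qc0, qc1, qc2. cbn [fst snd]. rewrite !Cmult_1_l. reflexivity. }
  rewrite !Hkill.
  assert (HXl : locally z (fun y => ((Z1 y / m y, Z2 y / m y), / m y) = X y)).
  { revert HU. apply filter_imp. intros y Hy. symmetry. now apply HX. }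
  apply (Pt_D2_ext_loc _ _ _ _ _ HXl).
  assert (Dm : exists u v, D2 m z u v /\ mp 1%C = RtoC u /\ mp Ci = RtoC v).
  { do 2 eexists. split; [unfold m; d2|].
    unfold mp, a1, a2, b1, b2, Re, Im. split; apply injective_projections; simpl; ring. }
  assert (DZ : exists u v u' v', D2 Z1 z u v /\ D2 Z2 z u' v' /\ Zp 1%C = (u, u') /\ Zp Ci = (v, v')).
  { do 4 eexists. split; [unfold Z1; d2|]. split; [unfold Z2; d2|].
    unfold Zp, a1, a2, b1, b2, c1, c2, d1, d2', Re, Im. split; apply injective_projections; simpl; ring. }
  destruct Dm as [mu [mv [Dm [M1 M2]]]]. destruct DZ as [zu [zv [zu' [zv' [DZ1 [DZ2 [E1 E2]]]]]]].
  rewrite M1, M2, E1, E2.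
  assert (Hm0' : m z <> 0) by (fold mz; lra).
  assert (Hq : forall x y u, (((x, y) * RtoC mz - Zz * RtoC u) / (RtoC mz * RtoC mz))%C =
    ((x * mz - Z1 z * u) / mz ^ 2, (y * mz - Z2 z * u) / mz ^ 2)).
  { intros x y u. rewrite <- RtoC_mult. unfold Zz.
    replace ((x, y) * RtoC mz - (Z1 z, Z2 z) * RtoC u)%C with ((x * mz - Z1 z * u, y * mz - Z2 z * u) : C)
      by (apply injective_projections; simpl; ring).
    rewrite Cdiv_RtoC by nra. f_equal; field; lra. }
  rewrite !Hq. unfold px, py, pw. cbn [fst snd].
  split; [|split].
  - exact (D2_div Z1 m z _ _ _ _ DZ1 Dm Hm0').
  - exact (D2_div Z2 m z _ _ _ _ DZ2 Dm Hm0').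
  - eapply D2_eq; [exact (D2_inv m z _ _ Dm Hm0')| |]; unfold mz; simpl; field; exact Hm0'.
Qed.

(** * The flux of a canonical end *)

(** The use of Bryant representations here: [theta] becomes twice the imaginary part
    of a holomorphic form, so that only a residue will matter. *)
Lemma along_bryant (U : C -> Prop) X A B C0 D g om q (gam : R -> C) t :
  locally (gam t) U -> bryant_rep U X A B C0 D -> weierstrass_data U A B C0 D g om ->
  along (thetaU q X) (thetaV q X) gam t =
  2 * Im (pairing q (bryant_quad (A (gam t)) (B (gam t)) (C0 (gam t)) (D (gam t)) (g (gam t)) (om (gam t)))
          * velocity gam t)%C.
Proof.
  intros HU HR HW. destruct (bryant_tangent U X A B C0 D g om (gam t) HU HR HW) as [Hw HD].
  destruct (Pt_D2_partials _ _ _ _ HD) as [E1 E2].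
  unfold along, thetaU, thetaV. rewrite E1, E2, theta_killing, theta_killing' by exact Hw.
  generalize (pairing q (bryant_quad (A (gam t)) (B (gam t)) (C0 (gam t)) (D (gam t)) (g (gam t)) (om (gam t)))).
  intros [x y]. destruct (velocity gam t) as [v1 v2]. unfold Im. simpl. ring.
Qed.

Definition rotated (z0 : C) (t : R) : C := (z0 * turning 1 (-1) t)%C.

Lemma rotated_derive z0 t :
  is_derive (fun t => fst (rotated z0 t)) t (snd (rotated z0 t)) /\
  is_derive (fun t => snd (rotated z0 t)) t (- fst (rotated z0 t)).
Proof.
  unfold rotated, turning, polar. simpl. split; auto_derive; auto; ring.
Qed.

Lemma rotated_velocity z0 t : velocity (rotated z0) t = (- Ci * rotated z0 t)%C.
Proof.
  destruct (rotated_derive z0 t) as [H1 H2].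
  transitivity ((snd (rotated z0 t), - fst (rotated z0 t)) : C).
  - apply injective_projections; apply is_derive_unique; assumption.
  - apply injective_projections; simpl; ring.
Qed.

Lemma rotated_Cmod z0 t : Cmod (rotated z0 t) = Cmod z0.
Proof. unfold rotated. rewrite Cmod_mult, turning_Cmod by lra. ring. Qed.

Lemma rotated_periodic z0 t : rotated z0 (t + 2 * PI) = rotated z0 t.
Proof. unfold rotated. now rewrite turning_periodic by now right. Qed.

Lemma rotated_continuous z0 t : continuous (rotated z0) t.
Proof.
  destruct (rotated_derive z0 t) as [H1 H2].
  apply (continuous_ext (fun s => (fst (rotated z0 s), snd (rotated z0 s)) : C)).
  - intros s. symmetry. apply surjective_pairing.
  - apply continuous_pair; apply (ex_derive_continuous (K := R_AbsRing) (V := R_NormedModule));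
      eexists; eassumption.
Qed.

Lemma rotated_regular Omega (z0 : C) : z0 <> 0%C -> (forall z, closed_disc (Cmod z0) z -> Omega z) ->
  regular_loop Omega (rotated z0).
Proof.
  intros Hz HO t. destruct (rotated_derive z0 t) as [H1 H2].
  assert (H0 : rotated z0 t <> 0%C).
  { apply Cmod_gt_0. rewrite rotated_Cmod. apply Cmod_gt_0. exact Hz. }
  split; [|split; [|split; [|split; [|split]]]].
  - split; [|exact H0]. apply HO. unfold closed_disc. rewrite rotated_Cmod; lra.
  - apply rotated_periodic.
  - eexists; exact H1.
  - eexists; exact H2.
  - apply (continuous_ext (fun t => (snd (rotated z0 t), - fst (rotated z0 t)) : C)).
    + intros s. rewrite rotated_velocity. generalize (rotated z0 s). intros w. apply injective_projections; simpl; req; ring.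
    + apply continuous_pair; [|apply (continuous_opp (V := R_NormedModule))];
        apply (ex_derive_continuous (K := R_AbsRing) (V := R_NormedModule)); eexists; eassumption.
  - rewrite rotated_velocity. intros E. apply H0.
    apply (f_equal (fun w => Ci * w)%C) in E.
    replace (Ci * (- Ci * rotated z0 t))%C with (rotated z0 t) in E.
    + rewrite E. ring.
    + apply injective_projections; simpl; ring.
Qed.

Lemma complex_derive_along (G : C -> C) (gam : R -> C) t (l : C) :
  complex_derive G (gam t) l ->
  ex_derive (fun s => fst (gam s)) t -> ex_derive (fun s => snd (gam s)) t ->
  is_derive (fun s => Re (G (gam s))) t (Re (l * velocity gam t)%C) /\
  is_derive (fun s => Im (G (gam s))) t (Im (l * velocity gam t)%C).
Proof.
  intros HG Hx Hy. apply complex_derive_D2 in HG. destruct HG as [H1 H2].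
  split; eapply is_derive_eq.
  - exact (D2_velocity _ gam t _ _ H1 Hx Hy).
  - unfold Re, Im. simpl. ring.
  - exact (D2_velocity _ gam t _ _ H2 Hx Hy).
  - unfold Re, Im. simpl. ring.
Qed.

Lemma pairing_bryant q A B C0 D g om :
  pairing q (bryant_quad A B C0 D g om) =
  (- (qc1 q * (om * (A * g + B) * (C0 * g + D)) + qc0 q * (om * (A * g + B) ^ 2)
      + qc2 q * (om * (C0 * g + D) ^ 2)))%C.
Proof. unfold pairing, bryant_quad, qc0, qc1, qc2. simpl. field. Qed.

(** The form [pairing q p] is, up to an exact form, [dg] times the value of the
    quadratic form [q] on the first column of the Bryant representation. For [g] a
    power of the coordinate this exhibits its pole. *)
Lemma pairing_primitive A B C0 D g om q z :
  (A z * D z - B z * C0 z = 1)%C ->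
  (exists A' B' C' D' : C,
      complex_derive A z A' /\ complex_derive B z B' /\
      complex_derive C0 z C' /\ complex_derive D z D' /\
      (D z * A' - B z * C' = g z * om z)%C /\
      (D z * B' - B z * D' = - (g z ^ 2) * om z)%C /\
      (- C0 z * A' + A z * C' = om z)%C /\
      (- C0 z * B' + A z * D' = - g z * om z)%C) ->
  forall g' : C, complex_derive g z g' ->
  complex_derive (fun y => - (qc1 q * (/ 2 * (A y * D y + B y * C0 y) + g y * (A y * C0 y))
     + qc0 q * (A y * B y + g y * (A y * A y)) + qc2 q * (C0 y * D y + g y * (C0 y * C0 y))))%C z
    (pairing q (bryant_quad (A z) (B z) (C0 z) (D z) (g z) (om z))
     - g' * (qc1 q * (A z * C0 z) + qc0 q * (A z * A z) + qc2 q * (C0 z * C0 z)))%C.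
Proof.
  intros Hdet [A' [B' [C' [D' [dA [dB [dC [dD [W1 [W2 [W3 W4]]]]]]]]]]] g' dg.
  destruct (weierstrass_solve _ _ _ _ _ _ _ _ _ _ Hdet W1 W2 W3 W4) as [EA [EB [EC ED]]].
  eapply complex_derive_eq.
  - apply complex_derive_opp. apply complex_derive_plus; [apply complex_derive_plus|]; apply complex_derive_scal;
    apply complex_derive_plus.
    + apply complex_derive_scal. apply complex_derive_plus; apply complex_derive_mult; eassumption.
    + apply complex_derive_mult; [eassumption|]. apply complex_derive_mult; eassumption.
    + apply complex_derive_mult; eassumption.
    + apply complex_derive_mult; [eassumption|]. apply complex_derive_mult; eassumption.
    + apply complex_derive_mult; eassumption.
    + apply complex_derive_mult; [eassumption|]. apply complex_derive_mult; eassumption.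
  - rewrite pairing_bryant, EA, EB, EC, ED. field.
Qed.

(** [z] times the form [g' (q_1 A C + q_0 A^2 + q_2 C^2)] of the end; it has no pole at
    the puncture because [mu >= 2]. *)
Definition residue_num (mu : nat) (f1 f2 : C -> C) (c : C) (q : quad) (z : C) : C :=
  (INR mu * z ^ (mu - 2) * (qc1 q * c * f1 z * f2 z * z + qc0 q * (f2 z * f2 z) * (z * z)
     + qc2 q * (c * c) * (f1 z * f1 z)))%C.

Lemma residue_num_0 mu (f1 f2 : C -> C) (c : C) q : (2 <= mu)%nat -> f1 0%C = 1%C -> f2 0%C = 1%C ->
  residue_num mu f1 f2 c q 0%C = if Nat.eq_dec mu 2 then (2 * (qc2 q * (c * c)))%C else 0%C.
Proof.
  intros Hmu Hf10 Hf20. unfold residue_num. rewrite Hf10, Hf20. destruct (Nat.eq_dec mu 2) as [->|Hn].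
  - simpl. apply injective_projections; simpl; ring.
  - destruct (mu - 2)%nat as [|n] eqn:E; [lia|]. simpl. ring.
Qed.

Section CanonicalEnd.
Context (Omega : C -> Prop) (X : C -> Pt) (mu : nat) (r : R) (h f1 f2 g1 g2 : C -> C) (b c : C).
Context (HB : bryant_end Omega X) (Hmu : (2 <= mu)%nat) (Hr : 0 < r)
  (HO : forall z, disc r z -> Omega z)
  (Hf1 : holomorphic_on (disc r) f1) (Hf2 : holomorphic_on (disc r) f2).
Let A := f2.
Let B := fun z => (b * z ^ (2 * mu - 1) * g2 z)%C.
Let C0 := fun z => (c * / z * f1 z)%C.
Let D := g1.
Let g := fun z : C => (z ^ mu)%C.
Let om := fun z : C => (h z / z ^ 2)%C.
Context (HR : bryant_rep (punctured (disc r)) X A B C0 D)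
  (HW : weierstrass_data (punctured (disc r)) A B C0 D g om).

(** The exact part of the form integrates to zero over a closed loop. *)
Lemma canonical_loop_int q (z0 : C) : z0 <> 0%C -> Cmod z0 < r ->
  loop_int (thetaU q X) (thetaV q X) (rotated z0)
  = - 2 * RInt (fun t => Re (residue_num mu f1 f2 c q (rotated z0 t))) 0 (2 * PI) /\
  ex_RInt (fun t => Re (residue_num mu f1 f2 c q (rotated z0 t))) 0 (2 * PI).
Proof.
  intros Hz0 Hz0r.
  assert (Hop : open (punctured (disc r))) by apply punctured_open, disc_open.
  assert (Hin : forall t, punctured (disc r) (rotated z0 t)).
  { intros t. split; [unfold disc; now rewrite rotated_Cmod|].
    apply Cmod_gt_0. rewrite rotated_Cmod. now apply Cmod_gt_0. }
  assert (Hreg : regular_loop Omega (rotated z0)).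
  { apply rotated_regular; auto. intros z Hz. apply HO. unfold closed_disc, disc in *. lra. }
  assert (HC : closed_form (punctured Omega) (thetaU q X) (thetaV q X)).
  { apply theta_closed.
    - apply punctured_open, HB. - apply HB. - intros z Hz. now apply HB.
    - intros z Hz. now apply (bryant_cmc_one Omega). }
  destruct (closed_form_cont _ _ _ HC) as [CU CV].
  assert (HI := regular_loop_integrable Omega _ _ _ CU CV Hreg).
  set (G := fun y => (- (qc1 q * (/ 2 * (A y * D y + B y * C0 y) + g y * (A y * C0 y))
     + qc0 q * (A y * B y + g y * (A y * A y)) + qc2 q * (C0 y * D y + g y * (C0 y * C0 y))))%C).
  assert (HN : forall z, disc r z -> continuous (residue_num mu f1 f2 c q) z).
  { intros z Hz. destruct (Hf1 z Hz) as [l1 d1]. destruct (Hf2 z Hz) as [l2 d2].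
    assert (dp := complex_derive_pow (fun y => y) z 1%C (mu - 2) (complex_derive_id z)).
    assert (Hex : exists l, complex_derive (residue_num mu f1 f2 c q) z l).
    { eexists. unfold residue_num.
      apply complex_derive_mult; [apply complex_derive_scal; exact dp|].
      apply complex_derive_plus; [apply complex_derive_plus|].
      - apply complex_derive_mult; [|apply complex_derive_id].
        apply complex_derive_mult; [|exact d2]. apply complex_derive_scal. exact d1.
      - apply complex_derive_mult; [apply complex_derive_scal; apply complex_derive_mult; exact d2|].
        apply complex_derive_mult; apply complex_derive_id.
      - apply complex_derive_scal. apply complex_derive_mult; exact d1. }
    destruct Hex as [l Hl]. eapply complex_derive_continuous; eauto. }
  assert (HNc : forall t, continuous (fun t => Re (residue_num mu f1 f2 c q (rotated z0 t))) t).
  { intros t. apply (continuous_comp (rotated z0) (fun y => Re (residue_num mu f1 f2 c q y))); [apply rotated_continuous|].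
    exact (proj1 (proj1 (continuous_C_pair _ _) (HN _ (proj1 (Hin t))))). }
  assert (EN : ex_RInt (fun t => Re (residue_num mu f1 f2 c q (rotated z0 t))) 0 (2 * PI)).
  { apply (ex_RInt_continuous (V := R_CompleteNormedModule)). intros t _. apply HNc. }
  split; [|exact EN].
  assert (Hder : forall t, is_derive (fun t => 2 * Im (G (rotated z0 t))) t
    (along (thetaU q X) (thetaV q X) (rotated z0) t + 2 * Re (residue_num mu f1 f2 c q (rotated z0 t)))).
  { intros t. set (z := rotated z0 t). destruct (Hin t) as [Hd Hz]. fold z in Hd, Hz.
    assert (dg := complex_derive_pow (fun y => y) z 1%C mu (complex_derive_id z)).
    assert (HG := pairing_primitive A B C0 D g om q z (proj1 (HR z (Hin t))) (HW z (Hin t)) _ dg).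
    fold G in HG.
    destruct (complex_derive_along G (rotated z0) t _ HG) as [_ H2].
    { eexists; exact (proj1 (rotated_derive z0 t)). }
    { eexists; exact (proj2 (rotated_derive z0 t)). }
    eapply is_derive_eq; [apply (is_derive_scal (fun t => Im (G (rotated z0 t))) t 2); exact H2|].
    rewrite (along_bryant (punctured (disc r)) X A B C0 D g om q (rotated z0) t (Hop _ (Hin t)) HR HW).
    fold z. rewrite rotated_velocity. fold z.
    assert (EN' : (INR mu * z ^ (mu - 1) * 1 * (qc1 q * (A z * C0 z) + qc0 q * (A z * A z) + qc2 q * (C0 z * C0 z))
       * z = residue_num mu f1 f2 c q z)%C).
    { unfold residue_num, A, C0. replace (mu - 1)%nat with (S (mu - 2)) by lia. simpl. field. exact Hz. }
    set (Pq := pairing q (bryant_quad (A z) (B z) (C0 z) (D z) (g z) (om z))).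
    set (Rq := (INR mu * z ^ (mu - 1) * 1 * (qc1 q * (A z * C0 z) + qc0 q * (A z * A z) + qc2 q * (C0 z * C0 z)))%C) in *.
    rewrite <- EN'. clearbody Pq Rq z. destruct Pq, Rq, z. unfold Re, Im. simpl. ring. }
  assert (HRI : is_RInt (fun t => along (thetaU q X) (thetaV q X) (rotated z0) t + 2 * Re (residue_num mu f1 f2 c q (rotated z0 t)))
    0 (2 * PI) 0).
  { replace 0 with (minus (2 * Im (G (rotated z0 (2 * PI)))) (2 * Im (G (rotated z0 0)))) at 2.
    - apply (is_RInt_derive (V := R_CompleteNormedModule) (fun t => 2 * Im (G (rotated z0 t)))).
      + intros t _. apply Hder.
      + intros t _. apply (continuous_plus (V := R_NormedModule)); [apply HI|].
        apply (continuous_mult (K := R_AbsRing)); [apply continuous_const|apply HNc].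
    - replace (2 * PI) with (0 + 2 * PI) by ring. rewrite rotated_periodic.
      unfold minus, plus, opp; simpl. req. ring. }
  apply (is_RInt_unique (V := R_CompleteNormedModule)) in HRI.
  rewrite RInt_plus_R, RInt_scal_R in HRI; auto.
  - unfold loop_int. match type of HRI with @eq _ ?a ?b => change (@eq R a b) in HRI end. lra.
  - apply (ex_RInt_continuous (V := R_CompleteNormedModule)). intros t _. apply HI.
  - now apply (ex_RInt_scal (V := R_NormedModule)).
Qed.

(** Only the residue survives on small circles. *)
Lemma canonical_loop_limit q eps : 0 < eps -> exists d, 0 < d /\ forall z0 : C, z0 <> 0%C -> Cmod z0 < d ->
  Rabs (loop_int (thetaU q X) (thetaV q X) (rotated z0) - (- 4 * PI * Re (residue_num mu f1 f2 c q 0%C))) <= eps.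
Proof.
  intros Heps. assert (HPI := PI_RGT_0).
  assert (HN : continuous (residue_num mu f1 f2 c q) (RtoC 0)).
  { assert (Hz : disc r (RtoC 0)) by (unfold disc; now rewrite Cmod_0).
    destruct (Hf1 _ Hz) as [l1 d1]. destruct (Hf2 _ Hz) as [l2 d2].
    assert (dp := complex_derive_pow (fun y => y) (RtoC 0) 1%C (mu - 2) (complex_derive_id (RtoC 0))).
    assert (Hex : exists l, complex_derive (residue_num mu f1 f2 c q) (RtoC 0) l).
    { eexists. unfold residue_num.
      apply complex_derive_mult; [apply complex_derive_scal; exact dp|].
      apply complex_derive_plus; [apply complex_derive_plus|].
      - apply complex_derive_mult; [|apply complex_derive_id].
        apply complex_derive_mult; [|exact d2]. apply complex_derive_scal. exact d1.
      - apply complex_derive_mult; [apply complex_derive_scal; apply complex_derive_mult; exact d2|].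
        apply complex_derive_mult; apply complex_derive_id.
      - apply complex_derive_scal. apply complex_derive_mult; exact d1. }
    destruct Hex as [l Hl]. eapply complex_derive_continuous; eauto. }
  apply continuous_C_pair in HN. destruct HN as [HN _].
  assert (He : 0 < eps / (4 * PI)) by (apply Rdiv_lt_0_compat; lra).
  assert (HL := proj1 (filterlim_locally _ _) HN (mkposreal _ He)).
  apply Cball_locally in HL. destruct HL as [d [Hd HL]].
  exists (Rmin d r). split; [now apply Rmin_pos|]. intros z0 Hz0 Hzd.
  assert (H1 : Cmod z0 < d) by (eapply Rlt_le_trans; [exact Hzd|apply Rmin_l]).
  assert (H2 : Cmod z0 < r) by (eapply Rlt_le_trans; [exact Hzd|apply Rmin_r]).
  destruct (canonical_loop_int q z0 Hz0 H2) as [-> EN].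
  assert (E : RInt (fun _ => Re (residue_num mu f1 f2 c q 0%C)) 0 (2 * PI) = 2 * PI * Re (residue_num mu f1 f2 c q 0%C)).
  { rewrite RInt_const. unfold scal; simpl; unfold mult; simpl. ring. }
  replace (-2 * RInt (fun t => Re (residue_num mu f1 f2 c q (rotated z0 t))) 0 (2 * PI) - -4 * PI * Re (residue_num mu f1 f2 c q 0%C))
    with (-2 * RInt (fun t => Re (residue_num mu f1 f2 c q (rotated z0 t)) - Re (residue_num mu f1 f2 c q 0%C)) 0 (2 * PI)).
  2:{ rewrite RInt_minus_R, E; [ring|exact EN|apply ex_RInt_const]. }
  rewrite Rabs_mult, (Rabs_left (-2)) by lra.
  replace eps with (- -2 * ((2 * PI - 0) * (eps / (4 * PI)))) by (field; lra).
  apply Rmult_le_compat_l; [lra|]. apply RInt_bound; [lra| |].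
  - apply (ex_RInt_minus (V := R_NormedModule)); [exact EN|apply ex_RInt_const].
  - intros t _. apply Rlt_le. apply (HL (rotated z0 t)).
    replace (rotated z0 t - 0)%C with (rotated z0 t) by ring. now rewrite rotated_Cmod.
Qed.
End CanonicalEnd.

(** * Differentials of maps of hyperbolic space *)

Definition fd (Phi : Pt -> Pt) (p : Pt) (L : Pt -> Pt) : Prop :=
  filterdiff (U := Pt_NM) (V := Pt_NM) Phi (locally (T := Pt_NM) p) L.

Lemma filterdiff_pair {U V W : NormedModule R_AbsRing} (f : U -> V) (g : U -> W) x lf lg :
  filterdiff f (locally x) lf -> filterdiff g (locally x) lg ->
  filterdiff (V := prod_NormedModule R_AbsRing V W) (fun t => (f t, g t)) (locally x) (fun t => (lf t, lg t)).
Proof.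
  intros Hf Hg.
  apply (filterdiff_comp'_2 (W := prod_NormedModule R_AbsRing V W) f g (fun a b => (a, b)) x lf lg (fun a b => (a, b)) Hf Hg).
  apply (filterdiff_ext (fun t => t)); [now intros []|].
  apply (filterdiff_ext_lin _ (fun t => t)); [apply filterdiff_id|now intros []].
Qed.

Definition fdR (f : Pt -> R) (p : Pt) (l : Pt -> R) : Prop :=
  filterdiff (U := Pt_NM) (V := R_NormedModule) f (locally (T := Pt_NM) p) l.

Lemma fd_components Phi p L :
  fdR (fun x => px (Phi x)) p (fun v => px (L v)) -> fdR (fun x => py (Phi x)) p (fun v => py (L v)) ->
  fdR (fun x => pw (Phi x)) p (fun v => pw (L v)) -> fd Phi p L.
Proof.
  intros H1 H2 H3.
  assert (H12 := filterdiff_pair (U := Pt_NM) (V := R_NormedModule) (W := R_NormedModule) _ _ p _ _ H1 H2).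
  assert (H := filterdiff_pair (U := Pt_NM) (V := prod_NormedModule R_AbsRing R_NormedModule R_NormedModule)
     (W := R_NormedModule) _ _ p _ _ H12 H3).
  unfold fd.
  apply (filterdiff_ext (U := Pt_NM) (V := Pt_NM) (fun t => ((px (Phi t), py (Phi t)), pw (Phi t)))).
  { intros y. now destruct (Phi y) as [[? ?] ?]. }
  apply (filterdiff_ext_lin (U := Pt_NM) (V := Pt_NM) _ (fun t => ((px (L t), py (L t)), pw (L t)))).
  - exact H.
  - intros y. now destruct (L y) as [[? ?] ?].
Qed.

Lemma is_linear_px : is_linear (U := Pt_NM) (V := R_NormedModule) px.
Proof.
  exact (is_linear_comp (U := Pt_NM) (V := C_R_NormedModule) (W := R_NormedModule) fst fst
    (is_linear_fst (K := R_AbsRing) (U := C_R_NormedModule) (V := R_NormedModule))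
    (is_linear_fst (K := R_AbsRing) (U := R_NormedModule) (V := R_NormedModule))).
Qed.
Lemma is_linear_py : is_linear (U := Pt_NM) (V := R_NormedModule) py.
Proof.
  exact (is_linear_comp (U := Pt_NM) (V := C_R_NormedModule) (W := R_NormedModule) fst snd
    (is_linear_fst (K := R_AbsRing) (U := C_R_NormedModule) (V := R_NormedModule))
    (is_linear_snd (K := R_AbsRing) (U := R_NormedModule) (V := R_NormedModule))).
Qed.
Lemma is_linear_pw : is_linear (U := Pt_NM) (V := R_NormedModule) pw.
Proof. exact (is_linear_snd (K := R_AbsRing) (U := C_R_NormedModule) (V := R_NormedModule)). Qed.

Lemma fdR_px p : fdR px p px.
Proof. apply filterdiff_linear, is_linear_px. Qed.
Lemma fdR_py p : fdR py p py.
Proof. apply filterdiff_linear, is_linear_py. Qed.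
Lemma fdR_pw p : fdR pw p pw.
Proof. apply filterdiff_linear, is_linear_pw. Qed.

Lemma fdR_const c p : fdR (fun _ => c) p (fun _ => 0).
Proof. apply (filterdiff_const (U := Pt_NM) (V := R_NormedModule)). Qed.

Lemma fdR_plus f g p lf lg : fdR f p lf -> fdR g p lg -> fdR (fun x => f x + g x) p (fun v => lf v + lg v).
Proof. intros. now apply (filterdiff_plus_fct (U := Pt_NM) (V := R_NormedModule)). Qed.

Lemma fdR_minus f g p lf lg : fdR f p lf -> fdR g p lg -> fdR (fun x => f x - g x) p (fun v => lf v - lg v).
Proof. intros. now apply (filterdiff_minus_fct (U := Pt_NM) (V := R_NormedModule)). Qed.

Lemma fdR_opp f p lf : fdR f p lf -> fdR (fun x => - f x) p (fun v => - lf v).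
Proof. intros. now apply (filterdiff_opp_fct (U := Pt_NM) (V := R_NormedModule)). Qed.

Lemma fdR_mult f g p lf lg : fdR f p lf -> fdR g p lg ->
  fdR (fun x => f x * g x) p (fun v => lf v * g p + f p * lg v).
Proof. intros. apply (filterdiff_mult_fct (K := R_AbsRing) (U := Pt_NM)); auto. exact Rmult_comm. Qed.

Lemma fdR_inv f p lf : fdR f p lf -> f p <> 0 -> fdR (fun x => / f x) p (fun v => - lf v / f p ^ 2).
Proof.
  intros H H0.
  assert (HI : filterdiff (U := R_NormedModule) (V := R_NormedModule) Rinv (locally (f p)) (fun y => scal y (- 1 / f p ^ 2))).
  { exact (is_derive_inv (fun x => x) (f p) 1 (is_derive_id _) H0). }
  apply (filterdiff_ext_lin (U := Pt_NM) (V := R_NormedModule) _ (fun v => scal (lf v) (- 1 / f p ^ 2))).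
  - apply (filterdiff_comp' (U := Pt_NM) (V := R_NormedModule) (W := R_NormedModule) f Rinv p lf _ H HI).
  - intros v. unfold scal; simpl; unfold mult; simpl. unfold Rdiv. req. ring.
Qed.

Lemma fdR_ext_lin f p l l' : fdR f p l -> (forall v, l v = l' v) -> fdR f p l'.
Proof. intros H E. exact (filterdiff_ext_lin (U := Pt_NM) (V := R_NormedModule) _ _ _ H E). Qed.

Lemma fd_proj Phi p L : fd Phi p L ->
  fdR (fun x => px (Phi x)) p (fun v => px (L v)) /\ fdR (fun x => py (Phi x)) p (fun v => py (L v)) /\
  fdR (fun x => pw (Phi x)) p (fun v => pw (L v)).
Proof.
  intros H. split; [|split].
  - apply (filterdiff_comp' (U := Pt_NM) (V := Pt_NM) (W := R_NormedModule) Phi px p L px H), fdR_px.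
  - apply (filterdiff_comp' (U := Pt_NM) (V := Pt_NM) (W := R_NormedModule) Phi py p L py H), fdR_py.
  - apply (filterdiff_comp' (U := Pt_NM) (V := Pt_NM) (W := R_NormedModule) Phi pw p L pw H), fdR_pw.
Qed.

Lemma fd_comp Phi Psi p L M : fd Psi p M -> fd Phi (Psi p) L -> fd (fun x => Phi (Psi x)) p (fun v => L (M v)).
Proof. intros H1 H2. exact (filterdiff_comp' (U := Pt_NM) (V := Pt_NM) (W := Pt_NM) Psi Phi p M L H1 H2). Qed.

Lemma fd_linear Phi p L : fd Phi p L ->
  forall v, L v = vadd (vadd (vscal (px v) (L ((1, 0), 0))) (vscal (py v) (L ((0, 1), 0)))) (vscal (pw v) (L ((0, 0), 1))).
Proof.
  intros [HL _] v.
  assert (Ep : forall x y : Pt, L (vadd x y) = vadd (L x) (L y)) by exact (@linear_plus R_AbsRing Pt_NM Pt_NM L HL).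
  assert (Es : forall (k : R) (x : Pt), L (vscal k x) = vscal k (L x)) by exact (@linear_scal R_AbsRing Pt_NM Pt_NM L HL).
  rewrite <- !Es, <- !Ep. f_equal. apply Pt_eq; unfold vadd, vscal, px, py, pw; simpl; ring.
Qed.

Lemma fd_vscal Phi p L k v : fd Phi p L -> L (vscal k v) = vscal k (L v).
Proof. intros [HL _]. exact (@linear_scal R_AbsRing Pt_NM Pt_NM L HL k v). Qed.
Lemma is_derive_Pt (gam : R -> Pt) t (v : Pt) :
  is_derive (V := Pt_NM) gam t v <->
  is_derive (fun s => px (gam s)) t (px v) /\ is_derive (fun s => py (gam s)) t (py v) /\
  is_derive (fun s => pw (gam s)) t (pw v).
Proof.
  split.
  - intros H. split; [|split].
    + exact (filterdiff_comp' (U := R_NormedModule) (V := Pt_NM) (W := R_NormedModule) gam px t _ px H (fdR_px _)).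
    + exact (filterdiff_comp' (U := R_NormedModule) (V := Pt_NM) (W := R_NormedModule) gam py t _ py H (fdR_py _)).
    + exact (filterdiff_comp' (U := R_NormedModule) (V := Pt_NM) (W := R_NormedModule) gam pw t _ pw H (fdR_pw _)).
  - intros [H1 [H2 H3]].
    assert (H12 := filterdiff_pair (U := R_NormedModule) (V := R_NormedModule) (W := R_NormedModule) _ _ t _ _ H1 H2).
    assert (H := filterdiff_pair (U := R_NormedModule) (V := prod_NormedModule R_AbsRing R_NormedModule R_NormedModule)
     (W := R_NormedModule) _ _ t _ _ H12 H3).
    apply (filterdiff_ext (U := R_NormedModule) (V := Pt_NM) (fun t => ((px (gam t), py (gam t)), pw (gam t)))).
    { intros y. now destruct (gam y) as [[? ?] ?]. }
    apply (filterdiff_ext_lin (U := R_NormedModule) (V := Pt_NM) _ _ _ H).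
    intros y. now destruct v as [[? ?] ?].
Qed.

Lemma fd_curve Phi (gam : R -> Pt) t (v : Pt) L :
  is_derive (V := Pt_NM) gam t v -> fd Phi (gam t) L ->
  is_derive (V := Pt_NM) (fun s => Phi (gam s)) t (L v).
Proof.
  intros H HL.
  apply (filterdiff_ext_lin (U := R_NormedModule) (V := Pt_NM) _ (fun y => L (scal y v))).
  - exact (filterdiff_comp' (U := R_NormedModule) (V := Pt_NM) (W := Pt_NM) gam Phi t _ L H HL).
  - intros y. exact (fd_vscal Phi _ L y v HL).
Qed.

Lemma is_derive_Pt_unique (gam : R -> Pt) t (v v' : Pt) :
  is_derive (V := Pt_NM) gam t v -> is_derive (V := Pt_NM) gam t v' -> v = v'.
Proof.
  rewrite !is_derive_Pt. intros [H1 [H2 H3]] [H1' [H2' H3']].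
  apply is_derive_unique in H1. apply is_derive_unique in H2. apply is_derive_unique in H3.
  apply is_derive_unique in H1'. apply is_derive_unique in H2'. apply is_derive_unique in H3'.
  apply Pt_eq; congruence.
Qed.

Lemma fdR_D2 (f : Pt -> R) (X : C -> Pt) z a b l : fdR f (X z) l -> Pt_D2 X z a b ->
  D2 (fun y => f (X y)) z (l a) (l b).
Proof.
  intros Hf [H1 [H2 H3]].
  assert (K : forall g u v, D2 g z u v ->
    filterdiff (U := C_R_NormedModule) (V := R_NormedModule) g (locally z) (fun y : C => fst y * u + snd y * v)).
  { intros g u v Hg. destruct z as [z1 z2]. apply filterdiff_differentiable_pt_lim in Hg.
    apply (filterdiff_ext (U := C_R_NormedModule) (V := R_NormedModule) (fun y : C => g (fst y, snd y))); [now intros []|].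
    exact Hg. }
  apply K in H1. apply K in H2. apply K in H3.
  assert (H12 := filterdiff_pair (U := C_R_NormedModule) (V := R_NormedModule) (W := R_NormedModule) _ _ z _ _ H1 H2).
  assert (H := filterdiff_pair (U := C_R_NormedModule) (V := prod_NormedModule R_AbsRing R_NormedModule R_NormedModule)
     (W := R_NormedModule) _ _ z _ _ H12 H3).
  assert (HX : filterdiff (U := C_R_NormedModule) (V := Pt_NM) X (locally z)
    (fun y : C => vadd (vscal (fst y) a) (vscal (snd y) b))).
  { apply (filterdiff_ext (U := C_R_NormedModule) (V := Pt_NM) (fun t => ((px (X t), py (X t)), pw (X t)))).
    { intros y. now destruct (X y) as [[? ?] ?]. }
    exact H. }
  assert (HC := filterdiff_comp' (U := C_R_NormedModule) (V := Pt_NM) (W := R_NormedModule) X f z _ l HX Hf).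
  destruct z as [z1 z2]. unfold D2. simpl. apply filterdiff_differentiable_pt_lim.
  apply (filterdiff_ext (U := C_R_NormedModule) (V := R_NormedModule) (fun y : C => f (X y))); [now intros []|].
  apply (filterdiff_ext_lin (U := C_R_NormedModule) (V := R_NormedModule) _ _ _ HC).
  intros y. destruct Hf as [Hl _].
  transitivity (plus (l (vscal (fst y) a)) (l (vscal (snd y) b))).
  { exact (@linear_plus R_AbsRing Pt_NM R_NormedModule l Hl (vscal (fst y) a) (vscal (snd y) b)). }
  exact (f_equal2 Rplus (@linear_scal R_AbsRing Pt_NM R_NormedModule l Hl (fst y) a) (@linear_scal R_AbsRing Pt_NM R_NormedModule l Hl (snd y) b)).
Qed.

Lemma fd_Pt_D2 Phi X z a b L : fd Phi (X z) L -> Pt_D2 X z a b -> Pt_D2 (fun y => Phi (X y)) z (L a) (L b).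
Proof.
  intros H HX. destruct (fd_proj _ _ _ H) as [H1 [H2 H3]].
  split; [|split].
  - exact (fdR_D2 _ X z a b _ H1 HX).
  - exact (fdR_D2 _ X z a b _ H2 HX).
  - exact (fdR_D2 _ X z a b _ H3 HX).
Qed.

(** * Moebius transformations *)

(** Generators: [z + b], [s^2 z] and [- 1 / z]. Writing the multiplier as a
    square makes the dilation factor [|s|^2] polynomial, and corresponds to the
    matrix [diag(s, 1/s)]. *)
Definition shift (b : C) (p : Pt) : Pt := ((fst p + b)%C, pw p).
Definition dilate (s : C) (p : Pt) : Pt := ((s * s * fst p)%C, (fst s * fst s + snd s * snd s) * pw p).
Definition invert (p : Pt) : Pt := ((- px p / edot p p, py p / edot p p), pw p / edot p p).

(** The action of Moebius transformations on quadratic fields, by pull-back. *)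
Definition pull_shift (b : C) (q : quad) : quad := ((qeval q b, qc1 q + 2 * qc2 q * b), qc2 q)%C.
Definition pull_dilate (s : C) (q : quad) : quad := ((qc0 q / (s * s), qc1 q), s * s * qc2 q)%C.
Definition pull_invert (q : quad) : quad := ((qc2 q, - qc1 q), qc0 q)%C.

Inductive moebius : (Pt -> Pt) -> (quad -> quad) -> Prop :=
| moebius_shift b : moebius (shift b) (pull_shift b)
| moebius_dilate (s : C) : s <> 0%C -> moebius (dilate s) (pull_dilate s)
| moebius_invert : moebius invert pull_invert
| moebius_comp N f M g : moebius N f -> moebius M g ->
    moebius (fun p => N (M p)) (fun q => g (f q)).

(** The naturality of every ingredient of [theta]. The three generators have it by
    direct computation and it is stable under composition. *)
Definition natural_at (N : Pt -> Pt) (pull : quad -> quad) (p : Pt) : Prop :=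
  H3 (N p) /\ exists L, fd N p L /\
  (forall a b, hip (N p) (L a) (L b) = hip p a b) /\
  (forall a b c, 0 < det3 a b c -> 0 < det3 (L a) (L b) (L c)) /\
  (forall q, L (killing (pull q) p) = killing q (N p)) /\
  (forall q v, sigma q (N p) (L v) = sigma (pull q) p v).

Ltac fdchange f := match goal with |- fdR _ ?p ?l => change (fdR f p l) end.

Ltac fdRt :=
  lazymatch goal with
  | |- fdR (fun _ => ?c) _ _ => apply (fdR_const c)
  | |- fdR (fun t => @?f t + @?g t) _ _ => eapply (fdR_plus f g); fdRt
  | |- fdR (fun t => @?f t - @?g t) _ _ => eapply (fdR_minus f g); fdRt
  | |- fdR (fun t => @?f t * @?g t) _ _ => eapply (fdR_mult f g); fdRt
  | |- fdR (fun t => - @?f t) _ _ => eapply (fdR_opp f); fdRt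
  | |- fdR (fun t => / @?f t) _ _ => eapply (fdR_inv f); [fdRt|]
  | |- fdR (fun t => px t) _ _ => apply fdR_px
  | |- fdR (fun t => py t) _ _ => apply fdR_py
  | |- fdR (fun t => pw t) _ _ => apply fdR_pw
  end.

Lemma shift_natural b p : H3 p -> natural_at (shift b) (pull_shift b) p.
Proof.
  intros Hp. split; [exact Hp|]. exists (fun v => v). split; [|split; [|split; [|split]]].
  - apply fd_components; unfold shift, px, py, pw; simpl; fold (px p) (py p) (pw p).
    + eapply fdR_ext_lin; [fdchange (fun x => px x + fst b); fdRt|]. intros v. unfold px. simpl. ring.
    + eapply fdR_ext_lin; [fdchange (fun x => py x + snd b); fdRt|]. intros v. unfold py. simpl. ring.
    + apply fdR_pw.
  - reflexivity.
  - auto.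
  - intros q. destruct q as [[[a0 b0] [a1 b1]] [a2 b2]], p as [[x y] w], b as [b3 b4].
    apply Pt_eq; unfold killing, pull_shift, shift, qeval, px, py, pw, qc0, qc1, qc2, Re; simpl; ring.
  - intros q v. destruct q as [[[a0 b0] [a1 b1]] [a2 b2]], p as [[x y] w], b as [b3 b4], v as [[v1 v2] v3].
    unfold sigma, pull_shift, shift, qeval, px, py, pw, qc0, qc1, qc2, Im; simpl.
    unfold Rdiv. f_equal. ring.
Qed.

Lemma sqr_sum_pos (s : C) : s <> 0%C -> 0 < fst s * fst s + snd s * snd s.
Proof. intros H. rewrite Cmod_sqr. apply Cmod_gt_0 in H. nra. Qed.

Lemma dilate_natural (s : C) p : s <> 0%C -> H3 p -> natural_at (dilate s) (pull_dilate s) p.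
Proof.
  intros Hs Hp. assert (Hs2 := sqr_sum_pos s Hs). unfold H3 in Hp.
  split; [unfold H3, dilate, pw at 1; simpl; nra|].
  exists (dilate s). destruct s as [s1 s2]. simpl in Hs2. split; [|split; [|split; [|split]]].
  - apply fd_components; unfold dilate, px, py, pw; simpl.
    + eapply fdR_ext_lin; [fdchange (fun x => (s1 * s1 - s2 * s2) * px x - (s1 * s2 + s2 * s1) * py x); fdRt|].
      intros v. unfold px, py. simpl. ring.
    + eapply fdR_ext_lin; [fdchange (fun x => (s1 * s1 - s2 * s2) * py x + (s1 * s2 + s2 * s1) * px x); fdRt|].
      intros v. unfold px, py. simpl. ring.
    + eapply fdR_ext_lin; [fdchange (fun x => (s1 * s1 + s2 * s2) * pw x); fdRt|].
      intros v. unfold pw. simpl. ring.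
  - intros [[a1 a2] a3] [[b1 b2] b3]. destruct p as [[x y] w]. unfold pw in Hp. simpl in Hp.
    unfold hip, edot, dilate, px, py, pw; simpl. field. split; nra.
  - intros [[a1 a2] a3] [[b1 b2] b3] [[c1 c2] c3] H.
    match goal with |- 0 < ?d => replace d with ((s1 * s1 + s2 * s2) ^ 3 * det3 ((a1, a2), a3) ((b1, b2), b3) ((c1, c2), c3)) end.
    + apply Rmult_lt_0_compat; [now apply pow_lt|exact H].
    + unfold det3, ecross, edot, dilate, px, py, pw; simpl. ring.
  - intros q. destruct q as [[[a0 b0] [a1 b1]] [a2 b2]], p as [[x y] w].
    assert (E : ((s1, s2) * (s1, s2) * ((a0, b0) / ((s1, s2) * (s1, s2))))%C = (a0, b0)).
    { field. exact Hs. }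
    apply Pt_eq; unfold killing, pull_dilate, dilate, qeval, px, py, pw, qc0, qc1, qc2, Re; cbn [fst snd].
    + rewrite <- E at 2. generalize ((a0, b0) / ((s1, s2) * (s1, s2)))%C. intros [u v]. simpl. ring.
    + rewrite <- E at 2. generalize ((a0, b0) / ((s1, s2) * (s1, s2)))%C. intros [u v]. simpl. ring.
    + simpl. ring.
  - intros q v. destruct q as [[[a0 b0] [a1 b1]] [a2 b2]], p as [[x y] w], v as [[v1 v2] v3].
    unfold pw in Hp. simpl in Hp.
    assert (E : ((s1, s2) * (s1, s2) * ((a0, b0) / ((s1, s2) * (s1, s2))))%C = (a0, b0)).
    { field. exact Hs. }
    unfold sigma, pull_dilate, dilate, px, py, pw, qc0, qc1, qc2; cbn [fst snd].
    rewrite <- E at 1. generalize ((a0, b0) / ((s1, s2) * (s1, s2)))%C. intros [u t]. unfold Im. simpl. field.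
    split; nra.
Qed.

Lemma edot_pos p : H3 p -> 0 < edot p p.
Proof. unfold H3, edot. intros H. nra. Qed.

Lemma invert_natural p : H3 p -> natural_at invert pull_invert p.
Proof.
  intros Hp. assert (Hn := edot_pos p Hp). unfold H3 in Hp.
  split; [unfold H3, invert, pw at 1; simpl; now apply Rdiv_lt_0_compat|].
  set (n := edot p p) in *.
  exists (fun v => ((- px v / n + px p * (2 * edot p v) / n ^ 2, py v / n - py p * (2 * edot p v) / n ^ 2),
     pw v / n - pw p * (2 * edot p v) / n ^ 2)).
  assert (Hinv : fdR (fun x => / edot x x) p (fun v => - (2 * edot p v) / n ^ 2)).
  { eapply fdR_ext_lin.
    - fdchange (fun x => / (px x * px x + py x * py x + pw x * pw x)). fdRt. change (n <> 0). lra.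
    - intros v. cbv beta. change (px p * px p + py p * py p + pw p * pw p) with n. unfold edot. field. lra. }
  split; [|split; [|split; [|split]]].
  - apply fd_components; unfold invert.
    + eapply fdR_ext_lin; [fdchange (fun x => - px x * / edot x x); eapply fdR_mult; [apply fdR_opp, fdR_px|exact Hinv]|].
      intros v. cbv beta. change (edot p p) with n. unfold px at 3. simpl. field. lra.
    + eapply fdR_ext_lin; [fdchange (fun x => py x * / edot x x); eapply fdR_mult; [apply fdR_py|exact Hinv]|].
      intros v. cbv beta. change (edot p p) with n. unfold py at 3. simpl. field. lra.
    + eapply fdR_ext_lin; [fdchange (fun x => pw x * / edot x x); eapply fdR_mult; [apply fdR_pw|exact Hinv]|].
      intros v. cbv beta. change (edot p p) with n. unfold pw at 3. simpl. field. lra.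
  - intros [[a1 a2] a3] [[b1 b2] b3]. unfold n in *. destruct p as [[x y] w].
    unfold hip, edot, invert, edot, px, py, pw in *; simpl in *. field. split; lra.
  - intros [[a1 a2] a3] [[b1 b2] b3] [[c1 c2] c3] H.
    match goal with |- 0 < ?d => replace d with (/ n ^ 3 * det3 ((a1, a2), a3) ((b1, b2), b3) ((c1, c2), c3)) end.
    + apply Rmult_lt_0_compat; [now apply Rinv_0_lt_compat, pow_lt|exact H].
    + unfold n in *. destruct p as [[x y] w]. unfold det3, ecross, edot, px, py, pw in *; simpl in *. field. lra.
  - intros q. destruct q as [[[a0 b0] [a1 b1]] [a2 b2]]. unfold n in *. destruct p as [[x y] w].
    apply Pt_eq; unfold killing, pull_invert, invert, qeval, edot, px, py, pw, qc0, qc1, qc2, Re in *; simpl in *; field; lra.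
  - intros q v. destruct q as [[[a0 b0] [a1 b1]] [a2 b2]], v as [[v1 v2] v3]. unfold n in *. destruct p as [[x y] w].
    unfold sigma, pull_invert, invert, edot, px, py, pw, qc0, qc1, qc2, Im in *; simpl in *. field. split; lra.
Qed.

Lemma natural_comp N f M g p : H3 p -> natural_at M g p -> natural_at N f (M p) ->
  natural_at (fun p => N (M p)) (fun q => g (f q)) p.
Proof.
  intros Hp [H1 [L1 [D1 [I1 [O1 [K1 S1]]]]]] [H2 [L2 [D2' [I2 [O2 [K2 S2]]]]]].
  split; [exact H2|]. exists (fun v => L2 (L1 v)). split; [|split; [|split; [|split]]].
  - now apply fd_comp.
  - intros a b. now rewrite I2, I1.
  - intros a b c H. apply O2, O1, H.
  - intros q. now rewrite K1, K2.
  - intros q v. now rewrite S2, S1.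
Qed.

Lemma moebius_natural N f : moebius N f -> forall p, H3 p -> natural_at N f p.
Proof.
  induction 1; intros p Hp.
  - now apply shift_natural. - now apply dilate_natural. - now apply invert_natural.
  - apply natural_comp; auto. apply IHmoebius1. now apply IHmoebius2.
Qed.

Lemma moebius_H3 N f p : moebius N f -> H3 p -> H3 (N p).
Proof. intros H Hp. now apply (moebius_natural N f H p Hp). Qed.

Lemma shift_inv b p : shift (- b) (shift b p) = p.
Proof. destruct p as [[x y] w]. apply Pt_eq; unfold shift, px, py, pw; simpl; ring. Qed.

Lemma dilate_inv (s : C) p : s <> 0%C -> dilate (/ s) (dilate s p) = p.
Proof.
  intros Hs. assert (Hs2 := sqr_sum_pos s Hs). destruct p as [[x y] w], s as [s1 s2]. simpl in Hs2.
  apply Pt_eq; unfold dilate, px, py, pw; simpl; field; simpl; nra.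
Qed.

Lemma invert_inv p : H3 p -> invert (invert p) = p.
Proof.
  intros Hp. assert (Hn := edot_pos p Hp).
  destruct p as [[x y] w]. unfold edot, px, py, pw in Hn. simpl in Hn.
  apply Pt_eq; unfold invert, edot, px, py, pw; simpl; field; repeat split; nra.
Qed.

Lemma moebius_inverse N f : moebius N f -> exists N' f', moebius N' f' /\
  forall p, H3 p -> N' (N p) = p /\ N (N' p) = p.
Proof.
  induction 1.
  - exists (shift (- b)), (pull_shift (- b)). split; [constructor|]. intros p _. split; [apply shift_inv|].
    replace (shift b) with (shift (- - b)) by (f_equal; ring). apply shift_inv.
  - exists (dilate (/ s)), (pull_dilate (/ s)).
    assert (Hs : (/ s)%C <> 0%C) by (intros E; apply (f_equal (Cmult s)) in E; rewrite Cinv_r, Cmult_0_r in E by auto;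
      injection E; lra).
    split; [now constructor|]. intros p _. split; [now apply dilate_inv|].
    replace (dilate s) with (dilate (/ / s)); [now apply dilate_inv|]. f_equal. field. auto.
  - exists invert, pull_invert. split; [constructor|]. intros p Hp. split; now apply invert_inv.
  - destruct IHmoebius1 as [N1 [f1 [H1 E1]]], IHmoebius2 as [N2 [f2 [H2 E2]]].
    exists (fun p => N2 (N1 p)), (fun q => f1 (f2 q)). split; [now constructor|]. intros p Hp. split.
    + rewrite (proj1 (E1 (M p) (moebius_H3 _ _ _ H0 Hp))). now apply E2.
    + rewrite (proj2 (E2 (N1 p) (moebius_H3 _ _ _ H1 Hp))). now apply E1.
Qed.

Lemma moebius_preserves N f : moebius N f -> preserves_metric_and_orientation N.
Proof.
  intros H p Hp. destruct (moebius_natural N f H p Hp) as [H1 [L [D1 [I1 [O1 _]]]]].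
  split; [exact H1|]. exists L. split; [exact D1|]. split; [exact I1|]. apply O1.
  unfold det3, ecross, edot, px, py, pw. simpl. lra.
Qed.

Lemma moebius_oriented N f : moebius N f -> oriented_isometry N.
Proof.
  intros H. destruct (moebius_inverse N f H) as [N' [f' [H' E]]].
  split; [now apply (moebius_preserves N f)|]. exists N'. split; [now apply (moebius_preserves N' f')|exact E].
Qed.

Lemma theta_moebius N f q X z a b : moebius N f -> H3 (X z) -> Pt_D2 X z a b ->
  thetaU q (fun y => N (X y)) z = thetaU (f q) X z /\ thetaV q (fun y => N (X y)) z = thetaV (f q) X z.
Proof.
  intros HN Hz HD. destruct (moebius_natural N f HN (X z) Hz) as [H1 [L [D1 [I1 [O1 [K1 S1]]]]]].
  destruct (Pt_D2_partials _ _ _ _ HD) as [E1 E2].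
  destruct (Pt_D2_partials _ _ _ _ (fd_Pt_D2 N X z a b L D1 HD)) as [E3 E4].
  unfold thetaU, thetaV. rewrite E1, E2, E3, E4, !S1, <- !K1, !I1. split; reflexivity.
Qed.

(** * Oriented isometries *)

Definition psub (p q : Pt) : Pt := vadd p (vscal (-1) q).

(** [2 (cosh d - 1)], where [d] is the hyperbolic distance. *)
Definition delta (p q : Pt) : R := edot (psub p q) (psub p q) / (pw p * pw q).

Lemma moebius_delta N f p q : moebius N f -> H3 p -> H3 q -> delta (N p) (N q) = delta p q.
Proof.
  intros H. revert p q. induction H; intros p q Hp Hq.
  - destruct p as [[x y] w], q as [[x' y'] w']. unfold delta, shift, psub, vadd, vscal, edot, px, py, pw. simpl.
    f_equal. ring.
  - assert (Hs2 := sqr_sum_pos s H). destruct s as [s1 s2]. simpl in Hs2.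
    unfold H3 in Hp, Hq.
    destruct p as [[x y] w], q as [[x' y'] w']. unfold delta, dilate, psub, vadd, vscal, edot, px, py, pw in *. simpl in *.
    field. repeat split; nra.
  - assert (Hnp := edot_pos p Hp). assert (Hnq := edot_pos q Hq). unfold H3 in Hp, Hq.
    destruct p as [[x y] w], q as [[x' y'] w']. unfold delta, invert, psub, vadd, vscal, edot, px, py, pw in *. simpl in *.
    field. repeat split; nra.
  - rewrite IHmoebius1 by (eapply moebius_H3; eauto). now apply IHmoebius2.
Qed.

Definition axis (t : R) : Pt := ((0, 0), t).

Lemma delta_axis s t : 0 < s -> 0 < t -> delta (axis s) (axis t) = s / t + t / s - 2.
Proof. intros Hs Ht. unfold delta, axis, psub, vadd, vscal, edot, px, py, pw. simpl. field. lra. Qed.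

(** Metric-preserving maps do not stretch the vertical axis: [ln w] is
    1-Lipschitz. *)
Lemma vertical_lipschitz T s t : preserves_metric_and_orientation T -> 0 < s <= t ->
  pw (T (axis t)) / t <= pw (T (axis s)) / s.
Proof.
  intros HT Hst.
  assert (HD : forall x, 0 < x -> exists l, is_derive (fun x => pw (T (axis x))) x l /\ l <= pw (T (axis x)) / x).
  { intros x Hx. destruct (HT (axis x) Hx) as [H1 [L [D1 [I1 _]]]]. unfold H3 in H1.
    exists (pw (L ((0, 0), 1))). split.
    - assert (Hax : is_derive (V := Pt_NM) axis x ((0, 0), 1)).
      { apply is_derive_Pt. unfold axis, px, py, pw. simpl. split; [|split].
        - apply (is_derive_const (K := R_AbsRing) (V := R_NormedModule)).
        - apply (is_derive_const (K := R_AbsRing) (V := R_NormedModule)).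
        - apply (is_derive_id (K := R_AbsRing)). }
      exact (proj2 (proj2 (proj1 (is_derive_Pt _ _ _) (fd_curve T axis x _ L Hax D1)))).
    - specialize (I1 ((0, 0), 1) ((0, 0), 1)). unfold hip in I1.
      set (v := L ((0, 0), 1)) in *.
      assert (E : edot v v = (pw (T (axis x)) / x) ^ 2).
      { apply (Rmult_eq_compat_r (pw (T (axis x)) ^ 2)) in I1.
        replace (edot v v / pw (T (axis x)) ^ 2 * pw (T (axis x)) ^ 2) with (edot v v) in I1 by (field; lra).
        rewrite I1. unfold edot, axis, px, py, pw. simpl. field. lra. }
      assert (Hpos : 0 < pw (T (axis x)) / x) by now apply Rdiv_lt_0_compat.
      unfold edot in E. destruct (Rle_dec (pw v) 0); [lra|]. apply Rsqr_incr_0_var; [unfold Rsqr; nra|lra]. }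
  destruct (Req_dec s t) as [->|Hne]; [lra|].
  assert (HDq : forall x, 0 < x -> exists l, is_derive (fun x => pw (T (axis x)) / x) x l /\ l <= 0).
  { intros x Hx. destruct (HD x Hx) as [l [H1 H2]]. exists ((l * x - pw (T (axis x)) * 1) / x ^ 2). split.
    - apply (is_derive_div (fun x => pw (T (axis x))) (fun x => x)); [exact H1|apply (is_derive_id (K := R_AbsRing))|lra].
    - assert (Hl : l * x - pw (T (axis x)) * 1 <= 0).
      { apply (Rmult_le_compat_r x) in H2; [|lra]. unfold Rdiv in H2. rewrite Rmult_assoc, Rinv_l in H2 by lra. lra. }
      apply (Rmult_le_reg_r (x ^ 2)); [apply pow_lt; lra|]. unfold Rdiv. rewrite Rmult_assoc, Rinv_l by (apply pow_nonzero; lra). lra. }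
  destruct (MVT_gen (fun x => pw (T (axis x)) / x) s t (Derive (fun x => pw (T (axis x)) / x))) as [c [Hc HE]].
  - intros x Hx. rewrite Rmin_left, Rmax_right in Hx by lra.
    destruct (HDq x) as [l [H1 _]]; [lra|]. apply Derive_correct. eexists; exact H1.
  - intros x Hx. rewrite Rmin_left, Rmax_right in Hx by lra.
    destruct (HDq x) as [l [H1 _]]; [lra|]. apply continuity_pt_filterlim.
    apply (ex_derive_continuous (fun x => pw (T (axis x)) / x)). eexists; exact H1.
  - rewrite Rmin_left, Rmax_right in Hc by lra.
    destruct (HDq c) as [l [H1 H2]]; [lra|].
    assert (EE : Derive (fun x : R => pw (T (axis x)) / x) c = l) by (apply is_derive_unique; exact H1).
    rewrite EE in HE. cbv beta in HE. nra.
Qed.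

Lemma complex_sqrt (a : C) : exists s : C, (s * s)%C = a /\ fst s * fst s + snd s * snd s = Cmod a.
Proof.
  destruct (polar_exists a) as [t [_ Ha]]. exists (polar (sqrt (Cmod a)) (t / 2)).
  assert (Hs : sqrt (Cmod a) * sqrt (Cmod a) = Cmod a) by apply sqrt_sqrt, Cmod_ge_0.
  split.
  - rewrite Ha at 3. unfold polar. apply injective_projections; simpl.
    + transitivity (sqrt (Cmod a) * sqrt (Cmod a) * (cos (t / 2) * cos (t / 2) - sin (t / 2) * sin (t / 2))); [ring|].
      rewrite Hs, <- cos_plus. do 2 f_equal. field.
    + transitivity (sqrt (Cmod a) * sqrt (Cmod a) * (sin (t / 2) * cos (t / 2) + cos (t / 2) * sin (t / 2))); [ring|].
      rewrite Hs, <- sin_plus. do 2 f_equal. field.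
  - unfold polar. simpl. pose proof (sin2_cos2 (t / 2)) as H. unfold Rsqr in H.
    transitivity (sqrt (Cmod a) * sqrt (Cmod a) * (sin (t / 2) * sin (t / 2) + cos (t / 2) * cos (t / 2))); [ring|].
    rewrite Hs, H. ring.
Qed.

(** A rotation puts the two points above the real axis, on a half-circle centred on
    it; an inversion at an end point of the half-circle makes it vertical. *)
Lemma to_axis_aux p q : H3 p -> H3 q -> exists N f s t, moebius N f /\ N p = axis s /\ N q = axis t /\ 0 < s /\ 0 < t.
Proof.
  intros Hp Hq. unfold H3 in *.
  destruct (Ceq_dec (fst q - fst p)%C 0%C) as [E|E].
  - exists (shift (- fst p)), (pull_shift (- fst p)), (pw p), (pw q). split; [constructor|].
    assert (Eq : fst q = fst p).
    { replace (fst q) with ((fst q - fst p) + fst p)%C by ring. rewrite E. ring. }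
    split; [|split; [|split]]; auto.
    + unfold shift, axis. f_equal. replace (fst p + - fst p)%C with (RtoC 0) by ring. reflexivity.
    + unfold shift, axis. f_equal. rewrite Eq. replace (fst p + - fst p)%C with (RtoC 0) by ring. reflexivity.
  - set (z := (fst q - fst p)%C) in *. set (d := Cmod z).
    assert (Hd : 0 < d) by now apply Cmod_gt_0.
    (* rotate so that the two points lie above the real axis *)
    destruct (complex_sqrt (Cconj z / RtoC d)%C) as [s [Es Es2]].
    assert (Hd0 : RtoC d <> 0%C) by (intros H; injection H; lra).
    rewrite Cmod_div, Cmod_conj, Cmod_R, Rabs_pos_eq in Es2 by (auto; lra). fold d in Es2.
    rewrite Rdiv_diag in Es2 by lra.
    assert (Hs : s <> 0%C) by (intros ->; simpl in Es2; lra).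
    (* abscissa of the centre, and radius, of the half-circle *)
    set (m := (d * d + pw q * pw q - pw p * pw p) / (2 * d)).
    set (R0 := sqrt (m * m + pw p * pw p)).
    assert (HR : R0 * R0 = m * m + pw p * pw p) by (apply sqrt_sqrt; nra).
    assert (HR0 : 0 < R0) by (apply sqrt_lt_R0; nra).
    assert (HRm : 0 < R0 - m) by nra.
    assert (Hm : m * m + pw p * pw p = (d - m) * (d - m) + pw q * pw q) by (unfold m; field; lra).
    assert (HRm' : 0 < d - m + R0) by nra.
    assert (Ep : shift (RtoC (R0 - m)) (dilate s (shift (- fst p) p)) = ((R0 - m, 0), pw p)).
    { unfold shift, dilate. cbn [fst snd]. rewrite Es2. apply Pt_eq; unfold px, py, pw; cbn [fst snd].
      - replace (s * s * (fst p + - fst p) + RtoC (R0 - m))%C with (RtoC (R0 - m)) by ring. reflexivity.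
      - replace (s * s * (fst p + - fst p) + RtoC (R0 - m))%C with (RtoC (R0 - m)) by ring. reflexivity.
      - unfold pw. simpl. ring. }
    assert (Eq : shift (RtoC (R0 - m)) (dilate s (shift (- fst p) q)) = ((d - m + R0, 0), pw q)).
    { unfold shift, dilate. cbn [fst snd]. rewrite Es2. rewrite Es.
      assert (Ez : (Cconj z / RtoC d * (fst q + - fst p) + RtoC (R0 - m))%C = RtoC (d - m + R0)).
      { change (fst q + - fst p)%C with z.
        replace (Cconj z / RtoC d * z)%C with (RtoC d).
        - rewrite <- RtoC_plus. f_equal. ring.
        - replace (Cconj z / RtoC d * z)%C with (z * Cconj z / RtoC d)%C by (field; auto).
          rewrite <- Cmod2_conj. fold d. rewrite <- RtoC_div by lra. f_equal. simpl. field. lra. }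
      rewrite Ez. apply Pt_eq; unfold px, py, pw; cbn [fst snd]; simpl; auto. ring. }
    assert (HI : forall x w, 0 < x -> 0 < w -> x * x + w * w = 2 * R0 * x ->
      shift (RtoC (/ (2 * R0))) (invert ((x, 0), w)) = axis (w / (2 * R0 * x))).
    { intros x w Hx Hw H.
      assert (En : edot ((x, 0), w) ((x, 0), w) = 2 * R0 * x).
      { rewrite <- H. unfold edot, px, py, pw. simpl. ring. }
      unfold invert. rewrite En. unfold shift, axis. apply Pt_eq; unfold px, py, pw; simpl; field; lra. }
    exists (fun x => shift (RtoC (/ (2 * R0))) (invert (shift (RtoC (R0 - m)) (dilate s (shift (- fst p) x))))).
    eexists. exists (pw p / (2 * R0 * (R0 - m))), (pw q / (2 * R0 * (d - m + R0))).
    split; [|split; [|split; [|split]]].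
    + apply (moebius_comp (shift _)); [constructor|].
      apply (moebius_comp invert); [constructor|].
      apply (moebius_comp (shift _)); [constructor|].
      apply (moebius_comp (dilate _)); [now constructor|]. constructor.
    + rewrite Ep. apply HI; auto. nra.
    + rewrite Eq. apply HI; auto. nra.
    + apply Rdiv_lt_0_compat; auto. nra.
    + apply Rdiv_lt_0_compat; auto. nra.
Qed.

Lemma to_axis p q : H3 p -> H3 q -> exists N f s t, moebius N f /\ N p = axis s /\ N q = axis t /\ 0 < s <= t.
Proof.
  intros Hp Hq. destruct (to_axis_aux p q Hp Hq) as [N [f [s [t [HN [Ep [Eq [Hs Ht]]]]]]]].
  destruct (Rle_dec s t) as [H|H].
  - exists N, f, s, t. repeat split; auto.
  - exists (fun x => invert (N x)), (fun q => f (pull_invert q)), (/ s), (/ t).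
    assert (HI : forall x, 0 < x -> invert (axis x) = axis (/ x)).
    { intros x Hx. unfold invert, axis, edot. apply Pt_eq; unfold px, py, pw; simpl; field; nra. }
    split; [apply (moebius_comp invert pull_invert); [constructor|auto]|].
    rewrite Ep, Eq, !HI by lra. repeat split; auto.
    + now apply Rinv_0_lt_compat.
    + apply Rinv_le_contravar; lra.
Qed.

Lemma preserves_comp T S : preserves_metric_and_orientation T -> preserves_metric_and_orientation S ->
  preserves_metric_and_orientation (fun p => T (S p)).
Proof.
  intros HT HS p Hp. destruct (HS p Hp) as [H1 [L1 [D1 [I1 O1]]]].
  destruct (HT (S p) H1) as [H2 [L2 [D2' [I2 O2]]]].
  split; [exact H2|]. exists (fun v => L2 (L1 v)). split; [now apply fd_comp|]. split.
  - intros a b. now rewrite I2, I1.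
  - assert (E : forall a b c, det3 (L2 a) (L2 b) (L2 c) =
      det3 (L2 ((1, 0), 0)) (L2 ((0, 1), 0)) (L2 ((0, 0), 1)) * det3 a b c).
    { intros a b c. rewrite (fd_linear T _ L2 D2' a), (fd_linear T _ L2 D2' b), (fd_linear T _ L2 D2' c).
      generalize (L2 ((1, 0), 0)) (L2 ((0, 1), 0)) (L2 ((0, 0), 1)). intros e1 e2 e3.
      unfold det3, ecross, edot, vadd, vscal, px, py, pw. simpl. ring. }
    rewrite E. now apply Rmult_lt_0_compat.
Qed.

Lemma oriented_comp T S : oriented_isometry T -> oriented_isometry S -> oriented_isometry (fun p => T (S p)).
Proof.
  intros [HT [T' [HT' ET]]] [HS [S' [HS' ES]]].
  split; [now apply (preserves_comp T S)|]. exists (fun p => S' (T' p)). split; [now apply (preserves_comp S' T')|].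
  intros p Hp. split.
  - rewrite (proj1 (ET (S p) (proj1 (HS p Hp)))). now apply ES.
  - rewrite (proj2 (ES (T' p) (proj1 (HT' p Hp)))). now apply ET.
Qed.

Lemma ratio_mono x y : 1 <= x -> x <= y -> x + / x <= y + / y.
Proof.
  intros Hx Hy. assert (0 < x) by lra. assert (0 < y) by lra.
  assert (E : y + / y - (x + / x) = (y - x) * (x * y - 1) * / (x * y)) by (field; lra).
  assert (0 <= (y - x) * (x * y - 1) * / (x * y)).
  { apply Rmult_le_pos; [apply Rmult_le_pos; nra|]. apply Rlt_le, Rinv_0_lt_compat. nra. }
  lra.
Qed.

(** Move both pairs of points to the vertical axis, where the distance is the
    logarithm of the ratio of the heights. *)
Lemma preserves_delta_le T p q : preserves_metric_and_orientation T -> H3 p -> H3 q ->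
  delta (T p) (T q) <= delta p q.
Proof.
  intros HT Hp Hq.
  assert (HTp : H3 (T p)) by now apply HT. assert (HTq : H3 (T q)) by now apply HT.
  destruct (to_axis p q Hp Hq) as [N1 [f1 [s1 [t1 [M1 [A1 [B1 Hst1]]]]]]].
  destruct (to_axis (T p) (T q) HTp HTq) as [N2 [f2 [s2 [t2 [M2 [A2 [B2 Hst2]]]]]]].
  destruct (moebius_inverse N1 f1 M1) as [N1' [f1' [M1' E1]]].
  rewrite <- (moebius_delta N1 f1 p q M1 Hp Hq), <- (moebius_delta N2 f2 (T p) (T q) M2 HTp HTq).
  rewrite A1, B1, A2, B2, !delta_axis by lra.
  assert (HU : preserves_metric_and_orientation (fun x => N2 (T (N1' x)))).
  { apply (preserves_comp N2 (fun x => T (N1' x))); [now apply (moebius_preserves N2 f2)|].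
    apply (preserves_comp T N1'); [exact HT|now apply (moebius_preserves N1' f1')]. }
  assert (HV := vertical_lipschitz _ s1 t1 HU Hst1). cbv beta in HV.
  rewrite <- A1, <- B1, !(fun x Hx => proj1 (E1 x Hx)), A2, B2 in HV by assumption.
  unfold axis, pw in HV. simpl in HV.
  assert (Hr : t2 / s2 <= t1 / s1).
  { apply (Rmult_le_compat_r (t1 / s2)) in HV; [|apply Rlt_le, Rdiv_lt_0_compat; lra].
    replace (t2 / t1 * (t1 / s2)) with (t2 / s2) in HV by (field; lra).
    replace (s2 / s1 * (t1 / s2)) with (t1 / s1) in HV by (field; lra). exact HV. }
  assert (H2 : 1 <= t2 / s2) by (apply Rle_div_r; lra).
  assert (H := ratio_mono _ _ H2 Hr).
  replace (/ (t2 / s2)) with (s2 / t2) in H by (field; lra).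
  replace (/ (t1 / s1)) with (s1 / t1) in H by (field; lra). lra.
Qed.

(** Both the map and its inverse are 1-Lipschitz. *)
Lemma isometry_delta T p q : oriented_isometry T -> H3 p -> H3 q -> delta (T p) (T q) = delta p q.
Proof.
  intros [HT [S [HS E]]] Hp Hq. apply Rle_antisym; [now apply preserves_delta_le|].
  rewrite <- (proj1 (E p Hp)) at 1. rewrite <- (proj1 (E q Hq)) at 1.
  apply preserves_delta_le; auto; now apply HT.
Qed.

Definition dist2 (p q : Pt) : R := edot (psub p q) (psub p q).

Lemma dist2_coord p q : dist2 p q = (px p - px q) ^ 2 + (py p - py q) ^ 2 + (pw p - pw q) ^ 2.
Proof. unfold dist2, psub, vadd, vscal, edot, px, py, pw. simpl. ring. Qed.

Lemma sqr_perturb a b e : 0 < e -> (a + b) ^ 2 <= (1 + e) * a ^ 2 + (1 + / e) * b ^ 2.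
Proof.
  intros He. assert (E : (1 + e) * a ^ 2 + (1 + / e) * b ^ 2 - (a + b) ^ 2 = / e * (e * a - b) ^ 2) by (field; lra).
  assert (0 <= / e * (e * a - b) ^ 2).
  { apply Rmult_le_pos; [apply Rlt_le, Rinv_0_lt_compat, He|apply pow2_ge_0]. }
  lra.
Qed.

(** Seen from far away, two points are at nearly the same distance. *)
Lemma far_ratio u v eps : 0 < eps -> exists M, forall y, M < edot y y -> dist2 u y <= (1 + eps) * dist2 v y.
Proof.
  intros He. set (K := dist2 u v). set (B := 2 / eps * ((1 + 2 / eps) * K)).
  exists (2 * (B + edot v v)). intros y Hy.
  assert (He2 : 0 < eps / 2) by lra.
  assert (H1 : dist2 u y <= (1 + eps / 2) * dist2 v y + (1 + 2 / eps) * K).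
  { unfold K. rewrite !dist2_coord.
    pose proof (sqr_perturb (px v - px y) (px u - px v) _ He2) as Hx.
    pose proof (sqr_perturb (py v - py y) (py u - py v) _ He2) as Hyy.
    pose proof (sqr_perturb (pw v - pw y) (pw u - pw v) _ He2) as Hw.
    replace (/ (eps / 2)) with (2 / eps) in * by (field; lra).
    replace (px v - px y + (px u - px v)) with (px u - px y) in Hx by ring.
    replace (py v - py y + (py u - py v)) with (py u - py y) in Hyy by ring.
    replace (pw v - pw y + (pw u - pw v)) with (pw u - pw y) in Hw by ring. lra. }
  assert (H2 : edot y y <= 2 * dist2 v y + 2 * edot v v).
  { rewrite dist2_coord. unfold edot.
    pose proof (pow2_ge_0 (px y - 2 * px v)). pose proof (pow2_ge_0 (py y - 2 * py v)).
    pose proof (pow2_ge_0 (pw y - 2 * pw v)). nra. }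
  assert (H3 : B <= dist2 v y) by lra.
  assert (H4 : (1 + 2 / eps) * K <= eps / 2 * dist2 v y).
  { apply (Rmult_le_compat_l (eps / 2)) in H3; [|lra]. unfold B in H3.
    replace (eps / 2 * (2 / eps * ((1 + 2 / eps) * K))) with ((1 + 2 / eps) * K) in H3 by (field; lra). exact H3. }
  lra.
Qed.

(** Compare the distances of [p] and [p'] to a point [x] going to infinity: in
    [delta p x] only the height of [p] survives in the limit. *)
Lemma height_ratio_le T p p' : oriented_isometry T -> bdry_maps T Inf Inf -> H3 p -> H3 p' ->
  pw (T p) / pw p <= pw (T p') / pw p'.
Proof.
  intros HT HB Hp Hp'.
  assert (HTH : forall x, H3 x -> H3 (T x)) by (intros x Hx; now apply (proj1 HT)).
  assert (Hk : forall eps, 0 < eps -> pw (T p) / pw p <= (1 + eps) * (1 + eps) * (pw (T p') / pw p')).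
  { intros eps He.
    destruct (far_ratio p' p eps He) as [M1 HM1].
    destruct (far_ratio (T p) (T p') eps He) as [M2 HM2].
    destruct (HB (fun y => M2 < edot y y)) as [M3 HM3].
    { exists M2. auto. }
    set (n := 1 + Rmax (pw p) (Rmax M1 M3)).
    assert (Hn : 1 <= n) by (unfold n; unfold H3 in Hp; generalize (Rmax_l (pw p) (Rmax M1 M3)); lra).
    assert (Hn1 : M1 < n) by (unfold n; generalize (Rmax_r (pw p) (Rmax M1 M3)) (Rmax_l M1 M3); lra).
    assert (Hn3 : M3 < n) by (unfold n; generalize (Rmax_r (pw p) (Rmax M1 M3)) (Rmax_r M1 M3); lra).
    set (x := axis n).
    assert (Hx : H3 x) by (unfold H3, x, axis, pw; simpl; lra).
    assert (Exx : edot x x = n * n) by (unfold x, axis, edot, px, py, pw; simpl; ring).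
    assert (A1 : dist2 p' x <= (1 + eps) * dist2 p x) by (apply HM1; rewrite Exx; nra).
    assert (A2 : dist2 (T p) (T x) <= (1 + eps) * dist2 (T p') (T x)).
    { apply HM2. apply HM3; auto. rewrite Exx. nra. }
    assert (D1 := isometry_delta T p x HT Hp Hx). assert (D2 := isometry_delta T p' x HT Hp' Hx).
    unfold delta in D1, D2. fold (dist2 (T p) (T x)) (dist2 p x) in D1. fold (dist2 (T p') (T x)) (dist2 p' x) in D2.
    assert (h1 := HTH _ Hp). assert (h2 := HTH _ Hp'). assert (h3 := HTH _ Hx).
    unfold H3 in *.
    set (wp := pw p) in *. set (wp' := pw p') in *. set (wx := pw x) in *.
    set (tp := pw (T p)) in *. set (tp' := pw (T p')) in *. set (tx := pw (T x)) in *.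
    set (P := dist2 p x) in *. set (P' := dist2 p' x) in *.
    set (Q := dist2 (T p) (T x)) in *. set (Q' := dist2 (T p') (T x)) in *.
    assert (EQ : Q = tp / wp * (P * tx / wx)).
    { apply (Rmult_eq_compat_r (tp * tx)) in D1. replace (Q / (tp * tx) * (tp * tx)) with Q in D1 by (field; lra).
      rewrite D1. field. lra. }
    assert (EQ' : Q' = tp' / wp' * (P' * tx / wx)).
    { apply (Rmult_eq_compat_r (tp' * tx)) in D2. replace (Q' / (tp' * tx) * (tp' * tx)) with Q' in D2 by (field; lra).
      rewrite D2. field. lra. }
    assert (HP0 : 0 < P).
    { assert (Hnp : wp + 1 <= n) by (unfold n; generalize (Rmax_l (pw p) (Rmax M1 M3)); fold wp; lra).
      unfold P. rewrite dist2_coord. fold wp. change (pw x) with n.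
      assert (0 < (wp - n) ^ 2) by nra.
      pose proof (pow2_ge_0 (px p - px x)). pose proof (pow2_ge_0 (py p - py x)). lra. }
    assert (Hc : 0 < P * tx / wx) by (apply Rdiv_lt_0_compat; [apply Rmult_lt_0_compat|]; lra).
    assert (Hr' : 0 < tp' / wp') by now apply Rdiv_lt_0_compat.
    apply (Rmult_le_reg_r (P * tx / wx)); [exact Hc|]. rewrite <- EQ.
    eapply Rle_trans; [exact A2|]. rewrite EQ'.
    assert (H4 : P' * tx / wx <= (1 + eps) * (P * tx / wx)).
    { replace ((1 + eps) * (P * tx / wx)) with ((1 + eps) * P * (tx / wx)) by (field; lra).
      replace (P' * tx / wx) with (P' * (tx / wx)) by (field; lra).
      apply Rmult_le_compat_r; [apply Rlt_le, Rdiv_lt_0_compat; lra|exact A1]. }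
    apply (Rmult_le_compat_l ((1 + eps) * (tp' / wp'))) in H4; [|nra]. lra. }
  assert (Hb : 0 < pw (T p') / pw p') by (apply Rdiv_lt_0_compat; [now apply HTH|exact Hp']).
  set (a := pw (T p) / pw p) in *. set (b := pw (T p') / pw p') in *.
  apply le_epsilon. intros eta Heta.
  set (e := Rmin 1 (eta / (3 * b))).
  assert (He : 0 < e) by (apply Rmin_pos; [lra|apply Rdiv_lt_0_compat; lra]).
  assert (He1 : e <= 1) by apply Rmin_l.
  assert (He2 : 3 * e * b <= eta).
  { assert (e <= eta / (3 * b)) by apply Rmin_r.
    apply (Rmult_le_compat_r (3 * b)) in H; [|lra].
    replace (eta / (3 * b) * (3 * b)) with eta in H by (field; lra). lra. }
  specialize (Hk e He). nra.
Qed.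

(** Heights are multiplied by a constant, so by the formula for [delta] the
    horizontal coordinates undergo a Euclidean similarity; the orientation excludes
    the reflections. *)
Lemma isometry_fixing_inf T : oriented_isometry T -> bdry_maps T Inf Inf ->
  exists s b : C, s <> 0%C /\ forall p, H3 p -> T p = shift b (dilate s p).
Proof.
  intros HT HB.
  assert (HTH : forall x, H3 x -> H3 (T x)) by (intros x Hx; now apply (proj1 HT)).
  set (o := axis 1). assert (Ho : H3 o) by (unfold H3, o, axis, pw; simpl; lra).
  set (lam := pw (T o)). assert (Hlam : 0 < lam) by now apply HTH.
  assert (Hw : forall p, H3 p -> pw (T p) = lam * pw p).
  { intros p Hp. assert (E : pw (T p) / pw p = lam / 1).
    { apply Rle_antisym; [apply (height_ratio_le T p o)|apply (height_ratio_le T o p)]; auto. }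
    unfold H3 in Hp. apply (Rmult_eq_compat_r (pw p)) in E.
    replace (pw (T p) / pw p * pw p) with (pw (T p)) in E by (field; lra). rewrite E. field. }
  assert (Hd : forall p q, H3 p -> H3 q ->
    (px (T p) - px (T q)) ^ 2 + (py (T p) - py (T q)) ^ 2 = lam ^ 2 * ((px p - px q) ^ 2 + (py p - py q) ^ 2)).
  { intros p q Hp Hq. assert (D := isometry_delta T p q HT Hp Hq). unfold delta in D.
    fold (dist2 (T p) (T q)) (dist2 p q) in D. rewrite !Hw in D by auto. unfold H3 in *.
    apply (Rmult_eq_compat_r (lam * pw p * (lam * pw q))) in D.
    replace (dist2 (T p) (T q) / (lam * pw p * (lam * pw q)) * (lam * pw p * (lam * pw q))) with (dist2 (T p) (T q)) in D
      by (field; lra).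
    replace (dist2 p q / (pw p * pw q) * (lam * pw p * (lam * pw q))) with (lam ^ 2 * dist2 p q) in D by (field; lra).
    rewrite !dist2_coord, !Hw in D by auto. nra. }
  set (e1 := ((1, 0), 1) : Pt). set (e2 := ((0, 1), 1) : Pt).
  assert (He1 : H3 e1) by (unfold H3, e1, pw; simpl; lra). assert (He2 : H3 e2) by (unfold H3, e2, pw; simpl; lra).
  (* the horizontal part divided by lam, which is an isometry of the plane *)
  set (g1 := fun p => (px (T p) - px (T o)) / lam). set (g2 := fun p => (py (T p) - py (T o)) / lam).
  assert (Hg : forall p q, H3 p -> H3 q ->
    (g1 p - g1 q) ^ 2 + (g2 p - g2 q) ^ 2 = (px p - px q) ^ 2 + (py p - py q) ^ 2).
  { intros p q Hp Hq. specialize (Hd p q Hp Hq). unfold g1, g2.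
    replace (((px (T p) - px (T o)) / lam - (px (T q) - px (T o)) / lam) ^ 2 +
       ((py (T p) - py (T o)) / lam - (py (T q) - py (T o)) / lam) ^ 2) with
      (((px (T p) - px (T q)) ^ 2 + (py (T p) - py (T q)) ^ 2) / lam ^ 2) by (field; lra).
    rewrite Hd. field. lra. }
  assert (Hgo1 : g1 o = 0) by (unfold g1; rewrite Rminus_diag; unfold Rdiv; ring).
  assert (Hgo2 : g2 o = 0) by (unfold g2; rewrite Rminus_diag; unfold Rdiv; ring).
  set (u1 := g1 e1). set (u2 := g2 e1). set (v1 := g1 e2). set (v2 := g2 e2).
  assert (Hn : forall p, H3 p -> g1 p ^ 2 + g2 p ^ 2 = px p ^ 2 + py p ^ 2).
  { intros p Hp. specialize (Hg p o Hp Ho). rewrite Hgo1, Hgo2 in Hg.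
    replace (px o) with 0 in Hg by reflexivity. replace (py o) with 0 in Hg by reflexivity. nra. }
  assert (Hu : u1 ^ 2 + u2 ^ 2 = 1) .
  { pose proof (Hn e1 He1) as H. fold u1 u2 in H. rewrite H. unfold e1, px, py. simpl. ring. }
  assert (Hv : v1 ^ 2 + v2 ^ 2 = 1) .
  { pose proof (Hn e2 He2) as H. fold v1 v2 in H. rewrite H. unfold e2, px, py. simpl. ring. }
  assert (Hx : forall p, H3 p -> g1 p * u1 + g2 p * u2 = px p).
  { intros p Hp. pose proof (Hg p e1 Hp He1) as H. pose proof (Hn p Hp). fold u1 u2 in H.
    replace (px e1) with 1 in H by reflexivity. replace (py e1) with 0 in H by reflexivity. nra. }
  assert (Hy : forall p, H3 p -> g1 p * v1 + g2 p * v2 = py p).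
  { intros p Hp. pose proof (Hg p e2 Hp He2) as H. pose proof (Hn p Hp). fold v1 v2 in H.
    replace (px e2) with 0 in H by reflexivity. replace (py e2) with 1 in H by reflexivity. nra. }
  assert (Huv : u1 * v1 + u2 * v2 = 0) by (exact (Hy e1 He1)).
  set (k := u1 * v2 - u2 * v1).
  assert (Hk2 : k * k = 1).
  { transitivity ((u1 ^ 2 + u2 ^ 2) * (v1 ^ 2 + v2 ^ 2) - (u1 * v1 + u2 * v2) ^ 2); [unfold k; ring|].
    rewrite Hu, Hv, Huv. ring. }
  assert (Hv1 : v1 = - k * u2).
  { transitivity (v1 * (u1 ^ 2 + u2 ^ 2) - u1 * (u1 * v1 + u2 * v2)); [rewrite Hu, Huv; ring|unfold k; ring]. }
  assert (Hv2 : v2 = k * u1).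
  { transitivity (v2 * (u1 ^ 2 + u2 ^ 2) - u2 * (u1 * v1 + u2 * v2)); [rewrite Hu, Huv; ring|unfold k; ring]. }
  assert (G1 : forall p, H3 p -> g1 p = px p * u1 + py p * v1).
  { intros p Hp. rewrite <- (Hx p Hp), <- (Hy p Hp), Hv1, Hv2.
    transitivity (g1 p * (u1 ^ 2 + k * k * u2 ^ 2) + g2 p * (u1 * u2 * (1 - k * k))); [rewrite Hk2|ring].
    rewrite !Rmult_1_l, Hu. ring. }
  assert (G2 : forall p, H3 p -> g2 p = px p * u2 + py p * v2).
  { intros p Hp. rewrite <- (Hx p Hp), <- (Hy p Hp), Hv1, Hv2.
    transitivity (g2 p * (k * k * u1 ^ 2 + u2 ^ 2) + g1 p * (u1 * u2 * (1 - k * k))); [rewrite Hk2|ring].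
    rewrite !Rmult_1_l, Hu. ring. }
  assert (HTp : forall p, H3 p -> T p = ((px (T o) + lam * (px p * u1 + py p * v1), py (T o) + lam * (px p * u2 + py p * v2)),
     lam * pw p)).
  { intros p Hp. apply Pt_eq; unfold px at 1, py at 1, pw at 1; cbn [fst snd].
    - change (px (T p) = px (T o) + lam * (px p * u1 + py p * v1)). rewrite <- (G1 p Hp). unfold g1. field. lra.
    - change (py (T p) = py (T o) + lam * (px p * u2 + py p * v2)). rewrite <- (G2 p Hp). unfold g2. field. lra.
    - change (pw (T p) = lam * pw p). now apply Hw. }
  (* the differential has determinant lam^3 k *)
  assert (Hk : k = 1).
  { destruct (proj1 HT o Ho) as [_ [L [D1 [_ O1]]]].
    assert (HL : forall v : Pt, L v = ((lam * (px v * u1 + py v * v1), lam * (px v * u2 + py v * v2)), lam * pw v)).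
    { intros v. set (gam := fun s : R => vadd o (vscal s v)).
      assert (Hgam : is_derive (V := Pt_NM) gam 0 v).
      { apply is_derive_Pt. unfold gam, vadd, vscal, px, py, pw. cbn [fst snd].
        split; [|split]; auto_derive; auto; ring. }
      assert (Hg0 : gam 0 = o) by (apply Pt_eq; unfold gam, vadd, vscal, px, py, pw; simpl; ring).
      assert (D1' : fd T (gam 0) L) by (rewrite Hg0; exact D1).
      apply (is_derive_Pt_unique (fun s => T (gam s)) 0); [exact (fd_curve T gam 0 v L Hgam D1')|].
      assert (Hloc : locally 0 (fun s => H3 (gam s))).
      { destruct (proj1 (is_derive_Pt _ _ _) Hgam) as [_ [_ Hd3]].
        assert (Hc : continuous (fun s => pw (gam s)) 0) by (apply (ex_derive_continuous (fun s => pw (gam s))); eexists; exact Hd3).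
        apply (Hc (fun w => 0 < w)). apply (open_gt 0). rewrite Hg0. exact Ho. }
      apply (filterdiff_ext_locally (U := R_NormedModule) (V := Pt_NM)
        (fun s => ((px (T o) + lam * (px (gam s) * u1 + py (gam s) * v1),
           py (T o) + lam * (px (gam s) * u2 + py (gam s) * v2)), lam * pw (gam s)))).
      - revert Hloc. apply filter_imp. intros s Hs. symmetry. now apply HTp.
      - apply is_derive_Pt. unfold gam, vadd, vscal, px, py, pw. cbn [fst snd].
        split; [|split]; auto_derive; auto; ring. }
    rewrite !HL in O1. unfold det3, ecross, edot, px, py, pw in O1. simpl in O1.
    replace (_ + _ + _) with (lam ^ 3 * k) in O1 by (unfold k; ring).
    assert (0 < lam ^ 3) by now apply pow_lt.
    assert (0 < k) by nra. nra. }
  destruct (complex_sqrt ((lam * u1, lam * u2) : C)) as [s [Es Es2]].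
  assert (Hmod : Cmod ((lam * u1, lam * u2) : C) = lam).
  { assert (E := Cmod_sqr ((lam * u1, lam * u2) : C)). simpl in E.
    pose proof (Cmod_ge_0 ((lam * u1, lam * u2) : C)).
    replace (lam * u1 * (lam * u1) + lam * u2 * (lam * u2)) with (lam * lam * (u1 ^ 2 + u2 ^ 2)) in E by ring.
    rewrite Hu in E. nra. }
  exists s, (fst (T o)). split.
  - intros E. rewrite E in Es2. simpl in Es2. lra.
  - intros p Hp. rewrite (HTp p Hp). unfold shift, dilate. cbn [fst snd]. rewrite Es, Es2, Hmod.
    apply Pt_eq; unfold px, py, pw; simpl; rewrite ?Hv1, ?Hv2, ?Hk; ring.
Qed.

(** * Action on the asymptotic boundary *)

Lemma continuous_Pt (Phi : Pt -> Pt) (p : Pt) :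
  continuous (T := Pt_NM) (U := R_UniformSpace) (fun x => px (Phi x)) p ->
  continuous (T := Pt_NM) (U := R_UniformSpace) (fun x => py (Phi x)) p ->
  continuous (T := Pt_NM) (U := R_UniformSpace) (fun x => pw (Phi x)) p ->
  continuous (T := Pt_NM) (U := Pt_NM) Phi p.
Proof.
  intros H1 H2 H3. apply filterlim_locally. intros eps.
  generalize (proj1 (filterlim_locally _ _) H1 eps) (proj1 (filterlim_locally _ _) H2 eps)
    (proj1 (filterlim_locally _ _) H3 eps).
  intros K1 K2 K3. generalize (filter_and _ _ K1 (filter_and _ _ K2 K3)). apply filter_imp.
  intros x [h1 [h2 h3]]. split; [split|]; assumption.
Qed.

Lemma fdR_continuous f p l : fdR f p l -> continuous (T := Pt_NM) (U := R_UniformSpace) f p.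
Proof.
  intros H. apply (filterdiff_continuous (U := Pt_NM) (V := R_NormedModule) f p). now exists l.
Qed.

Lemma bdry_maps_fin Phi c c' : (forall p, H3 p -> H3 (Phi p)) ->
  continuous (T := Pt_NM) (U := Pt_NM) Phi ((c, 0) : Pt) -> Phi (c, 0) = (c', 0) ->
  bdry_maps Phi (Fin c) (Fin c').
Proof.
  intros HH Hc E P HP. unfold to_bdry, within in *. simpl in *. rewrite <- E in HP.
  specialize (Hc _ HP).
  apply (filter_imp (F := locally (T := Pt_NM) ((c, 0) : Pt)) (fun x => H3 (Phi x) -> P (Phi x))); [|exact Hc].
  intros x Hx Hp. apply Hx. now apply HH.
Qed.

Lemma bdry_maps_comp Phi Psi a b c : bdry_maps Psi a b -> bdry_maps Phi b c -> bdry_maps (fun p => Phi (Psi p)) a c.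
Proof. intros H1 H2. exact (filterlim_comp _ _ _ Psi Phi _ _ _ H1 H2). Qed.

Lemma bdry_shift_fin b c : bdry_maps (shift b) (Fin c) (Fin (c + b)%C).
Proof.
  apply bdry_maps_fin; [auto| |reflexivity].
  apply continuous_Pt.
  - apply (fdR_continuous (fun x => px x + fst b) _ (fun v => px v + 0)). fdRt.
  - apply (fdR_continuous (fun x => py x + snd b) _ (fun v => py v + 0)). fdRt.
  - apply (fdR_continuous pw _ pw), fdR_pw.
Qed.

Lemma dilate_H3 (s : C) p : s <> 0%C -> H3 p -> H3 (dilate s p).
Proof. intros Hs Hp. apply (moebius_H3 (dilate s) (pull_dilate s)); auto. now constructor. Qed.

Lemma invert_H3 p : H3 p -> H3 (invert p).
Proof. apply (moebius_H3 invert pull_invert). constructor. Qed.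

Lemma bdry_dilate_fin (s : C) c : s <> 0%C -> bdry_maps (dilate s) (Fin c) (Fin (s * s * c)%C).
Proof.
  intros Hs. apply bdry_maps_fin.
  - intros p. now apply dilate_H3.
  - apply continuous_Pt.
    + eapply fdR_continuous.
      fdchange (fun x => (fst s * fst s - snd s * snd s) * px x - (fst s * snd s + snd s * fst s) * py x). fdRt.
    + eapply fdR_continuous.
      fdchange (fun x => (fst s * fst s - snd s * snd s) * py x + (fst s * snd s + snd s * fst s) * px x). fdRt.
    + eapply fdR_continuous.
      fdchange (fun x => (fst s * fst s + snd s * snd s) * pw x). fdRt.
  - unfold dilate. cbn [fst snd]. f_equal. unfold pw. simpl. ring.
Qed.

Lemma bdry_invert_fin (c : C) : c <> 0%C -> bdry_maps invert (Fin c) (Fin (- / c)%C).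
Proof.
  intros Hc. assert (Hc2 := sqr_sum_pos c Hc). apply bdry_maps_fin.
  - apply invert_H3.
  - assert (Hn : edot ((c, 0) : Pt) ((c, 0) : Pt) <> 0).
    { unfold edot, px, py, pw. simpl. lra. }
    apply continuous_Pt.
    + eapply fdR_continuous.
      fdchange (fun x => - px x * / (px x * px x + py x * py x + pw x * pw x)). fdRt. exact Hn.
    + eapply fdR_continuous.
      fdchange (fun x => py x * / (px x * px x + py x * py x + pw x * pw x)). fdRt. exact Hn.
    + eapply fdR_continuous.
      fdchange (fun x => pw x * / (px x * px x + py x * py x + pw x * pw x)). fdRt. exact Hn.
  - destruct c as [x y]. simpl in Hc2. unfold invert, edot, px, py, pw. simpl.
    apply Pt_eq; unfold px, py, pw; simpl; field; nra.
Qed.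

Lemma bdry_shift_inf b : bdry_maps (shift b) Inf Inf.
Proof.
  intros P [M HM]. exists (2 * M + 2 * (fst b * fst b + snd b * snd b)). intros p Hp Hlt.
  apply HM; [exact Hp|].
  assert (H : edot p p <= 2 * edot (shift b p) (shift b p) + 2 * (fst b * fst b + snd b * snd b)).
  { destruct p as [[x y] w], b as [b1 b2]. unfold shift, edot, px, py, pw. simpl.
    pose proof (pow2_ge_0 (x + 2 * b1)). pose proof (pow2_ge_0 (y + 2 * b2)). nra. }
  lra.
Qed.

Lemma edot_invert p : H3 p -> edot (invert p) (invert p) = / edot p p.
Proof.
  intros Hp. assert (Hn := edot_pos p Hp). destruct p as [[x y] w]. unfold invert, edot, px, py, pw in *. simpl in *.
  field. nra.
Qed.

Lemma bdry_invert_zero : bdry_maps invert (Fin 0%C) Inf.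
Proof.
  intros P [M HM]. unfold filtermap, to_bdry, within.
  set (K := 3 * (Rabs M + 1)). assert (HK : 0 < K) by (unfold K; generalize (Rabs_pos M); lra).
  set (e := Rmin 1 (/ K)). assert (He : 0 < e) by (apply Rmin_pos; [lra|now apply Rinv_0_lt_compat]).
  exists (mkposreal _ He). intros p Hb Hp. simpl in Hb.
  apply HM; [now apply invert_H3|]. rewrite edot_invert by exact Hp.
  assert (Hn := edot_pos p Hp).
  destruct Hb as [[Hx Hy] Hw]. unfold ball in *; simpl in *. unfold AbsRing_ball, abs, minus, plus, opp in *; simpl in *.
  assert (H1 : edot p p < 3 * e).
  { destruct p as [[x y] w]. unfold edot, px, py, pw. simpl in *. rewrite Ropp_0, Rplus_0_r in *.
    assert (e <= 1) by apply Rmin_l.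
    assert (x * x < e) by (rewrite <- (Rabs_pos_eq (x * x)), Rabs_mult by nra; pose proof (Rabs_pos x); nra).
    assert (y * y < e) by (rewrite <- (Rabs_pos_eq (y * y)), Rabs_mult by nra; pose proof (Rabs_pos y); nra).
    assert (w * w < e) by (rewrite <- (Rabs_pos_eq (w * w)), Rabs_mult by nra; pose proof (Rabs_pos w); nra).
    lra. }
  assert (H2 : 3 * e <= / (Rabs M + 1)).
  { assert (H : e <= / K) by apply Rmin_r. unfold K in H. rewrite Rinv_mult in H. lra. }
  assert (H3' : Rabs M + 1 < / edot p p).
  { rewrite <- (Rinv_inv (Rabs M + 1)). apply Rinv_lt_contravar; [|lra].
    apply Rmult_lt_0_compat; auto. apply Rinv_0_lt_compat. generalize (Rabs_pos M); lra. }
  generalize (Rle_abs M). lra.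
Qed.

Lemma bdry_invert_inf : bdry_maps invert Inf (Fin 0%C).
Proof.
  intros P HP. unfold to_bdry, within in HP. destruct HP as [e He]. simpl.
  exists (/ (e * e)). intros p Hp Hlt.
  assert (Hn := edot_pos p Hp). assert (Hepos := cond_pos e).
  assert (H1 : edot (invert p) (invert p) < e * e).
  { rewrite edot_invert by exact Hp. rewrite <- (Rinv_inv (e * e)). apply Rinv_lt_contravar; [|exact Hlt].
    apply Rmult_lt_0_compat; auto. apply Rinv_0_lt_compat. nra. }
  apply He; [|now apply invert_H3].
  set (v := invert p) in *. destruct v as [[x y] w]. unfold edot, px, py, pw in H1. simpl in H1.
  assert (A : forall a : R, a * a < e * e -> Rabs a < e).
  { intros a Ha. apply Rabs_def1; nra. }
  split; [split|]; unfold ball; simpl; unfold AbsRing_ball, abs, minus, plus, opp; simpl; rewrite Ropp_0, Rplus_0_r; apply A; nra.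
Qed.

(** * The Killing fields of a geodesic *)

(** The quadratic field vanishing at [c] and [d], with derivative 1 at [c] and -1 at
    [d]; a field of degree at most one vanishes at infinity. *)
Definition killing_quad (c d : Cbar) : quad :=
  match c, d with
  | Fin c, Fin d => ((c * d / (c - d), - (c + d) / (c - d)), / (c - d))%C
  | Fin c, Inf => ((- c, RtoC 1), RtoC 0)%C
  | Inf, Fin d => ((d, - RtoC 1), RtoC 0)%C
  | Inf, Inf => ((RtoC 0, RtoC 0), RtoC 0)%C
  end.

Definition axial (k : C) : quad := ((RtoC 0, k), RtoC 0)%C.

Lemma quad_eq (q q' : quad) : qc0 q = qc0 q' -> qc1 q = qc1 q' -> qc2 q = qc2 q' -> q = q'.
Proof. destruct q as [[? ?] ?], q' as [[? ?] ?]. unfold qc0, qc1, qc2. simpl. now intros -> -> ->. Qed.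

Lemma moebius_scal N f k q : moebius N f -> f (quad_scal k q) = quad_scal k (f q).
Proof.
  intros H. revert q. induction H; intros q.
  - apply quad_eq; unfold pull_shift, quad_scal, qeval, qc0, qc1, qc2; simpl; ring.
  - apply quad_eq; unfold pull_dilate, quad_scal, qc0, qc1, qc2; simpl; field; auto.
  - apply quad_eq; unfold pull_invert, quad_scal, qc0, qc1, qc2; simpl; ring.
  - rewrite IHmoebius1. apply IHmoebius2.
Qed.

(** For finite end points the map is [z |-> d - (d - c) / (z + 1)]. *)
Lemma axis_to_geodesic c d : c <> d -> exists N f N' f', moebius N f /\ moebius N' f' /\
  (forall p, H3 p -> N' (N p) = p /\ N (N' p) = p) /\
  bdry_maps N (Fin 0%C) c /\ bdry_maps N Inf d /\ bdry_maps N' c (Fin 0%C) /\ bdry_maps N' d Inf /\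
  f (killing_quad c d) = axial 1.
Proof.
  intros Hcd. destruct c as [c|], d as [d|].
  - assert (Hc : (d - c)%C <> 0%C).
    { intros E. apply Hcd. f_equal. replace d with ((d - c) + c)%C by ring. rewrite E. ring. }
    assert (Hc' : (c - d)%C <> 0%C).
    { intros E. apply Hcd. f_equal. replace c with ((c - d) + d)%C by ring. rewrite E. ring. }
    destruct (complex_sqrt (d - c)%C) as [s [Es _]].
    assert (Hs : s <> 0%C) by (intros ->; apply Hc; rewrite <- Es; ring).
    assert (Hs' : (/ s)%C <> 0%C) by (intros E; apply (f_equal (Cmult s)) in E; rewrite Cinv_r, Cmult_0_r in E by auto;
      injection E; lra).
    exists (fun p => shift d (dilate s (invert (shift 1 p)))), (fun q => pull_shift 1 (pull_invert (pull_dilate s (pull_shift d q)))),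
      (fun p => shift (- (1)) (invert (dilate (/ s) (shift (- d) p)))),
      (fun q => pull_shift (- d) (pull_dilate (/ s) (pull_invert (pull_shift (- (1)) q)))).
    split; [|split; [|split; [|split; [|split; [|split; [|split]]]]]].
    + apply (moebius_comp (shift d) _ (fun p => dilate s (invert (shift 1 p))) (fun q => pull_shift 1 (pull_invert (pull_dilate s q)))); [constructor|].
      apply (moebius_comp (dilate s) _ (fun p => invert (shift 1 p)) (fun q => pull_shift 1 (pull_invert q))); [now constructor|].
      apply (moebius_comp invert _ (shift 1) (pull_shift 1)); constructor.
    + apply (moebius_comp (shift (- (1))) _ (fun p => invert (dilate (/ s) (shift (- d) p)))
        (fun q => pull_shift (- d) (pull_dilate (/ s) (pull_invert q)))); [constructor|].
      apply (moebius_comp invert _ (fun p => dilate (/ s) (shift (- d) p)) (fun q => pull_shift (- d) (pull_dilate (/ s) q))); [constructor|].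
      apply (moebius_comp (dilate (/ s)) _ (shift (- d)) (pull_shift (- d))); [now constructor|constructor].
    + intros p Hp. split.
      * rewrite shift_inv, dilate_inv, invert_inv by auto. apply shift_inv.
      * assert (Hq : H3 (dilate (/ s) (shift (- d) p))) by now apply dilate_H3.
        replace (shift 1) with (shift (- - (1))) by (f_equal; ring). rewrite shift_inv, invert_inv by exact Hq.
        replace (dilate s) with (dilate (/ / s)) by (f_equal; field; auto). rewrite dilate_inv by exact Hs'.
        replace (shift d) with (shift (- - d)) by (f_equal; ring). apply shift_inv.
    + apply (bdry_maps_comp (shift d) (fun p => dilate s (invert (shift 1 p))) _ (Fin (c - d)%C)).
      2:{ replace (Fin c) with (Fin (c - d + d)%C) by (f_equal; ring). apply bdry_shift_fin. }
      apply (bdry_maps_comp (dilate s) (fun p => invert (shift 1 p)) _ (Fin (- (1))%C)).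
      2:{ replace (Fin (c - d)%C) with (Fin (s * s * (- (1)))%C) by (f_equal; rewrite Es; ring). now apply bdry_dilate_fin. }
      apply (bdry_maps_comp invert (shift 1) _ (Fin 1%C)).
      * replace (Fin 1%C) with (Fin (0 + 1)%C) by (f_equal; ring). apply bdry_shift_fin.
      * replace (Fin (- (1))%C) with (Fin (- / 1)%C) by (f_equal; field). apply bdry_invert_fin. intros E; injection E; lra.
    + apply (bdry_maps_comp (shift d) (fun p => dilate s (invert (shift 1 p))) _ (Fin 0%C)).
      2:{ replace (Fin d) with (Fin (0 + d)%C) by (f_equal; ring). apply bdry_shift_fin. }
      apply (bdry_maps_comp (dilate s) (fun p => invert (shift 1 p)) _ (Fin 0%C)).
      2:{ replace (Fin 0%C) with (Fin (s * s * 0)%C) at 2 by (f_equal; ring). now apply bdry_dilate_fin. }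
      apply (bdry_maps_comp invert (shift 1) _ Inf); [apply bdry_shift_inf|apply bdry_invert_inf].
    + apply (bdry_maps_comp (shift (- (1))) (fun p => invert (dilate (/ s) (shift (- d) p))) _ (Fin 1%C)).
      2:{ replace (Fin 0%C) with (Fin (1 + - (1))%C) by (f_equal; ring). apply bdry_shift_fin. }
      apply (bdry_maps_comp invert (fun p => dilate (/ s) (shift (- d) p)) _ (Fin (- (1))%C)).
      2:{ replace (Fin 1%C) with (Fin (- / - (1))%C) by (f_equal; field; intros E; injection E; lra). apply bdry_invert_fin.
          intros E; injection E; lra. }
      apply (bdry_maps_comp (dilate (/ s)) (shift (- d)) _ (Fin (c + - d)%C)); [apply bdry_shift_fin|].
      replace (Fin (- (1))%C) with (Fin (/ s * / s * (c + - d))%C); [now apply bdry_dilate_fin|].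
      f_equal. replace (c + - d)%C with (- (s * s))%C by (rewrite Es; ring). field. auto.
    + apply (bdry_maps_comp (shift (- (1))) (fun p => invert (dilate (/ s) (shift (- d) p))) _ Inf); [|apply bdry_shift_inf].
      apply (bdry_maps_comp invert (fun p => dilate (/ s) (shift (- d) p)) _ (Fin 0%C)); [|apply bdry_invert_zero].
      apply (bdry_maps_comp (dilate (/ s)) (shift (- d)) _ (Fin (d + - d)%C)); [apply bdry_shift_fin|].
      replace (Fin 0%C) with (Fin (/ s * / s * (d + - d))%C) by (f_equal; ring). now apply bdry_dilate_fin.
    + apply quad_eq; unfold pull_shift, pull_invert, pull_dilate, killing_quad, axial, qeval, qc0, qc1, qc2; cbn [fst snd];
        rewrite ?Es; field; repeat split; auto.
  - exists (shift c), (pull_shift c), (shift (- c)), (pull_shift (- c)).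
    split; [constructor|]. split; [constructor|]. split; [|split; [|split; [|split; [|split]]]].
    + intros p Hp. split; [apply shift_inv|]. replace (shift c) with (shift (- - c)) by (f_equal; ring). apply shift_inv.
    + replace (Fin c) with (Fin (0 + c)%C) by (f_equal; ring). apply bdry_shift_fin.
    + apply bdry_shift_inf.
    + replace (Fin 0%C) with (Fin (c + - c)%C) by (f_equal; ring). apply bdry_shift_fin.
    + apply bdry_shift_inf.
    + apply quad_eq; unfold pull_shift, killing_quad, axial, qeval, qc0, qc1, qc2; simpl; ring.
  - exists (fun p => shift d (invert p)), (fun q => pull_invert (pull_shift d q)),
      (fun p => invert (shift (- d) p)), (fun q => pull_shift (- d) (pull_invert q)).
    split; [apply (moebius_comp (shift d) (pull_shift d) invert pull_invert); constructor|].
    split; [apply (moebius_comp invert pull_invert (shift (- d)) (pull_shift (- d))); constructor|].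
    split; [|split; [|split; [|split; [|split]]]].
    + intros p Hp. split.
      * rewrite shift_inv. now apply invert_inv.
      * rewrite invert_inv by exact Hp. replace (shift d) with (shift (- - d)) by (f_equal; ring). apply shift_inv.
    + apply (bdry_maps_comp (shift d) invert _ Inf); [apply bdry_invert_zero|apply bdry_shift_inf].
    + apply (bdry_maps_comp (shift d) invert _ (Fin 0%C)); [apply bdry_invert_inf|].
      replace (Fin d) with (Fin (0 + d)%C) by (f_equal; ring). apply bdry_shift_fin.
    + apply (bdry_maps_comp invert (shift (- d)) _ Inf); [apply bdry_shift_inf|apply bdry_invert_inf].
    + apply (bdry_maps_comp invert (shift (- d)) _ (Fin 0%C)); [|apply bdry_invert_zero].
      replace (Fin 0%C) with (Fin (d + - d)%C) by (f_equal; ring). apply bdry_shift_fin.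
    + apply quad_eq; unfold pull_shift, pull_invert, killing_quad, axial, qeval, qc0, qc1, qc2; simpl; ring.
  - now contradiction Hcd.
Qed.

Definition axial_flow (std : R -> Pt -> Pt) (k : C) : Prop :=
  forall p, std 0 p = p /\ forall t, (H3 p -> H3 (std t p)) /\
    is_derive (V := Pt_NM) (fun s => std s p) t (killing (axial k) (std t p)).

Lemma std_translation_axial : axial_flow std_translation 1.
Proof.
  intros p. split.
  - unfold std_translation, vscal. rewrite exp_0. apply Pt_eq; unfold px, py, pw; simpl; ring.
  - intros t. split.
    + unfold H3, std_translation, vscal. unfold pw at 2. simpl. intros Hp. apply Rmult_lt_0_compat; auto. apply exp_pos.
    + destruct p as [[x y] w]. apply is_derive_Pt.
      unfold std_translation, vscal, killing, axial, qeval, qc0, qc1, qc2, px, py, pw. simpl.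
      split; [|split]; auto_derive; auto; ring.
Qed.

Lemma std_rotation_axial : axial_flow std_rotation Ci.
Proof.
  intros p. split.
  - unfold std_rotation. rewrite cos_0, sin_0. apply Pt_eq; unfold px, py, pw; simpl; ring.
  - intros t. split.
    + auto.
    + destruct p as [[x y] w]. apply is_derive_Pt.
      unfold std_rotation, killing, axial, qeval, qc0, qc1, qc2, px, py, pw. simpl.
      split; [|split]; auto_derive; auto; ring.
Qed.

Lemma similarity_fixing_zero (T : Pt -> Pt) (s b : C) :
  (forall p, H3 p -> T p = shift b (dilate s p)) -> bdry_maps T (Fin 0%C) (Fin 0%C) -> b = 0%C.
Proof.
  intros HT HB.
  assert (K : forall eps : posreal, Rabs (fst b) < eps /\ Rabs (snd b) < eps).
  { intros eps.
    assert (H : to_bdry (Fin 0%C) (fun p : Pt => Rabs (px p) < eps /\ Rabs (py p) < eps)).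
    { exists eps. intros [[x y] w] [[Hx Hy] _] _. unfold ball in Hx, Hy. simpl in Hx, Hy.
      unfold AbsRing_ball, abs, minus, plus, opp in Hx, Hy. simpl in Hx, Hy. rewrite Ropp_0, Rplus_0_r in Hx, Hy.
      split; [exact Hx|exact Hy]. }
    apply HB in H. destruct H as [e He].
    assert (Hepos := cond_pos e).
    assert (Hax : H3 (axis (e / 2))) by (unfold H3, axis, pw; simpl; lra).
    assert (Hball : ball (M := Pt_NM) ((RtoC 0, 0) : Pt) e (axis (e / 2))).
    { split; [split|]; unfold ball; simpl; unfold AbsRing_ball, abs, minus, plus, opp; simpl;
        rewrite Ropp_0, Rplus_0_r; [rewrite Rabs_R0; lra|rewrite Rabs_R0; lra|rewrite Rabs_pos_eq; lra]. }
    specialize (He _ Hball Hax). rewrite HT in He by exact Hax.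
    assert (E1 : px (shift b (dilate s (axis (e / 2)))) = fst b) by (unfold shift, dilate, axis, px; simpl; ring).
    assert (E2 : py (shift b (dilate s (axis (e / 2)))) = snd b) by (unfold shift, dilate, axis, py; simpl; ring).
    rewrite E1, E2 in He. exact He. }
  assert (Z : forall x, (forall eps : posreal, Rabs x < eps) -> x = 0).
  { intros x Hx. destruct (Req_dec x 0) as [|Hne]; auto. exfalso.
    specialize (Hx (mkposreal _ (Rabs_pos_lt x Hne))). simpl in Hx. lra. }
  destruct b as [b1 b2]. apply injective_projections; apply Z; intros eps; apply (K eps).
Qed.

Lemma pull_dilate_axial (s : C) k : s <> 0%C -> pull_dilate s (axial k) = axial k.
Proof. intros Hs. apply quad_eq; unfold pull_dilate, axial, qc0, qc1, qc2; simpl; field; auto. Qed.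

Section AxialField.
Context (std : R -> Pt -> Pt) (k : C) (Hstd : axial_flow std k) (c d : Cbar) (Hcd : c <> d).

Definition conjugate_field (Y : Pt -> Pt) : Prop :=
  exists flow, conjugate_flow std c d flow /\ generates flow Y.

Lemma conjugate_derive N f p t : moebius N f -> H3 p -> f (killing_quad c d) = axial 1 ->
  is_derive (V := Pt_NM) (fun s => N (std s p)) t (killing (quad_scal k (killing_quad c d)) (N (std t p))).
Proof.
  intros HN Hp Hf.
  destruct (moebius_natural N f HN (std t p)) as [_ [L [D1 [_ [_ [K1 _]]]]]]; [now apply Hstd|].
  rewrite <- K1, (moebius_scal N f _ _ HN), Hf.
  replace (quad_scal k (axial 1)) with (axial k).
  - apply (fd_curve N (fun s => std s p) t); [now apply Hstd|exact D1].
  - apply quad_eq; unfold quad_scal, axial, qc0, qc1, qc2; simpl; ring.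
Qed.

Lemma conjugate_field_exists : exists Y, conjugate_field Y.
Proof.
  destruct (axis_to_geodesic c d Hcd) as [N [f [N' [f' [HN [HN' [E [B1 [B2 [_ [_ Hf]]]]]]]]]]].
  exists (killing (quad_scal k (killing_quad c d))), (fun t y => N (std t (N' y))). split.
  - exists N. split; [now apply (moebius_oriented N f)|]. split; [exact B1|]. split; [exact B2|].
    intros t p Hp. now rewrite (proj1 (E p Hp)).
  - intros t p Hp. apply (conjugate_derive N f); auto. now apply (moebius_H3 N' f').
Qed.

(** Two isometries sending the vertical axis to the same oriented geodesic
    differ by a dilation, which commutes with the flow. *)
Lemma conjugate_field_unique Y : conjugate_field Y -> forall y, H3 y -> Y y = killing (quad_scal k (killing_quad c d)) y.
Proof.
  intros [flow [[Psi [HPsi [HP1 [HP2 HF]]]] HG]] y Hy.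
  destruct (axis_to_geodesic c d Hcd) as [N [f [N' [f' [HN [HN' [E [B1 [B2 [B3 [B4 Hf]]]]]]]]]]].
  assert (HTo : oriented_isometry (fun p => N' (Psi p))).
  { apply (oriented_comp N' Psi); [now apply (moebius_oriented N' f')|exact HPsi]. }
  destruct HPsi as [HPsi [Inv [HInv HE]]].
  assert (HPsiH : forall p, H3 p -> H3 (Psi p)) by (intros p Hp; now apply HPsi).
  assert (HInvH : forall p, H3 p -> H3 (Inv p)) by (intros p Hp; now apply HInv).
  destruct (isometry_fixing_inf _ HTo) as [s [b [Hs HT]]].
  { apply (bdry_maps_comp N' Psi _ d); assumption. }
  assert (Hb : b = 0%C).
  { apply (similarity_fixing_zero _ s b HT). apply (bdry_maps_comp N' Psi _ c); assumption. }
  assert (HPN : forall p, H3 p -> Psi p = N (dilate s p)).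
  { intros p Hp. rewrite <- (proj2 (E (Psi p) (HPsiH p Hp))), HT by exact Hp. f_equal. rewrite Hb.
    unfold shift. destruct (dilate s p) as [z w]. unfold pw. simpl. f_equal. ring. }
  set (p := Inv y). assert (Hp : H3 p) by now apply HInvH.
  assert (Ey : y = Psi p) by (symmetry; now apply HE).
  assert (HM : moebius (fun p => N (dilate s p)) (fun q => pull_dilate s (f q))).
  { apply (moebius_comp N f (dilate s) (pull_dilate s)); [exact HN|now constructor]. }
  assert (HMf : pull_dilate s (f (killing_quad c d)) = axial 1) by (rewrite Hf; now apply pull_dilate_axial).
  assert (D1 := conjugate_derive _ _ p 0 HM Hp HMf).
  assert (D2' := HG 0 y Hy).
  assert (Efl : forall t, flow t y = N (dilate s (std t p))).
  { intros t. rewrite Ey, HF by exact Hp. apply HPN. now apply Hstd. }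
  cbv beta in D1. rewrite Efl in D2'. rewrite (proj1 (Hstd p)) in *.
  rewrite <- (HPN p Hp), <- Ey in *.
  apply (is_derive_Pt_unique (fun t => N (dilate s (std t p))) 0); [|exact D1].
  revert D2'. apply is_derive_ext. intros t. apply Efl.
Qed.

End AxialField.

(** Translations and rotations about a geodesic correspond to the multiples by 1 and [i]
    of one quadratic field. *)
Lemma axial_flux std k c d Omega X v :
  axial_flow std k -> c <> d ->
  (forall Y, (forall p, H3 p -> Y p = killing (quad_scal k (killing_quad c d)) p) -> is_flux Omega X Y v) ->
  (exists Y, conjugate_field std c d Y) /\ forall Y, conjugate_field std c d Y -> is_flux Omega X Y v.
Proof.
  intros H1 H2 H. split; [now apply (conjugate_field_exists std k)|].
  intros Y HY. apply H. now apply (conjugate_field_unique std k).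
Qed.

(** * Change of coordinate *)

Lemma du_Pt_ext_loc X Y z : locally z (fun y => X y = Y y) -> du_Pt X z = du_Pt Y z /\ dv_Pt X z = dv_Pt Y z.
Proof.
  intros H.
  destruct (du_ext_loc (fun y => px (X y)) (fun y => px (Y y)) z) as [E1 E2].
  { revert H. apply filter_imp. now intros y ->. }
  destruct (du_ext_loc (fun y => py (X y)) (fun y => py (Y y)) z) as [E3 E4].
  { revert H. apply filter_imp. now intros y ->. }
  destruct (du_ext_loc (fun y => pw (X y)) (fun y => pw (Y y)) z) as [E5 E6].
  { revert H. apply filter_imp. now intros y ->. }
  split; apply Pt_eq; assumption.
Qed.

Lemma theta_ext_loc q X Y z : locally z (fun y => X y = Y y) -> thetaU q X z = thetaU q Y z /\ thetaV q X z = thetaV q Y z.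
Proof.
  intros H. destruct (du_Pt_ext_loc X Y z H) as [E1 E2]. apply locally_singleton in H.
  unfold thetaU, thetaV. now rewrite E1, E2, H.
Qed.

Lemma class_C_Pt_D2 U X z : open U -> class_C_Pt 1 U X -> U z -> Pt_D2 X z (du_Pt X z) (dv_Pt X z).
Proof. intros HU [H1 [H2 H3]] Hz. split; [|split]; now apply (class_C_D2 U). Qed.

Lemma Pt_D2_reparam X phi z a b (l : C) : Pt_D2 X (phi z) a b -> complex_derive phi z l ->
  Pt_D2 (fun y => X (phi y)) z (vadd (vscal (Re l) a) (vscal (Im l) b)) (vadd (vscal (- Im l) a) (vscal (Re l) b)).
Proof.
  intros [H1 [H2 H3]] Hl. apply complex_derive_D2 in Hl. destruct Hl as [L1 L2].
  assert (K : forall f u v, D2 f (phi z) u v ->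
    D2 (fun y => f (phi y)) z (Re l * u + Im l * v) (- Im l * u + Re l * v)).
  { intros f u v Hf.
    assert (Hf' : D2 f ((Re (phi z), Im (phi z)) : C) u v) by (destruct (phi z); exact Hf).
    assert (H := D2_comp f (fun y => Re (phi y)) (fun y => Im (phi y)) z _ _ _ _ _ _ Hf' L1 L2).
    cbv beta in H.
    replace (Re l * u + Im l * v) with (u * Re l + v * Im l) by ring.
    replace (- Im l * u + Re l * v) with (u * - Im l + v * Re l) by ring.
    revert H. apply D2_ext. intros y. now destruct (phi y). }
  split; [|split]; unfold vadd, vscal.
  - exact (K _ _ _ H1). - exact (K _ _ _ H2). - exact (K _ _ _ H3).
Qed.

(** Holomorphic changes of coordinate commute with the quarter turn in [theta]. *)
Lemma theta_reparam q X phi z a b (l : C) : Pt_D2 X (phi z) a b -> complex_derive phi z l ->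
  thetaU q (fun y => X (phi y)) z = Re l * thetaU q X (phi z) + Im l * thetaV q X (phi z) /\
  thetaV q (fun y => X (phi y)) z = - Im l * thetaU q X (phi z) + Re l * thetaV q X (phi z).
Proof.
  intros HX Hl.
  destruct (Pt_D2_partials _ _ _ _ (Pt_D2_reparam X phi z a b l HX Hl)) as [E1 E2].
  destruct (Pt_D2_partials _ _ _ _ HX) as [E3 E4].
  unfold thetaU, thetaV. rewrite E1, E2, E3, E4, !sigma_linear.
  unfold hip. rewrite !edot_vadd_l, !edot_vscal_l. unfold Rdiv. split; ring.
Qed.

Lemma complex_derive_linear_bound (phi : C -> C) (l : C) : phi 0%C = 0%C -> complex_derive phi 0%C l -> l <> 0%C ->
  exists d, 0 < d /\ forall z, Cmod z < d -> Cmod (phi z - l * z)%C <= Cmod l / 2 * Cmod z.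
Proof.
  intros H0 Hl Hn. assert (HP : 0 < Cmod l) by now apply Cmod_gt_0.
  apply complex_derive_D2 in Hl. destruct Hl as [L1 L2]. rewrite D2_eps in L1, L2.
  assert (He : 0 < Cmod l / 4) by lra.
  destruct (L1 _ He) as [d1 [P1 B1]]. destruct (L2 _ He) as [d2 [P2 B2]].
  exists (Rmin d1 d2). split; [now apply Rmin_pos|]. intros z Hz.
  assert (Ez : (z - 0)%C = z) by ring.
  specialize (B1 z). specialize (B2 z). rewrite Ez in B1, B2.
  assert (A1 := B1 (Rlt_le_trans _ _ _ Hz (Rmin_l _ _))). assert (A2 := B2 (Rlt_le_trans _ _ _ Hz (Rmin_r _ _))).
  rewrite H0 in A1, A2.
  eapply Rle_trans; [apply Cmod_le_Rabs|].
  replace (fst (phi z - l * z)%C) with (Re (phi z) - Re 0%C - (Re l * (fst z - fst (RtoC 0)) + - Im l * (snd z - snd (RtoC 0))))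
    by (unfold Re, Im; simpl; ring).
  replace (snd (phi z - l * z)%C) with (Im (phi z) - Im 0%C - (Im l * (fst z - fst (RtoC 0)) + Re l * (snd z - snd (RtoC 0))))
    by (unfold Re, Im; simpl; ring).
  lra.
Qed.

Lemma continuous_Cplus {T : UniformSpace} (f g : T -> C) x : continuous f x -> continuous g x ->
  continuous (fun y => (f y + g y)%C) x.
Proof. intros Hf Hg. exact (continuous_plus (K := R_AbsRing) (V := C_R_NormedModule) f g x Hf Hg). Qed.

Lemma continuous_Cmult {T : UniformSpace} (f g : T -> C) x : continuous f x -> continuous g x ->
  continuous (fun y => (f y * g y)%C) x.
Proof.
  intros Hf Hg.
  assert (F1 : continuous (fun y => fst (f y)) x) by exact (continuous_comp f fst x Hf (continuous_fst_C _)).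
  assert (F2 : continuous (fun y => snd (f y)) x) by exact (continuous_comp f snd x Hf (continuous_snd_C _)).
  assert (G1 : continuous (fun y => fst (g y)) x) by exact (continuous_comp g fst x Hg (continuous_fst_C _)).
  assert (G2 : continuous (fun y => snd (g y)) x) by exact (continuous_comp g snd x Hg (continuous_snd_C _)).
  apply (continuous_pair (fun y => fst (f y) * fst (g y) - snd (f y) * snd (g y))
    (fun y => fst (f y) * snd (g y) + snd (f y) * fst (g y))).
  - apply (continuous_minus (V := R_NormedModule)); apply (continuous_mult (K := R_AbsRing)); assumption.
  - apply (continuous_plus (V := R_NormedModule)); apply (continuous_mult (K := R_AbsRing)); assumption.
Qed.

Section SameEnd.
Context (Omega Omega' : C -> Prop) (X X' : C -> Pt) (r : R) (phi : C -> C) (l : C)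
  (N : Pt -> Pt) (f : quad -> quad)
  (HB : bryant_end Omega X) (HB' : bryant_end Omega' X') (Hr : 0 < r)
  (Hphi : holomorphic_on (disc r) phi) (Hphi0 : phi 0%C = 0%C)
  (Hl : complex_derive phi 0%C l) (Hl0 : l <> 0%C) (HN : moebius N f)
  (HX : forall z, punctured (disc r) z -> Omega z /\ punctured Omega' (phi z) /\ X z = N (X' (phi z))).

Lemma theta_transfer q z : punctured (disc r) z -> exists m, complex_derive phi z m /\
  thetaU q X z = Re m * thetaU (f q) X' (phi z) + Im m * thetaV (f q) X' (phi z) /\
  thetaV q X z = - Im m * thetaU (f q) X' (phi z) + Re m * thetaV (f q) X' (phi z).
Proof.
  intros Hz. destruct (HX z Hz) as [_ [Hz' _]].
  assert (HO : open (punctured Omega')) by (apply punctured_open, HB').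
  assert (HD := class_C_Pt_D2 _ X' (phi z) HO (proj1 (proj2 (proj2 HB')) 1%nat) Hz').
  destruct (Hphi z (proj1 Hz)) as [m Hm]. exists m. split; [exact Hm|].
  destruct (theta_ext_loc q X (fun y => N (X' (phi y))) z) as [E1 E2].
  { generalize (punctured_open (disc r) (disc_open r) z Hz). apply filter_imp. intros y Hy. now apply HX. }
  assert (HH : H3 (X' (phi z))) by (apply HB'; exact Hz').
  destruct (theta_moebius N f q (fun y => X' (phi y)) z _ _ HN HH (Pt_D2_reparam _ _ _ _ _ _ HD Hm)) as [E3 E4].
  destruct (theta_reparam (f q) X' phi z _ _ m HD Hm) as [E5 E6].
  split; [exact (eq_trans E1 (eq_trans E3 E5))|exact (eq_trans E2 (eq_trans E4 E6))].
Qed.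

Lemma along_transfer q rho t : 0 < rho < r ->
  along (thetaU q X) (thetaV q X) (turning rho (-1)) t =
  along (thetaU (f q) X') (thetaV (f q) X') (fun s => phi (turning rho (-1) s)) t /\
  ex_derive (fun s => fst (phi (turning rho (-1) s))) t /\ ex_derive (fun s => snd (phi (turning rho (-1) s))) t.
Proof.
  intros Hrho.
  assert (Hz : punctured (disc r) (turning rho (-1) t)).
  { split; [unfold disc; rewrite turning_Cmod; lra|now apply turning_neq0]. }
  destruct (theta_transfer q _ Hz) as [m [Hm [E1 E2]]].
  destruct (turning_derive rho (-1) t) as [T1 T2].
  destruct (complex_derive_along phi (turning rho (-1)) t m Hm (ex_intro _ _ T1) (ex_intro _ _ T2)) as [D1 D2'].
  split; [|split; [exact (ex_intro _ _ D1)|exact (ex_intro _ _ D2')]].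
  assert (EV : velocity (fun s => phi (turning rho (-1) s)) t = (m * velocity (turning rho (-1)) t)%C).
  { apply injective_projections; apply is_derive_unique; assumption. }
  unfold along. rewrite EV, E1, E2. unfold Re, Im. simpl. ring.
Qed.

(** A straight-line homotopy joins the image by [phi] of a small circle to the circle
    described by [l z], since [phi z - l z] is at most half as large as [l z]. *)
Lemma loop_transfer : exists d, 0 < d /\ forall q rho, 0 < rho < d ->
  (forall z, closed_disc rho z -> Omega z) /\
  loop_int (thetaU q X) (thetaV q X) (turning rho (-1)) =
  loop_int (thetaU (f q) X') (thetaV (f q) X') (rotated (l * RtoC rho)%C).
Proof.
  assert (HP : 0 < Cmod l) by now apply Cmod_gt_0.
  destruct (complex_derive_linear_bound phi l Hphi0 Hl Hl0) as [d1 [P1 B1]].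
  assert (HO' : open Omega') by apply HB'.
  destruct (open_ball Omega' 0%C HO' (proj1 (proj2 HB'))) as [r' [Pr' Br']].
  set (d2 := r' / (2 * Cmod l)).
  assert (P2 : 0 < d2) by (apply Rdiv_lt_0_compat; lra).
  exists (Rmin r (Rmin d1 d2)). split; [repeat apply Rmin_pos; lra|].
  intros q rho [Hrho0 Hrho].
  assert (Hr1 : rho < r) by (eapply Rlt_le_trans; [exact Hrho|apply Rmin_l]).
  assert (Hr2 : rho < d1).
  { eapply Rlt_le_trans; [exact Hrho|]. eapply Rle_trans; [apply Rmin_r|apply Rmin_l]. }
  assert (Hr3 : rho < d2).
  { eapply Rlt_le_trans; [exact Hrho|]. eapply Rle_trans; [apply Rmin_r|apply Rmin_r]. }
  assert (Hr3' : 2 * (Cmod l * rho) < r').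
  { apply (Rmult_lt_compat_l (2 * Cmod l)) in Hr3; [|lra]. unfold d2 in Hr3.
    replace (2 * Cmod l * (r' / (2 * Cmod l))) with r' in Hr3 by (field; lra). lra. }
  assert (HOm : forall z, closed_disc rho z -> Omega z).
  { intros z Hz. destruct (Ceq_dec z 0%C) as [->|Hn]; [apply HB|].
    apply HX. split; [unfold disc; unfold closed_disc in Hz; lra|exact Hn]. }
  split; [exact HOm|].
  assert (HC : closed_form (punctured Omega) (thetaU q X) (thetaV q X)).
  { apply theta_closed.
    - apply punctured_open, HB. - exact (proj1 (proj2 (proj2 HB)) 2%nat). - intros z Hz. now apply HB.
    - intros z Hz. now apply (bryant_cmc_one Omega). }
  assert (HC' : closed_form (punctured Omega') (thetaU (f q) X') (thetaV (f q) X')).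
  { apply theta_closed.
    - apply punctured_open, HB'. - exact (proj1 (proj2 (proj2 HB')) 2%nat). - intros z Hz. now apply HB'.
    - intros z Hz. now apply (bryant_cmc_one Omega'). }
  destruct (closed_form_cont _ _ _ HC) as [CP CQ]. destruct (closed_form_cont _ _ _ HC') as [CP' CQ'].
  set (tu := turning rho (-1)).
  assert (Htu : forall t, Cmod (tu t) = rho) by (intros t; apply turning_Cmod; lra).
  transitivity (loop_int (thetaU (f q) X') (thetaV (f q) X') (fun s => phi (tu s))).
  { unfold loop_int. apply RInt_ext. intros t _. now apply along_transfer. }
  assert (Hrot : forall t, rotated (l * RtoC rho)%C t = (l * tu t)%C).
  { intros t. unfold rotated, tu, turning, polar. apply injective_projections; simpl; ring. }
  apply (homotopy_invariance (punctured Omega') _ _ _ _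
    (fun st => (RtoC (1 - fst st) * phi (tu (snd st)) + RtoC (fst st) * (l * tu (snd st)))%C)); auto.
  - now apply punctured_open.
  - intros t. destruct (along_transfer q rho t) as [_ [A1 A2]]; [lra|]. split; [exact A1|]. split; [exact A2|].
    apply (continuous_ext (along (thetaU q X) (thetaV q X) tu)).
    + intros s. now apply along_transfer.
    + apply (regular_loop_integrable Omega); auto. apply turning_regular; auto.
  - apply (regular_loop_integrable Omega'); auto. apply rotated_regular.
    + intros E. apply (f_equal Cmod) in E. rewrite Cmod_mult, Cmod_0, Cmod_R, Rabs_pos_eq in E by lra. nra.
    + intros z Hz. apply Br'. unfold closed_disc in Hz. rewrite Cmod_mult, Cmod_R, Rabs_pos_eq in Hz by lra.
      unfold ballC; replace (z - 0)%C with z by ring. nra.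
  - intros [s t].
    assert (Hcs : continuous (fun st : R * R => RtoC (1 - fst st)) (s, t)).
    { apply (continuous_pair (fun st : R * R => 1 - fst st) (fun _ => 0)); [|apply continuous_const].
      apply (continuous_minus (V := R_NormedModule)); [apply continuous_const|apply continuous_fst]. }
    assert (Hcs' : continuous (fun st : R * R => RtoC (fst st)) (s, t)).
    { apply (continuous_pair (fun st : R * R => fst st) (fun _ => 0)); [apply continuous_fst|apply continuous_const]. }
    assert (Htc : continuous (fun st : R * R => tu (snd st)) (s, t)).
    { apply (continuous_comp (fun st : R * R => snd st) tu); [apply continuous_snd|apply turning_continuous]. }
    assert (Hpc : continuous (fun st : R * R => phi (tu (snd st))) (s, t)).
    { apply (continuous_comp (fun st : R * R => tu (snd st)) phi); [exact Htc|].
      destruct (Hphi (tu t)) as [m Hm]; [unfold disc; rewrite Htu; exact Hr1|].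
      exact (complex_derive_continuous _ _ _ Hm). }
    apply (continuous_Cplus (fun st : R * R => (RtoC (1 - fst st) * phi (tu (snd st)))%C)).
    + exact (continuous_Cmult (fun st : R * R => RtoC (1 - fst st)) _ _ Hcs Hpc).
    + apply (continuous_Cmult (fun st : R * R => RtoC (fst st))); [exact Hcs'|].
      apply (continuous_Cmult (fun _ : R * R => l)); [apply continuous_const|exact Htc].
  - intros s t Hs. cbn [fst snd].
    assert (HBd := B1 (tu t)). rewrite Htu in HBd. specialize (HBd Hr2).
    set (e := (phi (tu t) - l * tu t)%C) in *.
    assert (Ee : (RtoC (1 - s) * phi (tu t) + RtoC s * (l * tu t))%C = (l * tu t + RtoC (1 - s) * e)%C).
    { unfold e. rewrite RtoC_minus. ring. }
    assert (Hse : Cmod (RtoC (1 - s) * e) <= Cmod l / 2 * rho).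
    { rewrite Cmod_mult, Cmod_R, Rabs_pos_eq by lra. generalize (Cmod_ge_0 e). nra. }
    assert (Hlt : Cmod (l * tu t) = Cmod l * rho) by (rewrite Cmod_mult, Htu; reflexivity).
    assert (Hlr : 0 < Cmod l * rho) by now apply Rmult_lt_0_compat.
    rewrite Ee. split; [split|split; [|split]].
    + apply Br'. unfold ballC. match goal with |- Cmod ?x < _ => replace x with (l * tu t + RtoC (1 - s) * e)%C by ring end.
      eapply Rle_lt_trans; [apply Cmod_triangle|]. lra.
    + intros E0. assert (E1 : (l * tu t)%C = (- (RtoC (1 - s) * e))%C).
      { replace (l * tu t)%C with (l * tu t + RtoC (1 - s) * e - RtoC (1 - s) * e)%C by ring. rewrite E0. ring. }
      apply (f_equal Cmod) in E1. rewrite Cmod_opp in E1. lra.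
    + unfold tu. rewrite turning_periodic by now right. fold (tu t). exact Ee.
    + rewrite Rminus_0_r. ring.
    + rewrite Rminus_diag, Hrot. ring.
Qed.
End SameEnd.

(** * The flux of a horospherical end *)

(** The value of the field at a point of the sphere, read at infinity in the chart
    [- 1 / z]. *)
Definition qeval_bdry (q : quad) (B : Cbar) : C :=
  match B with Fin b => qeval q b | Inf => qc2 q end.

Lemma inf_to_bdry B : exists M f, moebius M f /\ bdry_maps M Inf B /\ forall q, qc2 (f q) = qeval_bdry q B.
Proof.
  destruct B as [b|].
  - exists (fun p => shift b (invert p)), (fun q => pull_invert (pull_shift b q)). split; [|split].
    + apply (moebius_comp (shift b) (pull_shift b) invert pull_invert); constructor.
    + apply (bdry_maps_comp (shift b) invert _ (Fin 0%C)); [apply bdry_invert_inf|].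
      replace (Fin b) with (Fin (0 + b)%C) by (f_equal; ring). apply bdry_shift_fin.
    + reflexivity.
  - exists (shift 0), (pull_shift 0). split; [constructor|]. split; [apply bdry_shift_inf|]. reflexivity.
Qed.

Definition reparametrizes (Omega : C -> Prop) (X : C -> Pt) (N : Pt -> Pt) (Omega' : C -> Prop) (X' : C -> Pt)
    (r : R) (phi : C -> C) (l : C) : Prop :=
  0 < r /\ holomorphic_on (disc r) phi /\ phi 0%C = 0%C /\ complex_derive phi 0%C l /\ l <> 0%C /\
  forall z, punctured (disc r) z -> Omega z /\ punctured Omega' (phi z) /\ X z = N (X' (phi z)).

(** An isometry sending the boundary point to infinity is unique up to a similarity,
    so the end is the image of the canonical one by an explicit Moebius
    transformation. It carries the value of [q] at [B] to a leading coefficient, up to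
    a nonzero factor. *)
Lemma horospherical_normal_form Omega X B mu : horospherical_end Omega X B mu ->
  exists Omega' X' N f (a : C) r phi (l : C), canonical_horospherical_end Omega' X' mu /\ moebius N f /\
    a <> 0%C /\ (forall q, qc2 (f q) = a * qeval_bdry q B)%C /\
    reparametrizes Omega X N Omega' X' r phi l.
Proof.
  intros [HB [_ [_ [_ [Phi [Omega' [X' [HPhi [HPB [HC [r [phi [l [Hr [Hp [Hp0 [Hl [Hl0 HX]]]]]]]]]]]]]]]]]].
  destruct (inf_to_bdry B) as [M [f [HM [HMB Hf]]]].
  destruct (moebius_inverse M f HM) as [M' [f' [HM' E]]].
  assert (HT : oriented_isometry (fun p => Phi (M p))).
  { apply (oriented_comp Phi M); [exact HPhi|now apply (moebius_oriented M f)]. }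
  destruct (isometry_fixing_inf _ HT) as [s [b [Hs HTp]]].
  { now apply (bdry_maps_comp Phi M _ B). }
  assert (Hs' : (/ s)%C <> 0%C) by (intros E0; apply (f_equal (Cmult s)) in E0; rewrite Cinv_r, Cmult_0_r in E0 by auto;
    injection E0; lra).
  exists Omega', X', (fun p => M (dilate (/ s) (shift (- b) p))), (fun q => pull_shift (- b) (pull_dilate (/ s) (f q))),
    (/ s * / s)%C, r, phi, l.
  split; [exact HC|]. split; [|split; [|split]].
  - apply (moebius_comp M f (fun p => dilate (/ s) (shift (- b) p)) (fun q => pull_shift (- b) (pull_dilate (/ s) q))); [exact HM|].
    apply (moebius_comp (dilate (/ s)) (pull_dilate (/ s)) (shift (- b)) (pull_shift (- b))); [now constructor|constructor].
  - now apply Cmult_neq_0.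
  - intros q. unfold pull_shift, pull_dilate, qc2 at 1. cbn [fst snd]. now rewrite Hf.
  - repeat (split; [assumption|]). intros z Hz. destruct (HX z Hz) as [H1 [H2 H3']].
    split; [exact H1|]. split; [exact H2|].
    assert (HXz : H3 (X z)) by (apply HB; split; [exact H1|apply Hz]).
    rewrite <- H3'. rewrite <- (proj2 (E (X z) HXz)) at 2.
    rewrite HTp by (now apply (moebius_H3 M' f')).
    rewrite shift_inv, dilate_inv by exact Hs. now rewrite (proj2 (E (X z) HXz)).
Qed.

Definition flux_coefficient (mu : nat) (a c : C) : C :=
  if Nat.eq_dec mu 2 then (4 * (c * c) * a)%C else 0%C.

(** The flux is the integral of [theta] over every small circle, hence the limit of
    these integrals. *)
Lemma canonical_flux Omega X N f Omega' X' mu r phi l : bryant_end Omega X ->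
  canonical_horospherical_end Omega' X' mu -> moebius N f -> reparametrizes Omega X N Omega' X' r phi l ->
  exists c : C, c <> 0%C /\ forall q Y, (forall p, H3 p -> Y p = killing q p) ->
    is_flux Omega X Y (- 2 * PI * Re (flux_coefficient mu (qc2 (f q)) c)).
Proof.
  intros HB [HB' [_ [_ [Hmu [r' [h [f1 [f2 [g1 [g2 [b [c [Hr' [HO' [Hh [Hh0 [Hf1 [Hf10 [Hf2 [Hf20 [Hg1 [Hg10 [Hg2 [Hg20
    [Hb [Hc [HR HW]]]]]]]]]]]]]]]]]]]]]]]]]]] HN [Hr [Hp [Hp0 [Hl [Hl0 HX]]]]].
  cbv zeta in HR, HW.
  exists c. split; [exact Hc|]. intros q Y HY.
  destruct (loop_transfer Omega Omega' X X' r phi l N f HB HB' Hr Hp Hp0 Hl Hl0 HN HX) as [d [Hd HL]].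
  assert (HF : forall rho, 0 < rho < d ->
    is_flux Omega X Y (loop_int (thetaU (f q) X') (thetaV (f q) X') (rotated (l * RtoC rho)%C))).
  { intros rho Hrho. destruct (HL q rho Hrho) as [HO E]. rewrite <- E. apply is_flux_small_circle; auto. lra. }
  assert (Hval : - 2 * PI * Re (flux_coefficient mu (qc2 (f q)) c) =
    - 4 * PI * Re (residue_num mu f1 f2 c (f q) 0%C)).
  { rewrite (residue_num_0 mu f1 f2 c (f q) Hmu Hf10 Hf20). unfold flux_coefficient.
    destruct (Nat.eq_dec mu 2); unfold Re; simpl; ring. }
  rewrite Hval. set (V := - 4 * PI * Re (residue_num mu f1 f2 c (f q) 0%C)).
  (* the flux does not depend on the radius of the circle *)
  assert (Hd2 : 0 < d / 2 < d) by lra. set (v := loop_int (thetaU (f q) X') (thetaV (f q) X') (rotated (l * RtoC (d / 2))%C)).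
  assert (Hv : is_flux Omega X Y v) by exact (HF _ Hd2).
  replace V with v; [exact Hv|].
  assert (HP : 0 < Cmod l) by now apply Cmod_gt_0.
  assert (Heps : forall eps, 0 < eps -> Rabs (v - V) <= eps).
  { intros eps Heps.
    destruct (canonical_loop_limit Omega' X' mu r' h f1 f2 g1 g2 b c HB' Hmu Hr' HO' Hf1 Hf2 HR HW (f q) eps Heps)
      as [d' [Hd' HLim]].
    set (rho := Rmin (d / 2) (d' / (2 * Cmod l))).
    assert (Hq : 0 < d' / (2 * Cmod l)) by (apply Rdiv_lt_0_compat; lra).
    assert (Hrho : 0 < rho) by (apply Rmin_pos; lra).
    assert (Hrho1 : rho <= d / 2) by apply Rmin_l.
    assert (Hrho2 : Cmod l * rho < d').
    { assert (H : rho <= d' / (2 * Cmod l)) by apply Rmin_r.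
      apply (Rmult_le_compat_l (Cmod l)) in H; [|lra].
      replace (Cmod l * (d' / (2 * Cmod l))) with (d' / 2) in H by (field; lra). lra. }
    assert (Emod : Cmod (l * RtoC rho) = Cmod l * rho) by (rewrite Cmod_mult, Cmod_R, Rabs_pos_eq by lra; reflexivity).
    assert (HF' := HF rho ltac:(lra)).
    destruct HF' as [[gam [n [k HK]]] HF']. destruct Hv as [_ Hv].
    rewrite <- (Hv _ _ _ HK), (HF' _ _ _ HK). apply HLim.
    - apply Cmod_gt_0. rewrite Emod. now apply Rmult_lt_0_compat.
    - now rewrite Emod. }
  destruct (Req_dec v V) as [|Hne]; auto. exfalso.
  assert (Hpos : 0 < Rabs (v - V)) by (apply Rabs_pos_lt; lra).
  specialize (Heps (Rabs (v - V) / 2)). lra.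
Qed.

(** * The Hopf differential *)

Definition bryant_point (A B C0 D : C) : Pt :=
  let m := Cmod A ^ 2 + Cmod B ^ 2 in (((Cconj A * C0 + Cconj B * D) / RtoC m)%C, 1 / m).

Definition row_sqr (A B : C) : R := fst A * fst A + snd A * snd A + (fst B * fst B + snd B * snd B).

Lemma row_sqr_pos (A B C0 D : C) : (A * D - B * C0 = 1)%C -> 0 < row_sqr A B.
Proof.
  intros Hd. unfold row_sqr.
  destruct (Rle_lt_dec (fst A * fst A + snd A * snd A + (fst B * fst B + snd B * snd B)) 0) as [Hle|]; auto. exfalso.
  assert (fst A = 0 /\ snd A = 0 /\ fst B = 0 /\ snd B = 0) as [h1 [h2 [h3 h4]]] by (repeat split; nra).
  assert (EA0 : A = 0%C) by (apply injective_projections; assumption).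
  assert (EB0 : B = 0%C) by (apply injective_projections; assumption).
  rewrite EA0, EB0 in Hd. injection Hd. simpl. lra.
Qed.

Lemma row_sqr_swap (A B C0 D : C) : (A * D - B * C0 = 1)%C -> 0 < row_sqr C0 D.
Proof.
  intros H. rewrite <- (Ropp_involutive (row_sqr C0 D)).
  assert (K : 0 < row_sqr D C0) by (apply (row_sqr_pos D C0 B A); rewrite <- H; ring).
  unfold row_sqr in *. lra.
Qed.

Lemma bryant_point_eq (A B C0 D : C) : 0 < row_sqr A B ->
  bryant_point A B C0 D =
  (((fst A * fst C0 + snd A * snd C0 + (fst B * fst D + snd B * snd D)) / row_sqr A B,
    (fst A * snd C0 - snd A * fst C0 + (fst B * snd D - snd B * fst D)) / row_sqr A B), 1 / row_sqr A B).
Proof.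
  intros H. unfold bryant_point.
  assert (Em : Cmod A ^ 2 + Cmod B ^ 2 = row_sqr A B).
  { unfold row_sqr. rewrite !Cmod_sqr. ring. }
  rewrite Em. f_equal. rewrite <- Cdiv_RtoC by lra. f_equal. apply injective_projections; simpl; ring.
Qed.

Lemma bryant_point_shift (A B C0 D b : C) : 0 < row_sqr A B ->
  shift b (bryant_point A B C0 D) = bryant_point A B (C0 + b * A) (D + b * B).
Proof.
  intros H. rewrite !bryant_point_eq by exact H. unfold shift. cbn [fst snd].
  unfold row_sqr in *. destruct A as [a1 a2], B as [b1 b2], C0 as [c1 c2], D as [d1 d2], b as [e1 e2]. simpl in *.
  apply Pt_eq; unfold px, py, pw; simpl; field; lra.
Qed.

Lemma bryant_point_dilate (A B C0 D s : C) : s <> 0%C -> 0 < row_sqr A B ->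
  dilate s (bryant_point A B C0 D) = bryant_point (A / s) (B / s) (s * C0) (s * D).
Proof.
  intros Hs H. assert (Hs2 := sqr_sum_pos s Hs).
  assert (E : row_sqr (A / s) (B / s) = row_sqr A B / (fst s * fst s + snd s * snd s)).
  { destruct A as [a1 a2], B as [b1 b2], s as [s1 s2]. unfold row_sqr in *. simpl in *. field. nra. }
  assert (H' : 0 < row_sqr (A / s) (B / s)) by (rewrite E; now apply Rdiv_lt_0_compat).
  rewrite !bryant_point_eq by assumption. rewrite E. set (m := row_sqr A B) in *.
  destruct A as [a1 a2], B as [b1 b2], C0 as [c1 c2], D as [d1 d2], s as [s1 s2]. unfold dilate. simpl in *.
  apply Pt_eq; unfold px, py, pw; simpl; field; nra.
Qed.

Lemma bryant_point_invert (A B C0 D : C) : (A * D - B * C0 = 1)%C ->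
  invert (bryant_point A B C0 D) = bryant_point C0 D (- A) (- B).
Proof.
  intros Hd. assert (H := row_sqr_pos _ _ _ _ Hd). assert (H' := row_sqr_swap _ _ _ _ Hd).
  rewrite !bryant_point_eq by assumption.
  assert (K : (fst A * fst C0 + snd A * snd C0 + (fst B * fst D + snd B * snd D)) ^ 2 +
    (fst A * snd C0 - snd A * fst C0 + (fst B * snd D - snd B * fst D)) ^ 2 + 1 = row_sqr A B * row_sqr C0 D).
  { assert (E1 := f_equal fst Hd). assert (E2 := f_equal snd Hd). cbn [fst snd RtoC] in E1, E2.
    replace 1 with (fst (A * D - B * C0)%C ^ 2 + snd (A * D - B * C0)%C ^ 2).
    - unfold row_sqr. simpl. ring.
    - rewrite E1, E2. simpl. ring. }
  set (m := row_sqr A B) in *. set (m' := row_sqr C0 D) in *.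
  unfold invert.
  match goal with |- context [edot ?p ?p] => assert (En : edot p p = m' / m) end.
  { unfold edot, px, py, pw. cbn [fst snd].
    match goal with |- ?x / m * _ + ?y / m * _ + _ = _ => transitivity ((x ^ 2 + y ^ 2 + 1) / (m * m)); [field; lra|] end.
    rewrite K. field. lra. }
  rewrite En. apply Pt_eq; unfold px, py, pw; cbn [fst snd]; simpl; field; lra.
Qed.

(** Isometries act on Bryant representations by left multiplication, which does
    not change the Weierstrass data. *)
Lemma bryant_rep_moebius N f : moebius N f -> forall U X A B C0 D g om,
  bryant_rep U X A B C0 D -> weierstrass_data U A B C0 D g om ->
  exists A1 B1 C1 D1, bryant_rep U (fun z => N (X z)) A1 B1 C1 D1 /\ weierstrass_data U A1 B1 C1 D1 g om.
Proof.
  intros HN. induction HN; intros U X A B C0 D gg om HR HW.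
  - exists A, B, (fun z => C0 z + b * A z)%C, (fun z => D z + b * B z)%C. split.
    + intros z Hz. destruct (HR z Hz) as [Hd [[A' [B' [C' [D' [dA [dB [dC [dD H0]]]]]]]] HX]].
      split; [rewrite <- Hd; ring|]. split.
      * exists A', B', (C' + b * A')%C, (D' + b * B')%C. split; [exact dA|]. split; [exact dB|].
        split; [apply complex_derive_plus; [exact dC|now apply complex_derive_scal]|].
        split; [apply complex_derive_plus; [exact dD|now apply complex_derive_scal]|]. rewrite <- H0. ring.
      * cbv zeta in *. rewrite HX. apply bryant_point_shift. eapply row_sqr_pos; eauto.
    + intros z Hz. destruct (HW z Hz) as [A' [B' [C' [D' [dA [dB [dC [dD [W1 [W2 [W3 W4]]]]]]]]]]].
      exists A', B', (C' + b * A')%C, (D' + b * B')%C. split; [exact dA|]. split; [exact dB|].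
      split; [apply complex_derive_plus; [exact dC|now apply complex_derive_scal]|].
      split; [apply complex_derive_plus; [exact dD|now apply complex_derive_scal]|].
      split; [etransitivity; [|exact W1]; ring|]. split; [etransitivity; [|exact W2]; ring|].
      split; [etransitivity; [|exact W3]; ring|]. etransitivity; [|exact W4]; ring.
  - exists (fun z => / s * A z)%C, (fun z => / s * B z)%C, (fun z => s * C0 z)%C, (fun z => s * D z)%C. split.
    + intros z Hz. destruct (HR z Hz) as [Hd [[A' [B' [C' [D' [dA [dB [dC [dD H0]]]]]]]] HX]].
      split; [rewrite <- Hd; field; auto|]. split.
      * exists (/ s * A')%C, (/ s * B')%C, (s * C')%C, (s * D')%C.
        repeat (split; [now apply complex_derive_scal|]). rewrite <- H0. field; auto.
      * cbv zeta in *. rewrite HX. rewrite (Cmult_comm (/ s) (A z)), (Cmult_comm (/ s) (B z)).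
        apply bryant_point_dilate; auto. eapply row_sqr_pos; eauto.
    + intros z Hz. destruct (HW z Hz) as [A' [B' [C' [D' [dA [dB [dC [dD [W1 [W2 [W3 W4]]]]]]]]]]].
      exists (/ s * A')%C, (/ s * B')%C, (s * C')%C, (s * D')%C.
      repeat (split; [now apply complex_derive_scal|]).
      split; [etransitivity; [|exact W1]; field; auto|]. split; [etransitivity; [|exact W2]; field; auto|].
      split; [etransitivity; [|exact W3]; field; auto|]. etransitivity; [|exact W4]; field; auto.
  - exists C0, D, (fun z => - A z)%C, (fun z => - B z)%C. split.
    + intros z Hz. destruct (HR z Hz) as [Hd [[A' [B' [C' [D' [dA [dB [dC [dD H0]]]]]]]] HX]].
      split; [rewrite <- Hd; ring|]. split.
      * exists C', D', (- A')%C, (- B')%C. split; [exact dC|]. split; [exact dD|].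
        repeat (split; [now apply complex_derive_opp|]). rewrite <- H0. ring.
      * cbv zeta in *. rewrite HX. now apply bryant_point_invert.
    + intros z Hz. destruct (HW z Hz) as [A' [B' [C' [D' [dA [dB [dC [dD [W1 [W2 [W3 W4]]]]]]]]]]].
      exists C', D', (- A')%C, (- B')%C. split; [exact dC|]. split; [exact dD|].
      repeat (split; [now apply complex_derive_opp|]).
      split; [etransitivity; [|exact W1]; ring|]. split; [etransitivity; [|exact W2]; ring|].
      split; [etransitivity; [|exact W3]; ring|]. etransitivity; [|exact W4]; ring.
  - destruct (IHHN2 U X A B C0 D gg om HR HW) as [A1 [B1 [C1 [D1 [HR1 HW1]]]]].
    exact (IHHN1 U (fun z => M (X z)) A1 B1 C1 D1 gg om HR1 HW1).
Qed.

Lemma bryant_rep_reparam (U V : C -> Prop) X A B C0 D phi :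
  (forall z, V z -> U (phi z)) -> (forall z, V z -> exists l, complex_derive phi z l) ->
  bryant_rep U X A B C0 D ->
  bryant_rep V (fun z => X (phi z)) (fun z => A (phi z)) (fun z => B (phi z)) (fun z => C0 (phi z)) (fun z => D (phi z)).
Proof.
  intros HV Hp HR z Hz. destruct (HR _ (HV z Hz)) as [Hd [[A' [B' [C' [D' [dA [dB [dC [dD H0]]]]]]]] HX]].
  destruct (Hp z Hz) as [l Hl].
  split; [exact Hd|]. split; [|exact HX].
  exists (A' * l)%C, (B' * l)%C, (C' * l)%C, (D' * l)%C.
  split; [now apply complex_derive_comp|]. split; [now apply complex_derive_comp|].
  split; [now apply complex_derive_comp|]. split; [now apply complex_derive_comp|].
  transitivity ((A' * D' - B' * C') * (l * l))%C; [ring|rewrite H0; ring].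
Qed.

Lemma weierstrass_reparam (U V : C -> Prop) A B C0 D g om phi phi' :
  (forall z, V z -> U (phi z)) -> (forall z, V z -> complex_derive phi z (phi' z)) ->
  weierstrass_data U A B C0 D g om ->
  weierstrass_data V (fun z => A (phi z)) (fun z => B (phi z)) (fun z => C0 (phi z)) (fun z => D (phi z))
    (fun z => g (phi z)) (fun z => om (phi z) * phi' z)%C.
Proof.
  intros HV Hp HW z Hz. destruct (HW _ (HV z Hz)) as [A' [B' [C' [D' [dA [dB [dC [dD [W1 [W2 [W3 W4]]]]]]]]]]].
  assert (Hl := Hp z Hz). set (l := phi' z) in *.
  exists (A' * l)%C, (B' * l)%C, (C' * l)%C, (D' * l)%C.
  split; [now apply complex_derive_comp|]. split; [now apply complex_derive_comp|].
  split; [now apply complex_derive_comp|]. split; [now apply complex_derive_comp|].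
  apply (f_equal (fun w => (w * l)%C)) in W1, W2, W3, W4. cbv beta in *.
  split; [etransitivity; [|etransitivity; [exact W1|]]; ring|].
  split; [etransitivity; [|etransitivity; [exact W2|]]; ring|].
  split; [etransitivity; [|etransitivity; [exact W3|]]; unfold l; ring|].
  etransitivity; [|etransitivity; [exact W4|]]; ring.
Qed.

(** The point determines [F F^*], as this matrix has determinant one; and
    [F F^* = G G^*] means that [F^{-1} G] is unitary. *)
Lemma same_point_unitary (A B C0 D A1 B1 C1 D1 : C) :
  (A * D - B * C0 = 1)%C -> (A1 * D1 - B1 * C1 = 1)%C ->
  bryant_point A B C0 D = bryant_point A1 B1 C1 D1 ->
  (D * A1 - B * C1 = Cconj (- C0 * B1 + A * D1))%C /\ (D * B1 - B * D1 = - Cconj (- C0 * A1 + A * C1))%C.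
Proof.
  intros Hd Hd1 HP. assert (H := row_sqr_pos _ _ _ _ Hd). assert (H1 := row_sqr_pos _ _ _ _ Hd1).
  rewrite !bryant_point_eq in HP by assumption.
  assert (Em : row_sqr A B = row_sqr A1 B1).
  { apply (f_equal snd) in HP. simpl in HP. unfold Rdiv in HP. rewrite !Rmult_1_l in HP.
    now apply Rinv_eq_reg. }
  assert (E11 : (A * Cconj A + B * Cconj B = A1 * Cconj A1 + B1 * Cconj B1)%C).
  { rewrite <- !Cmod_sqr_RtoC, <- !RtoC_plus. f_equal. exact Em. }
  assert (E21 : (Cconj A * C0 + Cconj B * D = Cconj A1 * C1 + Cconj B1 * D1)%C).
  { rewrite <- Em in HP. assert (Hx := f_equal (fun p => row_sqr A B * fst (fst p)) HP).
    assert (Hy := f_equal (fun p => row_sqr A B * snd (fst p)) HP). cbn [fst snd] in Hx, Hy.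
    set (m := row_sqr A B) in *.
    apply injective_projections; simpl.
    - replace (fst A * fst C0 - - snd A * snd C0 + (fst B * fst D - - snd B * snd D)) with
        (m * ((fst A * fst C0 + snd A * snd C0 + (fst B * fst D + snd B * snd D)) / m)) by (field; lra).
      rewrite Hx. field. lra.
    - replace (fst A * snd C0 + - snd A * fst C0 + (fst B * snd D + - snd B * fst D)) with
        (m * ((fst A * snd C0 - snd A * fst C0 + (fst B * snd D - snd B * fst D)) / m)) by (field; lra).
      rewrite Hy. field. lra. }
  assert (E12 : (A * Cconj C0 + B * Cconj D = A1 * Cconj C1 + B1 * Cconj D1)%C).
  { apply (f_equal Cconj) in E21. rewrite !Cplus_conj, !Cmult_conj, !Cconj_conj in E21. exact E21. }
  assert (Hc : (Cconj A * Cconj D - Cconj B * Cconj C0 = 1)%C).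
  { rewrite <- !Cmult_conj, <- Cminus_conj, Hd. apply injective_projections; simpl; ring. }
  assert (Hc1 : (Cconj A1 * Cconj D1 - Cconj B1 * Cconj C1 = 1)%C).
  { rewrite <- !Cmult_conj, <- Cminus_conj, Hd1. apply injective_projections; simpl; ring. }
  set (h11 := (A * Cconj A + B * Cconj B)%C) in *. set (h21 := (Cconj A * C0 + Cconj B * D)%C) in *.
  set (h12 := (A * Cconj C0 + B * Cconj D)%C) in *.
  set (h22 := (C0 * Cconj C0 + D * Cconj D)%C).
  assert (Hh : h11 <> 0%C).
  { unfold h11. rewrite <- !Cmod_sqr_RtoC, <- !RtoC_plus. intros E. injection E. unfold row_sqr in H. lra. }
  assert (E22 : (h22 = C1 * Cconj C1 + D1 * Cconj D1)%C).
  { assert (K : (h11 * h22 = h12 * h21 + 1)%C).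
    { transitivity (h12 * h21 + (A * D - B * C0) * (Cconj A * Cconj D - Cconj B * Cconj C0))%C;
        [unfold h11, h12, h21, h22; ring|rewrite Hd, Hc; ring]. }
    assert (K1 : (h11 * (C1 * Cconj C1 + D1 * Cconj D1) = h12 * h21 + 1)%C).
    { rewrite E11, E12, E21.
      transitivity ((A1 * Cconj C1 + B1 * Cconj D1) * (Cconj A1 * C1 + Cconj B1 * D1)
        + (A1 * D1 - B1 * C1) * (Cconj A1 * Cconj D1 - Cconj B1 * Cconj C1))%C; [ring|rewrite Hd1, Hc1; ring]. }
    transitivity (h11 * h22 / h11)%C; [field; exact Hh|]. rewrite K, <- K1. field. exact Hh. }
  rewrite !Cplus_conj, !Cmult_conj, !Copp_conj.
  split.
  - transitivity ((D * h11 - B * h21) * Cconj D1 - (D * h12 - B * h22) * Cconj B1)%C.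
    + rewrite E11, E12, E21, E22.
      transitivity ((D * A1 - B * C1) * (Cconj A1 * Cconj D1 - Cconj B1 * Cconj C1))%C; [rewrite Hc1; ring|ring].
    + transitivity ((A * D - B * C0) * (- Cconj C0 * Cconj B1 + Cconj A * Cconj D1))%C;
        [unfold h11, h12, h21, h22; ring|rewrite Hd; ring].
  - transitivity (- ((D * h11 - B * h21) * Cconj C1) + (D * h12 - B * h22) * Cconj A1)%C.
    + rewrite E11, E12, E21, E22.
      transitivity ((D * B1 - B * D1) * (Cconj A1 * Cconj D1 - Cconj B1 * Cconj C1))%C; [rewrite Hc1; ring|ring].
    + transitivity (- ((A * D - B * C0) * (- Cconj C0 * Cconj A1 + Cconj A * Cconj C1)))%C;
        [unfold h11, h12, h21, h22; ring|rewrite Hd; ring].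
Qed.

(** A holomorphic function that is conjugate to a holomorphic function is locally
    constant. With [k = 1] and [k = -1] this applies to the entries of a matrix of
    SU(2). *)
Lemma conjugate_holomorphic_derive (a d : C -> C) z (k : R) la ld : k * k = 1 ->
  locally z (fun y => a y = (RtoC k * Cconj (d y))%C) ->
  complex_derive a z la -> complex_derive d z ld -> la = 0%C /\ ld = 0%C.
Proof.
  intros Hk Hl Ha Hd.
  assert (Ha' := complex_derive_D2 a z la). assert (Hd' := complex_derive_D2 d z ld).
  apply Ha' in Ha. apply Hd' in Hd. destruct Ha as [A1 A2], Hd as [D1 D2'].
  assert (E1 : locally z (fun y => Re (a y) = k * Re (d y))).
  { revert Hl. apply filter_imp. intros y ->. unfold Re. simpl. ring. }
  assert (E2 : locally z (fun y => Im (a y) = - k * Im (d y))).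
  { revert Hl. apply filter_imp. intros y ->. unfold Im. simpl. ring. }
  assert (B1 := D2_ext_loc _ _ _ _ _ E1 A1). assert (B2 := D2_ext_loc _ _ _ _ _ E2 A2).
  destruct (D2_unique _ _ _ _ _ _ B1 (D2_scal k _ _ _ _ D1)) as [F1 F2].
  destruct (D2_unique _ _ _ _ _ _ B2 (D2_scal (- k) _ _ _ _ D2')) as [F3 F4].
  destruct la as [x y], ld as [u v]. unfold Re, Im in *. simpl in *.
  assert (x = 0) by lra. assert (y = 0) by lra.
  assert (u = 0) by nra. assert (v = 0) by nra. split; apply injective_projections; assumption.
Qed.

(** At a zero of [omega] the field [bryant_quad] vanishes and so does the differential
    of the surface. *)
Lemma omega_nonzero Omega X U A B C0 D g om z : bryant_end Omega X -> punctured Omega z -> locally z U ->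
  bryant_rep U X A B C0 D -> weierstrass_data U A B C0 D g om -> om z <> 0%C.
Proof.
  intros HB Hz HU HR HW E.
  destruct (bryant_tangent U X A B C0 D g om z HU HR HW) as [_ HD].
  destruct (Pt_D2_partials _ _ _ _ HD) as [E1 _].
  assert (HI : 0 < I_uu X z) by now apply HB.
  unfold I_uu in HI. rewrite E1, E in HI.
  replace (killing _ (X z)) with (((0, 0), 0) : Pt) in HI.
  - unfold hip, edot, px, py, pw in HI. simpl in HI. unfold Rdiv in HI. lra.
  - symmetry. apply Pt_eq; unfold killing, bryant_quad, qeval, qc0, qc1, qc2, px, py, pw, Re; simpl; ring.
Qed.

(** Two Bryant representations of a surface differ by a constant matrix of
    SU(2), which acts on [g] by a Moebius transformation and leaves [omega dg]
    invariant. *)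
Lemma hopf_coefficient_unique Omega X z (q q1 : C) : bryant_end Omega X -> punctured Omega z ->
  hopf_coefficient X z q -> hopf_coefficient X z q1 -> q = q1.
Proof.
  intros HB Hz [eps [A [B [C0 [D [g [om [g' [He [HR [HW [Hg ->]]]]]]]]]]]]
    [eps1 [A1 [B1 [C1 [D1 [g1 [om1 [g1' [He1 [HR1 [HW1 [Hg1 ->]]]]]]]]]]]].
  cbv zeta in *. set (U := fun y : C => Cmod (y - z)%C < eps) in *. set (U1 := fun y : C => Cmod (y - z)%C < eps1) in *.
  set (W := fun y => U y /\ U1 y /\ punctured Omega y).
  assert (HU : open U).
  { intros y Hy. apply Cball_locally. exists (eps - Cmod (y - z)). unfold U in *. split; [lra|].
    intros x Hx. eapply Rle_lt_trans; [apply (Cmod_triangle' x z y)|]. lra. }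
  assert (HU1 : open U1).
  { intros y Hy. apply Cball_locally. exists (eps1 - Cmod (y - z)). unfold U1 in *. split; [lra|].
    intros x Hx. eapply Rle_lt_trans; [apply (Cmod_triangle' x z y)|]. lra. }
  assert (HWo : forall y, W y -> locally y W).
  { intros y [h1 [h2 h3]]. apply filter_and; [now apply HU|]. apply filter_and; [now apply HU1|].
    apply (punctured_open Omega); [apply HB|exact h3]. }
  assert (HWz : W z).
  { assert (E0 : Cmod (z - z)%C = 0) by (replace (z - z)%C with (RtoC 0) by ring; apply Cmod_0).
    split; [|split]; [unfold U; lra|unfold U1; lra|exact Hz]. }
  set (a := fun y => (D y * A1 y - B y * C1 y)%C). set (b := fun y => (D y * B1 y - B y * D1 y)%C).
  set (c := fun y => (- C0 y * A1 y + A y * C1 y)%C). set (d := fun y => (- C0 y * B1 y + A y * D1 y)%C).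
  (* the matrix F^{-1} F1, with rows (a, b) and (c, d), is in SU(2) and has
     holomorphic entries, so it is locally constant *)
  assert (Huni : forall y, W y -> a y = Cconj (d y) /\ b y = (- Cconj (c y))%C).
  { intros y [h1 [h2 _]]. destruct (HR y h1) as [Hd [_ HX]]. destruct (HR1 y h2) as [Hd1 [_ HX1]].
    apply same_point_unitary; auto. transitivity (X y); [symmetry; exact HX|exact HX1]. }
  assert (Hder : forall y, W y -> complex_derive a y 0%C /\ complex_derive b y 0%C /\ complex_derive c y 0%C /\ complex_derive d y 0%C).
  { intros y Hy. pose proof Hy as [h1 [h2 h3]].
    destruct (HR y h1) as [_ [[A' [B' [C' [D' [dA [dB [dC [dD _]]]]]]]] _]].
    destruct (HR1 y h2) as [_ [[A1' [B1' [C1' [D1' [dA1 [dB1 [dC1 [dD1 _]]]]]]]] _]].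
    assert (Ka : exists l, complex_derive a y l).
    { eexists. apply complex_derive_minus; apply complex_derive_mult; eassumption. }
    assert (Kb : exists l, complex_derive b y l).
    { eexists. apply complex_derive_minus; apply complex_derive_mult; eassumption. }
    assert (Kc : exists l, complex_derive c y l).
    { eexists. apply complex_derive_plus; apply complex_derive_mult; try eassumption. apply complex_derive_opp; eassumption. }
    assert (Kd : exists l, complex_derive d y l).
    { eexists. apply complex_derive_plus; apply complex_derive_mult; try eassumption. apply complex_derive_opp; eassumption. }
    destruct Ka as [la Ha], Kb as [lb Hb], Kc as [lc Hc], Kd as [ld Hd].
    destruct (conjugate_holomorphic_derive a d y 1 la ld) as [Ea Ed]; auto.
    { ring. }
    { generalize (HWo y Hy). apply filter_imp. intros x Hx. rewrite (proj1 (Huni x Hx)). ring. }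
    destruct (conjugate_holomorphic_derive b c y (-1) lb lc) as [Eb Ec]; auto.
    { ring. }
    { generalize (HWo y Hy). apply filter_imp. intros x Hx. rewrite (proj2 (Huni x Hx)).
      apply injective_projections; simpl; ring. }
    subst. split; [|split; [|split]]; assumption. }
  assert (Hfac : forall y, W y -> (A1 y = A y * a y + B y * c y)%C /\ (B1 y = A y * b y + B y * d y)%C /\
    (C1 y = C0 y * a y + D y * c y)%C /\ (D1 y = C0 y * b y + D y * d y)%C).
  { intros y [h1 [h2 _]]. destruct (HR y h1) as [Hd _]. unfold a, b, c, d. repeat split.
    - transitivity ((A y * D y - B y * C0 y) * A1 y)%C; [rewrite Hd|]; ring.
    - transitivity ((A y * D y - B y * C0 y) * B1 y)%C; [rewrite Hd|]; ring.
    - transitivity ((A y * D y - B y * C0 y) * C1 y)%C; [rewrite Hd|]; ring.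
    - transitivity ((A y * D y - B y * C0 y) * D1 y)%C; [rewrite Hd|]; ring. }
  assert (Hdet : forall y, W y -> (a y * d y - b y * c y = 1)%C).
  { intros y [h1 [h2 _]]. destruct (HR y h1) as [Hd _]. destruct (HR1 y h2) as [Hd1 _].
    transitivity ((A y * D y - B y * C0 y) * (A1 y * D1 y - B1 y * C1 y))%C; [unfold a, b, c, d; ring|rewrite Hd, Hd1; ring]. }
  (* F1 = F U with U constant transforms the Weierstrass data *)
  assert (Hom : forall y, W y -> (om1 y = om y * (a y - g y * c y) ^ 2)%C /\
    (g1 y * om1 y = om y * (a y - g y * c y) * (d y * g y - b y))%C).
  { intros y Hy. destruct (Hder y Hy) as [da [_ [dc _]]]. destruct (Hfac y Hy) as [FA [FB [FC FD]]].
    pose proof Hy as [h1 [h2 h3]].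
    destruct (HR y h1) as [Hd _].
    destruct (HW y h1) as [A' [B' [C' [D' [dA [dB [dC [dD [W1 [W2 [W3 W4]]]]]]]]]]].
    destruct (weierstrass_solve _ _ _ _ _ _ _ _ _ _ Hd W1 W2 W3 W4) as [EA [EB [EC ED]]].
    destruct (HW1 y h2) as [A1' [B1' [C1' [D1' [dA1 [_ [dC1 [_ [V1 [_ [V3 _]]]]]]]]]]].
    assert (EA1 : A1' = (om y * (A y * g y + B y) * (a y - g y * c y))%C).
    { apply (complex_derive_unique A1 y); [exact dA1|].
      apply (complex_derive_ext_loc (fun x => A x * a x + B x * c x)%C).
      - generalize (HWo y Hy). apply filter_imp. intros x Hx. symmetry. apply (Hfac x Hx).
      - eapply complex_derive_eq.
        + apply complex_derive_plus; apply complex_derive_mult; eassumption.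
        + rewrite EA, EB. ring. }
    assert (EC1 : C1' = (om y * (C0 y * g y + D y) * (a y - g y * c y))%C).
    { apply (complex_derive_unique C1 y); [exact dC1|].
      apply (complex_derive_ext_loc (fun x => C0 x * a x + D x * c x)%C).
      - generalize (HWo y Hy). apply filter_imp. intros x Hx. symmetry. apply (Hfac x Hx).
      - eapply complex_derive_eq.
        + apply complex_derive_plus; apply complex_derive_mult; eassumption.
        + rewrite EC, ED. ring. }
    rewrite <- V1. rewrite <- V3 at 1. rewrite EA1, EC1, FA, FB, FC, FD. split.
    - transitivity ((A y * D y - B y * C0 y) * (om y * (a y - g y * c y) ^ 2))%C; [ring|rewrite Hd; ring].
    - transitivity ((A y * D y - B y * C0 y) * (om y * (a y - g y * c y) * (d y * g y - b y)))%C; [ring|rewrite Hd; ring]. }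
  assert (Hnz : forall y, W y -> (a y - g y * c y)%C <> 0%C).
  { intros y Hy E. destruct (Hom y Hy) as [E1 _].
    apply (omega_nonzero Omega X U1 A1 B1 C1 D1 g1 om1 y HB (proj2 (proj2 Hy)) (HU1 y (proj1 (proj2 Hy))) HR1 HW1).
    rewrite E1, E. ring. }
  assert (Hom0 : forall y, W y -> om y <> 0%C).
  { intros y Hy. apply (omega_nonzero Omega X U A B C0 D g om y HB (proj2 (proj2 Hy)) (HU y (proj1 Hy)) HR HW). }
  assert (Eg : forall y, W y -> ((d y * g y - b y) * / (a y - g y * c y) = g1 y)%C).
  { intros y Hy. destruct (Hom y Hy) as [E1 E2]. rewrite E1 in E2.
    transitivity (om y * (a y - g y * c y) * (d y * g y - b y) / (om y * (a y - g y * c y) ^ 2))%C.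
    - field. split; [now apply Hnz|now apply Hom0].
    - rewrite <- E2. field. split; [now apply Hnz|now apply Hom0]. }
  destruct (Hder z HWz) as [da [db [dc dd]]].
  assert (N0 := Hnz z HWz).
  assert (Eg' : g1' = (g' * / (a z - g z * c z) ^ 2)%C).
  { apply (complex_derive_unique g1 z); [exact Hg1|].
    apply (complex_derive_ext_loc (fun y => (d y * g y - b y) * / (a y - g y * c y))%C).
    - generalize (HWo z HWz). apply filter_imp. exact Eg.
    - eapply complex_derive_eq.
      + apply complex_derive_mult.
        * apply complex_derive_minus; [apply complex_derive_mult; eassumption|eassumption].
        * apply (complex_derive_inv (fun y => (a y - g y * c y)%C)); [|exact N0].
          apply complex_derive_minus; [eassumption|apply complex_derive_mult; eassumption].
      + cbv beta.
        transitivity (g' * (a z * d z - b z * c z) * / (a z - g z * c z) ^ 2)%C; [field; exact N0|].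
        rewrite (Hdet z HWz). ring. }
  rewrite (proj1 (Hom z HWz)), Eg'. field. exact N0.
Qed.

Lemma zero_at_puncture (F : C -> C) r : 0 < r -> continuous F (RtoC 0) ->
  (forall z, punctured (disc r) z -> F z = 0%C) -> F 0%C = 0%C.
Proof.
  intros Hr HF HZ. destruct (Ceq_dec (F 0%C) 0%C) as [|Hn]; auto. exfalso.
  assert (Hl : locally (RtoC 0) (fun z => F z <> 0%C)).
  { apply (HF (fun w : C => w <> 0%C)).
    apply Cball_locally. exists (Cmod (F 0%C)). split; [now apply Cmod_gt_0|].
    intros y Hy E. rewrite E in Hy. replace (0 - F 0)%C with (- F 0)%C in Hy by ring. rewrite Cmod_opp in Hy. lra. }
  apply Cball_locally in Hl. destruct Hl as [d [Hd Hl]].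
  set (x := Rmin d r / 2). assert (Hm : 0 < Rmin d r) by now apply Rmin_pos.
  assert (Hx : 0 < x) by (unfold x; lra).
  assert (Hxm : Cmod (RtoC x) = x) by (rewrite Cmod_R; apply Rabs_pos_eq; lra).
  apply (Hl (RtoC x)).
  - replace (RtoC x - 0)%C with (RtoC x) by ring. rewrite Hxm.
    assert (Rmin d r <= d) by apply Rmin_l. unfold x. lra.
  - apply HZ. split.
    + unfold disc. rewrite Hxm. assert (Rmin d r <= r) by apply Rmin_r. unfold x. lra.
    + intros E. injection E. lra.
Qed.

Lemma holomorphic_cderiv r phi : holomorphic_on (disc r) phi ->
  (forall z, disc r z -> complex_derive phi z (cderiv phi z)) /\ holomorphic_on (disc r) (cderiv phi).
Proof.
  intros H.
  assert (K : forall z, disc r z -> complex_derive phi z (cderiv phi z)).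
  { intros z Hz. destruct (H z Hz) as [l Hl]. now rewrite (cderiv_correct _ _ _ Hl). }
  split; [exact K|]. intros z Hz. apply (derivative_holomorphic phi (cderiv phi) z (r - Cmod z)).
  - unfold disc in Hz. lra.
  - intros y Hy. apply K. unfold ballC in Hy. unfold disc.
    replace y with ((y - z) + z)%C by ring. eapply Rle_lt_trans; [apply Cmod_triangle|]. lra.
Qed.

Lemma pow_plus_2 (x : C) n : (x ^ (n + 2) = x ^ n * (x * x))%C.
Proof. rewrite Nat.add_comm. simpl. ring. Qed.

(** The Hopf differential has coefficient [mu h(phi) phi^(mu - 3) phi'^2], with a zero
    of order [mu - 3] at the puncture or, if [mu = 2], a simple pole. *)
Lemma canonical_hopf Omega X N f Omega' X' mu r phi l : bryant_end Omega X ->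
  canonical_horospherical_end Omega' X' mu -> moebius N f -> reparametrizes Omega X N Omega' X' r phi l ->
  (hopf_holomorphic_at_0 Omega X <-> (3 <= mu)%nat).
Proof.
  intros HB [HB' [_ [_ [Hmu [r' [h [f1 [f2 [g1 [g2 [b [c [Hr' [HO' [Hh [Hh0 [Hf1 [Hf10 [Hf2 [Hf20 [Hg1 [Hg10 [Hg2 [Hg20
    [Hb [Hc [HR HW]]]]]]]]]]]]]]]]]]]]]]]]]]] HN [Hr [Hp [Hp0 [Hl [Hl0 HX]]]]].
  cbv zeta in HR, HW.
  destruct (holomorphic_cderiv r phi Hp) as [Hd Hdd].
  assert (Hphi_small : exists r0, 0 < r0 <= r /\ forall z, disc r0 z -> disc r' (phi z)).
  { assert (Hc0 := complex_derive_continuous phi _ _ Hl).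
    assert (HL : locally (RtoC 0) (fun z => disc r' (phi z))).
    { apply (Hc0 (disc r')). apply (disc_open r'). unfold disc. rewrite Hp0, Cmod_0. exact Hr'. }
    apply Cball_locally in HL. destruct HL as [e [He HL]]. exists (Rmin e r).
    split; [split; [now apply Rmin_pos|apply Rmin_r]|]. intros z Hz. apply HL.
    replace (z - 0)%C with z by ring. eapply Rlt_le_trans; [exact Hz|apply Rmin_l]. }
  destruct Hphi_small as [r0 [[Hr0 Hr0r] Hsmall]].
  assert (Hsub : forall z, punctured (disc r0) z -> punctured (disc r) z).
  { intros z [Hz Hz0]. split; [unfold disc in *; lra|exact Hz0]. }
  assert (Hnz : forall z, punctured (disc r0) z -> phi z <> 0%C) by (intros z Hz; apply HX; now apply Hsub).
  set (hq := fun z => (h (phi z) / phi z ^ 2 * cderiv phi z * (INR mu * phi z ^ (mu - 1) * cderiv phi z))%C).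
  assert (Hhopf : forall z, punctured (disc r0) z -> hopf_coefficient X z (hq z)).
  { intros z Hz. destruct (open_ball (punctured (disc r0)) z (punctured_open _ (disc_open r0)) Hz) as [eps [He HE]].
    set (U := fun y : C => Cmod (y - z)%C < eps).
    assert (HUr : forall y, U y -> punctured (disc r') (phi y)).
    { intros y Hy. split; [apply Hsmall, HE, Hy|apply Hnz, HE, Hy]. }
    assert (HUd : forall y, U y -> complex_derive phi y (cderiv phi y)).
    { intros y Hy. apply Hd. apply Hsub, HE, Hy. }
    assert (HR1 := bryant_rep_reparam _ U _ _ _ _ _ phi HUr (fun y Hy => ex_intro _ _ (HUd y Hy)) HR).
    assert (HW1 := weierstrass_reparam _ U _ _ _ _ _ _ phi (cderiv phi) HUr HUd HW).
    destruct (bryant_rep_moebius N f HN U _ _ _ _ _ _ _ HR1 HW1) as [A1 [B1 [C1 [D1 [HR2 HW2]]]]].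
    exists eps, A1, B1, C1, D1, (fun y => (phi y ^ mu)%C), (fun y => (h (phi y) / phi y ^ 2 * cderiv phi y)%C),
      (INR mu * phi z ^ (mu - 1) * cderiv phi z)%C.
    split; [exact He|]. cbv zeta. fold U. split; [|split; [exact HW2|split; [|reflexivity]]].
    - intros y Hy. destruct (HR2 y Hy) as [K1 [K2 K3]]. split; [exact K1|]. split; [exact K2|].
      cbv zeta in *. rewrite <- K3. apply HX. apply Hsub, HE, Hy.
    - apply complex_derive_pow. apply Hd. apply Hsub, Hz. }
  split.
  - intros [r1 [q [Hr1 [Hq HQ]]]].
    destruct (Nat.eq_dec mu 2) as [E|]; [exfalso|lia].
    set (F := fun z => (q z * phi z - 2 * (h (phi z) * (cderiv phi z * cderiv phi z)))%C).
    assert (HF0 : F 0%C = 0%C).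
    { apply (zero_at_puncture F (Rmin r0 r1)); [now apply Rmin_pos| |].
      - assert (D0 : forall s, 0 < s -> disc s 0%C) by (intros s Hs; unfold disc; now rewrite Cmod_0).
        destruct (Hq _ (D0 r1 Hr1)) as [lq dq]. destruct (Hdd _ (D0 r Hr)) as [ld dd].
        destruct (Hh _ (D0 r' Hr')) as [lh dh]. rewrite <- Hp0 in dh.
        eapply (complex_derive_continuous F). apply complex_derive_minus.
        + apply complex_derive_mult; eassumption.
        + apply complex_derive_scal. apply complex_derive_mult; [|apply complex_derive_mult; exact dd].
          apply (complex_derive_comp h phi); [exact dh|exact Hl].
      - intros z [Hz Hz0].
        assert (Hz1 : punctured (disc r0) z) by (split; [eapply Rlt_le_trans; [exact Hz|apply Rmin_l]|exact Hz0]).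
        assert (Hz2 : punctured (disc r1) z) by (split; [eapply Rlt_le_trans; [exact Hz|apply Rmin_r]|exact Hz0]).
        destruct (HQ z Hz2) as [HOz Hqz].
        assert (Eq : q z = hq z) by (apply (hopf_coefficient_unique Omega X z); auto; now split).
        unfold F. rewrite Eq. unfold hq. rewrite E.
        replace (RtoC (INR 2)) with (RtoC 2) by (f_equal; simpl; ring). cbn [Nat.sub].
        generalize (cderiv phi z) (h (phi z)) (phi z) (Hnz z Hz1). intros u v w Hw. field. exact Hw. }
    unfold F in HF0. rewrite Hp0 in HF0.
    assert (Ed : cderiv phi 0%C = l) by now apply cderiv_correct.
    rewrite Ed in HF0.
    assert (K : (2 * (h 0 * (l * l)))%C <> 0%C).
    { apply Cmult_neq_0; [intros E2; injection E2; lra|]. apply Cmult_neq_0; [exact Hh0|]. now apply Cmult_neq_0. }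
    apply K. transitivity (- (q 0 * 0 - 2 * (h 0 * (l * l))))%C; [ring|]. rewrite HF0. ring.
  - intros Hmu3.
    exists r0, (fun z => (h (phi z) * (INR mu * phi z ^ (mu - 3) * (cderiv phi z * cderiv phi z)))%C).
    split; [exact Hr0|]. split.
    + intros z Hz. destruct (Hh _ (Hsmall z Hz)) as [lh dh].
      assert (Hzr : disc r z) by (unfold disc in *; lra).
      destruct (Hdd z Hzr) as [ld dd]. assert (dp := Hd z Hzr).
      eexists. apply complex_derive_mult; [apply (complex_derive_comp h phi); eassumption|].
      apply complex_derive_mult; [|apply complex_derive_mult; exact dd].
      apply complex_derive_scal, complex_derive_pow. exact dp.
    + intros z Hz. split; [now apply HX, Hsub|].
      replace (h (phi z) * _)%C with (hq z); [now apply Hhopf|].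
      unfold hq. replace (mu - 1)%nat with (mu - 3 + 2)%nat by lia. rewrite pow_plus_2.
      generalize (phi z ^ (mu - 3))%C. intros x. field. now apply Hnz.
Qed.

(** * The flux polynomial *)

(** The coefficient is [4 a c^2] if [mu = 2], where [c] comes from the canonical
    representation and [a] from the isometry, and zero if [mu >= 3]. *)
Lemma horospherical_flux Omega X B mu : horospherical_end Omega X B mu ->
  exists kappa : C, (kappa = 0%C <-> (3 <= mu)%nat) /\ (hopf_holomorphic_at_0 Omega X <-> (3 <= mu)%nat) /\
  forall c d, c <> d ->
    translation_flux Omega X c d (- 2 * PI * Re (kappa * qeval_bdry (killing_quad c d) B)%C) /\
    rotation_flux Omega X c d (2 * PI * Im (kappa * qeval_bdry (killing_quad c d) B)%C).
Proof.
  intros HE. assert (HB : bryant_end Omega X) by apply HE.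
  destruct (horospherical_normal_form Omega X B mu HE) as [Omega' [X' [N [f [a [r [phi [l [HC [HN [Ha [Hf HP]]]]]]]]]]]].
  destruct (canonical_flux Omega X N f Omega' X' mu r phi l HB HC HN HP) as [c0 [Hc0 HF]].
  assert (Hmu : (2 <= mu)%nat) by apply HC.
  exists (flux_coefficient mu a c0).
  assert (Elin : forall x, flux_coefficient mu (a * x) c0 = (flux_coefficient mu a c0 * x)%C).
  { intros x. unfold flux_coefficient. destruct (Nat.eq_dec mu 2); ring. }
  split; [|split].
  - unfold flux_coefficient. destruct (Nat.eq_dec mu 2) as [E|E].
    + split; [|lia]. intros H. exfalso. revert H. apply Cmult_neq_0; [|exact Ha].
      apply Cmult_neq_0; [intros H; injection H; lra|]. now apply Cmult_neq_0.
    + split; [lia|reflexivity].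
  - now apply (canonical_hopf Omega X N f Omega' X' mu r phi l).
  - intros c d Hcd. set (q := killing_quad c d).
    assert (K : forall k Y, (forall p, H3 p -> Y p = killing (quad_scal k q) p) ->
      is_flux Omega X Y (- 2 * PI * Re (k * (flux_coefficient mu a c0 * qeval_bdry q B))%C)).
    { intros k Y HY.
      replace (k * (flux_coefficient mu a c0 * qeval_bdry q B))%C with (flux_coefficient mu (qc2 (f (quad_scal k q))) c0).
      - now apply HF.
      - rewrite Hf, Elin. destruct B; unfold qeval_bdry, quad_scal, qeval, qc0, qc1, qc2; simpl; ring. }
    split.
    + apply (axial_flux std_translation 1 c d Omega X); auto using std_translation_axial.
      intros Y HY. specialize (K 1%C Y HY). now rewrite Cmult_1_l in K.
    + apply (axial_flux std_rotation Ci c d Omega X); auto using std_rotation_axial.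
      intros Y HY. specialize (K Ci Y HY).
      match goal with |- is_flux _ _ _ ?x => match type of K with is_flux _ _ _ ?y => replace x with y; [exact K|] end end.
      unfold Re, Im. simpl. ring.
Qed.

Lemma C_infty_fraction (m k d : C) (F : C -> C) :
  (forall z, z <> d -> F z = (m + k / (z - d))%C) -> filterlim F C_infty (locally m).
Proof.
  intros HF P HP. apply Cball_locally in HP. destruct HP as [e [He HP]].
  exists (Cmod d + Cmod k / e). intros z Hz.
  assert (Hk : 0 <= Cmod k / e) by (apply Rdiv_le_0_compat; [apply Cmod_ge_0|exact He]).
  assert (Hzd : Cmod k / e < Cmod (z - d)).
  { assert (H := Cmod_triangle (z - d) d). replace (z - d + d)%C with z in H by ring. lra. }
  assert (Hp : 0 < Cmod (z - d)) by lra.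
  assert (Hn : (z - d)%C <> 0%C) by now apply Cmod_gt_0.
  apply HP. rewrite HF.
  2:{ intros ->. apply Hn. ring. }
  replace (m + k / (z - d) - m)%C with (k / (z - d))%C by ring.
  rewrite Cmod_div by exact Hn. apply (Rmult_lt_reg_r (Cmod (z - d))); [lra|].
  apply (Rmult_lt_compat_l e) in Hzd; [|exact He].
  replace (e * (Cmod k / e)) with (Cmod k) in Hzd by (field; lra).
  replace (Cmod k / Cmod (z - d) * Cmod (z - d)) with (Cmod k) by (field; apply Rgt_not_eq; lra). lra.
Qed.

Lemma Cminus_neq_0 (x y : C) : x <> y -> (x - y)%C <> 0%C.
Proof. intros H E. apply H. replace x with (x - y + y)%C by ring. rewrite E. ring. Qed.

Lemma ext_fraction_fin (k b : C) c d : c <> d ->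
  ext_fraction (fun x y => (k * ((x - b) * (y - b)))%C) c d (k * qeval_bdry (killing_quad c d) (Fin b))%C.
Proof.
  intros Hcd. destruct c as [c|], d as [d|]; unfold ext_fraction, qeval_bdry, killing_quad, qeval, qc0, qc1, qc2; cbn [fst snd].
  - assert (H : (c - d)%C <> 0%C) by (apply Cminus_neq_0; congruence). field. exact H.
  - apply (C_infty_fraction _ (- (k * ((c - b) * (c - b))))%C c). intros z Hz.
    assert (H : (z - c)%C <> 0%C) by now apply Cminus_neq_0.
    assert (H' : (c - z)%C <> 0%C) by (apply Cminus_neq_0; congruence). field. split; assumption.
  - apply (C_infty_fraction _ (k * ((d - b) * (d - b)))%C d). intros z Hz.
    assert (H : (z - d)%C <> 0%C) by now apply Cminus_neq_0. field. exact H.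
  - now contradiction Hcd.
Qed.

Lemma ext_fraction_inf (k : C) c d : c <> d ->
  ext_fraction (fun _ _ => k) c d (k * qeval_bdry (killing_quad c d) Inf)%C.
Proof.
  intros Hcd. destruct c as [c|], d as [d|]; unfold ext_fraction, qeval_bdry, killing_quad, qc2; cbn [fst snd].
  - reflexivity.
  - apply (C_infty_fraction _ (- k)%C c). intros z Hz.
    assert (H : (z - c)%C <> 0%C) by now apply Cminus_neq_0.
    assert (H' : (c - z)%C <> 0%C) by (apply Cminus_neq_0; congruence). field. split; assumption.
  - apply (C_infty_fraction _ k d). intros z Hz.
    assert (H : (z - d)%C <> 0%C) by now apply Cminus_neq_0. field. exact H.
  - now contradiction Hcd.
Qed.

Lemma polynomial2_product (k b : C) : polynomial2 (fun x y => (k * ((x - b) * (y - b)))%C).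
Proof.
  exists 1%nat, (fun i j => match i, j with O, O => k * (b * b) | 1%nat, 1%nat => k | _, _ => - (k * b) end)%C.
  intros x y. do 3 (rewrite ?sum_Sn, ?sum_O; unfold plus; simpl). ring.
Qed.

Lemma polynomial2_const (k : C) : polynomial2 (fun _ _ => k).
Proof.
  exists O, (fun _ _ => k). intros x y. do 2 (rewrite ?sum_O; simpl). ring.
Qed.

Lemma polynomial2_continuous P (x : C) : polynomial2 P -> continuous (fun t : C => P x (x + t)%C) (RtoC 0).
Proof.
  intros [N [a HP]].
  apply (continuous_ext (fun t : C => sum_n (fun i => sum_n (fun j => (a i j * x ^ i * (x + t) ^ j)%C) N) N)).
  { intros t. symmetry. apply HP. }
  assert (K : forall (F : nat -> C -> C) n, (forall i, continuous (F i) (RtoC 0)) ->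
    continuous (fun t : C => sum_n (fun i => F i t) n) (RtoC 0)).
  { intros F n HF. induction n.
    - apply (continuous_ext (F O)); [|apply HF]. intros t. now rewrite sum_O.
    - apply (continuous_ext (fun t => (sum_n (fun i => F i t) n + F (S n) t)%C)).
      + intros t. now rewrite sum_Sn.
      + now apply continuous_Cplus. }
  apply (K (fun i t => sum_n (fun j => (a i j * x ^ i * (x + t) ^ j)%C) N)). intros i.
  apply (K (fun j t => (a i j * x ^ i * (x + t) ^ j)%C)). intros j.
  apply (continuous_Cmult (fun _ => (a i j * x ^ i)%C)); [apply continuous_const|].
  eapply complex_derive_continuous. apply complex_derive_pow. apply complex_derive_plus;
    [apply complex_derive_const|apply complex_derive_id].
Qed.

Lemma is_flux_unique Omega X Y v v' : is_flux Omega X Y v -> is_flux Omega X Y v' -> v = v'.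
Proof. intros [[gam [n [k HK]]] H] [_ H']. rewrite <- (H _ _ _ HK). now apply H'. Qed.

(** The fluxes through finite geodesics determine the polynomial off the
    diagonal; the diagonal follows by continuity. *)
Lemma flux_polynomial2_unique Omega X P P' : is_flux_polynomial2 Omega X P -> is_flux_polynomial2 Omega X P' ->
  forall x y, P' x y = P x y.
Proof.
  intros [HP H] [HP' H'].
  assert (Hoff : forall x y, x <> y -> P' x y = P x y).
  { intros x y Hxy. assert (Hne : Fin x <> Fin y) by congruence.
    destruct (H _ _ Hne) as [l [El [[[Y1 HY1] T] [[Y2 HY2] R0]]]].
    destruct (H' _ _ Hne) as [l' [El' [[_ T'] [_ R0']]]].
    assert (E1 := is_flux_unique _ _ _ _ _ (T Y1 HY1) (T' Y1 HY1)).
    assert (E2 := is_flux_unique _ _ _ _ _ (R0 Y2 HY2) (R0' Y2 HY2)).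
    assert (E : l = l') by (apply injective_projections; unfold Re, Im in *; lra).
    simpl in El, El'. assert (N0 := Cminus_neq_0 x y Hxy).
    transitivity ((P' x y / (x - y)) * (x - y))%C; [field; exact N0|].
    rewrite <- El', <- E, El. field. exact N0. }
  intros x y. destruct (Ceq_dec x y) as [<-|Hxy]; [|now apply Hoff].
  assert (Z : (P' x (x + 0) - P x (x + 0))%C = 0%C).
  { apply (zero_at_puncture (fun t => (P' x (x + t) - P x (x + t))%C) 1); [lra| |].
    - apply (continuous_Cplus (fun t => P' x (x + t)%C) (fun t => (- P x (x + t))%C)).
      + now apply polynomial2_continuous.
      + apply (continuous_opp (K := R_AbsRing) (V := C_R_NormedModule)). now apply polynomial2_continuous.
    - intros t [_ Ht]. rewrite Hoff; [ring|]. intros E. apply Ht.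
      replace t with (x + t - x)%C by ring. rewrite <- E. ring. }
  replace (x + 0)%C with x in Z by ring.
  replace (P' x x) with (P' x x - P x x + P x x)%C by ring. rewrite Z. ring.
Qed.

(** The finite and the infinite case differ only by the polynomial, [k (x - b) (y - b)]
    or [k], and by the value [v c d] of the quadratic field. *)
Lemma flux_polynomial_package Omega X mu (kappa : C) (num : C -> C -> C -> C) (x0 : C) (v : Cbar -> Cbar -> C) :
  (kappa = 0%C <-> (3 <= mu)%nat) -> (hopf_holomorphic_at_0 Omega X <-> (3 <= mu)%nat) ->
  (forall c d, c <> d -> translation_flux Omega X c d (- 2 * PI * Re (kappa * v c d)%C) /\
    rotation_flux Omega X c d (2 * PI * Im (kappa * v c d)%C)) ->
  (forall k, polynomial2 (num k)) ->
  (forall k c d, c <> d -> ext_fraction (num k) c d (k * v c d)%C) ->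
  (forall x, num 0%C x x = 0%C) -> (forall k, num k x0 x0 = k) ->
  (forall c d : Cbar, c <> d -> exists l : C, ext_fraction (num kappa) c d l /\
     translation_flux Omega X c d (- 2 * PI * Re l) /\ rotation_flux Omega X c d (2 * PI * Im l)) /\
  is_flux_polynomial Omega X (fun x => num (RtoC (- 2 * PI) * kappa)%C x x) /\
  (kappa = 0%C <-> hopf_holomorphic_at_0 Omega X) /\
  (forall Pi, is_flux_polynomial Omega X Pi -> ((forall x, Pi x = 0%C) <-> hopf_holomorphic_at_0 Omega X)).
Proof.
  intros Hk Hh HF HP HE H0 H1. assert (HPI := PI_RGT_0).
  set (k' := (RtoC (- 2 * PI) * kappa)%C).
  assert (HQ : is_flux_polynomial2 Omega X (num k')).
  { split; [apply HP|]. intros c d Hcd. exists (k' * v c d)%C. split; [now apply HE|].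
    destruct (HF c d Hcd) as [HT HR].
    replace (Re (k' * v c d)%C) with (- 2 * PI * Re (kappa * v c d)%C) by (unfold k', Re; simpl; ring).
    replace (- Im (k' * v c d)%C) with (2 * PI * Im (kappa * v c d)%C) by (unfold k', Im; simpl; ring).
    split; assumption. }
  assert (HU : forall P', is_flux_polynomial2 Omega X P' -> forall x y, P' x y = num k' x y).
  { intros P' HP'. now apply (flux_polynomial2_unique Omega X). }
  split; [|split; [|split]].
  - intros c d Hcd. exists (kappa * v c d)%C. split; [now apply HE|]. now apply HF.
  - exists (num k'). split; [exact HQ|]. split; [exact HU|]. reflexivity.
  - now rewrite Hh.
  - intros Pi [P [HP2 [_ EPi]]]. rewrite Hh, <- Hk. split.
    + intros HZ. assert (E : k' = 0%C) by (rewrite <- (H1 k'), <- (HU P HP2), <- EPi; apply HZ).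
      destruct (Ceq_dec kappa 0%C) as [|Hn]; auto. exfalso. revert E. apply Cmult_neq_0; [|exact Hn].
      intros E. injection E. lra.
    + intros E x. rewrite EPi, (HU P HP2). unfold k'. rewrite E, Cmult_0_r. apply H0.
Qed.

Theorem theorem7 (Omega : C -> Prop) (X : C -> Pt) (B : Cbar) (mu : nat)
    (HE : horospherical_end Omega X B mu) :
  (forall b : C, B = Fin b ->
     exists kappa : C,
       (forall c d : Cbar, c <> d ->
          exists l : C,
            ext_fraction (fun x y => (kappa * ((x - b) * (y - b)))%C) c d l /\
            translation_flux Omega X c d (- 2 * PI * Re l)%R /\
            rotation_flux Omega X c d (2 * PI * Im l)%R) /\
       is_flux_polynomial Omega X
         (fun x => (RtoC (- 2 * PI) * kappa * (x - b) ^ 2)%C) /\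
       (kappa = 0%C <-> hopf_holomorphic_at_0 Omega X) /\
       (forall Pi : C -> C, is_flux_polynomial Omega X Pi ->
          ((forall x, Pi x = 0%C) <-> hopf_holomorphic_at_0 Omega X)) /\
       (hopf_holomorphic_at_0 Omega X <-> (3 <= mu)%nat)) /\
  (B = Inf ->
     exists kappa : C,
       (forall c d : Cbar, c <> d ->
          exists l : C,
            ext_fraction (fun _ _ => kappa) c d l /\
            translation_flux Omega X c d (- 2 * PI * Re l)%R /\
            rotation_flux Omega X c d (2 * PI * Im l)%R) /\
       is_flux_polynomial Omega X (fun _ => (RtoC (- 2 * PI) * kappa)%C) /\
       (kappa = 0%C <-> hopf_holomorphic_at_0 Omega X) /\
       (forall Pi : C -> C, is_flux_polynomial Omega X Pi ->
          ((forall x, Pi x = 0%C) <-> hopf_holomorphic_at_0 Omega X)) /\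
       (hopf_holomorphic_at_0 Omega X <-> (3 <= mu)%nat)).
Proof.
  destruct (horospherical_flux Omega X B mu HE) as [kappa [Hk [Hh HF]]].
  split.
  - intros b ->. exists kappa.
    destruct (flux_polynomial_package Omega X mu kappa (fun k x y => (k * ((x - b) * (y - b)))%C) (b + 1)%C
      (fun c d => qeval_bdry (killing_quad c d) (Fin b)) Hk Hh HF) as [R1 [R2 [R3 R4]]].
    + intros k. apply polynomial2_product.
    + intros k c d. apply ext_fraction_fin.
    + intros x. ring.
    + intros k. ring.
    + split; [exact R1|]. split; [|split; [exact R3|split; [exact R4|exact Hh]]].
      destruct R2 as [P [H1 [H2 H3]]]. exists P. split; [exact H1|]. split; [exact H2|].
      intros x. rewrite <- H3. ring.
  - intros ->. exists kappa.
    destruct (flux_polynomial_package Omega X mu kappa (fun k _ _ => k) 0%C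
      (fun c d => qeval_bdry (killing_quad c d) Inf) Hk Hh HF) as [R1 [R2 [R3 R4]]].
    + intros k. apply polynomial2_const.
    + intros k c d. apply ext_fraction_inf.
    + reflexivity.
    + reflexivity.
    + split; [exact R1|]. split; [exact R2|split; [exact R3|split; [exact R4|exact Hh]]].
Qed.
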